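(* Let $X$ and $Y$ be bounded Lipschitz domains in $\mathbb{R}^n$, let $\varphi:\overline{X}\to\overline{Y}$ be a given homeomorphism, let $\alpha>0$ and let $p\ge n$. Let $$\mathcal{A}^p_\varphi=\{f\in W^{1,p}(X,\mathbb{R}^n): J_f>0\text{ a.e.},\ f-\varphi\in W^{1,p}_0(X,\mathbb{R}^n)\},$$ and for $f\in\mathcal{A}^p_\varphi$ let $$E[f]=E^p_\alpha[f]=\int_X\left(|Df|^p+\frac{1}{J_f^{\alpha}}\right)dx.$$ Then there exists an $f_0\in\mathcal{A}^p_\varphi$ such that $$\inf_{f\in\mathcal{A}^p_\varphi}E[f]=E[f_0].$$
   Context: $Df$ is the weak derivative of $f$, $|Df|$ is its matrix norm, and $J_f=\det Df$ is the Jacobian determinant. $W^{1,p}_0(X,\mathbb{R}^n)$ is the usual Sobolev space of mappings with zero boundary values, so $f-\varphi\in W^{1,p}_0(X,\mathbb{R}^n)$ expresses that $f$ has boundary values $\varphi$ on $\partial X$.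
   Formalization: The class A^p_φ is assumed nonempty; without this the claim fails, e.g. for n = 1, X = Y = (0,1), φ(x) = 1 − x, where no f with f′ > 0 a.e. has boundary values φ. *)

(* Defs.v *)
From HB Require Import structures.
From mathcomp Require Import all_boot all_order all_algebra.
From mathcomp Require Import all_classical all_reals all_analysis.

Set Implicit Arguments.
Unset Strict Implicit.
Unset Printing Implicit Defensive.

Import Order.TTheory GRing.Theory Num.Theory.
Import numFieldNormedType.Exports.

Local Open Scope classical_set_scope.
Local Open Scope ring_scope.

(* The sigma-algebra generated by the coordinates, i.e. the Borel sets. *)
Section measurable_rV.
Context {R : realType} (n : nat).

Let coord (i : 'I_n) (x : 'rV[R]_n) : measurableTypeR R := x 0 i.

Let rV_set0 : g_sigma_preimage coord set0.
Proof. exact: sigma_algebra0. Qed.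

Let rV_setC A : g_sigma_preimage coord A -> g_sigma_preimage coord (~` A).
Proof. exact: sigma_algebraC. Qed.

Let rV_bigcup (F : (set _)^nat) : (forall i, g_sigma_preimage coord (F i)) ->
  g_sigma_preimage coord (\bigcup_i (F i)).
Proof. exact: sigma_algebra_bigcup. Qed.

HB.instance Definition _ := @isMeasurable.Build default_measure_display
  'rV[R]_n (g_sigma_preimage coord) rV_set0 rV_setC rV_bigcup.

Lemma measurable_coord (i : 'I_n) :
  measurable_fun setT (fun x : 'rV[R]_n => x 0 i : measurableTypeR R).
Proof.
move=> _ A mA; apply: sub_sigma_algebra.
by rewrite (bigD1 i)//=; left; exists A.
Qed.

Lemma measurable_fun_coordP d (T : measurableType d) (f : T -> 'rV[R]_n) :
  (forall i, measurable_fun setT (fun t => f t 0 i : measurableTypeR R)) ->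
  measurable_fun setT f.
Proof.
move=> mf _ A mA; rewrite setTI; move: A mA.
suff : g_sigma_preimage coord `<=` [set A | measurable (f @^-1` A)] by exact.
apply: smallest_sub.
  split => /=.
  - by rewrite preimage_set0.
  - by move=> B mB; rewrite setTD preimage_setC; exact: measurableC.
  - by move=> F mF; rewrite preimage_bigcup; exact: bigcupT_measurable.
apply: (big_ind (fun G => G `<=` _)) => [//|G H mG mH|i _ B [C mC <-] /=].
  by rewrite subUset.
by rewrite setTI -[X in measurable X]setTI; exact: (mf i measurableT C mC).
Qed.
End measurable_rV.

Section lebesgue_rV.
Context {R : realType}.

Definition consrV n (tx : measurableTypeR R * 'rV[R]_n) : 'rV[R]_n.+1 :=
  \row_i if unlift ord0 i is Some j then tx.2 0 j else tx.1.

Definition unconsrV n (x : 'rV[R]_n.+1) : measurableTypeR R * 'rV[R]_n :=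
  (x 0 ord0, \row_j x 0 (lift ord0 j)).

Lemma consrVK n : cancel (@consrV n) (@unconsrV n).
Proof.
move=> [t x]; rewrite /unconsrV /consrV mxE unlift_none; congr pair.
by apply/rowP => j; rewrite !mxE liftK.
Qed.

Lemma measurable_consrV n : measurable_fun setT (@consrV n).
Proof.
apply: measurable_fun_coordP => i; case: (unliftP ord0 i) => [j|] ->.
  rewrite (_ : (fun _ => _) =
      (fun x : 'rV[R]_n => x 0 j : measurableTypeR R) \o snd).
    by apply: measurableT_comp; [exact: measurable_coord|exact: measurable_snd].
  by apply/funext => tx; rewrite mxE liftK.
rewrite (_ : (fun _ => _) = fst); first exact: measurable_fst.
by apply/funext => tx; rewrite mxE unlift_none.
Qed.

Lemma measurable_unconsrV n : measurable_fun setT (@unconsrV n).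
Proof.
apply: measurable_fun_pair => /=; first exact: measurable_coord.
apply: measurable_fun_coordP => j.
under eq_fun do rewrite mxE.
exact: measurable_coord.
Qed.

Section step.
Context (n : nat) (mu : {sigma_finite_measure set 'rV[R]_n -> \bar R}).
Local Open Scope ereal_scope.

Definition leb_step : set 'rV[R]_n.+1 -> \bar R :=
  pushforward (@lebesgue_measure R \x mu) (@consrV n).


Let preimage_consrV A : measurable A -> measurable (@consrV n @^-1` A).
Proof.
by move=> mA; rewrite -[X in measurable X]setTI; exact: measurable_consrV.
Qed.

Let leb_step0 : leb_step set0 = 0.
Proof. by rewrite /leb_step /pushforward preimage_set0 measure0. Qed.

Let leb_step_ge0 A : 0 <= leb_step A.
Proof. by rewrite /leb_step /pushforward measure_ge0. Qed.

Let leb_step_sigma_additive : semi_sigma_additive leb_step.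
Proof.
move=> F mF tF mUF; rewrite /leb_step /pushforward preimage_bigcup.
apply: measure_semi_sigma_additive.
- by move=> i; exact: preimage_consrV.
- apply/trivIsetP => /= i j _ _ ij; rewrite -preimage_setI.
  by move/trivIsetP : tF => /(_ _ _ _ _ ij) ->//; rewrite preimage_set0.
- by rewrite -preimage_bigcup; exact: preimage_consrV.
Qed.

HB.instance Definition _ := isMeasure.Build _ _ _ leb_step
  leb_step0 leb_step_ge0 leb_step_sigma_additive.

Let leb_step_sigma_finite : sigma_finite setT leb_step.
Proof.
have /sigma_finiteP[F [TF ndF Foo]] := sigma_finiteT (@lebesgue_measure R).
have /sigma_finiteP[G [TG ndG Goo]] := sigma_finiteT mu.
exists (fun k => @unconsrV n @^-1` (F k `*` G k)).
  rewrite -preimage_bigcup (_ : \bigcup_k _ = setT) ?preimage_setT//.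
  rewrite -setXTT TF TG predeqE => -[x y]; split.
    by move=> [k _ []/= ? ?]; split; exists k.
  move=> [/= [k _ Fkx] [l _ Gly]]; exists (maxn k l) => //; split.
  - by move: x Fkx; exact/subsetPset/ndF/leq_maxl.
  - by move: y Gly; exact/subsetPset/ndG/leq_maxr.
move=> k; have [mF Fk] := Foo k; have [mG Gk] := Goo k; split.
  rewrite -[X in measurable X]setTI; apply: measurable_unconsrV => //.
  exact: measurableX.
rewrite /leb_step /pushforward -comp_preimage (_ : _ \o _ = id); last first.
  by apply/funext => tx; exact: consrVK.
by rewrite preimage_id product_measure1E// lte_mul_pinfty// ge0_fin_numE.
Qed.

HB.instance Definition _ := Measure_isSigmaFinite.Build _ _ _ leb_step
  leb_step_sigma_finite.
End step.

Fixpoint lebesgue_rV n : {sigma_finite_measure set 'rV[R]_n -> \bar R} :=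
  if n is m.+1 then leb_step (lebesgue_rV m) else \d_(0 : 'rV[R]_0).

(* The defining property: a box has measure the product of its sides. *)
Lemma lebesgue_rV_box n (A : 'I_n -> set (measurableTypeR R)) :
  (forall i, measurable (A i)) ->
  lebesgue_rV n [set x : 'rV[R]_n | forall i, A i (x 0%R i)] =
  (\prod_(i < n) lebesgue_measure (A i))%E.
Proof.
elim: n A => [|n IH] A mA.
  by rewrite big_ord0 /= diracE mem_set// => -[].
rewrite big_ord_recl /= /leb_step /pushforward -IH; last by [].
rewrite -product_measure1E//; last first.
  rewrite (_ : mkset _ =
    \bigcap_(i in setT) [set x : 'rV[R]_n | A (lift ord0 i) (x 0 i)]); last first.
    by apply/seteqP; split => [x /= Ax i _|x /= Ax i]; exact: Ax.
  apply: fin_bigcap_measurable => [|i _]; first exact: finite_finset.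
  by rewrite -[X in measurable X]setTI; exact: measurable_coord.
congr (_ _); apply/seteqP; split => [[t x] /= Ax|[t x] /= [At Ax] i].
  split; first by have := Ax ord0; rewrite mxE unlift_none.
  by move=> i; have := Ax (lift ord0 i); rewrite mxE liftK.
by rewrite mxE; case: unliftP => [j ->|->]; [exact: Ax|exact: At].
Qed.
End lebesgue_rV.

Section lipschitz_domain.
Context {R : realType}.

(* Near z, and up to the isometry x |-> x *m Q, the set X lies strictly above
   the graph of g, where g is a function of all coordinates but the i-th. *)
Definition above_lipschitz_graph n (X : set 'rV[R]_n) (z : 'rV[R]_n) : Prop :=
  exists (Q : 'M[R]_n) (i : 'I_n) (g : 'rV[R]_n.-1 -> R),
    [/\ Q *m Q^T = 1%:M, lipschitz g &
        \forall x \near z, X x <-> g (col' i (x *m Q)) < (x *m Q) 0 i].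

Definition bounded_lipschitz_domain n (X : set 'rV[R]_n) : Prop :=
  [/\ open X, connected X, X !=set0, bounded_set X &
      forall z, (closure X `\` X) z -> above_lipschitz_graph X z].

Definition homeomorphism_between (T U : topologicalType) (A : set T) (B : set U)
    (f : T -> U) : Prop :=
  [/\ set_bij A B f, {within A, continuous f} &
      exists2 g : U -> T, {within B, continuous g} & {in A, cancel f g}].
End lipschitz_domain.

Section sobolev.
Context {R : realType} {n : nat}.
Local Notation mu := (@lebesgue_rV R n).
Implicit Types (X : set 'rV[R]_n) (u g eta : 'rV[R]_n -> R).

Definition partial (i : 'I_n) u : 'rV[R]_n -> R := 'D_(delta_mx 0 i) u.

Definition smooth u : Prop :=
  forall s : seq 'I_n, continuous (foldr partial u s) /\
    forall i x, derivable (foldr partial u s) x (delta_mx 0 i).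

Definition test_function X eta : Prop :=
  let supp := closure [set x | eta x != 0] in
  [/\ smooth eta, compact supp & supp `<=` X].

Definition locally_integrable_in X u : Prop :=
  forall K, compact K -> K `<=` X -> mu.-integrable K (EFin \o u).

Definition is_weak_partial X (i : 'I_n) u g : Prop :=
  [/\ locally_integrable_in X u, locally_integrable_in X g &
      forall eta, test_function X eta ->
        \int[mu]_(x in X) (u x * partial i eta x) =
        - \int[mu]_(x in X) (g x * eta x)].

(* Any choice of the weak derivative, which is unique up to a null set. *)
Definition weak_partial X (i : 'I_n) u : 'rV[R]_n -> R :=
  xget (fun=> 0) [set g | is_weak_partial X i u g].

Definition Lp (p : R) X u : Prop := u \_ X \in Lfun mu p%:E.

Definition W1p (p : R) X u : Prop :=
  Lp p X u /\ forall i, exists2 g, is_weak_partial X i u g & Lp p X g.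

Definition W1p_norm (p : R) X u : \bar R :=
  ('N[mu]_p%:E[EFin \o u \_ X] +
   \sum_(i < n) 'N[mu]_p%:E[EFin \o (weak_partial X i u) \_ X])%E.

(* The closure of the test functions in W^{1,p}(X). *)
Definition W1p0 (p : R) X u : Prop :=
  W1p p X u /\ forall e : R, 0 < e ->
    exists2 eta, test_function X eta & (W1p_norm p X (u \- eta)%R < e%:E)%E.

Definition component k (f : 'rV[R]_n -> 'rV[R]_k) (j : 'I_k) : 'rV[R]_n -> R :=
  fun x => f x 0 j.

(* Row i is the weak gradient of the i-th component of f. *)
Definition weak_diff k X (f : 'rV[R]_n -> 'rV[R]_k) (x : 'rV[R]_n) :
    'M[R]_(k, n) :=
  \matrix_(i, j) weak_partial X j (component f i) x.

Definition jacobian_det X (f : 'rV[R]_n -> 'rV[R]_n) (x : 'rV[R]_n) : R :=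
  \det (weak_diff X f x).
End sobolev.

Section energy.
Context {R : realType}.

Definition euclidean_norm n (v : 'cV[R]_n) : R :=
  Num.sqrt (\sum_(i < n) v i 0 ^+ 2).

Definition operator_norm m n (A : 'M[R]_(m, n)) : R :=
  sup [set euclidean_norm (A *m v) | v in [set v | euclidean_norm v <= 1]].

Context {n : nat}.
Local Notation mu := (@lebesgue_rV R n).
Implicit Types (X : set 'rV[R]_n) (f phi : 'rV[R]_n -> 'rV[R]_n).

Definition admissible (p : R) X phi : set ('rV[R]_n -> 'rV[R]_n) :=
  [set f | [/\ forall j, W1p p X (component f j),
               {ae mu, forall x, X x -> 0 < jacobian_det X f x} &
               forall j, W1p0 p X (component (f \- phi) j)]].

Definition energy (alpha p : R) X f : \bar R :=
  (\int[mu]_(x in X) (operator_norm (weak_diff X f x) `^ p +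
                      (jacobian_det X f x `^ alpha)^-1)%:E)%E.
End energy.

(* Main.v *)
(** The direct method. In dimension n >= 2, take a minimising sequence, bounded
    in W^{1,p} by Poincare's inequality and, by Rellich, Cauchy in L^p. Weak limits
    are replaced by strong ones: convex combinations of the tails of the sequence
    (f_k, Df_k, J_{f_k}) that nearly minimise a strictly convex functional converge
    almost everywhere, since the midpoint of two of them cannot do much better.
    Let delta be the limit of the averaged Jacobians. Since the density
    |M|^p + J^{-alpha} is convex in (M, J), Fatou bounds the integral of
    |Df_0|^p + delta^{-alpha} by the infimum. The Jacobian is a null Lagrangian, so
    the integrals of J_{f_k} eta converge to that of J_{f_0} eta for every test
    function eta because p >= n; Fatou again gives delta <= J_{f_0}, and finiteness
    of the integral forces J_{f_0} > 0.

    In dimension 1, where p may be less than 2, all admissible maps have the same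
    mean slope, the map with constant slope is admissible, and it minimises the
    energy by Jensen's inequality. *)

From HB Require Import structures.
Require Import Defs.
From mathcomp Require Import all_boot all_order all_algebra fingroup perm.
From mathcomp Require Import all_classical all_reals all_analysis.
From mathcomp Require Import measurable_realfun ring lra.

Set Implicit Arguments.
Unset Strict Implicit.
Unset Printing Implicit Defensive.

Import Order.TTheory GRing.Theory Num.Theory.
Import numFieldNormedType.Exports.

Local Open Scope classical_set_scope.
Local Open Scope ring_scope.

(** * Lebesgue measure on row vectors *)

Section rV_borel.
Context {R : realType} {n : nat}.
Local Notation rV := 'rV[R]_n.
Local Notation mu := (@lebesgue_rV R n).

(** The determinant of an average is not the average of the determinants, so the Jacobian is carried
    as a component of its own and compared with the determinant of the limit only at the end. For p
    = n the Jacobians are bounded in L^1 alone, and no higher power of them is available for a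
    strictly convex functional; exp (- J) is bounded for every J >= 0, at the price that its limit
    may vanish, that is, that delta may be infinite until it has been compared with the integrable
    J_{f_0}. In the other components strict convexity is Clarkson's inequality, which asks for p >=
    2; this is what separates dimension 1.

    Two conventions shape the statements. L^p norms are replaced by the integrals of |u|^p, and the
    inequalities of Hoelder and Minkowski by cruder ones with explicit constants. Weak derivatives
    are chosen representatives, determined only almost everywhere, so a function is handled together
    with its derivatives as one family. *)

Lemma rV_norm_ltP (x : rV) (e : R) : 0 < e ->
  (`|x| < e) <-> (forall i, `|x 0 i| < e).
Proof.
move=> e0; rewrite [`|x|]/Num.norm/= mx_normrE; split => [/bigmax_ltP[_ h] i|h].
  exact: (h (ord0, i)).
by apply/bigmax_ltP; split => // -[j i] _ /=; rewrite ord1; exact: h.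
Qed.

Lemma rV_coord_norm (x : rV) i : `|x 0 i| <= `|x|.
Proof.
rewrite [`|x|]/Num.norm/= mx_normrE.
by apply: (le_bigmax _ (fun ij : 'I_1 * 'I_n => `|x ij.1 ij.2|) (ord0, i)).
Qed.

Lemma measurable_box (A : 'I_n -> set (measurableTypeR R)) :
  (forall i, measurable (A i)) ->
  measurable [set x : rV | forall i, A i (x 0 i)].
Proof.
move=> mA; rewrite (_ : mkset _ =
    \bigcap_(i in setT) [set x : rV | A i (x 0 i)]); last first.
  by apply/seteqP; split => [x /= Ax i _|x /= Ax i]; exact: Ax.
apply: fin_bigcap_measurable => [|i _]; first exact: finite_finset.
by rewrite -[X in measurable X]setTI; exact: measurable_coord.
Qed.

Lemma measurable_ball_rV (x : rV) (e : R) : measurable (ball x e).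
Proof.
have [e0|e0] := ltP 0 e; last first.
  rewrite (_ : ball x e = set0)//; apply/seteqP; split => // y.
  by rewrite -ball_normE/= => h; move: (le_lt_trans (normr_ge0 _) h); rewrite ltNge e0.
rewrite (_ : ball x e = [set y : rV | forall i, ball (x 0 i : R) e (y 0 i)]).
  by apply: (@measurable_box (fun i => ball (x 0 i : R) e)) => i; rewrite ball_itv; exact: measurable_itv.
apply/seteqP; split => y; rewrite -ball_normE /=.
  by move=> /(rV_norm_ltP _ e0) h i; rewrite -ball_normE/=; have := h i; rewrite !mxE.
by move=> h; rewrite -ball_normE/=; apply/rV_norm_ltP => // i; rewrite !mxE.
Qed.

Lemma rat_vec_dense (x : rV) (e : R) : 0 < e ->
  exists q : 'rV[rat]_n, `|x - \row_i ratr (q 0 i)| < e.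
Proof.
move=> e0.
have /choice[q hq] : forall i, exists q : rat, `|x 0 i - ratr q| < e.
  move=> i; have /rat_in_itvoo[q] : x 0 i - e < x 0 i + e by lra.
  by rewrite in_itv/= => /andP[? ?]; exists q; rewrite ltr_norml; lra.
exists (\row_i q i); apply/rV_norm_ltP => // i.
by rewrite !mxE; exact: hq.
Qed.

(** The measurable sets are generated by the coordinates, so openness must be turned into a
    countable union: balls of the sup norm are boxes, and rational centres with radii 1/(k+1)
    suffice. *)
Lemma open_measurable_rV (A : set rV) : open A -> measurable A.
Proof.
move=> oA; pose c (q : 'rV[rat]_n) : rV := \row_i ratr (q 0 i).
pose F (qk : 'rV[rat]_n * nat) :=
  if `[< ball (c qk.1) (qk.2.+1%:R^-1) `<=` A >] then ball (c qk.1) (qk.2.+1%:R^-1)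
  else set0.
have -> : A = \bigcup_qk F qk.
  apply/seteqP; split => [x Ax|x [qk _]]; last first.
    by rewrite /F; case: asboolP => // h /h.
  have /nbhs_ballP[e /= e0 eA] := open_nbhs_nbhs (conj oA Ax).
  have [k /= ke] : exists k : nat, k.+1%:R^-1 < e / 2.
    by have /ltr_add_invr[k] : 0 < e / 2 := divr_gt0 e0 (ltr0n _ 2); rewrite add0r; exists k.
  have k0 : 0 < k.+1%:R^-1 :> R by rewrite invr_gt0.
  have [q hq] := rat_vec_dense x k0.
  exists (q, k) => //; rewrite /F asboolT => /=.
    by rewrite -ball_normE/= distrC.
  move=> y; rewrite -ball_normE/= => hy; apply: eA; rewrite -ball_normE/=.
  rewrite -[x](subrK (c q)) -addrA; apply: le_lt_trans (ler_normD _ _) _.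
  by rewrite (_ : e = e / 2 + e / 2) ?ltrD ?(lt_trans _ ke)//; lra.
apply: countable_bigcupT_measurable => [|qk]; first exact: countableP.
by rewrite /F; case: asboolP => // _; exact: measurable_ball_rV.
Qed.

Lemma closed_measurable_rV (A : set rV) : closed A -> measurable A.
Proof.
move=> cA; rewrite -(setCK A); apply: measurableC; apply: open_measurable_rV; exact: closed_openC.
Qed.

Lemma continuous_measurable_rV (f : rV -> R) : continuous f ->
  measurable_fun setT f.
Proof.
move=> cf; apply: (measurability _ (RGenOpens.measurableE R)) => //.
move=> _ [_ [a [b ->] <-]]; apply: open_measurable_rV; rewrite setTI.
by move/continuousP : cf; apply; exact: interval_open.
Qed.

Definition boxes : set (set rV) :=
  [set [set x : rV | forall i, A i (x 0 i)] | A in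
    [set A : 'I_n -> set (measurableTypeR R) | forall i, measurable (A i)]].

Lemma measurable_boxesE : @measurable _ rV = <<s boxes >>.
Proof.
apply/seteqP; split; last first.
  apply: smallest_sub; first exact: sigma_algebra_measurable.
  by move=> _ [A mA <-]; exact: measurable_box.
suff h : \big[setU/set0]_(i < n) preimage_set_system [set: rV]
    (fun x : rV => x 0 i : measurableTypeR R) measurable `<=` <<s boxes>>.
  by apply: (smallest_sub _ h); exact: smallest_sigma_algebra.
apply: (big_ind (fun G => G `<=` <<s boxes>>)) => [//|G H mG mH|i _ B [C mC <-] /=].
  by rewrite subUset.
rewrite setTI; apply: sub_sigma_algebra.
exists (fun j => if j == i then C else setT) => /=.
  by move=> j; case: ifP.
apply/seteqP; split => x /=; first by move/(_ i); rewrite eqxx.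
by move=> Cx j; case: eqP => // ->.
Qed.

Lemma setI_closed_boxes : setI_closed boxes.
Proof.
move=> _ _ [A mA <-] [B mB <-]; exists (fun i => A i `&` B i) => /=.
  by move=> i; exact: measurableI.
apply/seteqP; split => x /=; first by move=> h; split => i; case: (h i).
by move=> [hA hB] i; split.
Qed.

Definition cube (r : R) : set rV := [set x | forall i, `[- r, r]%classic (x 0 i)].

Lemma measurable_cube r : measurable (cube r).
Proof. exact: (@measurable_box (fun=> `[- r, r]%classic)). Qed.

Lemma cube_norm r x : 0 <= r -> cube r x <-> `|x| <= r.
Proof.
move=> r0; split => [h|h i]; last first.
  by rewrite /= in_itv/= -ler_norml (le_trans (rV_coord_norm _ _)).
rewrite [`|x|]/Num.norm/= mx_normrE; apply/bigmax_leP; split => // -[j i] _ /=.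
by rewrite ord1 ler_norml; have := h i; rewrite /= in_itv.
Qed.

Let mu_box (A : 'I_n -> set (measurableTypeR R)) : (forall i, measurable (A i)) ->
  mu [set x : rV | forall i, A i (x 0 i)] =
  (\prod_(i < n) lebesgue_measure (A i))%E.
Proof. exact: lebesgue_rV_box. Qed.

Lemma lebesgue_cube r : 0 <= r -> mu (cube r) = ((2 * r) ^+ n)%:E.
Proof.
move=> r0; rewrite /cube (@mu_box (fun=> `[- r, r]%classic))//.
rewrite (eq_bigr (fun=> (2 * r)%:E)) => [|i _].
  by rewrite prodEFin prodr_const card_ord.
by rewrite lebesgue_measure_itv/= lte_fin; case: ltP => h; rewrite -?EFinD; congr EFin; lra.
Qed.

Lemma bigcup_cube : \bigcup_k cube k%:R = setT.
Proof.
apply/seteqP; split => // x _; exists (Num.bound `|x|) => //.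
by apply/cube_norm => //; apply/ltW/archi_boundP.
Qed.

(** Boxes form a generating pi-system, and the cubes exhaust the space by sets of finite measure.
    Invariance under translations and reflections, hidden by the recursive definition of the
    measure, is read off from this. *)
Lemma lebesgue_rV_unique (m : {measure set rV -> \bar R}) :
  (forall A : 'I_n -> set (measurableTypeR R), (forall i, measurable (A i)) ->
     m [set x : rV | forall i, A i (x 0 i)] =
     (\prod_(i < n) lebesgue_measure (A i))%E) ->
  forall A, measurable A -> mu A = m A.
Proof.
move=> mE A mA.
apply: (measure_unique boxes (fun k => cube k%:R)) => //.
- exact: measurable_boxesE.
- exact: setI_closed_boxes.
- by move=> k; exists (fun=> `[- k%:R, k%:R]%classic).
- exact: bigcup_cube.
- by move=> _ [B mB <-]; rewrite mE//; exact: mu_box.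
- by move=> k; rewrite -[X in (X < _)%E]/(mu (cube k%:R)) lebesgue_cube// ltry.
Qed.

Lemma bounded_lebesgue_fin (A : set rV) r : measurable A ->
  (forall x, A x -> `|x| <= r) -> (mu A < +oo)%E.
Proof.
move=> mA Ar; apply: (@le_lt_trans _ _ (mu (cube (Num.max r 0)))).
  apply: le_measure; rewrite ?inE//; first exact: measurable_cube.
  by move=> x /Ar xr; apply/cube_norm; rewrite ?le_max ?lexx ?orbT// xr.
by rewrite lebesgue_cube ?ltry// le_max lexx orbT.
Qed.

Lemma compact_bound (K : set rV) : compact K ->
  exists2 r, 0 < r & forall x, K x -> `|x| <= r.
Proof.
move=> /compact_bounded[M [_ hM]]; exists (Num.max M 0 + 1).
  by rewrite ltr_pwDr// le_max lexx orbT.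
by move=> x Kx; apply: hM => //; rewrite ltr_pwDr// le_max lexx.
Qed.

Lemma compact_lebesgue_fin (K : set rV) : compact K -> (mu K < +oo)%E.
Proof.
move=> cK; have [r _ Kr] := compact_bound cK.
apply: (@bounded_lebesgue_fin _ r) => //; apply: closed_measurable_rV.
exact: compact_closed.
Qed.

Lemma lebesgue_shift (a : R) (A : set (measurableTypeR R)) : measurable A ->
  lebesgue_measure ((fun x => x + a : measurableTypeR R) @^-1` A) = lebesgue_measure A.
Proof.
have ma : measurable_fun setT (fun x : measurableTypeR R => x + a : measurableTypeR R).
  by apply: measurable_funD.
pose f : {mfun measurableTypeR R >-> measurableTypeR R} :=
  HB.pack (fun x : measurableTypeR R => x + a : measurableTypeR R) (isMeasurableFun.Build _ _ _ _ _ ma).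
move=> mA; rewrite -[LHS]/(pushforward lebesgue_measure f A).
apply/esym/lebesgue_measure_unique => //= _ [[b c]] _ <- /=.
rewrite /pushforward (_ : _ @^-1` _ = `](b - a), (c - a)]%classic).
  rewrite !lebesgue_measure_itv/= !lte_fin ltrD2r; case: ifP => // _.
  by rewrite -!EFinD opprB addrA subrK.
by apply/seteqP; split => x /=; rewrite !in_itv/= ltrBlDr lerBrDr.
Qed.

Section coordinatewise.
Variable t : 'I_n -> measurableTypeR R -> measurableTypeR R.
Hypothesis mt : forall i, measurable_fun setT (t i).
Hypothesis tE : forall i A, measurable A ->
  lebesgue_measure (t i @^-1` A) = lebesgue_measure A.
Let T (x : rV) : rV := \row_i t i (x 0 i).

Let mT : measurable_fun setT T.
Proof.
apply: measurable_fun_coordP => i; under eq_fun do rewrite mxE.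
exact: (measurableT_comp (mt i) (measurable_coord i)).
Qed.

(** Boxes are pulled back to boxes, so preservation of length in each coordinate is enough;
    translations and reflections are both of this form. *)
Lemma coordinatewise_lebesgue A : measurable A -> mu (T @^-1` A) = mu A.
Proof.
pose f : {mfun rV >-> rV} := HB.pack T (isMeasurableFun.Build _ _ _ _ _ mT).
move=> mA; rewrite -[LHS]/(pushforward mu f A); apply/esym/lebesgue_rV_unique => //.
move=> B mB; transitivity (mu [set x : rV | forall i, (t i @^-1` B i) (x 0 i)]).
  rewrite -[LHS]/(mu (T @^-1` [set x : rV | forall i, B i (x 0 i)])).
  congr (mu _).
  by apply/seteqP; split => x /= h i; have := h i; rewrite mxE.
rewrite (@mu_box (fun i => t i @^-1` B i)); first by apply: eq_bigr => i _; exact: tE.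
by move=> i; rewrite -[X in measurable X]setTI; exact: mt.
Qed.
End coordinatewise.

Lemma measurable_add_rV (a : rV) : measurable_fun setT (fun x : rV => x + a).
Proof.
apply: measurable_fun_coordP => i; under eq_fun do rewrite mxE.
by apply: measurable_funD => //; exact: measurable_coord.
Qed.

Lemma measurable_opp_rV : measurable_fun setT (fun x : rV => - x).
Proof.
apply: measurable_fun_coordP => i; under eq_fun do rewrite mxE.
exact: (measurable_funN (measurable_coord i)).
Qed.

Lemma lebesgue_rV_shift (a : rV) A : measurable A ->
  mu ((fun x => x + a) @^-1` A) = mu A.
Proof.
move=> mA; rewrite -[RHS](@coordinatewise_lebesgue (fun i y => y + a 0 i))//.
- congr (mu _); apply/seteqP; split => x /=.
    by congr A; apply/rowP => i; rewrite !mxE.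
  by congr A; apply/rowP => i; rewrite !mxE.
- by move=> i; apply: measurable_funD.
- by move=> i B mB; exact: lebesgue_shift.
Qed.

Lemma lebesgue_rV_opp (A : set rV) : measurable A -> mu ((fun x : rV => - x) @^-1` A) = mu A.
Proof.
move=> mA; rewrite -[RHS](@coordinatewise_lebesgue (fun i y => - y))//.
- congr (mu _); apply/seteqP; split => x /=.
    by congr A; apply/rowP => i; rewrite !mxE.
  by congr A; apply/rowP => i; rewrite !mxE.
- by move=> i; exact: oppr_measurable.
- by move=> i B mB; exact: lebesgue_measureN.
Qed.

Section change.
Local Open Scope ereal_scope.
Variable T : rV -> rV.
Hypotheses (mT : measurable_fun setT T)
  (TE : forall A, measurable A -> mu (T @^-1` A) = mu A).

Lemma integral_preserving (f : rV -> \bar R) : measurable_fun setT f ->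
  \int[mu]_x f (T x) = \int[mu]_x f x.
Proof.
pose g : {mfun rV >-> rV} := HB.pack T (isMeasurableFun.Build _ _ _ _ _ mT).
have h f' : measurable_fun setT f' -> (forall x, 0 <= f' x) ->
    \int[mu]_x f' (T x) = \int[mu]_x f' x.
  move=> mf f0; rewrite -[LHS]/(\int[mu]_(x in g @^-1` setT) (f' \o g) x).
  rewrite -ge0_integral_pushforward//.
  by apply: eq_measure_integral => A mA _; exact: TE.
move=> mf; rewrite -[LHS]/(\int[mu]_x (f \o T) x) integralE [RHS]integralE.
rewrite funepos_comp funeneg_comp; congr (_ - _).
  by apply: (h f^\+) => [|x]; [exact: measurable_funepos|exact: funepos_ge0].
by apply: (h f^\-) => [|x]; [exact: measurable_funeneg|exact: funeneg_ge0].
Qed.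
End change.

Lemma integral_shift (a : rV) (f : rV -> \bar R) : measurable_fun setT f ->
  (\int[mu]_x f (x + a)%R = \int[mu]_x f x)%E.
Proof.
apply: integral_preserving; first exact: measurable_add_rV.
exact: lebesgue_rV_shift.
Qed.

Lemma integral_reflect (a : rV) (f : rV -> \bar R) : measurable_fun setT f ->
  (\int[mu]_x f (a - x)%R = \int[mu]_x f x)%E.
Proof.
move=> mf; rewrite -[RHS](integral_shift a)//.
rewrite -[RHS](integral_preserving measurable_opp_rV lebesgue_rV_opp).
  by apply: eq_integral => x _; rewrite addrC.
by apply: measurableT_comp => //; exact: measurable_add_rV.
Qed.

End rV_borel.

(** * Smooth and test functions *)

Section smooth.
Context {R : realType} {n : nat}.
Local Notation rV := 'rV[R]_n.
Implicit Types (u v : rV -> R) (C : set (rV -> R)).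

(** Restriction to a line gives access to the calculus of one real variable: chain rule, mean value
    theorem, fundamental theorem. *)
Lemma is_derive_line u (x w : rV) (l : R) :
  is_derive (0 : R) 1 (fun h : R => u (h *: w + x)) l -> is_derive x w u l.
Proof.
have e : (fun h : R => h^-1 *: (((fun h : R => u (h *: w + x)) \o shift 0) (h *: 1)
     - u (0 *: w + x))) = (fun h : R => h^-1 *: ((u \o shift x) (h *: w) - u x)).
  by apply/funext => h /=; rewrite addr0 scale0r add0r /GRing.scale/= mulr1.
by move=> [d dE]; split; [rewrite /derivable -e|rewrite -dE /derive e].
Qed.

Lemma line_is_derive u (x w : rV) (t : R) : derivable u (t *: w + x) w ->
  is_derive t 1 (fun h : R => u (h *: w + x)) ('D_w u (t *: w + x)).
Proof.
move=> d; have e : (fun h : R => h^-1 *: (((fun h : R => u (h *: w + x)) \o shift t) (h *: 1)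
     - u (t *: w + x))) =
   (fun h : R => h^-1 *: ((u \o shift (t *: w + x)) (h *: w) - u (t *: w + x))).
  by apply/funext => h; rewrite /comp /shift -[h *: 1]/(h * 1) mulr1 scalerDl addrA.
by split; [rewrite /derivable e|rewrite /derive e].
Qed.

(** Coinduction for [smooth]: iterated partial derivatives never leave a class closed under them, so
    continuity and differentiability of the members suffice. *)
Lemma smooth_class C : (forall u, C u -> continuous u) ->
  (forall u, C u -> forall i x, derivable u x (delta_mx 0 i)) ->
  (forall u, C u -> forall i, C (partial i u)) ->
  forall u, C u -> smooth u.
Proof.
move=> cC dC pC u Cu s.
have Cs : C (foldr partial u s) by elim: s => //= i s IH; exact: pC.
by split; [exact: cC|move=> i x; exact: dC].
Qed.

Lemma smooth_continuous u : smooth u -> continuous u.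
Proof. by move=> /(_ [::])[]. Qed.

Lemma smooth_derivable u i x : smooth u -> derivable u x (delta_mx 0 i).
Proof. by move=> /(_ [::])[_]; exact. Qed.

Lemma smooth_partial u i : smooth u -> smooth (partial i u).
Proof. by move=> su s; have := su (rcons s i); rewrite foldr_rcons. Qed.

(** By Leibniz' rule the derivative of a product is a sum of two products, so products alone are not
    closed under differentiation; sums of products of smooth functions are. *)
Inductive smooth_alg : set (rV -> R) :=
| smooth_alg_mul u v : smooth u -> smooth v -> smooth_alg (u * v)
| smooth_alg_add u v : smooth_alg u -> smooth_alg v -> smooth_alg (u + v).

Lemma smooth_algP : smooth_alg `<=` smooth.
Proof.
apply: smooth_class.
- move=> u0; elim=> [u v su sv x|u v _ cu _ cv x].
    by apply: continuousM; exact: smooth_continuous.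
  by apply: continuousD; [exact: cu|exact: cv].
- move=> u0; elim=> [u v su sv i x|u v _ cu _ cv i x].
    by apply: derivableM; exact: smooth_derivable.
  by apply: derivableD; [exact: cu|exact: cv].
- have der u : smooth_alg u -> forall i x, derivable u x (delta_mx 0 i).
    elim=> [u' v su sv i x|u' v _ cu _ cv i x].
      by apply: derivableM; exact: smooth_derivable.
    by apply: derivableD; [exact: cu|exact: cv].
  move=> u0; elim=> [u v su sv i|u v hu cu hv cv i].
    rewrite (_ : partial i _ = u * partial i v + v * partial i u); last first.
      by apply/funext => x; rewrite /partial deriveM//; exact: smooth_derivable.
    exact: (smooth_alg_add (smooth_alg_mul su (smooth_partial i sv)) (smooth_alg_mul sv (smooth_partial i su))).
  rewrite (_ : partial i _ = partial i u + partial i v).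
    by apply: smooth_alg_add.
  by apply/funext => x; rewrite /partial deriveD//; exact: der.
Qed.

Lemma smooth_cst c : smooth (cst c : rV -> R).
Proof.
apply: (@smooth_class [set cst c | c in setT]); last by exists c.
- by move=> _ [d _ <-]; exact: cst_continuous.
- by move=> _ [d _ <-] i x; exact: derivable_cst.
- by move=> _ [d _ <-] i; exists 0 => //; apply/funext => x; rewrite /partial derive_cst.
Qed.

Lemma smoothM u v : smooth u -> smooth v -> smooth (u \* v).
Proof. by move=> su sv; apply: smooth_algP; exact: smooth_alg_mul. Qed.

Lemma smoothD u v : smooth u -> smooth v -> smooth (u \+ v).
Proof.
move=> su sv; rewrite (_ : _ \+ _ = u * (cst 1) + v * (cst 1)); last first.
  by apply/funext => x /=; rewrite !fctE !mulr1.
exact: (smooth_algP (smooth_alg_add (smooth_alg_mul su (smooth_cst 1)) (smooth_alg_mul sv (smooth_cst 1)))).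
Qed.

Lemma smoothZ c u : smooth u -> smooth (fun x => c * u x).
Proof. by move=> su; exact: (@smoothM (cst c) u (smooth_cst c) su). Qed.

Lemma smoothB u v : smooth u -> smooth v -> smooth (u \- v).
Proof.
move=> su sv; rewrite (_ : _ \- _ = u \+ (fun x => -1 * v x)).
  exact: (smoothD su (smoothZ (-1) sv)).
by apply/funext => x /=; rewrite mulN1r.
Qed.

Lemma partialD u v i x : smooth u -> smooth v ->
  partial i (u \+ v) x = partial i u x + partial i v x.
Proof. by move=> su sv; rewrite /partial deriveD//; exact: smooth_derivable. Qed.

Lemma partialB u v i x : smooth u -> smooth v ->
  partial i (u \- v) x = partial i u x - partial i v x.
Proof. by move=> su sv; rewrite /partial deriveB//; exact: smooth_derivable. Qed.

Lemma partialM u v i x : smooth u -> smooth v ->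
  partial i (u \* v) x = u x * partial i v x + v x * partial i u x.
Proof. by move=> su sv; rewrite /partial deriveM//; exact: smooth_derivable. Qed.

Lemma partialZ c u i x : smooth u -> partial i (fun y => c * u y) x = c * partial i u x.
Proof.
move=> su; rewrite (partialM _ _ (smooth_cst c) su) /cst.
by rewrite {2}/partial derive_cst mulr0 addr0.
Qed.

Lemma growth_rate_shift u (a x w : rV) :
  (fun h : R => h^-1 *: (((fun x => u (x + a)) \o shift x) (h *: w) - u (x + a))) =
  (fun h : R => h^-1 *: ((u \o shift (x + a)) (h *: w) - u (x + a))).
Proof. by apply/funext => h /=; rewrite addrA. Qed.

Lemma partial_shift u (a : rV) i : partial i (fun x => u (x + a)) = (fun x => partial i u (x + a)).
Proof.
by apply/funext => x; rewrite /partial /derive growth_rate_shift.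
Qed.

Lemma continuous_addr (a : rV) : continuous (fun y : rV => y + a).
Proof.
move=> x; apply: (@continuousD _ rV rV id (cst a)); first exact: cvg_id.
exact: cst_continuous.
Qed.

Lemma smooth_shift u (a : rV) : smooth u -> smooth (fun x => u (x + a)).
Proof.
move=> su.
apply: (@smooth_class [set (fun x => w (x + a)) | w in [set w : rV -> R | smooth w]]); last by exists u.
- move=> _ [w sw <-] x.
  have ca : {for x, continuous (fun y : rV => y + a)}.
    exact: continuous_addr.
  exact: (continuous_comp ca (@smooth_continuous w sw (x + a))).
- move=> _ [w sw <-] i x; rewrite /derivable growth_rate_shift.
  exact: (@smooth_derivable w i (x + a) sw).
- move=> _ [w sw <-] i; rewrite partial_shift; exists (partial i w); [exact: smooth_partial|by []].
Qed.

End smooth.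

(** * Smooth bumps of one real variable *)

Section bump.
Context {R : realType}.
Implicit Types (P : {poly R}) (t x : R).

(** The classical function exp (-1/t), flat at 0; the polynomial factor makes the family closed
    under differentiation. *)
Definition exp_tail P t : R := if 0 < t then P.[t^-1] * expR (- t^-1) else 0.

Lemma horner_bound P : exists2 C, 0 <= C & forall y, 1 <= y -> `|P.[y]| <= C * y ^+ size P.
Proof.
exists (\sum_(i < size P) `|P`_i|); first by apply: sumr_ge0.
move=> y y1; rewrite horner_coef (le_trans (ler_norm_sum _ _ _))// mulr_suml.
apply: ler_sum => i _; rewrite normrM ler_wpM2l// ger0_norm ?exprn_ge0 ?(le_trans _ y1)//.
by rewrite ler_weXn2l// ltnW.
Qed.

(** With y = 1/t and m the size of P, |P(y)| is at most C y^m, while y^(m+1) <= (m+1)! exp y; the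
    surplus power of y is the factor |t|. *)
Lemma exp_tail_bound P : exists2 C, 0 <= C & forall t, t < 1 -> `|exp_tail P t| <= C * `|t|.
Proof.
have [C C0 hC] := horner_bound P; pose m := size P.
exists (C * m.+1`!%:R); first by rewrite mulr_ge0.
move=> t t1; rewrite /exp_tail; case: ltP => [t0|_]; last by rewrite normr0 mulr_ge0// mulr_ge0.
have y1 : 1 <= t^-1 by rewrite invf_ge1// ltW.
have y0 : 0 < t^-1 by rewrite invr_gt0.
rewrite normrM (ger0_norm (expR_ge0 _)) expRN (gtr0_norm t0).
have eb : t^-1 ^+ m.+1 <= m.+1`!%:R * expR t^-1.
  have f0 : 0 < (m.+1)`!%:R :> R by rewrite ltr0n fact_gt0.
  have := expR_ge1Dxn m (ltW y0).
  rewrite -(ler_pM2l f0) mulrDr mulrCA mulfV ?gt_eqF// !mulr1.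
  by apply: le_trans; rewrite lerDr ltW.
have e0 := expR_gt0 t^-1.
rewrite ler_pdivrMr//; apply: le_trans (hC _ y1) _.
rewrite -!mulrA ler_wpM2l// mulrA mulrAC.
by rewrite -ler_pdivrMr// -exprSr.
Qed.

Lemma exp_tail_derive P t :
  is_derive t 1 (exp_tail P) (exp_tail ('X ^+ 2 * (P - P^`())) t).
Proof.
have [t0|t0|<-] := ltgtP 0 t.
- have d : is_derive t 1 (fun s : R => P.[s^-1] * expR (- s^-1))
      (exp_tail ('X ^+ 2 * (P - P^`())) t).
    have dV : is_derive t 1 (fun s : R => s^-1) (- t ^- 2 *: 1).
      by apply: is_deriveV; rewrite gt_eqF.
    have dN : is_derive t 1 (fun s : R => - s^-1) (- (- t ^- 2 *: 1)).
      exact: is_deriveN.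
    have d1 := @is_derive1_comp _ (horner P) _ t _ _ (is_derive_poly P t^-1) dV.
    have d2 := @is_derive1_comp _ expR _ t _ _ (is_derive_expR (- t^-1)) dN.
    have d3 := is_deriveM d1 d2; apply: is_derive_eq d3 _.
    rewrite /exp_tail t0 /= hornerM hornerXn hornerD hornerN /GRing.scale /= !mulr1.
    by rewrite -exprVn; ring.
  apply: near_eq_is_derive d; near=> s.
  by rewrite /exp_tail ifT//; near: s; exact: lt_nbhsr.
- have -> : exp_tail ('X ^+ 2 * (P - P^`())) t = 0 by rewrite /exp_tail ltNge ltW.
  apply: near_eq_is_derive (is_derive_cst 0 t 1); near=> s.
  rewrite /exp_tail/= ifF//; apply/negbTE; rewrite -leNgt ltW//; near: s.
  exact: lt_nbhsl.
- have -> : exp_tail ('X ^+ 2 * (P - P^`())) 0 = 0 by rewrite /exp_tail ltxx.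
  (* At 0 the difference quotient of [exp_tail P] is [exp_tail ('X * P)], which the bound sends to
     0. *)
  have [C C0 hC] := exp_tail_bound ('X * P).
  have cv : (fun h : R => h^-1 *: ((exp_tail P \o shift 0) (h *: 1) - exp_tail P 0)) @ 0^' --> (0 : R).
    apply/cvgrPdist_le => e e0; near=> h.
    rewrite sub0r normrN /= addr0 {2}/exp_tail ltxx subr0 -[h *: 1]/(h * 1) mulr1.
    have -> : h^-1 *: exp_tail P h = exp_tail ('X * P) h.
      by rewrite /exp_tail; case: ifP => _; rewrite ?scaler0// hornerM hornerX -mulrA.
    have h1 : h < 1.
      near: h; apply: nbhs_dnbhs; exact: lt_nbhsl.
    apply: (le_trans (hC _ h1)).
    have hh : `|h| <= e / (C + 1).
      near: h; apply: nbhs_dnbhs; apply/nbhs_ballP; exists (e / (C + 1)) => /=.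
        by rewrite divr_gt0// ltr_wpDl.
      by move=> y; rewrite /ball/= sub0r normrN => /ltW.
    apply: (le_trans (ler_wpM2l C0 hh)).
    by rewrite mulrCA ger_pMr// ler_pdivrMr ?ltr_wpDl// mul1r lerDl.
  by split; [apply/cvg_ex; exists 0|exact/cvg_lim].
Unshelve. all: by end_near. Qed.

Lemma exp_tailN P t : exp_tail (- P) t = - exp_tail P t.
Proof. by rewrite /exp_tail; case: ifP => _; rewrite ?oppr0// hornerN mulNr. Qed.

(** A product of two opposite tails vanishes outside [-e, e]; closing such products under sums gives
    a class stable under differentiation. *)
Inductive bumps (e : R) : set (R -> R) :=
| bumps_base P Q : bumps e (fun t => exp_tail P (e - t) * exp_tail Q (e + t))
| bumps_add g h : bumps e g -> bumps e h -> bumps e (g + h).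

Lemma bumps_derive e g : bumps e g ->
  exists2 g', bumps e g' & forall t, is_derive t 1 g (g' t).
Proof.
elim=> [P Q|g0 h0 _ [g1 bg dg] _ [h1 bh dh]]; last first.
  by exists (g1 + h1) => [|t]; [exact: bumps_add|exact: is_deriveD].
pose D (S : {poly R}) := 'X ^+ 2 * (S - S^`()).
exists ((fun t => exp_tail (- D P) (e - t) * exp_tail Q (e + t)) +
        (fun t => exp_tail P (e - t) * exp_tail (D Q) (e + t))).
  by apply: bumps_add; exact: bumps_base.
move=> t.
have d1 : is_derive t 1 (fun s : R => e - s) (0 - 1).
  by apply: is_deriveB.
have d2 : is_derive t 1 (fun s : R => e + s) (0 + 1).
  by apply: is_deriveD.
have d3 := @is_derive1_comp _ (exp_tail P) (fun s => e - s) t _ _ (exp_tail_derive P _) d1.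
have d4 := @is_derive1_comp _ (exp_tail Q) (fun s => e + s) t _ _ (exp_tail_derive Q _) d2.
have d5 := is_deriveM d3 d4; apply: is_derive_eq d5 _.
rewrite -[RHS]/(exp_tail (- D P) (e - t) * exp_tail Q (e + t) +
  exp_tail P (e - t) * exp_tail (D Q) (e + t)).
by rewrite exp_tailN /D /comp /GRing.scale /=; ring.
Qed.

Lemma derivable_continuous (g : R -> R) (g' : R -> R) :
  (forall t, is_derive t 1 g (g' t)) -> continuous g.
Proof.
by move=> h t; apply: differentiable_continuous; apply/derivable1_diffP; case: (h t).
Qed.

Definition bump1 e t := exp_tail 1 (e - t) * exp_tail 1 (e + t).

Lemma exp_tail1_ge0 t : 0 <= exp_tail 1 t.
Proof. by rewrite /exp_tail; case: ifP => // _; rewrite hornerC mul1r expR_ge0. Qed.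

Lemma bump1_ge0 e t : 0 <= bump1 e t.
Proof. by rewrite mulr_ge0// exp_tail1_ge0. Qed.

Lemma bump1N e t : bump1 e (- t) = bump1 e t.
Proof. by rewrite /bump1 opprK mulrC. Qed.

Lemma bump1_eq0 e t : e <= `|t| -> bump1 e t = 0.
Proof.
rewrite /bump1 /exp_tail ler_normr => /orP[h|h].
  by rewrite ifF ?mul0r//; apply/negbTE; rewrite -leNgt; lra.
by rewrite [X in _ * X]ifF ?mulr0//; apply/negbTE; rewrite -leNgt; lra.
Qed.

(** A positive lower bound near 0 keeps the integral of the product bump away from 0 when it is
    normalised. *)
Lemma bump1_lb e t : 0 < e -> `|t| <= e / 2 -> expR (- (e / 2)^-1) ^+ 2 <= bump1 e t.
Proof.
move=> e0; have ee : 0 < e / 2 by rewrite divr_gt0.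
have h s : e / 2 <= s -> expR (- (e / 2)^-1) <= exp_tail 1 s.
  move=> es; have s0 : 0 < s by exact: lt_le_trans es.
  by rewrite /exp_tail s0 hornerC mul1r ler_expR lerN2 lef_pV2.
rewrite ler_norml => /andP[h1 h2]; rewrite expr2 /bump1.
by apply: ler_pM; rewrite ?expR_ge0//; apply: h; lra.
Qed.

End bump.

(** * Test functions and mollifiers *)

Section test_functions.
Context {R : realType} {n : nat}.
Local Notation rV := 'rV[R]_n.
Local Notation mu := (@lebesgue_rV R n).
Implicit Types (u f : rV -> R) (X : set rV).

Lemma compact_cube r : compact (@cube R n r).
Proof.
exact: (@rV_compact _ _ (fun=> `[- r, r]%classic) (fun=> @segment_compact _ _ _)).
Qed.

Lemma continuous_support_bounded f r : continuous f ->
  (forall x, r <= `|x| -> f x = 0) -> exists2 M, 0 < M & forall x, `|f x| <= M.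
Proof.
move=> cf fr.
have /compact_bounded[M [_ hM]] : compact (f @` cube r).
  by apply: continuous_compact; [exact: continuous_subspaceT|exact: compact_cube].
exists (Num.max M 0 + 1); first by rewrite ltr_pwDr// le_max lexx orbT.
move=> x; have [xr|xr] := ltP `|x| r; last by rewrite fr// normr0 addr_ge0// le_max lexx orbT.
apply: (hM (Num.max M 0 + 1)); first by rewrite ltr_pwDr// le_max lexx.
exists x => //; apply/cube_norm; last exact: ltW.
exact: le_trans (ltW xr).
Qed.

Lemma integrable_bounded_support f r M : measurable_fun setT f ->
  (forall x, r <= `|x| -> f x = 0) -> (forall x, `|f x| <= M) ->
  mu.-integrable setT (EFin \o f).
Proof.
move=> mf fr fM; have mc := @measurable_cube R n r.
have e : EFin \o f = (EFin \o f) \_ (cube r).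
  apply/funext => x; rewrite patchE; case: ifPn => // /negP xr /=.
  rewrite fr// leNgt; apply/negP => h; apply: xr; rewrite inE.
  by apply/cube_norm; [exact: le_trans (ltW h)|exact: ltW].
rewrite e; apply/(integrable_mkcond _ mc).
apply: measurable_bounded_integrable => //.
- by apply: compact_lebesgue_fin; exact: compact_cube.
- exact: measurable_funTS.
- exists M; split; first exact: num_real.
  by move=> N MN x _ /=; exact: (le_trans (fM x) (ltW MN)).
Qed.

Lemma integrable_continuous_support f r : continuous f ->
  (forall x, r <= `|x| -> f x = 0) -> mu.-integrable setT (EFin \o f).
Proof.
move=> cf fr; have [M _ fM] := continuous_support_bounded cf fr.
by apply: (integrable_bounded_support _ fr fM); exact: continuous_measurable_rV.
Qed.

Lemma test_functionI X u (K : set rV) : smooth u -> compact K -> K `<=` X ->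
  (forall x, ~ K x -> u x = 0) -> test_function X u.
Proof.
move=> su cK KX uK; have sK : closure [set x | u x != 0] `<=` K.
  have clK : closed K by apply: compact_closed.
  rewrite [X in _ `<=` X]((closure_id K).1 clK); apply: closureS => x /eqP ux.
  by apply: contrapT => /uK.
split => //; last exact: subset_trans KX.
by apply: subclosed_compact sK => //; exact: closed_closure.
Qed.

Lemma test_function_smooth X u : test_function X u -> smooth u.
Proof. by case. Qed.

Lemma test_function_eq0 X u x : test_function X u -> ~ X x -> u x = 0.
Proof.
move=> [_ _ sX] nX; apply: contrapT => ux; apply: nX; apply: sX.
by apply: subset_closure; exact/eqP.
Qed.

Lemma test_function_support X u : test_function X u ->
  exists2 K, compact K /\ K `<=` X & forall x, ~ K x -> u x = 0.
Proof.
move=> [su cK KX]; exists (closure [set x | u x != 0]) => // x nx.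
by apply: contrapT => ux; apply: nx; apply: subset_closure; exact/eqP.
Qed.

Lemma test_function_bound X u : test_function X u ->
  exists2 r, 0 < r & forall x, r <= `|x| -> u x = 0.
Proof.
move=> /test_function_support[K [cK _] uK]; have [r r0 Kr] := compact_bound cK.
exists (r + 1) => [|x xr]; first by rewrite addr_gt0.
by apply: uK => /Kr; lra.
Qed.

Lemma test_function_sub X Y u : X `<=` Y -> test_function X u -> test_function Y u.
Proof. by move=> XY [su cK KX]; split => //; exact: subset_trans XY. Qed.

Lemma partial_support u i (K : set rV) : closed K ->
  (forall x, ~ K x -> u x = 0) -> forall x, ~ K x -> partial i u x = 0.
Proof.
move=> cK uK x nKx.
have nx : \forall y \near x, ~ K y.
  by apply: open_nbhs_nbhs; split => //; exact: closed_openC.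
suff : is_derive x (delta_mx 0 i) u 0 by case.
apply: near_eq_is_derive (is_derive_cst 0 x (delta_mx 0 i)).
by near=> y; rewrite uK//; near: y.
Unshelve. all: by end_near. Qed.

Lemma test_function_partial X u i : test_function X u -> test_function X (partial i u).
Proof.
move=> tu; have [K [cK KX] uK] := test_function_support tu.
apply: (test_functionI (smooth_partial i (test_function_smooth tu)) cK KX).
by apply: partial_support => //; exact: compact_closed.
Qed.

Lemma test_functionD X u v : test_function X u -> test_function X v -> test_function X (u \+ v).
Proof.
move=> tu tv; have [K [cK KX] uK] := test_function_support tu.
have [L [cL LX] vL] := test_function_support tv.
apply: (@test_functionI _ _ (K `|` L)).
- exact: smoothD (test_function_smooth tu) (test_function_smooth tv).
- exact: compactU.
- by rewrite subUset.
- by move=> x /= h; rewrite uK ?vL ?addr0// => ?; apply: h; [right|left].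
Qed.

Lemma test_functionMl X u v : smooth u -> test_function X v -> test_function X (u \* v).
Proof.
move=> su tv; have [L [cL LX] vL] := test_function_support tv.
apply: (test_functionI _ cL LX) => [|x nL]; last by rewrite /= vL// mulr0.
exact: smoothM su (test_function_smooth tv).
Qed.

Lemma test_functionZ X c u : test_function X u -> test_function X (fun x => c * u x).
Proof. exact: test_functionMl (smooth_cst c). Qed.

Lemma test_functionB X u v : test_function X u -> test_function X v -> test_function X (u \- v).
Proof.
move=> tu tv; rewrite (_ : _ \- _ = u \+ (fun x => -1 * v x)).
  exact: (test_functionD tu (test_functionZ (-1) tv)).
by apply/funext => x /=; rewrite mulN1r.
Qed.

Lemma test_function_continuous X u : test_function X u -> continuous u.
Proof. by move=> /test_function_smooth/smooth_continuous. Qed.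

Lemma test_function_integrable X u : test_function X u -> mu.-integrable setT (EFin \o u).
Proof.
move=> tu; have [r _ ur] := test_function_bound tu.
exact: integrable_continuous_support (test_function_continuous tu) ur.
Qed.

(** The support is measured in the sup norm. Evenness turns rho (x - y) into a translate of rho in
    the variable y. *)
Definition mollifier (e : R) (rho : rV -> R) :=
  [/\ smooth rho, (forall x, 0 <= rho x), (forall x, rho (- x) = rho x),
      (forall x, e <= `|x| -> rho x = 0) & (\int[mu]_x (rho x)%:E = 1)%E].

Lemma continuous_prod (F : 'I_n -> rV -> R) : (forall i, continuous (F i)) ->
  continuous (fun x => \prod_i F i x).
Proof.
move=> cF; elim: (index_enum _) => [|i s IH].
  by under eq_fun do rewrite big_nil; exact: cst_continuous.
under eq_fun do rewrite big_cons.
by move=> x; apply: continuousM; [exact: cF|exact: IH].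
Qed.

(** The j-th partial derivative only replaces the j-th factor by its derivative, again a bump;
    letting the factors vary over all bumps gives a class closed under differentiation. *)
Lemma prod_bump_smooth e (g : 'I_n -> R -> R) : (forall i, bumps e (g i)) ->
  smooth (fun x : rV => \prod_i g i (x 0 i)).
Proof.
pose C := [set (fun x : rV => \prod_i g i (x 0 i)) | g in
  [set g : 'I_n -> R -> R | forall i, bumps e (g i)]].
have dC (g0 : 'I_n -> R -> R) j : (forall i, bumps e (g0 i)) ->
    exists2 w, C w & forall x : rV,
      is_derive x (delta_mx 0 j) (fun x : rV => \prod_i g0 i (x 0 i)) (w x).
  move=> bg; have [g' bg' dg] := bumps_derive (bg j).
  pose g1 i := if i == j then g' else g0 i.
  exists (fun x : rV => \prod_i g1 i (x 0 i)).
    by exists g1 => // i; rewrite /g1; case: eqP.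
  move=> x; apply: is_derive_line.
  rewrite (_ : (fun h : R => _) =
    (g0 j \o (fun h : R => h + x 0 j)) * (cst (\prod_(i | i != j) g0 i (x 0 i)))); last first.
    apply/funext => h; rewrite (bigD1 j)//= fctE /comp !mxE !eqxx /= mulr1; congr (_ * _).
    by apply: eq_bigr => i ij; rewrite !mxE (negbTE ij) mulr0 add0r.
  have d1 : is_derive (0 : R) 1 (fun h : R => h + x 0 j) (1 + 0) by apply: is_deriveD.
  have d2 := @is_derive1_comp _ (g0 j) (fun h => h + x 0 j) 0 _ _ (dg _) d1.
  have d3 := is_deriveM d2 (is_derive_cst (\prod_(i | i != j) g0 i (x 0 i)) (0 : R) 1).
  apply: is_derive_eq d3 _.
  have e1 : g1 j = g' by rewrite /g1 eqxx.
  rewrite scaler0 add0r add0r addr0 mulr1 [RHS](bigD1 j)// e1 [RHS]mulrC.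
  by congr (_ * _); apply: eq_bigr => i /negbTE ij; rewrite /g1 ij.
move=> bg; apply: (@smooth_class _ _ C); last by exists g.
- move=> _ [g0 bg0 <-]; apply: (@continuous_prod (fun i x => g0 i (x 0 i))) => i x.
  have [g' _ dg] := bumps_derive (bg0 i).
  apply: (@continuous_comp _ _ _ (fun x : rV => x 0 i) (g0 i)).
    exact: coord_continuous.
  exact: (derivable_continuous dg).
- by move=> _ [g0 bg0 <-] i x; have [w _ /(_ x)[]] := dC g0 i bg0.
- move=> _ [g0 bg0 <-] i; have [w Cw dw] := dC g0 i bg0.
  rewrite (_ : partial i _ = w)//; apply/funext => x.
  by have [_] := dw x.
Qed.

Lemma mollifier_exists e : 0 < e -> exists rho, mollifier e rho.
Proof.
move=> e0; pose B (x : rV) := \prod_i bump1 e (x 0 i).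
have sB : smooth B.
  by apply: (@prod_bump_smooth e (fun=> bump1 e)) => i; exact: bumps_base.
have B0 x : 0 <= B x by apply: prodr_ge0 => i _; exact: bump1_ge0.
have Be x : e <= `|x| -> B x = 0.
  move=> ex; have [i xi] : exists i, e <= `|x 0 i|.
    apply: contrapT => /forallNP h; move: ex; rewrite leNgt => /negP; apply.
    by apply/rV_norm_ltP => // i; rewrite ltNge; exact/negP/h.
  by rewrite /B (bigD1 i)//= bump1_eq0// mul0r.
have iB := integrable_continuous_support (smooth_continuous sB) Be.
have mB : measurable_fun setT B by apply: continuous_measurable_rV; exact: smooth_continuous.
set I := (\int[mu]_x (B x)%:E)%E.
have If : I \is a fin_num by exact: integrable_fin_num.
pose d := expR (- (e / 2)^-1) ^+ 2; have d0 : 0 < d by rewrite exprn_gt0// expR_gt0.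
(* Each of the n factors of [B] is at least [d] on the cube of half-side e / 2, so the normalising
   constant is positive. *)
have I0 : (0 < I)%E.
  have mc := @measurable_cube R n (e / 2).
  apply: (@lt_le_trans _ _ (\int[mu]_(x in cube (e / 2)) (d ^+ n)%:E)%E).
    rewrite integral_cst// -[X in (_ * X)%E]/(mu (cube (e / 2))) lebesgue_cube ?ltW ?divr_gt0//.
    by rewrite -EFinM lte_fin mulr_gt0// exprn_gt0// mulr_gt0// divr_gt0.
  apply: (@le_trans _ _ (\int[mu]_(x in cube (e / 2)) (B x)%:E)%E).
    apply: ge0_le_integral => //.
    - by move=> x _; rewrite lee_fin exprn_ge0// ltW.
    - by apply/measurable_EFinP; exact: measurable_funTS.
    - move=> x xc; rewrite lee_fin -{1}(card_ord n) -prodr_const; apply: ler_prod => i _.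
      rewrite ltW//= /d; apply: bump1_lb => //; rewrite ler_norml.
      by have := xc i; rewrite /= in_itv.
  apply: ge0_subset_integral => //; first exact/measurable_EFinP.
  by move=> x _; rewrite lee_fin.
have fI0 : 0 < fine I by rewrite fine_gt0// I0 ltey_eq If.
exists (fun x => (fine I)^-1 * B x); split.
- exact: smoothZ.
- by move=> x; rewrite mulr_ge0// invr_ge0 ltW.
- move=> x; congr (_ * _); apply: eq_bigr => i _; by rewrite mxE bump1N.
- by move=> x /Be ->; rewrite mulr0.
- under eq_integral do rewrite EFinM.
  rewrite (integralZl measurableT iB).
  by rewrite -/I -(fineK If) -EFinM mulVf// gt_eqF.
Qed.

Lemma mollifier_test X e rho (x : rV) : mollifier e rho ->
  closed_ball_ Num.norm x e `<=` X -> test_function X (fun y => rho (x - y)).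
Proof.
move=> [sr _ rN re _] bX.
have -> : (fun y => rho (x - y)) = (fun y => rho (y - x)).
  by apply/funext => y; rewrite -rN opprB.
apply: (@test_functionI _ _ (closed_ball_ Num.norm x e)) => //.
- exact: smooth_shift.
- apply: bounded_closed_compact; last exact: closed_closed_ball_.
  exists (`|x| + e); split; [exact: num_real|] => M hM y /= hy; apply: le_trans (ltW hM).
  by rewrite -[y](subrK x) addrC (le_trans (ler_normD _ _))// lerD2l distrC.
- by move=> y /negP; rewrite /closed_ball_/= -ltNge => h; apply: re; rewrite distrC ltW.
Qed.

End test_functions.

(** * Translation and Poincare estimates *)

Section powR_facts.
Context {R : realType}.
Implicit Types (c s t p a b : R).

Lemma ln_ge1BV s : 0 < s -> 1 - s^-1 <= ln s.
Proof.
move=> s0; have h : -1 < s^-1 - 1 by rewrite ltrBrDr addNr invr_gt0.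
have := le_ln1Dx h; rewrite addrC subrK lnV ?posrE//; lra.
Qed.

(** Bernoulli's inequality for real exponents: s^p = s exp ((p - 1) ln s), with exp x >= 1 + x and
    ln s >= 1 - 1/s. *)
Lemma powR_ge_tangent1 s p : 0 <= s -> 1 <= p -> 1 + p * (s - 1) <= s `^ p.
Proof.
rewrite le_eqVlt => /orP[/eqP<-|s0] p1.
  by rewrite sub0r mulrN1 powR0 ?gt_eqF ?(lt_le_trans _ p1)//; lra.
have p0 : 0 < p by exact: lt_le_trans p1.
rewrite -(mulr_powRB1 (ltW s0) p0).
have -> : 1 + p * (s - 1) = s * (1 + (p - 1) * (1 - s^-1)).
  by field; rewrite gt_eqF.
rewrite (ler_pM2l s0) /powR gt_eqF//.
apply: le_trans (expR_ge1Dx _); rewrite lerD2l ler_wpM2l ?subr_ge0//.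
exact: ln_ge1BV.
Qed.

Lemma powR_ge_tangent c t p : 0 < c -> 0 <= t -> 1 <= p ->
  c `^ p + p * c `^ (p - 1) * (t - c) <= t `^ p.
Proof.
move=> c0 t0 p1; have p0 : 0 < p by exact: lt_le_trans p1.
have st : 0 <= t / c by rewrite divr_ge0// ltW.
have := powR_ge_tangent1 st p1; rewrite -(ler_pM2l (powR_gt0 p c0)) -(powRM _ (ltW c0) st).
rewrite [c * (t / c)]mulrC divfK ?gt_eqF//; apply: le_trans.
rewrite -(mulr_powRB1 (ltW c0) p0) le_eqVlt; apply/orP; left; apply/eqP.
by field; rewrite gt_eqF.
Qed.

(** Add the tangent inequalities at the midpoint: their linear terms cancel. *)
Lemma powR_half a b p : 0 <= a -> 0 <= b -> 1 <= p ->
  ((a + b) / 2) `^ p <= (a `^ p + b `^ p) / 2.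
Proof.
move=> a0 b0 p1; have [h|h] := eqVneq ((a + b) / 2) 0.
  by rewrite h powR0 ?gt_eqF ?(lt_le_trans _ p1)// divr_ge0// addr_ge0// powR_ge0.
have c0 : 0 < (a + b) / 2 by rewrite lt_neqAle eq_sym h divr_ge0// addr_ge0.
have := powR_ge_tangent c0 a0 p1; have := powR_ge_tangent c0 b0 p1.
set q := p * _; set x := _ `^ p; set y := b `^ p; set z := a `^ p => h1 h2.
suff : 0 <= q * (b - (a + b) / 2) + q * (a - (a + b) / 2) by lra.
by rewrite -mulrDr (_ : b - _ + _ = 0) ?mulr0//; lra.
Qed.

(** The sum is twice the midpoint. The sharp constant 2^(p-1) is rounded up to 2^p; it stands in for
    the triangle inequality of the L^p norm. *)
Lemma normD_powR a b p : 1 <= p ->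
  `|a + b| `^ p <= 2 `^ p * (`|a| `^ p + `|b| `^ p).
Proof.
move=> p1; have p0 : 0 <= p by exact: le_trans p1.
apply: (@le_trans _ _ ((`|a| + `|b|) `^ p)).
  by rewrite ge0_ler_powR ?nnegrE ?addr_ge0// ler_normD.
have -> : `|a| + `|b| = 2 * ((`|a| + `|b|) / 2) by field.
rewrite powRM ?divr_ge0 ?addr_ge0// ler_wpM2l ?powR_ge0//.
apply: le_trans (powR_half _ _ p1) _ => //.
by rewrite ler_pdivrMr// ler_peMr ?addr_ge0 ?powR_ge0// ler1n.
Qed.

Lemma powR_scale c a p : `|c * a| `^ p = `|c| `^ p * `|a| `^ p.
Proof. by rewrite normrM powRM. Qed.

End powR_facts.

Section jensen.
Context d (T : measurableType d) {R : realType} (mu : {measure set T -> \bar R}).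
Local Open Scope ereal_scope.

Lemma measurable_powR_norm (D : set T) (u : T -> R) p : measurable_fun D u ->
  measurable_fun D (fun x => (`|u x| `^ p)%R).
Proof.
move=> mf; apply: (measurableT_comp (measurable_powR p)).
exact: measurableT_comp.
Qed.

(** The tangent to t^p at c, the absolute value of the mean, is integrated against the probability
    density k. *)
Lemma jensen_powR (D : set T) (k u : T -> R) (p : R) : measurable D ->
  (1 <= p)%R -> measurable_fun D k -> measurable_fun D u ->
  (forall x, D x -> (0 <= k x)%R) -> \int[mu]_(x in D) (k x)%:E = 1 ->
  mu.-integrable D (fun x => (k x * u x)%:E) ->
  ((`|\int[mu]_(x in D) (k x * u x)| `^ p)%R)%:E <=
  \int[mu]_(x in D) (k x * `|u x| `^ p)%:E.
Proof.
move=> mD p1 mk muu k0 k1 iku; set c := (`|_|)%R.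
have p0 : (0 < p)%R by exact: lt_le_trans p1.
have [c0|c0] := eqVneq c 0%R.
  rewrite c0 powR0 ?gt_eqF//; apply: integral_ge0 => x Dx.
  by rewrite lee_fin mulr_ge0 ?powR_ge0 ?k0.
have {}c0 : (0 < c)%R by rewrite lt_neqAle eq_sym c0 normr_ge0.
pose q := (p * c `^ (p - 1))%R.
have q0 : (0 <= q)%R by rewrite mulr_ge0 ?powR_ge0 ?ltW.
have cp0 : (0 <= c `^ p)%R by exact: powR_ge0.
have mu1 : measurable_fun D (fun x => (k x * `|u x|)%:E).
  by apply/measurable_EFinP; apply: measurable_funM => //; exact: measurableT_comp.
have mup : measurable_fun D (fun x => (k x * `|u x| `^ p)%:E).
  by apply/measurable_EFinP; apply: measurable_funM => //; exact: measurable_powR_norm.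
have mkE : measurable_fun D (fun x => (k x)%:E) by exact/measurable_EFinP.
have n1 x : D x -> 0 <= (c `^ p)%:E * (k x)%:E.
  by move=> Dx; rewrite -EFinM lee_fin mulr_ge0// k0.
have n2 x : D x -> 0 <= q%:E * (k x * `|u x|)%:E.
  by move=> Dx; rewrite -EFinM lee_fin mulr_ge0// mulr_ge0// k0.
have n3 x : D x -> 0 <= (k x * `|u x| `^ p)%:E.
  by move=> Dx; rewrite lee_fin mulr_ge0 ?powR_ge0// k0.
have n4 x : D x -> 0 <= (q * c)%:E * (k x)%:E.
  move=> Dx; rewrite -EFinM lee_fin; apply: mulr_ge0; last exact: k0.
  by apply: mulr_ge0 => //; exact: ltW.
have n5 x : D x -> 0 <= (k x)%:E by move=> Dx; rewrite lee_fin k0.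
have n6 x : D x -> 0 <= (k x * `|u x|)%:E by move=> Dx; rewrite lee_fin mulr_ge0// k0.
have m1 : measurable_fun D (fun x => (c `^ p)%:E * (k x)%:E) by exact: measurable_funeM.
have m2 : measurable_fun D (fun x => q%:E * (k x * `|u x|)%:E) by exact: measurable_funeM.
have m4 : measurable_fun D (fun x => (q * c)%:E * (k x)%:E) by exact: measurable_funeM.
(* The negative term of the tangent is moved to the right, so that both integrands are nonnegative
   and the right side may be infinite. *)
have A : \int[mu]_(x in D) ((c `^ p)%:E * (k x)%:E + q%:E * (k x * `|u x|)%:E) <=
         \int[mu]_(x in D) ((k x * `|u x| `^ p)%:E + (q * c)%:E * (k x)%:E).
  apply: ge0_le_integral => //.
  - by move=> x Dx; rewrite adde_ge0 ?n1 ?n2.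
  - exact: emeasurable_funD.
  - exact: emeasurable_funD.
  - move=> x Dx; rewrite -!EFinM -!EFinD lee_fin.
    have := powR_ge_tangent c0 (normr_ge0 (u x)) p1; rewrite -/q => h.
    have := ler_wpM2l (k0 _ Dx) h; lra.
have qc0 : 0 <= (q * c)%:E by rewrite lee_fin mulr_ge0// ltW.
move: A; rewrite (ge0_integralD _ mD n1 m1 n2 m2) (ge0_integralD _ mD n3 mup n4 m4).
rewrite !ge0_integralZl// k1 !mule1.
have cB : c%:E <= \int[mu]_(x in D) (k x * `|u x|)%:E.
  rewrite EFin_normr_Rintegral//; apply: le_trans (le_abse_integral _ _ _) _ => //.
    by apply/measurable_EFinP; exact: measurable_funM.
  apply: ge0_le_integral => //.
  - by apply/measurable_EFinP; apply: measurableT_comp => //; exact: measurable_funM.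
  - by move=> x Dx; rewrite lee_fin normrM ger0_norm// k0.
move=> A; have : (c `^ p)%:E + q%:E * c%:E <= \int[mu]_(x in D) (k x * `|u x| `^ p)%:E + (q * c)%:E.
  by apply: le_trans A; rewrite leeD2l// lee_wpmul2l// lee_fin.
by rewrite -EFinM leeD2rE.
Qed.

End jensen.

(** * Translations, integration by parts and Poincare's inequality for test functions *)

Section translation.
Context {R : realType} {n : nat}.
Local Notation rV := 'rV[R]_n.
Local Notation mu := (@lebesgue_rV R n).
Local Notation lam := (@lebesgue_measure R).
Local Notation de i := (delta_mx 0 i : rV).
Implicit Types (u v w : rV -> R) (X : set rV).

Lemma measurable_scale_add (a : rV) :
  measurable_fun setT (fun xr : rV * measurableTypeR R => xr.1 + (xr.2 : R) *: a).
Proof.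
apply: measurable_fun_coordP => j; under eq_fun do rewrite !mxE.
apply: measurable_funD.
  exact: (measurableT_comp (measurable_coord j) measurable_fst).
by apply: measurable_funM => //; exact: measurable_snd.
Qed.

Lemma measurable_line (a x : rV) :
  measurable_fun setT (fun r : measurableTypeR R => x + (r : R) *: a).
Proof.
exact: (measurableT_comp (measurable_scale_add a) (@pair1_measurable _ _ _ _ x)).
Qed.

Lemma lebesgue_itv0 (s : R) : 0 < s -> lam `[0, s] = s%:E.
Proof. by move=> s0; rewrite lebesgue_measure_itv/= lte_fin s0 -EFinB subr0. Qed.

(** By Tonelli the translates are integrated first, and all of them have the integral of g. *)
Lemma line_average (g : rV -> \bar R) (a : rV) (s : R) : 0 < s ->
  measurable_fun setT g -> (forall x, (0 <= g x)%E) ->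
  (\int[mu]_x \int[lam]_(r in `[0%R, s]) g (x + r *: a)%R = s%:E * \int[mu]_x g x)%E.
Proof.
move=> s0 mg g0; pose D : set (measurableTypeR R) := `[0, s]%classic.
have mD : measurable D by exact: measurable_itv.
pose F (xr : rV * measurableTypeR R) : \bar R := (g (xr.1 + (xr.2 : R) *: a)%R * (\1_D xr.2)%:E)%E.
have F0 xr : (0 <= F xr)%E by rewrite /F mule_ge0 ?lee_fin.
have mF : measurable_fun setT F.
  apply: emeasurable_funM; first exact: (measurableT_comp mg (measurable_scale_add a)).
  apply/measurable_EFinP.
  exact: (measurableT_comp (measurable_indic _) measurable_snd).
transitivity (\int[mu]_x \int[lam]_r F (x, r))%E.
  apply: eq_integral => x _; rewrite integral_mkcond; apply: eq_integral => r _.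
  by rewrite /F/= patchE indicE; case: ifP => _; rewrite ?mule1 ?mule0.
rewrite (@fubini_tonelli _ _ _ _ _ mu lam _ mF F0).
transitivity (\int[lam]_(r in D) (\int[mu]_x g x))%E.
  rewrite [RHS]integral_mkcond; apply: eq_integral => r _.
  rewrite /F/= patchE indicE; case: ifP => rD.
    under eq_integral do rewrite mule1.
    exact: integral_shift.
  by under eq_integral do rewrite mule0; rewrite integral0.
by rewrite integral_cst//= -/D /D lebesgue_itv0// muleC.
Qed.

Lemma line_FTC w i x (s : R) : smooth w -> 0 < s ->
  w (x + s *: de i) - w x = \int[lam]_(r in `[0, s]) partial i w (x + r *: de i).
Proof.
move=> sw s0; pose F r := w (r *: de i + x); pose f r := partial i w (r *: de i + x).
have dF (r : R) : is_derive r 1 F (f r) by apply: line_is_derive; exact: smooth_derivable.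
have cl (u : rV -> R) : continuous u -> continuous (fun r : R => u (r *: de i + x)).
  move=> cu r; apply: (@continuous_comp _ _ _ (fun r : R => r *: de i + x) u); last exact: cu.
  apply: (@continuousD _ rV R^o (fun r : R => r *: de i) (cst x)); last exact: cst_continuous.
  exact: scalel_continuous.
have cF : continuous F by apply: cl; exact: smooth_continuous.
have cf : continuous f by apply: cl; exact/smooth_continuous/smooth_partial.
have FTC : (\int[lam]_(r in `[0%R, s]) (f r)%:E = (F s)%:E - (F 0%R)%:E)%E.
  apply: continuous_FTC2 => //.
  - exact: continuous_subspaceT.
  - split.
    + by move=> r _; case: (dF r).
    + by apply: cvg_at_right_filter; exact: cF.
    + by apply: cvg_at_left_filter; exact: cF.
  - by move=> r _; rewrite derive1E; case: (dF r).
have := congr1 fine FTC; rewrite /= /F scale0r add0r [s *: _ + x]addrC => <-.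
by apply: eq_Rintegral => r _; rewrite /f addrC.
Qed.

Lemma integrable_line w i x (s : R) : continuous w ->
  lam.-integrable `[0, s] (fun r : measurableTypeR R => (w (x + (r : R) *: de i))%:E).
Proof.
move=> cw; apply: continuous_compact_integrable; first exact: segment_compact.
apply: continuous_subspaceT => r.
apply: (@continuous_comp _ _ _ (fun r : R => x + r *: de i) w); last exact: cw.
apply: (@continuousD _ rV R^o (cst x) (fun r : R => r *: de i)); first exact: cst_continuous.
exact: scalel_continuous.
Qed.

(** Along the segment the difference is the mean over [0, s] of s times the derivative; Jensen
    bounds its p-th power by a mean of p-th powers, and after integration in x [line_average]
    removes the translations. *)
Lemma translation_estimate p w i (s : R) : 1 <= p -> smooth w -> 0 < s ->
  (\int[mu]_x (`|w (x + s *: de i)%R - w x| `^ p)%:E <=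
   (s `^ p)%:E * \int[mu]_x (`|partial i w x| `^ p)%:E)%E.
Proof.
move=> p1 sw s0; have p0 : 0 < p by exact: lt_le_trans p1.
have cdw : continuous (partial i w) by exact/smooth_continuous/smooth_partial.
have mdw : measurable_fun setT (partial i w) by exact: continuous_measurable_rV.
have mw : measurable_fun setT w by apply: continuous_measurable_rV; exact: smooth_continuous.
pose g x := (s^-1 * `|s * partial i w x| `^ p)%:E.
have mg : measurable_fun setT g.
  apply/measurable_EFinP; apply: measurable_funM => //; apply: measurable_powR_norm.
  exact: measurable_funM.
have g0 x : (0 <= g x)%E by rewrite lee_fin mulr_ge0 ?powR_ge0// invr_ge0 ltW.
have -> : ((s `^ p)%:E * \int[mu]_x (`|partial i w x| `^ p)%:E =
    \int[mu]_x \int[lam]_(r in `[0%R, s]) g (x + r *: de i)%R)%E.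
  rewrite (line_average (de i) s0 mg g0) -!ge0_integralZl//; last first.
  - by rewrite lee_fin powR_ge0.
  - by apply/measurable_EFinP; exact: measurable_powR_norm.
  - by rewrite lee_fin ltW.
  apply: eq_integral => x _; rewrite /g -!EFinM mulrA mulfV ?gt_eqF// mul1r.
  by rewrite powR_scale (gtr0_norm s0).
apply: ge0_le_integral => //.
- apply/measurable_EFinP; apply: measurable_powR_norm; apply: measurable_funB => //.
  exact: (measurableT_comp mw (measurable_add_rV _)).
- pose F (xr : rV * measurableTypeR R) : \bar R := (g (xr.1 + (xr.2 : R) *: de i)%R * (\1_(`[0, s]%classic) xr.2)%:E)%E.
  have F0 xr : (0 <= F xr)%E by apply: mule_ge0 => //; rewrite lee_fin.
  have mF : measurable_fun setT F.
    apply: emeasurable_funM; first exact: (measurableT_comp mg (measurable_scale_add _)).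
    apply/measurable_EFinP.
    by apply: (measurableT_comp (measurable_indic _) measurable_snd).
  rewrite (_ : (fun x => _) = (fun x => \int[lam]_r F (x, r))%E).
    exact: measurable_fun_fubini_tonelli_F.
  apply/funext => x; rewrite integral_mkcond; apply: eq_integral => r _.
  by rewrite /F/= patchE indicE; case: ifP => _; rewrite ?mule1 ?mule0.
- move=> x _; rewrite (line_FTC i x sw s0).
  have -> : \int[lam]_(r in `[0, s]) partial i w (x + r *: de i) =
     \int[lam]_(r in `[0, s]) (s^-1 * (s * partial i w (x + r *: de i))).
    by apply: eq_Rintegral => r _; rewrite mulrA mulVf ?gt_eqF// mul1r.
  have mdl : measurable_fun `[0, s] (fun r : measurableTypeR R => s * partial i w (x + (r : R) *: de i)).
    apply: measurable_funM => //; apply: measurable_funTS.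
    exact: (measurableT_comp mdw (measurable_line _ _)).
  apply: (@jensen_powR _ _ _ lam `[0, s]%classic (fun=> s^-1)
     (fun r : measurableTypeR R => s * partial i w (x + (r : R) *: de i))) => //.
  + by move=> r _; rewrite invr_ge0 ltW.
  + by rewrite integral_cst//= lebesgue_itv0// -EFinM mulVf// gt_eqF.
  + apply: eq_integrable (integrable_line i x s cdw) => // r _.
    by rewrite mulrA mulVf ?gt_eqF// mul1r.
Qed.

(** The difference w(x + e_i) - w(x) integrates to 0 by translation invariance; written as an
    integral over a unit segment, it integrates by Fubini to the integral of the partial
    derivative. *)
Lemma integral_partial X i w : test_function X w -> \int[mu]_x partial i w x = 0.
Proof.
move=> tw; have sw := test_function_smooth tw.
have iw := test_function_integrable tw.
have idw := test_function_integrable (test_function_partial i tw).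
have cdw : continuous (partial i w) by exact/smooth_continuous/smooth_partial.
have mdw : measurable_fun setT (partial i w) by exact: continuous_measurable_rV.
have mw : measurable_fun setT w by apply: continuous_measurable_rV; exact: smooth_continuous.
pose D : set (measurableTypeR R) := `[0, 1]%classic.
have mD : measurable D by exact: measurable_itv.
pose F (xr : rV * measurableTypeR R) : \bar R := (partial i w (xr.1 + (xr.2 : R) *: de i)%R * \1_D xr.2)%:E.
have mF : measurable_fun setT F.
  apply/measurable_EFinP.
  apply: measurable_funM; first exact: (measurableT_comp mdw (measurable_scale_add _)).
  exact: (measurableT_comp (measurable_indic _) measurable_snd).
have iF : (mu \x lam)%E.-integrable setT F.
  apply/(integrable12ltyP mu lam mF).
  have := line_average (de i) ltr01 (measurableT_comp (@abse_measurable R setT) ((measurable_EFinP _ _).2 mdw)) (fun x => abse_ge0 _).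
  move=> h; rewrite (_ : (\int[mu]_x _)%E = (\int[mu]_x \int[lam]_(r in `[0%R, 1%R]) `|(partial i w (x + r *: de i))%:E|)%E).
    by rewrite h mul1e; case/integrableP : idw.
  apply: eq_integral => x _; rewrite [RHS]integral_mkcond; apply: eq_integral => r _.
  by rewrite /F/= patchE indicE; case: ifP => _; rewrite ?mulr1// mulr0 normr0.
have := Fubini iF.
have -> : (\int[mu]_x \int[lam]_r F (x, r) = \int[mu]_x ((w (x + 1 *: de i))%:E - (w x)%:E))%E.
  apply: eq_integral => x _; rewrite -EFinB (line_FTC i x sw ltr01).
  rewrite [RHS]fineK; last first.
    by apply: integrable_fin_num => //; exact: (integrable_line i x 1 cdw).
  rewrite [RHS]integral_mkcond; apply: eq_integral => r _.
  by rewrite /F/= patchE indicE; case: ifP => _; rewrite ?mulr1// mulr0.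
have -> : (\int[lam]_r \int[mu]_x F (x, r) = \int[mu]_x (partial i w x)%:E)%E.
  transitivity (\int[lam]_(r in D) (\int[mu]_x (partial i w x)%:E))%E.
    rewrite [RHS]integral_mkcond; apply: eq_integral => r _.
    rewrite /F/= patchE indicE; case: ifP => rD.
      under eq_integral do rewrite mulr1.
      by apply: (@integral_shift R n (r *: de i) (EFin \o partial i w)); exact/measurable_EFinP.
    by under eq_integral do rewrite mulr0; rewrite integral0.
  by rewrite integral_cst//= -/D /D lebesgue_itv0 ?mule1.
rewrite integralB//; last first.
  apply/integrableP; split.
    apply/measurable_EFinP; exact: (measurableT_comp mw (measurable_add_rV _)).
  rewrite (@integral_shift R n (1 *: de i) (fun x => `|(w x)%:E|%E)); first by case/integrableP : iw.
  by apply: measurableT_comp => //; exact/measurable_EFinP.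
rewrite (@integral_shift R n (1 *: de i) (EFin \o w)); last exact/measurable_EFinP.
by rewrite subee ?integrable_fin_num// /Rintegral => <-.
Qed.

Lemma integration_by_parts_rV X i u v : smooth u -> test_function X v ->
  \int[mu]_x (u x * partial i v x) = - \int[mu]_x (partial i u x * v x).
Proof.
move=> su tv; have sv := test_function_smooth tv.
have i1 := test_function_integrable (test_functionMl su (test_function_partial i tv)).
have i2 := test_function_integrable (test_functionMl (smooth_partial i su) tv).
apply/eqP; rewrite -addr_eq0; apply/eqP.
rewrite -RintegralD// -[RHS](integral_partial i (test_functionMl su tv)).
by apply: eq_Rintegral => x _; rewrite partialM// [v x * _]mulrC.
Qed.

(** A shift by 2 r + 1 in one coordinate moves X off itself, so on X the translate vanishes and w
    is, up to sign, its own difference. *)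
Lemma poincare_test p X r i w : 1 <= p -> 0 < r -> (forall x, X x -> `|x| <= r) ->
  test_function X w ->
  (\int[mu]_x (`|w x| `^ p)%:E <=
   ((2 * r + 1) `^ p)%:E * \int[mu]_x (`|partial i w x| `^ p)%:E)%E.
Proof.
move=> p1 r0 Xr tw; have sw := test_function_smooth tw.
have p0 : 0 < p by exact: lt_le_trans p1.
have mw : measurable_fun setT w by apply: continuous_measurable_rV; exact: smooth_continuous.
have s0 : 0 < 2 * r + 1 by rewrite addr_gt0// mulr_gt0.
apply: le_trans (translation_estimate i p1 sw s0).
apply: ge0_le_integral => //.
- by apply/measurable_EFinP; exact: measurable_powR_norm.
- apply/measurable_EFinP; apply: measurable_powR_norm; apply: measurable_funB => //.
  exact: (measurableT_comp mw (measurable_add_rV _)).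
- move=> x _; rewrite lee_fin; have [Xx|nXx] := pselect (X x); last first.
    by rewrite (test_function_eq0 tw nXx) normr0 powR0 ?powR_ge0// gt_eqF.
  rewrite (test_function_eq0 tw (x := x + _)) ?sub0r ?normrN// => /Xr.
  apply/negP; rewrite -ltNge; apply: lt_le_trans (rV_coord_norm _ i).
  rewrite !mxE !eqxx mulr1; apply: lt_le_trans (ler_norm _).
  have := le_trans (rV_coord_norm x i) (Xr x Xx); rewrite ler_norml => /andP[h _]; lra.
Qed.

End translation.

(** * Mollification *)

Section mollification.
Context {R : realType} {n : nat}.
Local Notation rV := 'rV[R]_n.
Local Notation mu := (@lebesgue_rV R n).
Local Notation de i := (delta_mx 0 i : rV).
Local Notation L1 g := (mu.-integrable setT (EFin \o g)).
Local Notation test := (test_function (@setT rV)).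
Implicit Types (u v w g h rho : rV -> R) (X : set rV).

Lemma test_function_bounded X w : test_function X w ->
  exists2 M, 0 < M & forall x, `|w x| <= M.
Proof.
move=> tw; have [r _ wr] := test_function_bound tw.
exact: continuous_support_bounded (test_function_continuous tw) wr.
Qed.

Lemma test_function_measurable X w : test_function X w -> measurable_fun setT w.
Proof. by move=> tw; apply: continuous_measurable_rV; exact: test_function_continuous tw. Qed.

Lemma is_derive_line_sub w i (x : rV) (r : R) : smooth w ->
  is_derive r 1 (fun r : R => w (r *: de i + x)) (partial i w (r *: de i + x)).
Proof. by move=> sw; apply: line_is_derive; exact: smooth_derivable. Qed.

Lemma coordinate_lipschitz w i M (x : rV) (t : R) : smooth w ->
  (forall z, `|partial i w z| <= M) -> `|w (x + t *: de i) - w x| <= M * `|t|.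
Proof.
move=> sw hM.
have pos (y : rV) (s : R) : 0 <= s -> `|w (y + s *: de i) - w y| <= M * s.
  move=> s0; have dF r := is_derive_line_sub i y r sw.
  have [|c _] := MVT_segment s0 (fun r _ => dF r).
    exact/continuous_subspaceT/(derivable_continuous dF).
  rewrite scale0r add0r subr0 [s *: _ + y]addrC => ->.
  by rewrite normrM [`|s|]ger0_norm// ler_wpM2r.
have [t0|t0] := leP 0 t; first by rewrite (ger0_norm t0); exact: pos.
have := pos (x + t *: de i) (- t); rewrite scaleNr addrK distrC (ltr0_norm t0).
by apply; rewrite oppr_ge0 ltW.
Qed.

(** Only partial derivatives are at hand, so the displacement is made one coordinate at a time. *)
Lemma test_function_lipschitz X w : test_function X w ->
  exists2 L, 0 < L & forall x y, `|w x - w y| <= L * `|x - y|.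
Proof.
move=> tw; have sw := test_function_smooth tw.
have /choice[M hM] : forall i, exists M, forall z, `|partial i w z| <= M.
  by move=> i; have [M _ hM] := test_function_bounded (test_function_partial i tw); exists M.
have M0 i : 0 <= M i by exact: le_trans (hM i 0).
have key (x d : rV) (s : seq 'I_n) :
    `|w (x + \sum_(i <- s) d 0 i *: de i) - w x| <= \sum_(i <- s) M i * `|d 0 i|.
  elim: s => [|i s IH]; first by rewrite !big_nil addr0 subrr normr0.
  rewrite !big_cons; set a := x + \sum_(j <- s) d 0 j *: de j.
  rewrite (_ : w _ - w x = (w (a + d 0 i *: de i) - w a) + (w a - w x)).
    by apply: le_trans (ler_normD _ _) _; rewrite lerD//; exact: coordinate_lipschitz.
  rewrite [RHS]addrA subrK /a -addrA; congr (w _ - _); congr (_ + _); exact: addrC.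
exists (\sum_i M i + 1); first by rewrite ltr_wpDl// sumr_ge0.
move=> x y; have := key y (x - y) (index_enum _); rewrite -row_sum_delta subrKC.
move=> h; apply: (le_trans h); rewrite mulrDl mul1r mulr_suml ler_wpDr//.
by apply: ler_sum => i _; rewrite ler_wpM2l// rV_coord_norm.
Qed.

Definition conv rho g (x : rV) : R := \int[mu]_y (rho (x - y) * g y).

Lemma measurable_reflect (x : rV) rho : measurable_fun setT rho ->
  measurable_fun setT (fun y : rV => rho (x - y)).
Proof.
move=> mr; under eq_fun do rewrite addrC.
exact: (measurableT_comp mr (measurableT_comp (measurable_add_rV x) measurable_opp_rV)).
Qed.

Lemma measurable_diff_pair rho : measurable_fun setT rho ->
  measurable_fun setT (fun xy : rV * rV => rho (xy.1 - xy.2)).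
Proof.
move=> mr; apply: (measurableT_comp mr).
apply: measurable_fun_coordP => i; under eq_fun do rewrite !mxE.
apply: measurable_funB.
  exact: (measurableT_comp (measurable_coord i) measurable_fst).
exact: (measurableT_comp (measurable_coord i) measurable_snd).
Qed.

Lemma conv_integrable rho g x : test rho -> L1 g -> L1 (fun y => rho (x - y) * g y).
Proof.
move=> tr ig; have [M _ hM] := test_function_bounded tr.
apply: (@integrableMr _ _ _ mu setT measurableT (fun y => rho (x - y)) (EFin \o g)) => //.
  by apply: measurable_reflect; exact: test_function_measurable tr.
by exists M; split; [exact: num_real|move=> N MN y _ /=; exact: le_trans (hM _) (ltW MN)].
Qed.

Lemma L1Z c g : L1 g -> L1 (fun y => c * g y).
Proof. by move=> ig; exact: (integrableZl measurableT c ig). Qed.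

Lemma L1D g h : L1 g -> L1 h -> L1 (g \+ h).
Proof. by move=> ig ih; exact: (integrableD measurableT ig ih). Qed.

Lemma L1B g h : L1 g -> L1 h -> L1 (g \- h).
Proof. by move=> ig ih; exact: (integrableB measurableT ig ih). Qed.

(** The constant [L] depends on rho only: mollifications at one scale of an L^1-bounded family are
    equicontinuous. *)
Lemma conv_lipschitz rho : test rho -> exists2 L, 0 <= L & forall g x y, L1 g ->
  `|conv rho g x - conv rho g y| <= L * \int[mu]_z `|g z| * `|x - y|.
Proof.
move=> tr; have [L L0 hL] := test_function_lipschitz tr.
exists L => [|g x x' ig]; first exact: ltW.
have iag : L1 (fun y => `|g y|) by exact: integrable_norm.
rewrite /conv -RintegralB//; [|exact: conv_integrable|exact: conv_integrable].
apply: le_trans (le_normr_Rintegral _ _) _ => //.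
  exact: (L1B (conv_integrable x tr ig) (conv_integrable x' tr ig)).
rewrite mulrAC -RintegralZl//; apply: le_Rintegral => //.
- exact: (integrable_norm (L1B (conv_integrable x tr ig) (conv_integrable x' tr ig))).
- exact: (integrableZl measurableT (L * `|x - x'|) iag).
- move=> y _; rewrite -mulrBl normrM ler_wpM2r//.
  by apply: le_trans (hL _ _) _; rewrite opprB addrA subrK.
Qed.

Lemma lipschitz_continuous_rV (f : rV -> R) L :
  (forall x y, `|f x - f y| <= L * `|x - y|) -> continuous f.
Proof.
move=> hL x; suff H : f @ nbhs x --> f x by exact: H.
apply/cvgrPdist_lt => e e0; apply/nbhs_ballP.
have L0 : 0 < `|L| + 1 by rewrite ltr_wpDl.
exists (e / (`|L| + 1)) => /=; first by rewrite divr_gt0.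
move=> y; rewrite -ball_normE /= => h; apply: le_lt_trans (hL _ _) _.
apply: (@le_lt_trans _ _ ((`|L| + 1) * `|x - y|)).
  by rewrite ler_wpM2r// (le_trans (ler_norm _))// lerDl.
by rewrite mulrC -ltr_pdivlMr.
Qed.

Lemma conv_continuous rho g : test rho -> L1 g -> continuous (conv rho g).
Proof.
move=> tr ig; have [L _ hL] := conv_lipschitz tr.
by apply: (@lipschitz_continuous_rV _ (L * \int[mu]_z `|g z|)) => x y; exact: hL.
Qed.

(** Differentiation under the integral sign along a line, with majorant M |g|, where M bounds the
    partial derivative of rho. *)
Lemma conv_is_derive rho g i x : test rho -> L1 g ->
  is_derive x (de i) (conv rho g) (conv (partial i rho) g x).
Proof.
move=> tr ig; apply: is_derive_line.
have sr := test_function_smooth tr; have tdr := test_function_partial i tr.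
have [M M0 hM] := test_function_bounded tdr.
pose f (h : R) (y : rV) := rho (h *: de i + x - y) * g y.
have df (h : R) y : is_derive h 1 (f^~ y) (partial i rho (h *: de i + x - y) * g y).
  have d1 := is_derive_line_sub i (x - y) h sr.
  have d2 : is_derive h 1 (fun h : R => rho (h *: de i + (x - y)) * cst (g y) h)
      (rho (h *: de i + (x - y)) *: 0 + cst (g y) h *: partial i rho (h *: de i + (x - y))).
    by apply: is_deriveM.
  rewrite (_ : f^~ y = fun h : R => rho (h *: de i + (x - y)) * cst (g y) h); last first.
    by apply/funext => t; rewrite /f addrA.
  by apply: is_derive_eq d2 _; rewrite scaler0 add0r addrA mulrC.
have iaf (h : R) : L1 (f h) by exact: conv_integrable.
have iG : L1 (fun y => M * `|g y|).
  exact: (integrableZl measurableT M (integrable_norm ig)).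
have I0 : `](-1), 1[%classic (0 : R) by rewrite /= in_itv/= ltrN10 ltr01.
have pE (h : R) y : partial1of2 f h y = partial i rho (h *: de i + x - y) * g y.
  by rewrite partial1of2E; case: (df h y).
have Gu (h : R) y : `](-1), 1[%classic h -> setT y -> `|partial1of2 f h y| <= M * `|g y|.
  by move=> _ _; rewrite pE normrM ler_wpM2r.
have d1 (h : R) y : `](-1), 1[%classic h -> setT y -> derivable (f^~ y) h 1.
  by move=> _ _; case: (df h y).
have G0 y : 0 <= M * `|g y| by rewrite mulr_ge0// ltW.
have D : derivable (fun h : R => \int[mu]_y f h y) (0 : R) 1.
  by apply: (@derivable_under_integral R _ rV mu f setT measurableT 0 (-1) 1 I0 _ d1 (fun y => M * `|g y|) G0 iG Gu).
have E : (fun h : R => \int[mu]_y f h y)^`()%classic (0 : R) = \int[mu]_y partial1of2 f 0 y.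
  by apply: (@differentiation_under_integral R _ rV mu f setT measurableT 0 (-1) 1 I0 _ d1 (fun y => M * `|g y|) G0 iG Gu).
split; first exact: D.
rewrite -derive1E [LHS]E /conv; apply: eq_Rintegral => y _.
by rewrite pE scale0r add0r.
Qed.

Lemma conv_partial rho g i : test rho -> L1 g ->
  partial i (conv rho g) = conv (partial i rho) g.
Proof. by move=> tr ig; apply/funext => x; case: (conv_is_derive i x tr ig). Qed.

Lemma conv_smooth rho g : test rho -> L1 g -> smooth (conv rho g).
Proof.
move=> tr ig; apply: (@smooth_class _ _ [set conv r g | r in [set r | test r]]); last by exists rho.
- by move=> _ [r t_r <-]; exact: conv_continuous.
- by move=> _ [r t_r <-] i x; case: (conv_is_derive i x t_r ig).
- move=> _ [r t_r <-] i; rewrite conv_partial//.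
  by exists (partial i r) => //; exact: test_function_partial.
Qed.

Lemma mollifier_testT e rho : mollifier e rho -> test rho.
Proof.
move=> [sr _ _ re _]; apply: (@test_functionI _ _ _ _ (cube `|e|)) => //.
  exact: compact_cube.
move=> x h; apply: re; rewrite leNgt; apply/negP => xe; apply: h.
by apply/cube_norm => //; exact: le_trans (ltW xe) (ler_norm _).
Qed.

Lemma mollifier_mass e rho (x : rV) : mollifier e rho ->
  (\int[mu]_y (rho (x - y))%:E = 1)%E.
Proof.
move=> mr; have tr := mollifier_testT mr; case: mr => _ _ _ _ r1.
rewrite (@integral_reflect R n x (EFin \o rho))//.
by apply/measurable_EFinP; exact: test_function_measurable tr.
Qed.

Lemma mollifier_mass_left e rho (y : rV) : mollifier e rho ->
  (\int[mu]_x (rho (x - y))%:E = 1)%E.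
Proof.
move=> mr; have tr := mollifier_testT mr; case: mr => _ _ _ _ r1.
rewrite (@integral_shift R n (- y) (EFin \o rho))//.
by apply/measurable_EFinP; exact: test_function_measurable tr.
Qed.

Lemma convD rho g h x : test rho -> L1 g -> L1 h ->
  conv rho (g \+ h) x = conv rho g x + conv rho h x.
Proof.
move=> tr ig ih; rewrite /conv -RintegralD//; [|exact: conv_integrable|exact: conv_integrable].
by apply: eq_Rintegral => y _; rewrite mulrDr.
Qed.

Lemma convZ rho c g x : test rho -> L1 g ->
  conv rho (fun y => c * g y) x = c * conv rho g x.
Proof.
move=> tr ig; rewrite /conv -RintegralZl//; last exact: conv_integrable.
by apply: eq_Rintegral => y _; rewrite mulrCA.
Qed.

Lemma convB rho g h x : test rho -> L1 g -> L1 h ->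
  conv rho (g \- h) x = conv rho g x - conv rho h x.
Proof.
move=> tr ig ih; rewrite /conv -RintegralB//; [|exact: conv_integrable|exact: conv_integrable].
by apply: eq_Rintegral => y _; rewrite mulrBr.
Qed.

Lemma L1_measurable g : L1 g -> measurable_fun setT g.
Proof. by move=> /integrableP[/measurable_EFinP]. Qed.

(** Jensen with the density rho (x - y) in y; then Tonelli, since rho (x - y) has mass one in x as
    well. *)
Lemma conv_le p e rho g : 1 <= p -> mollifier e rho -> L1 g ->
  (\int[mu]_x (`|conv rho g x| `^ p)%:E <= \int[mu]_x (`|g x| `^ p)%:E)%E.
Proof.
move=> p1 mr ig; have tr := mollifier_testT mr; have mg := L1_measurable ig.
have mrho := test_function_measurable tr; have r0 : forall x, 0 <= rho x by case: mr.
pose F (xy : rV * rV) : \bar R := (rho (xy.1 - xy.2) * `|g xy.2| `^ p)%:E.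
have F0 xy : (0 <= F xy)%E by rewrite lee_fin mulr_ge0 ?powR_ge0.
have mF : measurable_fun setT F.
  apply/measurable_EFinP; apply: measurable_funM; first exact: measurable_diff_pair.
  exact: (measurableT_comp (measurable_powR_norm p mg) measurable_snd).
apply: (@le_trans _ _ (\int[mu]_x \int[mu]_y F (x, y))%E).
  apply: ge0_le_integral => //.
  - apply/measurable_EFinP; apply: measurable_powR_norm.
    by apply: continuous_measurable_rV; exact: conv_continuous.
  - exact: measurable_fun_fubini_tonelli_F.
  - move=> x _; apply: (@jensen_powR _ _ _ mu setT (fun y => rho (x - y)) g) => //.
    + exact: measurable_reflect.
    + exact: mollifier_mass mr.
    + exact: conv_integrable.
rewrite (@fubini_tonelli _ _ _ _ _ mu mu _ mF F0).
apply: ge0_le_integral => //.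
- by move=> y _; exact: integral_ge0.
- exact: measurable_fun_fubini_tonelli_G.
- by apply/measurable_EFinP; exact: measurable_powR_norm.
move=> y _; rewrite /F /=; under eq_integral do rewrite EFinM.
rewrite ge0_integralZr//; first by rewrite (mollifier_mass_left y mr) mul1e.
- by apply/measurable_EFinP; exact: (measurableT_comp mrho (measurable_add_rV _)).
- by move=> x _; rewrite lee_fin.
Qed.

Lemma translation_estimateN p w i (s : R) : 1 <= p -> smooth w ->
  (\int[mu]_x (`|w (x + s *: de i)%R - w x| `^ p)%:E <=
   (`|s| `^ p)%:E * \int[mu]_x (`|partial i w x| `^ p)%:E)%E.
Proof.
move=> p1 sw; have p0 : 0 < p by exact: lt_le_trans p1.
have mw : measurable_fun setT w by apply: continuous_measurable_rV; exact: smooth_continuous.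
have [s0|s0|<-] := ltgtP 0 s; last first.
- rewrite normr0 powR0 ?gt_eqF// mul0e (eq_integral (cst 0%E)) ?integral0// => x _.
  by rewrite scale0r addr0 subrr normr0 powR0// gt_eqF.
- have := translation_estimate i p1 sw (_ : 0 < - s); rewrite oppr_gt0 => /(_ s0).
  rewrite (ltr0_norm s0); apply: le_trans.
  pose G x := (`|w (x + (- s) *: de i) - w x| `^ p)%:E.
  have mG : measurable_fun setT G.
    apply/measurable_EFinP; apply: measurable_powR_norm; apply: measurable_funB => //.
    exact: (measurableT_comp mw (measurable_add_rV _)).
  rewrite -[X in (_ <= X)%E](integral_shift (s *: de i) mG) le_eqVlt; apply/orP; left.
  by apply/eqP; apply: eq_integral => x _; rewrite /G scaleNr addrK distrC.
- by rewrite gtr0_norm//; exact: translation_estimate.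
Qed.

(** The displacement is made coordinate by coordinate, each move at the price of a factor 2^p, so
    the constant is independent of w and d. *)
Lemma shift_estimate p : 1 <= p -> exists2 C, 0 <= C &
  forall w (d : rV), smooth w ->
  (\int[mu]_x (`|w (x + d)%R - w x| `^ p)%:E <=
   (C * `|d| `^ p)%:E * \sum_i \int[mu]_x (`|partial i w x| `^ p)%:E)%E.
Proof.
move=> p1; have p0 : 0 < p by exact: lt_le_trans p1.
(* Induction on the list of coordinates already moved; the full list gives back d. *)
suff H (s : seq 'I_n) : exists2 C, 0 <= C & forall w (d : rV), smooth w ->
    (\int[mu]_x (`|w (x + \sum_(i <- s) d 0%R i *: de i)%R - w x| `^ p)%:E <=
    (C * `|d| `^ p)%:E * \sum_i \int[mu]_x (`|partial i w x| `^ p)%:E)%E.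
  have [C C0 hC] := H (index_enum _); exists C; [exact: C0|move=> w d sw].
  apply: le_trans (hC w d sw); rewrite le_eqVlt; apply/orP; left; apply/eqP.
  by apply: eq_integral => x _; rewrite -row_sum_delta.
elim: s => [|i s [C C0 IH]].
  exists 0 => // w d sw; rewrite mul0r mul0e (eq_integral (cst 0%E)) ?integral0// => x _.
  by rewrite big_nil addr0 subrr normr0 powR0// gt_eqF.
exists (2 `^ p * (1 + C)); first by rewrite mulr_ge0 ?powR_ge0 ?addr_ge0.
move=> w d sw; set S := (\sum_i _)%E.
have mw : measurable_fun setT w by apply: continuous_measurable_rV; exact: smooth_continuous.
have mwa (a : rV) : measurable_fun setT (fun x : rV => w (x + a)) by exact: (measurableT_comp mw (measurable_add_rV a)).
have S0 : (0 <= S)%E by apply: sume_ge0 => j _; apply: integral_ge0 => x _; rewrite lee_fin powR_ge0.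
set a := \sum_(j <- s) d 0 j *: de j.
pose F x := (`|w (x + d 0 i *: de i) - w x| `^ p)%:E.
have mF : measurable_fun setT F.
  by apply/measurable_EFinP; apply: measurable_powR_norm; exact: measurable_funB.
have FS : (\int[mu]_x F (x + a)%R <= (`|d| `^ p)%:E * S)%E.
  rewrite (integral_shift a mF); apply: le_trans (translation_estimateN i _ p1 sw) _.
  apply: lee_pmul; rewrite ?lee_fin ?powR_ge0//.
  - by apply: integral_ge0 => x _; rewrite lee_fin powR_ge0.
  - by rewrite ge0_ler_powR ?nnegrE ?(ltW p0)// rV_coord_norm.
  - rewrite /S (bigD1 i)//= leeDl// sume_ge0// => j _.
    by apply: integral_ge0 => x _; rewrite lee_fin powR_ge0.
pose G x := (`|w (x + a) - w x| `^ p)%:E.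
have GS : (\int[mu]_x G x <= (C * `|d| `^ p)%:E * S)%E by exact: IH.
have mFa : measurable_fun setT (fun x : rV => F (x + a)) by exact: (measurableT_comp mF (measurable_add_rV a)).
have mG : measurable_fun setT G.
  by apply/measurable_EFinP; apply: measurable_powR_norm; exact: measurable_funB.
apply: (@le_trans _ _ (\int[mu]_x ((2 `^ p)%:E * (F (x + a)%R + G x)))%E).
  apply: ge0_le_integral => //.
  - by apply/measurable_EFinP; apply: measurable_powR_norm; exact: measurable_funB.
  - by apply: measurable_funeM; exact: emeasurable_funD.
  move=> x _; rewrite /F /G -EFinD -EFinM lee_fin big_cons -/a.
  rewrite (_ : w (x + _) - w x = (w (x + a + d 0 i *: de i) - w (x + a)) + (w (x + a) - w x)).
    exact: normD_powR.
  rewrite [RHS]addrA subrK; congr (w _ - _); rewrite -addrA; congr (_ + _); exact: addrC.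
have gF x : setT x -> (0 <= F (x + a)%R)%E by move=> _; rewrite lee_fin powR_ge0.
have gG x : setT x -> (0 <= G x)%E by move=> _; rewrite lee_fin powR_ge0.
rewrite ge0_integralZl ?lee_fin ?powR_ge0//; last 2 first.
- exact: emeasurable_funD.
- by move=> x _; rewrite adde_ge0 ?gF ?gG.
rewrite (ge0_integralD _ measurableT gF mFa gG mG).
rewrite -mulrA EFinM -muleA lee_wpmul2l ?lee_fin ?powR_ge0//.
rewrite mulrDl mul1r EFinD ge0_muleDl ?lee_fin ?mulr_ge0 ?powR_ge0//.
exact: leeD.
Qed.

End mollification.

Lemma mule_fin_lty {R : realType} (c : R) (x : \bar R) : 0 <= c -> (0 <= x)%E -> (x < +oo)%E -> (c%:E * x < +oo)%E.
Proof. by move=> c0; case: x => [x| |]// _ _; rewrite -EFinM ltry. Qed.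

(** * Modulars and dyadic convex hulls *)

Section modular.
Context d (T : measurableType d) {R : realType} (mu : {measure set T -> \bar R}).
Variable D : set T.
Hypothesis mD : measurable D.
Local Open Scope ereal_scope.
Implicit Types (u v w : T -> R) (p : R).

(** The p-th power of the L^p norm, used in its place to avoid roots; it is convex, and subadditive
    up to the factor 2^p. *)
Definition pint p u : \bar R := \int[mu]_(x in D) (`|u x| `^ p)%:E.

Lemma measurable_pint p u : measurable_fun D u ->
  measurable_fun D (fun x => (`|u x| `^ p)%:E).
Proof. by move=> mf; apply/measurable_EFinP; exact: measurable_powR_norm. Qed.

Lemma pint_ge0 p u : 0 <= pint p u.
Proof. by apply: integral_ge0 => x _; rewrite lee_fin powR_ge0. Qed.

Lemma pintD p u v : (1 <= p)%R -> measurable_fun D u -> measurable_fun D v ->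
  pint p (u \+ v)%R <= (2 `^ p)%:E * (pint p u + pint p v).
Proof.
move=> p1 mf mv.
have u0 x : D x -> 0 <= (`|u x| `^ p)%:E by move=> _; rewrite lee_fin powR_ge0.
have v0 x : D x -> 0 <= (`|v x| `^ p)%:E by move=> _; rewrite lee_fin powR_ge0.
have mU := measurable_pint p mf; have mV := measurable_pint p mv.
rewrite /pint -(ge0_integralD _ mD u0 mU v0 mV) -ge0_integralZl//; last 2 first.
- exact: emeasurable_funD.
- by move=> x Dx; rewrite adde_ge0 ?u0 ?v0.
apply: ge0_le_integral => //.
- by apply: measurable_pint; exact: measurable_funD.
- by apply: measurable_funeM; exact: emeasurable_funD.
- by move=> x Dx; rewrite -EFinD -EFinM lee_fin; exact: normD_powR.
Qed.

Lemma pintN p u : pint p (\- u)%R = pint p u.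
Proof. by apply: eq_integral => x _; rewrite /= normrN. Qed.

Lemma pintB p u v : (1 <= p)%R -> measurable_fun D u -> measurable_fun D v ->
  pint p (u \- v)%R <= (2 `^ p)%:E * (pint p u + pint p v).
Proof.
move=> p1 mf mv; rewrite -(pintN p v); apply: (pintD p1 mf).
exact: measurable_funN.
Qed.

Lemma pintBC p u v : pint p (u \- v)%R = pint p (v \- u)%R.
Proof. by apply: eq_integral => x _; rewrite /= distrC. Qed.

Lemma pintZ p c u : measurable_fun D u ->
  pint p (fun x => (c * u x)%R) = (`|c| `^ p)%:E * pint p u.
Proof.
move=> mf; rewrite /pint -ge0_integralZl//; last exact: measurable_pint.
by apply: eq_integral => x _; rewrite powR_scale EFinM.
Qed.

(** Sublevel sets are stable under midpoints, the form in which bounds pass to convex hulls. *)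
Lemma pint_half p u v : (1 <= p)%R -> measurable_fun D u -> measurable_fun D v ->
  forall c, pint p u <= c -> pint p v <= c -> pint p (fun x => (u x + v x) / 2)%R <= c.
Proof.
move=> p1 mf mv c uc vc; have p0 : (0 <= p)%R by exact: le_trans p1.
have h0 : (0 <= 2^-1 :> R)%R by [].
have u0 x : D x -> 0 <= (2^-1)%:E * (`|u x| `^ p)%:E by move=> _; rewrite -EFinM lee_fin mulr_ge0 ?powR_ge0.
have v0 x : D x -> 0 <= (2^-1)%:E * (`|v x| `^ p)%:E by move=> _; rewrite -EFinM lee_fin mulr_ge0 ?powR_ge0.
have mU := measurable_funeM (2^-1)%:E (measurable_pint p mf).
have mV := measurable_funeM (2^-1)%:E (measurable_pint p mv).
apply: (@le_trans _ _ ((2^-1)%:E * pint p u + (2^-1)%:E * pint p v)).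
  rewrite /pint -!ge0_integralZl//; try exact: measurable_pint; try by move=> x _; rewrite lee_fin powR_ge0.
  rewrite -(ge0_integralD _ mD u0 mU v0 mV).
  apply: ge0_le_integral => //.
  - apply: measurable_pint; apply: measurable_funM => //; exact: measurable_funD.
  - exact: emeasurable_funD.
  - move=> x Dx; rewrite -!EFinM -EFinD lee_fin.
    apply: (@le_trans _ _ (((`|u x| + `|v x|) / 2) `^ p)%R).
      rewrite ge0_ler_powR ?nnegrE ?divr_ge0 ?addr_ge0// normrM [X in (_ * X)%R]ger0_norm//.
      by rewrite ler_wpM2r// ler_normD.
    by apply: le_trans (powR_half _ _ p1) _ => //; rewrite le_eqVlt; apply/orP; left; apply/eqP; ring.
apply: (@le_trans _ _ ((2^-1)%:E * c + (2^-1)%:E * c)).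
  have h1 : 0 <= (2^-1 : R)%:E by rewrite lee_fin invr_ge0.
  exact: (leeD (lee_wpmul2l h1 uc) (lee_wpmul2l h1 vc)).
have c0 : 0 <= c by exact: le_trans (pint_ge0 p u) uc.
have e1 : (2^-1 + 2^-1 = 1 :> R)%R by lra.
by rewrite -ge0_muleDl ?lee_fin// -EFinD e1 mul1e.
Qed.

(** The series of the |w k|^p has integral at most 1, and the p-th root of its sum dominates every
    term. *)
Lemma fast_bound p (w : nat -> T -> R) : (1 <= p)%R ->
  (forall k, measurable_fun D (w k)) ->
  (forall k, pint p (w k) <= (1 / (2 ^ k.+1)%:R)%:E) ->
  exists S : T -> R, [/\ measurable_fun D S, (forall x, (0 <= S x)%R), pint p S < +oo &
    {ae mu, forall x, D x -> forall k, (`|w k x| <= S x)%R}].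
Proof.
move=> p1 mw wk; have p0 : (0 < p)%R by exact: lt_le_trans p1.
pose f k x := (`|w k x| `^ p)%:E; pose F x := \sum_(0 <= k <oo) f k x.
have f0 k x : 0 <= f k x by rewrite lee_fin powR_ge0.
have mf k : measurable_fun D (f k) by exact: measurable_pint.
have mF : measurable_fun D F by apply: ge0_emeasurable_sum => //.
have F0 x : 0 <= F x by apply: nneseries_ge0 => k _ _.
have iF : \int[mu]_(x in D) F x <= 1.
  rewrite integral_nneseries//; apply: le_trans (epsilon_trick0 xpredT ler01).
  by apply: lee_nneseries => k *; [exact: integral_ge0|exact: wk k].
have FS : mu.-integrable D F.
  apply/integrableP; split => //; rewrite (eq_integral F); first exact: le_lt_trans iF (ltry _).
  by move=> x _; rewrite gee0_abs.
pose S x := ((fine (F x)) `^ p^-1)%R.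
have S0 x : (0 <= S x)%R by exact: powR_ge0.
have SpE x : ((`|S x| `^ p)%R)%:E = (fine (F x))%:E.
  rewrite ger0_norm// /S -powRrM mulVf ?gt_eqF// powRr1//.
  by apply: fine_ge0.
have mS : measurable_fun D S.
  apply: (measurableT_comp (measurable_powR _)).
  exact: (measurableT_comp (fine_measurable measurableT) mF).
exists S; split => //.
- apply: le_lt_trans (ltry 1); apply: le_trans iF; apply: ge0_le_integral => //.
  + exact: measurable_pint.
  + by move=> x _; rewrite SpE; case: (F x) (F0 x) => [r| |]//= _; rewrite leey.
- have := integrable_ae mD FS; apply: filterS => x /[swap] Dx /(_ Dx) Fx k.
  rewrite -(@powRr1 _ `|w k x|)// -(mulfV (lt0r_neq0 p0)) powRrM.
  rewrite ge0_ler_powR ?nnegrE ?invr_ge0 ?powR_ge0 ?(ltW p0) ?fine_ge0//.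
  rewrite -lee_fin fineK//.
  apply: le_trans (nneseries_lim_ge (P := xpredT) k.+1 _) => //.
  by rewrite big_nat_recr//= leeDr// sume_ge0.
Qed.

(** Riesz-Fischer with a majorant: the weights 2^k turn one bound S on all weighted increments into
    the geometric bounds S / 2^k. *)
Lemma fast_cvg p (v : nat -> T -> R) : (1 <= p)%R ->
  (forall k, measurable_fun D (v k)) -> pint p (v 0%N) < +oo ->
  (forall k, pint p (fun x => 2 ^+ k * (v k.+1 x - v k x))%R <= (1 / (2 ^ k.+1)%:R)%:E) ->
  exists u H : T -> R, [/\ measurable_fun D u, measurable_fun D H, pint p H < +oo &
    {ae mu, forall x, D x -> (v k x @[k --> \oo] --> u x) /\
                             (forall k, `|v k x| <= H x)%R}].
Proof.
move=> p1 mv v0 hv; have p0 : (0 < p)%R by exact: lt_le_trans p1.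
have mw k : measurable_fun D (fun x => 2 ^+ k * (v k.+1 x - v k x))%R.
  by apply: measurable_funM => //; exact: measurable_funB.
have [S [mS S0 pS [N [mN N0 BN]]]] := fast_bound p1 mw hv.
have key x k : ~ N x -> D x -> (`|v k.+1 x - v k x| <= S x / 2 ^+ k)%R.
  move=> Nx Dx; have : D x -> forall k : nat, (`|2 ^+ k * (v k.+1 x - v k x)| <= S x)%R.
    by apply: contrapT => h; apply: Nx; exact: BN.
  move=> /(_ Dx k); rewrite normrM ger0_norm// => h.
  by rewrite ler_pdivlMr ?exprn_gt0// mulrC.
(* The sum of S / 2^j over j < k is S (2 - 2 / 2^k), whence the majorant |v 0| + 2 S. *)
have mono x k : ~ N x -> D x -> (`|v k x - v 0%N x| <= S x * (2 - 2 / 2 ^+ k))%R.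
  move=> Nx Dx; elim: k => [|k IH].
    by rewrite subrr normr0 mulr_ge0// expr0 divr1 subrr.
  have -> : (v k.+1 x - v 0%N x = (v k.+1 x - v k x) + (v k x - v 0%N x))%R by lra.
  apply: le_trans (ler_normD _ _) _.
  apply: (le_trans (lerD (key x k Nx Dx) IH)); rewrite -mulrDr ler_wpM2l//.
  by rewrite exprS le_eqVlt; apply/orP; left; apply/eqP; field; rewrite expf_neq0.
have step x k l : ~ N x -> D x -> (`|v (k + l)%N x - v k x| <= S x * (2 / 2 ^+ k - 2 / 2 ^+ (k + l)))%R.
  move=> Nx Dx; elim: l => [|l IH].
    by rewrite addn0 !subrr normr0 mulr0.
  have -> : (v (k + l.+1)%N x - v k x =
      (v (k + l).+1 x - v (k + l)%N x) + (v (k + l)%N x - v k x))%R.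
    by rewrite addnS; lra.
  apply: le_trans (ler_normD _ _) _.
  apply: (le_trans (lerD (key x (k + l)%N Nx Dx) IH)); rewrite -mulrDr ler_wpM2l//.
  by rewrite addnS exprS le_eqVlt; apply/orP; left; apply/eqP; field; rewrite !expf_neq0.
(* Resetting the sequence to 0 on the null set makes it converge everywhere on D, so that its limit
   is measurable even if the measure is not complete. *)
pose w k x := if x \in N then 0%R else v k x.
have cw x : D x -> cvgn (w ^~ x).
  move=> Dx; have [xN|xN] := boolP (x \in N).
    rewrite (_ : w ^~ x = fun=> 0%R); first exact: is_cvg_cst.
    by apply/funext => k; rewrite /w xN.
  rewrite (_ : w ^~ x = v ^~ x); last by apply/funext => k; rewrite /w (negbTE xN).
  have Nx : ~ N x by move=> Nx; move/negP : xN; apply; rewrite inE.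
  apply/cauchy_cvgP/cauchyP => e e0.
  have [k ke] : exists k, (S x * (2 / 2 ^+ k) < e)%R.
    have c0 : (S x * 2 * (2^-1) ^+ k @[k --> \oo] --> (0 : R))%R.
      by apply: cvg_geometric; rewrite ger0_norm// invf_lt1// ltr1n.
    move/cvgrPdist_lt : c0 => /(_ e e0)[k _ hk]; exists k.
    have := hk k (leqnn k); rewrite /= sub0r normrN; apply: le_lt_trans.
    by rewrite mulrA exprVn ler_norm.
  exists (v k x); exists k => // m /= km; rewrite -(subnKC km) -ball_normE/= distrC.
  apply: le_lt_trans (step _ _ _ Nx Dx) _; apply: le_lt_trans ke.
  by rewrite ler_wpM2l// gerBl divr_ge0.
have mw' k : measurable_fun D (w k).
  apply: measurable_fun_if => //.
  - by apply: (measurable_fun_bool true); rewrite (_ : _ @^-1` _ = N);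
      [exact: measurableI|apply/seteqP; split => x /=; [move=> /set_mem|move=> /mem_set]].
  - by apply: measurable_funS (mv k) => // x [].
exists (fun x => limn (w ^~ x)), (fun x => `|v 0%N x| + 2 * S x)%R; split.
- by apply: (measurable_fun_cvg mw') => x Dx; exact: cw.
- by apply: measurable_funD; [exact: measurableT_comp|exact: measurable_funM].
- apply: le_lt_trans (pintD p1 _ _) _.
  + exact: measurableT_comp.
  + exact: measurable_funM.
  apply: mule_fin_lty; [exact: powR_ge0|by apply: adde_ge0; exact: pint_ge0|apply: lte_add_pinfty].
    have -> : pint p (fun x => `|v 0%N x|)%R = pint p (v 0%N) by apply: eq_integral => x _; rewrite normr_id.
    exact: v0.
  rewrite pintZ//; apply: mule_fin_lty => //; exact: pint_ge0.
- exists N; split => // x /= /not_implyP[Dx]; apply: contra_notP => Nx; split.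
    have := cw x Dx; rewrite /w memNset//.
  move=> k; have := mono x k Nx Dx => h.
  rewrite -[X in (`|X|)%R](subrK (v 0%N x)) addrC; apply: le_trans (ler_normD _ _) _.
  rewrite lerD2l; apply: le_trans h _; rewrite mulrC ler_wpM2r//.
  by rewrite gerBl divr_ge0.
Qed.

End modular.

Section hull.
Context {R : realType} {E : Type}.
Implicit Types (u : nat -> E -> R) (v w : E -> R).

(* Midpoints suffice, so that weights stay dyadic and convexity is only used
   at the midpoint. *)
Inductive hull u (m : nat) : set (E -> R) :=
| hull_in k : (m <= k)%N -> hull u m (u k)
| hull_mid v w : hull u m v -> hull u m w -> hull u m (fun t => (v t + w t) / 2).

Lemma hull_sub u m m' : (m <= m')%N -> hull u m' `<=` hull u m.
Proof.
move=> mm w; elim=> [k km'|v1 v2 _ h1 _ h2]; first exact/hull_in/(leq_trans mm).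
exact: hull_mid.
Qed.

Lemma hull_prop u m (P : (E -> R) -> Prop) :
  (forall k, (m <= k)%N -> P (u k)) ->
  (forall v w, P v -> P w -> P (fun t => (v t + w t) / 2)) ->
  forall w, hull u m w -> P w.
Proof. by move=> h1 h2 w; elim=> // v1 v2 _ p1 _ p2; exact: h2. Qed.

(* Near-minimisers of Phi over the hulls of the tails are asymptotically close,
   because the midpoint of two of them cannot do much better. *)
Lemma hull_near_minimizers u (Phi : (E -> R) -> R) (gap : (E -> R) -> (E -> R) -> R)
    (B : R) (eps : nat -> R) :
  (forall w, 0 <= Phi w) -> (forall k, Phi (u k) <= B) ->
  (forall v w, hull u 0 v -> hull u 0 w ->
     Phi (fun t => (v t + w t) / 2) + gap v w <= (Phi v + Phi w) / 2) ->
  (forall j, 0 < eps j) -> (forall j, eps j.+1 <= eps j) ->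
  exists h : nat -> E -> R, (forall j, hull u j (h j)) /\
    (forall j, gap (h j) (h j.+1) <= eps j).
Proof.
move=> P0 PB mid e0 eS.
pose A k := Phi @` hull u k.
have A0 k : has_inf (A k).
  split; first by exists (Phi (u k)), (u k) => //; exact: hull_in.
  by exists 0 => _ [w _ <-].
pose m k := inf (A k).
have mB k : m k <= B.
  apply: le_trans (PB k); apply: inf_lbound; first by case: (A0 k).
  by exists (u k) => //; exact: hull_in.
have mle k w : hull u k w -> m k <= Phi w.
  by move=> hw; apply: inf_lbound; [case: (A0 k)|exists w].
have mnd k l : (k <= l)%N -> m k <= m l.
  move=> kl; apply: lb_le_inf; first by case: (A0 l).
  by move=> _ [w hw <-]; apply: mle; exact: hull_sub hw.
pose M := sup (range m).
have hM : has_sup (range m).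
  by split; [exists (m 0%N), 0%N|exists B => _ [k _ <-]].
have mM k : m k <= M by apply: sup_upper_bound => //; exists k.
(* M is the limit of the infima over the tails. The near-minimiser is taken in a tail so late that
   the infimum there exceeds M - eps j / 2; the last clause keeps the index of that tail. *)
have pick j : exists w, [/\ hull u j w, Phi w < M + eps j / 2 &
    exists2 k, hull u k w & M - eps j / 2 < m k].
  have ej : 0 < eps j / 2 by rewrite divr_gt0.
  have [_ [k _ <-] hk] := sup_adherent ej hM.
  have hk' : M - eps j / 2 < m (maxn j k).
    by apply: lt_le_trans hk _; apply: mnd; exact: leq_maxr.
  have [_ [w hw <-] hPw] := inf_adherent ej (A0 (maxn j k)).
  exists w; split.
  - by apply: hull_sub hw; exact: leq_maxl.
  - by apply: lt_le_trans hPw _; rewrite lerD2r; exact: mM.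
  - by exists (maxn j k).
have [h hh] := choice pick; exists h; split => j; first by case: (hh j).
have [hj Pj [k hk mk]] := hh j; have [hj1 Pj1 [l hl ml]] := hh j.+1.
have h0 := hull_sub (leq0n j) hj; have h01 := hull_sub (leq0n j.+1) hj1.
have := mid _ _ h0 h01; have := eS j.
suff : M - eps j / 2 <= Phi (fun t => (h j t + h j.+1 t) / 2) by lra.
(* The midpoint lies only in the hull with the smaller index; either index yields the lower bound,
   because eps is nonincreasing. *)
have [kl|lk] := leqP k l.
  apply: le_trans (ltW mk) _; apply: mle; apply: hull_mid => //; exact: hull_sub hl.
apply: (@le_trans _ _ (m l)); first by have := eS j; lra.
by apply: mle; apply: hull_mid => //; apply: hull_sub hk; exact: ltnW.
Qed.

End hull.

(** * Inequalities with a quantitative midpoint defect *)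

Section convexity.
Context {R : realType}.
Implicit Types (a b p q x y : R).

(** Dividing by x + y leaves ratios in [0, 1], which a power q >= 1 does not increase. *)
Lemma powR_superadditive x y q : 0 <= x -> 0 <= y -> 1 <= q ->
  x `^ q + y `^ q <= (x + y) `^ q.
Proof.
move=> x0 y0 q1; have q0 : 0 < q by exact: lt_le_trans q1.
have [s0|s0] := eqVneq (x + y) 0.
  have [-> ->] : x = 0 /\ y = 0 by split; lra.
  by rewrite addr0 powR0 ?gt_eqF// addr0.
have {}s0 : 0 < x + y by rewrite lt_neqAle eq_sym s0 addr_ge0.
have key z : 0 <= z -> z <= x + y -> z `^ q <= (x + y) `^ q * (z / (x + y)).
  rewrite le_eqVlt => /orP[/eqP <- _|z0 zs].
    by rewrite mul0r mulr0 powR0// gt_eqF.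
  rewrite -[X in X `^ q <= _](divfK (lt0r_neq0 s0)) powRM ?divr_ge0 ?(ltW z0) ?(ltW s0)//.
  rewrite mulrC ler_pM2l ?powR_gt0//; apply: ge1r_powR => //.
  by rewrite divr_gt0//= ler_pdivrMr// mul1r.
have h1 := key x x0 (_ : x <= x + y); have h2 := key y y0 (_ : y <= x + y).
rewrite lerDl in h1; rewrite lerDr in h2.
apply: le_trans (lerD (h1 y0) (h2 x0)) _.
by rewrite -mulrDr -mulrDl divff ?mulr1// gt_eqF.
Qed.

(** With q = p / 2 >= 1 applied to squares: superadditivity, then the parallelogram identity, then
    convexity. *)
Lemma clarkson a b p : 2 <= p ->
  `|(a + b) / 2| `^ p + `|(a - b) / 2| `^ p <= (`|a| `^ p + `|b| `^ p) / 2.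
Proof.
move=> p2; pose q := p / 2.
have q1 : 1 <= q by rewrite ler_pdivlMr// mul1r.
have pE x : `|x| `^ p = (x ^+ 2) `^ q.
  have -> : p = 2 * q by rewrite /q mulrC divfK.
  by rewrite powRrM powR_mulrn// real_normK ?num_real.
rewrite !pE; apply: le_trans (powR_superadditive _ _ q1) _; rewrite ?sqr_ge0//.
have -> : ((a + b) / 2) ^+ 2 + ((a - b) / 2) ^+ 2 = (a ^+ 2 + b ^+ 2) / 2 by field.
by apply: powR_half; rewrite ?sqr_ge0.
Qed.

(** In terms of A = exp (-a/2) and B = exp (-b/2) this is A B + (A - B)^2 / 2 = (A^2 + B^2) / 2. The
    defect controls exp (-x/2), which is why that function appears later. *)
Lemma expR_half a b :
  expR (- ((a + b) / 2)) + (expR (- a / 2) - expR (- b / 2)) ^+ 2 / 2 =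
  (expR (- a) + expR (- b)) / 2.
Proof.
have -> : expR (- ((a + b) / 2)) = expR (- a / 2) * expR (- b / 2).
  by rewrite -expRD; congr expR; field.
have -> : expR (- a) = expR (- a / 2) ^+ 2 by rewrite expr2 -expRD; congr expR; field.
have -> : expR (- b) = expR (- b / 2) ^+ 2 by rewrite expr2 -expRD; congr expR; field.
by field.
Qed.

End convexity.

(** * Almost everywhere convergence of near-minimisers in the hulls *)

Section hull_limit.
Context d (T : measurableType d) {R : realType} (mu : {measure set T -> \bar R}).
Variable D : set T.
Hypothesis mD : measurable D.
Hypothesis muD : (mu D < +oo)%E.

(** Integrates a pointwise midpoint inequality with defect b. Finiteness of the defect is part of
    the conclusion, so that [fine] loses nothing. *)
Lemma fine_half_le (a b c e : T -> R) : measurable_fun D a -> measurable_fun D b ->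
  measurable_fun D c -> measurable_fun D e ->
  (forall x, D x -> 0 <= a x) -> (forall x, D x -> 0 <= b x) ->
  (forall x, D x -> 0 <= c x) -> (forall x, D x -> 0 <= e x) ->
  (forall x, D x -> a x + b x <= (c x + e x) / 2) ->
  (\int[mu]_(x in D) (c x)%:E < +oo)%E -> (\int[mu]_(x in D) (e x)%:E < +oo)%E ->
  (\int[mu]_(x in D) (b x)%:E < +oo)%E /\
  fine (\int[mu]_(x in D) (a x)%:E)%E + fine (\int[mu]_(x in D) (b x)%:E)%E <=
  (fine (\int[mu]_(x in D) (c x)%:E)%E + fine (\int[mu]_(x in D) (e x)%:E)%E) / 2.
Proof.
move=> ma mb mc me a0 b0 c0 e0 h ic ie.
have E0 (f : T -> R) : (forall x, D x -> 0 <= f x) -> forall x, D x -> (0 <= (f x)%:E)%E.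
  by move=> f0 x Dx; rewrite lee_fin f0.
have Em (f : T -> R) : measurable_fun D f -> measurable_fun D (fun x => (f x)%:E) by move=> ?; exact/measurable_EFinP.
have I0 (f : T -> R) : (forall x, D x -> 0 <= f x) -> (0 <= \int[mu]_(x in D) (f x)%:E)%E.
  by move=> f0; apply: integral_ge0 => x Dx; rewrite lee_fin f0.
have : (\int[mu]_(x in D) (a x)%:E + \int[mu]_(x in D) (b x)%:E <=
  (2^-1)%:E * (\int[mu]_(x in D) (c x)%:E + \int[mu]_(x in D) (e x)%:E))%E.
  rewrite -(ge0_integralD _ mD (E0 _ a0) (Em _ ma) (E0 _ b0) (Em _ mb)).
  rewrite -(ge0_integralD _ mD (E0 _ c0) (Em _ mc) (E0 _ e0) (Em _ me)).
  rewrite -ge0_integralZl//; last 2 first.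
  - by apply: emeasurable_funD; exact: Em.
  - by move=> x Dx; rewrite -EFinD lee_fin addr_ge0 ?c0 ?e0.
  apply: ge0_le_integral => //.
  - by move=> x Dx; rewrite -EFinD lee_fin addr_ge0 ?a0 ?b0.
  - by apply: emeasurable_funD; exact: Em.
  - by apply: measurable_funeM; apply: emeasurable_funD; exact: Em.
  - by move=> x Dx; rewrite -!EFinD -EFinM lee_fin mulrC h.
move: ic ie (I0 _ a0) (I0 _ b0) (I0 _ c0) (I0 _ e0).
move: (integral _ _ _) => iC; move: (integral _ _ _) => iE.
move: (integral _ _ (fun x => (a x)%:E)) => iA; move: (integral _ _ _) => iB.
case: iC => [C| |]// _; case: iE => [E| |]// _.
case: iA => [A| |]//; case: iB => [B| |]//= _ _ _ _ h1; split; rewrite ?ltry//.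
by move: h1; rewrite -!EFinD -EFinM lee_fin mulrC.
Qed.

Variables (I : finType) (p : R) (u : nat -> option I * T -> R) (B : R).
Hypothesis p2 : 2 <= p.
Hypothesis mu_ : forall k o, measurable_fun D (fun x => u k (o, x)).
Hypothesis uB : forall k i, (pint mu D p (fun x => u k (Some i, x)) <= B%:E)%E.
Hypothesis u0 : forall k x, 0 <= u k (None, x).

Let good (h : option I * T -> R) :=
  [/\ forall o, measurable_fun D (fun x => h (o, x)),
      forall i, (pint mu D p (fun x => h (Some i, x)) <= B%:E)%E &
      forall x, 0 <= h (None, x)].

Lemma hull_good m : hull u m `<=` good.
Proof.
have p1 : 1 <= p by apply: le_trans p2; rewrite ler1n.
apply: hull_prop; first by move=> k _; split.
move=> v w [mv vB v0] [mw wB w0]; split.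
- by move=> o; apply: measurable_funM => //; exact: measurable_funD.
- by move=> i; exact: pint_half.
- by move=> x; rewrite divr_ge0// addr_ge0.
Qed.

(* Strictly convex in all components: Clarkson in the [Some i], and
   [exp (- x)] in the nonnegative [None], on which no bound is assumed. *)
Let Phi (h : option I * T -> R) : R :=
  \sum_i fine (pint mu D p (fun x => h (Some i, x))) +
  fine (\int[mu]_(x in D) (expR (- h (None, x)))%:E)%E.

Let gap (v w : option I * T -> R) : R :=
  \sum_i fine (pint mu D p (fun x => (v (Some i, x) - w (Some i, x)) / 2)) +
  fine (\int[mu]_(x in D) ((expR (- v (None, x) / 2) - expR (- w (None, x) / 2)) ^+ 2 / 2)%:E)%E.

Let mexp (h : option I * T -> R) c : good h ->
  measurable_fun D (fun x => expR (- h (None, x) * c)).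
Proof.
move=> [mh _ _]; apply: (measurableT_comp (@measurable_expR R)).
by apply: measurable_funM => //; exact: measurable_funN.
Qed.

Let expfin (h : option I * T -> R) : good h ->
  (\int[mu]_(x in D) (expR (- h (None, x)))%:E <= mu D)%E.
Proof.
move=> gh; have me := mexp 1 gh; case: gh => mh _ h0.
rewrite -[X in (_ <= X)%E]mul1e -integral_cst//; apply: ge0_le_integral => //.
- apply/measurable_EFinP; apply: eq_measurable_fun me => x _.
  by rewrite mulr1.
- by move=> x Dx; rewrite lee_fin expR_le1 oppr_le0.
Qed.

Let gap_parts (v w : option I * T -> R) : good v -> good w ->
  (forall i, (pint mu D p (fun x => ((v (Some i, x) - w (Some i, x)) / 2)%R) < +oo)%E /\
    fine (pint mu D p (fun x => (v (Some i, x) + w (Some i, x)) / 2)) +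
    fine (pint mu D p (fun x => (v (Some i, x) - w (Some i, x)) / 2)) <=
    (fine (pint mu D p (fun x => v (Some i, x))) + fine (pint mu D p (fun x => w (Some i, x)))) / 2) /\
  ((\int[mu]_(x in D) ((expR (- v (None, x) / 2) - expR (- w (None, x) / 2)) ^+ 2 / 2)%R%:E < +oo)%E /\
   fine (\int[mu]_(x in D) (expR (- ((v (None, x) + w (None, x)) / 2)))%:E)%E +
   fine (\int[mu]_(x in D) ((expR (- v (None, x) / 2) - expR (- w (None, x) / 2)) ^+ 2 / 2)%:E)%E <=
   (fine (\int[mu]_(x in D) (expR (- v (None, x)))%:E)%E +
    fine (\int[mu]_(x in D) (expR (- w (None, x)))%:E)%E) / 2).
Proof.
move=> gv gw; have [mv vB v0] := gv; have [mw wB w0] := gw; split.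
  move=> i; apply: fine_half_le.
  - by apply: measurable_powR_norm; apply: measurable_funM => //; exact: measurable_funD.
  - by apply: measurable_powR_norm; apply: measurable_funM => //; exact: measurable_funB.
  - exact: measurable_powR_norm.
  - exact: measurable_powR_norm.
  - by move=> x _; exact: powR_ge0.
  - by move=> x _; exact: powR_ge0.
  - by move=> x _; exact: powR_ge0.
  - by move=> x _; exact: powR_ge0.
  - by move=> x _; exact: clarkson.
  - exact: le_lt_trans (vB i) (ltry _).
  - exact: le_lt_trans (wB i) (ltry _).
have e1 h : good h -> measurable_fun D (fun x => expR (- h (None, x))).
  by move=> gh; apply: eq_measurable_fun (mexp 1 gh) => x _; rewrite mulr1.
apply: fine_half_le.
- apply: (measurableT_comp (@measurable_expR R)); apply: measurable_funN.
  by apply: measurable_funM => //; exact: measurable_funD.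
- apply: measurable_funM => //; apply: measurable_funX; apply: measurable_funB; exact: mexp.
- exact: e1.
- exact: e1.
- by move=> x _; exact: expR_ge0.
- by move=> x _; rewrite divr_ge0// sqr_ge0.
- by move=> x _; exact: expR_ge0.
- by move=> x _; exact: expR_ge0.
- by move=> x _; rewrite expR_half.
- exact: le_lt_trans (expfin gv) muD.
- exact: le_lt_trans (expfin gw) muD.
Qed.

(** In the [None] component only exp (-h/2) is known to converge; its limit may be 0, where h itself
    tends to infinity. *)
Lemma hull_limit : exists h : nat -> option I * T -> R,
  [/\ forall j, hull u j (h j),
   forall i, exists v H : T -> R, [/\ measurable_fun D v, measurable_fun D H,
      (pint mu D p H < +oo)%E &
      {ae mu, forall x, D x -> (h j (Some i, x) @[j --> \oo] --> v x) /\
                               (forall j, `|h j (Some i, x)| <= H x)}] &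
   exists2 e : T -> R, measurable_fun D e &
      {ae mu, forall x, D x -> expR (- h j (None, x) / 2) @[j --> \oo] --> e x}].
Proof.
have p1 : 1 <= p by apply: le_trans p2; rewrite ler1n.
have p0 : 0 < p by exact: lt_le_trans p1.
(* The weight 2^j of [fast_cvg], times the 2 that undoes the halved difference in the gap, is
   2^(j+1). The first factor cancels its p-th power, the second is the summable bound that
   remains. *)
pose eps (j : nat) : R := (2 ^+ j.+1) `^ (- p) / (2 ^ j.+1)%:R.
have z0 (j : nat) : 0 < 2 ^+ j :> R by rewrite exprn_gt0.
have eps0 j : 0 < eps j by rewrite divr_gt0 ?powR_gt0// ltr0n expn_gt0.
have epsS j : eps j.+1 <= eps j.
  rewrite /eps; apply: ler_pM; rewrite ?powR_ge0 ?invr_ge0 ?ler0n//.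
    rewrite !powRN lef_pV2 ?posrE ?powR_gt0// ge0_ler_powR ?nnegrE ?(ltW p0) ?(ltW (z0 _))//.
    by rewrite ler_eXn2l// ltr1n.
  by rewrite lef_pV2 ?posrE ?ltr0n ?expn_gt0// ler_nat leq_exp2l.
have gu k : good (u k) by apply: (@hull_good 0); exact: hull_in.
have B0 k i : fine (pint mu D p (fun x => u k (Some i, x))) <= B.
  have := uB k i; have := pint_ge0 mu D p (fun x => u k (Some i, x)).
  by case: (pint _ _ _ _).
have [|||h [hh hgap]] := @hull_near_minimizers _ _ u Phi gap
    (\sum_(i : I) B + fine (mu D)) eps _ _ _ eps0 epsS.
- move=> w; rewrite addr_ge0 ?sumr_ge0// => [i _|].
    by apply: fine_ge0; exact: pint_ge0.
  by apply: fine_ge0; apply: integral_ge0 => x _; rewrite lee_fin expR_ge0.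
- move=> k; rewrite lerD//; first by apply: ler_sum => i _; exact: B0.
  apply: fine_le; rewrite ?ge0_fin_numE//; last exact: expfin.
  + by apply: le_lt_trans (expfin (gu k)) muD.
  + by apply: integral_ge0 => x _; rewrite lee_fin expR_ge0.
- move=> v w /hull_good gv /hull_good gw; have [h1 [_ h2]] := gap_parts gv gw.
  rewrite /Phi /gap addrACA -big_split/= addrACA -big_split/= mulrDl mulr_suml; apply: lerD; last exact: h2.
  by apply: ler_sum => i _; case: (h1 i).
- exists h; have gh j : good (h j) by apply: (@hull_good j).
  have g0 j := gap_parts (gh j) (gh j.+1).
  have S0 j : 0 <= \sum_i fine (pint mu D p (fun x => (h j (Some i, x) - h j.+1 (Some i, x)) / 2)).
    by apply: sumr_ge0 => i _; apply: fine_ge0; exact: pint_ge0.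
  have T0 j : 0 <= fine (\int[mu]_(x in D) ((expR (- h j (None, x) / 2) - expR (- h j.+1 (None, x) / 2)) ^+ 2 / 2)%:E)%E.
    by apply: fine_ge0; apply: integral_ge0 => x _; rewrite lee_fin divr_ge0// sqr_ge0.
  split => //.
  + move=> i; apply: fast_cvg => //.
    * by move=> j; case: (gh j).
    * by have [_ hB _] := gh 0%N; exact: le_lt_trans (hB i) (ltry _).
    * move=> j; have [m1 _ _] := gh j; have [m2 _ _] := gh j.+1.
      have md : measurable_fun D (fun x => (h j (Some i, x) - h j.+1 (Some i, x)) / 2).
        by apply: measurable_funM => //; exact: measurable_funB.
      rewrite (_ : pint mu D p _ = pint mu D p (fun x => - 2 ^+ j.+1 * ((h j (Some i, x) - h j.+1 (Some i, x)) / 2))); last first.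
        by apply: eq_integral => x _; congr ((`| _ | `^ _)%:E); rewrite exprS; field.
      rewrite pintZ// normrN ger0_norm ?(ltW (z0 _))//.
      have [hfin _] := (g0 j).1 i.
      have tle : fine (pint mu D p (fun x => (h j (Some i, x) - h j.+1 (Some i, x)) / 2)) <= eps j.
        apply: le_trans (hgap j); rewrite /gap (bigD1 i)//= -addrA lerDl addr_ge0//.
        by apply: sumr_ge0 => k _; apply: fine_ge0; exact: pint_ge0.
      rewrite -(fineK (_ : pint mu D p _ \is a fin_num)); last by rewrite ge0_fin_numE// pint_ge0.
      rewrite -EFinM lee_fin; apply: le_trans (ler_wpM2l (powR_ge0 _ _) tle) _.
      by rewrite /eps powRN mulrA mulfV ?gt_eqF ?powR_gt0// mul1r.
  + have mv j : measurable_fun D (fun x => expR (- h j (None, x) / 2)) by exact: mexp.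
    have p12 : 1 <= 2 :> R by rewrite ler1n.
    (* The exponential gap is a square, hence the exponent 2. The same eps serves, since p >= 2 and
       2 (2^j)^2 <= (2^(j+1))^2. *)
    have [|j|e [H [me _ _ eP]]] := @fast_cvg _ _ _ mu D mD 2 (fun j x => expR (- h j (None, x) / 2)) p12 mv.
    * apply: le_lt_trans muD; rewrite -[X in (_ <= X)%E]mul1e -integral_cst//; apply: ge0_le_integral => //.
      - exact: measurable_pint.
      - move=> x Dx; rewrite lee_fin ger0_norm ?expR_ge0// powR_mulrn ?expR_ge0// exprn_ile1 ?expR_ge0//.
        by rewrite expR_le1 pmulr_lle0// oppr_le0; case: (gh 0%N).
    * have [hfin _] := (g0 j).2.
      set G := (\int[mu]_(x in D) _)%E in hfin.
      rewrite (_ : pint mu D 2 _ = ((2 ^+ j) ^+ 2 * 2)%:E * G)%E; last first.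
        rewrite /G -ge0_integralZl//; last 2 first.
        - apply/measurable_EFinP; apply: measurable_funM => //; apply: measurable_funX.
          exact: measurable_funB.
        - by move=> x _; rewrite lee_fin divr_ge0// sqr_ge0.
        apply: eq_integral => x _; rewrite -EFinM powR_mulrn// -normrX ger0_norm ?sqr_ge0//.
        by congr EFin; field.
      have G0 : (0 <= G)%E by apply: integral_ge0 => x _; rewrite lee_fin divr_ge0// sqr_ge0.
      have tle : fine G <= eps j by apply: le_trans (hgap j); rewrite /gap lerDr.
      rewrite -(fineK (_ : G \is a fin_num)); last by rewrite ge0_fin_numE.
      rewrite -EFinM lee_fin; apply: le_trans (ler_wpM2l _ tle) _; first by rewrite mulr_ge0// sqr_ge0.
      rewrite /eps powRN mulrA mul1r ger_pMl ?invr_gt0 ?ltr0n ?expn_gt0//.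
      rewrite ler_pdivrMr ?powR_gt0// mul1r.
      apply: (@le_trans _ _ ((2 ^+ j.+1) `^ 2)).
        rewrite powR_mulrn ?(ltW (z0 _))// (exprS 2 j) exprMn.
        by have := sqr_ge0 (2 ^+ j : R); lra.
      by apply: ler_powR => //; rewrite exprn_ege1// ler1n.
    by exists e => //; apply: filterS eP => x h1 Dx; have [] := h1 Dx.
Qed.

End hull_limit.

Section dominated.
Context d (T : measurableType d) {R : realType} (mu : {measure set T -> \bar R}).
Variable D : set T.
Hypothesis mD : measurable D.

Lemma cvge0_le (u : nat -> \bar R) (e : R) : u k @[k --> \oo] --> 0%E -> 0 < e ->
  \forall k \near \oo, (u k <= e%:E)%E.
Proof.
move=> /fine_cvgP[fu u0] e0; move/cvgrPdist_lt : u0 => /(_ _ e0).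
apply: filterS2 fu => k uk; rewrite /= sub0r normrN => h.
by rewrite -(fineK uk) lee_fin; apply: le_trans (ltW h); exact: ler_norm.
Qed.

Lemma powR_cvg0 (u : nat -> R) p : 1 <= p -> u k @[k --> \oo] --> 0 ->
  `|u k| `^ p @[k --> \oo] --> 0.
Proof.
move=> p1 u0; apply/cvgrPdist_lt => e e0.
have e1 : 0 < Num.min e 1 by rewrite lt_min e0 ltr01.
move/cvgrPdist_lt : u0 => /(_ _ e1); apply: filterS => k.
rewrite !sub0r !normrN lt_min => /andP[ue u1].
rewrite ger0_norm ?powR_ge0//; have [->|k0] := eqVneq (u k) 0.
  by rewrite normr0 powR0// gt_eqF// (lt_le_trans _ p1).
by apply: le_lt_trans ue; apply: ge1r_powR => //; rewrite normr_gt0 k0 ltW.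
Qed.

(** The majorant passes to the limit, so |v k - u|^p is dominated by 2^p * 2 * H^p. *)
Lemma pint_dominated p (v : nat -> T -> R) (u H : T -> R) : 1 <= p ->
  (forall k, measurable_fun D (v k)) -> measurable_fun D u -> measurable_fun D H ->
  (pint mu D p H < +oo)%E ->
  {ae mu, forall x, D x -> (v k x @[k --> \oo] --> u x) /\ (forall k, `|v k x| <= H x)} ->
  forall e, 0 < e -> \forall k \near \oo, (pint mu D p (v k \- u)%R <= e%:E)%E.
Proof.
move=> p1 mv mu_ mH Hoo vu; have p0 : 0 < p by exact: lt_le_trans p1.
have [] := @dominated_convergence _ _ _ mu D mD (fun k x => (`|v k x - u x| `^ p)%:E)
   (cst 0%E) (fun x => ((2 `^ p * 2)%:E * (`|H x| `^ p)%:E)%E).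
- by move=> k; apply: measurable_pint; exact: measurable_funB.
- exact: measurable_cst.
- apply: filterS vu => x /[swap] Dx /(_ Dx)[vu _]; apply: cvg_EFin; first by apply: nearW.
  apply: (@powR_cvg0 (fun k => v k x - u x)) => //.
  by rewrite -(subrr (u x)); apply: cvgB => //; exact: cvg_cst.
- apply: integrableZl => //; apply/integrableP; split; first exact: measurable_pint.
  rewrite (eq_integral (fun x => (`|H x| `^ p)%:E)) // => x _.
  by rewrite gee0_abs// lee_fin powR_ge0.
- apply: filterS vu => x + k Dx => /(_ Dx)[vu vH].
  have uH : `|u x| <= H x.
    apply: (ler_cvg_to (cvg_norm vu) (cvg_cst (H x))).
    by apply: nearW => j; exact: vH.
  have H0 : 0 <= H x by exact: le_trans uH.
  rewrite -EFinM /= lee_fin ger0_norm ?powR_ge0// -mulrA.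
  apply: le_trans (normD_powR _ _ p1) _; rewrite ler_wpM2l ?powR_ge0// mulr2n mulrDl mul1r normrN.
  by rewrite (ger0_norm H0) lerD// ge0_ler_powR ?nnegrE ?(ltW p0).
- move=> _ + _ e e0 => /cvge0_le/(_ e0); apply: filterS => k; apply: le_trans.
  rewrite le_eqVlt; apply/orP; left; apply/eqP; apply: eq_integral => x _ /=.
  by rewrite subr0 (ger0_norm (powR_ge0 _ _)).
Qed.

End dominated.

(** * Approximation in L^p by mollification *)

Section mollifier_approximation.
Context {R : realType} {n : nat}.
Local Notation rV := 'rV[R]_n.
Local Notation mu := (@lebesgue_rV R n).
Local Notation L1 g := (mu.-integrable setT (EFin \o g)).
Local Notation test := (test_function (@setT rV)).
Local Notation P p u := (pint mu setT p u).
Implicit Types (rho g h : rV -> R) (p e : R) (A : set rV).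

(** Open sets are the pi-system on which mollification can be estimated directly; the Dynkin
    argument starts from them. *)
Lemma measurable_openE : @measurable _ rV = <<s [set A : set rV | open A] >>.
Proof.
apply/seteqP; split; last first.
  apply: smallest_sub; first exact: sigma_algebra_measurable.
  by move=> A; exact: open_measurable_rV.
suff h : \big[setU/set0]_(i < n) preimage_set_system [set: rV]
    (fun x : rV => x 0 i : measurableTypeR R) measurable `<=` <<s [set A : set rV | open A]>>.
  by apply: (smallest_sub _ h); exact: smallest_sigma_algebra.
apply: (big_ind (fun G => G `<=` <<s [set A : set rV | open A]>>)) => [//|G H mG mH|i _ B [C mC <-] /=].
  by rewrite subUset.
rewrite setTI; move: C mC.
have sO : sigma_algebra setT <<s [set A : set rV | open A]>> by exact: smallest_sigma_algebra.
suff : <<s @RGenOpens.G R >> `<=` [set C | <<s [set A : set rV | open A]>> ((fun x : rV => x 0 i) @^-1` C)].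
  by move=> h C; rewrite -[measurable _]/((ocitv (R := R)).-sigma.-measurable C) RGenOpens.measurableE => /h.
apply: smallest_sub; first (split => /=).
- by rewrite preimage_set0; case: sO.
- by move=> C mC; rewrite setTD preimage_setC -setTD; case: sO => _ + _; apply.
- by move=> F mF; rewrite preimage_bigcup; case: sO => _ _; apply.
move=> _ [x [y ->]]; apply: sub_sigma_algebra => /=.
by apply: open_comp; [move=> z _; exact: coord_continuous|exact: interval_open].
Qed.

Lemma L1_indic A : measurable A -> (mu A < +oo)%E -> L1 (\1_A : rV -> R).
Proof.
move=> mA Aoo; apply/integrableP; split; first by apply/measurable_EFinP; exact: measurable_indic.
rewrite (eq_integral (fun x => (\1_A x)%:E)); first by rewrite integral_indic// setIT.
by move=> x _; rewrite gee0_abs// lee_fin.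
Qed.

Lemma mollifier_sub e e' rho : e <= e' -> mollifier e rho -> mollifier e' rho.
Proof. by move=> ee' [? ? ? h ?]; split=> // x ex; apply: h; exact: le_trans ex. Qed.

(** Quantifying over all mollifiers of small radius, not over one sequence, makes the property
    stable under sums: the smaller of two radii serves both. *)
Definition mollifies p g := forall d, 0 < d -> exists2 e, 0 < e &
  forall rho, mollifier e rho -> (P p (conv rho g \- g)%R <= d%:E)%E.

Lemma conv_measurable rho g : test rho -> L1 g -> measurable_fun setT (conv rho g).
Proof. by move=> tr Lg; apply: continuous_measurable_rV; exact: conv_continuous. Qed.

(** Mollification does not increase the modular, by [conv_le], so the error of g is split into
    three. The constant in [d1] is the cost of the two splittings. *)
Lemma mollifies_closed p g : 1 <= p -> L1 g ->
  (forall d, 0 < d -> exists h, [/\ L1 h, mollifies p h & (P p (g \- h)%R <= d%:E)%E]) ->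
  mollifies p g.
Proof.
move=> p1 Lg H d d0; pose K := 2 `^ p : R.
have K0 : 0 < K by exact: powR_gt0.
pose d1 := d / (K * (1 + K * 2)).
have d10 : 0 < d1 by rewrite divr_gt0 ?mulr_gt0 ?addr_gt0 ?mulr_gt0.
have [h [Lh mh gh]] := H _ d10; have [e e0 he] := mh _ d10.
exists e => // rho mr; have tr := mollifier_testT mr.
have mg := L1_measurable Lg; have mh' := L1_measurable Lh.
have mcg := conv_measurable tr Lg; have mch := conv_measurable tr Lh.
have Lgh := L1B Lg Lh.
have -> : P p (conv rho g \- g)%R = P p (conv rho (g \- h) \+ ((conv rho h \- h) \+ (h \- g)))%R.
  by apply: eq_integral => x _ /=; rewrite convB//; congr ((`| _ | `^ _)%:E); ring.
have m1 : measurable_fun setT (conv rho h \- h) by exact: measurable_funB.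
have m2 : measurable_fun setT (h \- g) by exact: measurable_funB.
have hh := pintD mu measurableT p1 (conv_measurable tr Lgh) (measurable_funD m1 m2). apply: le_trans hh _.
apply: (@le_trans _ _ (K%:E * (d1%:E + K%:E * (d1%:E + d1%:E)))%E).
  apply: lee_wpmul2l; first by rewrite lee_fin (ltW K0).
  apply: leeD; first exact: le_trans (conv_le p1 mr Lgh) gh.
  apply: le_trans (pintD mu measurableT p1 m1 m2) _.
  apply: lee_wpmul2l; first by rewrite lee_fin (ltW K0).
  by apply: leeD; [exact: he|rewrite pintBC].
have -> : (K%:E * (d1%:E + K%:E * (d1%:E + d1%:E)) = (K * (d1 + K * (d1 + d1)))%:E)%E by [].
rewrite lee_fin le_eqVlt; apply/orP; left; apply/eqP.
rewrite /d1; field.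
by rewrite !gt_eqF// addr_gt0// mulr_gt0.
Qed.

Lemma mollifiesD p g h : 1 <= p -> L1 g -> L1 h -> mollifies p g -> mollifies p h ->
  mollifies p (g \+ h).
Proof.
move=> p1 Lg Lh mg mh d d0; pose K := 2 `^ p : R.
have K0 : 0 < K by exact: powR_gt0.
have d10 : 0 < d / (K * 2) by rewrite divr_gt0 ?mulr_gt0.
have [e1 e10 h1] := mg _ d10; have [e2 e20 h2] := mh _ d10.
exists (Num.min e1 e2); first by rewrite lt_min e10.
move=> rho mr; have tr := mollifier_testT mr.
have r1 : (P p (conv rho g \- g)%R <= (d / (K * 2))%:E)%E.
  by apply: h1; apply: mollifier_sub mr; rewrite ge_min lexx.
have r2 : (P p (conv rho h \- h)%R <= (d / (K * 2))%:E)%E.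
  by apply: h2; apply: mollifier_sub mr; rewrite ge_min lexx orbT.
have -> : P p (conv rho (g \+ h) \- (g \+ h))%R = P p ((conv rho g \- g) \+ (conv rho h \- h))%R.
  by apply: eq_integral => x _ /=; rewrite convD//; congr ((`| _ | `^ _)%:E); ring.
have m1 : measurable_fun setT (conv rho g \- g) by apply: measurable_funB; [exact: conv_measurable|exact: L1_measurable].
have m2 : measurable_fun setT (conv rho h \- h) by apply: measurable_funB; [exact: conv_measurable|exact: L1_measurable].
apply: le_trans (pintD mu measurableT p1 m1 m2) _.
apply: le_trans (lee_wpmul2l _ (leeD r1 r2)) _; first by rewrite lee_fin (ltW K0).
rewrite -EFinD -EFinM lee_fin le_eqVlt; apply/orP; left; apply/eqP.
by rewrite -/K; field; rewrite gt_eqF.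
Qed.

Lemma mollifiesZ p c g : L1 g -> mollifies p g -> mollifies p (fun y => c * g y).
Proof.
move=> Lg mg d d0; pose K := `|c| `^ p + 1.
have K0 : 0 < K by rewrite ltr_wpDl ?powR_ge0.
have d10 : 0 < d / K by rewrite divr_gt0.
have [e e0 h] := mg _ d10; exists e => // rho mr; have tr := mollifier_testT mr.
have -> : P p (conv rho (fun y => c * g y) \- (fun y => c * g y))%R = P p (fun x => c * (conv rho g \- g) x)%R.
  by apply: eq_integral => x _ /=; rewrite convZ//; congr ((`| _ | `^ _)%:E); ring.
rewrite pintZ//; last by apply: measurable_funB; [exact: conv_measurable|exact: L1_measurable].
apply: le_trans (lee_wpmul2l _ (h _ mr)) _; first by rewrite lee_fin powR_ge0.
rewrite -EFinM lee_fin mulrA ler_pdivrMr// mulrC ler_wpM2l ?(ltW d0)//.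
by rewrite lerDl.
Qed.

(* Where the convolution and the indicator of an open set differ, the centre is
   near the boundary or outside the set; the mass outside is what is missing inside. *)
Lemma mollifies_open p U : 1 <= p -> open U -> (mu U < +oo)%E -> mollifies p \1_U.
Proof.
move=> p1 oU Ufin d d0; have p0 : 0 < p by exact: lt_le_trans p1.
have mU := open_measurable_rV oU.
(* The neighbourhood of radius 1/(k+1) of the complement. As U is open, its traces on U decrease to
   the empty set, and their measures tend to 0 because mu U is finite. *)
pose V k : set rV := \bigcup_(y in ~` U) ball y (k.+1%:R^-1).
have oV k : open (V k) by apply: bigcup_open => y _; exact: ball_open.
have mUV k : measurable (U `&` V k) by apply: measurableI => //; exact: open_measurable_rV.
have UV0 : \bigcap_k (U `&` V k) = set0.
  rewrite -subset0 => x Hx; have [Ux _] := Hx 0%N I.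
  have /nbhs_ballP[e e0 xe] := open_nbhs_nbhs (conj oU Ux).
  have [k ke] : exists k, k.+1%:R^-1 < e.
    have e0' : 0 < e := e0; have [k _ /(_ k (leqnn k))] := near_infty_natSinv_lt (PosNum e0'); by exists k.
  have [_ [y nUy yx]] := Hx k I; apply: nUy; apply: xe; apply: ball_sym.
  by apply: le_ball yx; exact: ltW.
have Vd : {homo (fun k => U `&` V k) : k l / (k <= l)%N >-> (l <= k)%O}.
  move=> k l kl; apply/subsetPset => x [Ux [y ny yx]]; split=> //; exists y => //.
  by apply: le_ball yx; rewrite lef_pV2 ?posrE// ler_nat.
have := @nonincreasing_cvg_mu _ _ _ mu (fun k => U `&` V k).
rewrite UV0 measure0 => /(_ _ mUV measurable0 Vd) mu0.
have {}mu0 : (mu \o (fun k => U `&` V k)) k @[k --> \oo] --> 0%E.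
  by apply: mu0; apply: le_lt_trans Ufin; apply: le_measure; rewrite ?inE// => x [].
have [k _ /(_ k (leqnn k)) /= muk] := cvge0_le mu0 (divr_gt0 d0 (ltr0n _ 2 : 0 < 2)).
exists (k.+1%:R^-1) => // rho mr; have tr := mollifier_testT mr.
have mB := mUV k; move: muk mB; set B := U `&` V k => muk mB.
have LU : L1 (\1_U : rV -> R) by exact: L1_indic.
have [_ r0 _ rs _] := mr.
have c0 x : 0 <= conv rho \1_U x.
  apply: Rintegral_ge0 => y _; exact: mulr_ge0.
have c1 x : conv rho \1_U x <= 1.
  rewrite /conv -[leRHS](_ : fine 1%E = 1)// -(mollifier_mass x mr) -/(Rintegral _ _ _).
  apply: le_Rintegral => //; first exact: conv_integrable.
    have := mollifier_test (X := setT) (x := x) mr => /(_ (subsetT _)).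
    exact: test_function_integrable.
  by move=> y _; rewrite ler_piMr// indicE; case: (_ \in _).
(* Once integrated, mu U cancels against the mass of the convolution, which is at most mu U; what
   remains bounds the L^1 error by 2 mu B, with no separate estimate outside U. *)
have pt x : `|conv rho \1_U x - \1_U x| + \1_U x <= conv rho \1_U x + 2 * \1_B x.
  have [xU|xU] := boolP (x \in U).
    have [xV|xV] := boolP (x \in V k).
      have -> : \1_B x = 1 :> R by rewrite indicE /B in_setI xU xV.
      rewrite indicE xU mulr1n distrC ger0_norm ?subr_ge0//.
      by have := c0 x; lra.
    have -> : conv rho \1_U x = 1.
      rewrite /conv -[RHS](_ : fine 1%E = 1)// -(mollifier_mass x mr) -/(Rintegral _ _ _).
      apply: eq_Rintegral => y _; have [Uy|Uy] := boolP (y \in U); first by rewrite indicE Uy mulr1.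
      rewrite rs ?mul0r// leNgt; apply/negP => xy; move/negP : xV; apply; apply/mem_set.
      exists y; first by move=> /mem_set Uy'; rewrite Uy' in Uy.
      by rewrite -ball_normE/= distrC.
    by rewrite !indicE xU subrr normr0 add0r lerDl mulr_ge0.
  rewrite (_ : \1_U x = 0); last by rewrite indicE (negbTE xU).
  by rewrite subr0 addr0 ger0_norm// lerDl mulr_ge0// indicE.
have mc := conv_measurable tr LU.
have mUf : measurable_fun setT (\1_U : rV -> R) by exact: measurable_indic.
have dm : measurable_fun setT (conv rho \1_U \- \1_U)%R by exact: measurable_funB.
have Lc : (\int[mu]_x (conv rho \1_U x)%:E <= mu U)%E.
  have := conv_le (lexx 1) mr LU.
  rewrite (eq_integral (fun x => (conv rho \1_U x)%:E)); last first.
    by move=> x _; rewrite powRr1 ?ger0_norm.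
  move=> h; apply: le_trans h _; have -> : (mu U = \int[mu]_x (\1_U x)%:E)%E by rewrite integral_indic// setIT.
  rewrite le_eqVlt; apply/orP; left; apply/eqP; apply: eq_integral => x _.
  by rewrite powRr1// ger0_norm// indicE.
have main : (\int[mu]_x (`|conv rho \1_U x - \1_U x|)%:E + mu U <= mu U + 2%:E * mu B)%E.
  have -> : (mu U = \int[mu]_x (\1_U x)%:E)%E by rewrite integral_indic// setIT.
  have -> : (mu B = \int[mu]_x (\1_B x)%:E)%E by rewrite integral_indic// setIT.
  have mBf : measurable_fun setT (fun x => (\1_B x : R)%:E) by apply/measurable_EFinP; exact: measurable_indic.
  have mUE : measurable_fun setT (fun x => (\1_U x : R)%:E) by exact/measurable_EFinP.
  have mcE : measurable_fun setT (fun x => (conv rho \1_U x)%:E) by exact/measurable_EFinP.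
  have mdE : measurable_fun setT (fun x => (`|conv rho \1_U x - \1_U x|)%:E).
    by apply/measurable_EFinP; exact: measurableT_comp.
  apply: (@le_trans _ _ (\int[mu]_x (conv rho \1_U x)%:E + 2%:E * \int[mu]_x (\1_B x)%:E)%E); last first.
    apply: leeD => //; by apply: le_trans Lc _; rewrite integral_indic// setIT.
  rewrite -ge0_integralZl// -ge0_integralD// -ge0_integralD//; try exact: measurable_funeM; try by move=> x _; rewrite lee_fin c0.
  apply: ge0_le_integral => //.
  - by move=> x _; rewrite adde_ge0// lee_fin.
  - exact: emeasurable_funD.
  - by apply: emeasurable_funD => //; exact: measurable_funeM.
  - by move=> x _; have := pt x; rewrite -lee_fin EFinD EFinD EFinM.
(* The difference lies in [-1, 1], so its p-th power is at most its absolute value. *)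
apply: (@le_trans _ _ (\int[mu]_x (`|conv rho \1_U x - \1_U x|)%:E)%E).
  apply: ge0_le_integral => //.
  - exact: measurable_pint.
  - by apply/measurable_EFinP; exact: measurableT_comp.
  move=> x _; rewrite lee_fin /=; have [->|nz] := eqVneq (conv rho \1_U x - \1_U x) 0.
    by rewrite normr0 powR0// gt_eqF.
  apply: ge1r_powR => //; rewrite normr_gt0 nz /= ler_norml.
  have : 0 <= (\1_U x : R) <= 1 by rewrite indicE; case: (_ \in _); rewrite ?lexx ?ler01.
  by have := c0 x; have := c1 x; lra.
have Ur : mu U \is a fin_num by rewrite ge0_fin_numE.
move: main; rewrite (addeC (mu U)) leeD2rE// => main.
apply: le_trans main _; apply: le_trans (lee_wpmul2l _ muk) _ => //.
by rewrite -EFinM lee_fin mulrC divfK.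
Qed.

Lemma indicUI A B Q : A `&` B = set0 ->
  (\1_((A `|` B) `&` Q) : rV -> R) = \1_(A `&` Q) \+ \1_(B `&` Q).
Proof.
move=> AB; apply/funext => x /=; rewrite !indicE !in_setI in_setU.
have := in_set0 x; rewrite -AB in_setI.
by case: (x \in A); case: (x \in B); case: (x \in Q); rewrite //= ?addr0 ?add0r.
Qed.

(** Dynkin's argument from open sets. Intersecting with a fixed open Q of finite measure keeps
    complements integrable. *)
Lemma mollifies_measurable p Q A : 1 <= p -> open Q -> (mu Q < +oo)%E -> measurable A ->
  mollifies p \1_(A `&` Q).
Proof.
move=> p1 oQ Qfin; have mQ := open_measurable_rV oQ.
have fin B : measurable B -> (mu (B `&` Q) < +oo)%E.
  by move=> mB; apply: le_lt_trans Qfin; apply: le_measure; rewrite ?inE//; exact: measurableI.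
have LI B : measurable B -> L1 (\1_(B `&` Q) : rV -> R).
  by move=> mB; apply: L1_indic; [exact: measurableI|exact: fin].
have e0 : mollifies p (\1_(set0 `&` Q) : rV -> R).
  by rewrite set0I; apply: mollifies_open => //; rewrite measure0.
rewrite measurable_openE; move: A; apply: (dynkin_induction measurable_openE).
- by move=> A B oA oB; exact: openI.
- by rewrite setTI; exact: mollifies_open.
- move=> A oA; apply: mollifies_open => //; first exact: openI.
  by apply: fin; exact: open_measurable_rV.
- move=> S mS mo; have mQ' : mollifies p (\1_Q : rV -> R) by exact: mollifies_open.
  rewrite (_ : \1_(~` S `&` Q) = \1_Q \+ (fun x => -1 * \1_(S `&` Q) x)).
    exact: (mollifiesD p1 (L1_indic mQ Qfin) (L1Z (-1) (LI _ mS)) mQ' (mollifiesZ (-1) (LI _ mS) mo)).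
  apply/funext => x /=; rewrite !indicE !in_setI in_setC.
  by case: (x \in S); case: (x \in Q); rewrite //= ?mulN1r ?subrr ?subr0.
- move=> F mF tF hF; have mU : measurable (\bigcup_k F k) by exact: bigcupT_measurable.
  pose G K := \big[setU/set0]_(k < K) F k.
  have mG K : measurable (G K) by apply: bigsetU_measurable.
  have hG K : mollifies p (\1_(G K `&` Q) : rV -> R).
    elim: K => [|K IH]; first by rewrite /G big_ord0.
    rewrite /G big_ord_recr/= -/(G K) indicUI; first exact: (mollifiesD p1 (LI _ (mG K)) (LI _ (mF K)) IH (hF K)).
    rewrite -subset0 => x []; rewrite /G -bigcup_mkord => -[k /= kK Fkx] FKx.
    move/trivIsetP : tF => /(_ k K I I); rewrite neq_ltn kK => /(_ isT).
    by move=> e; have : (F k `&` F K) x by []; rewrite e.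
  apply: mollifies_closed => //; first exact: LI.
  move=> e e0'.
  have [] := @pint_dominated _ _ _ mu setT measurableT p (fun K => \1_(G K `&` Q) : rV -> R)
     \1_(\bigcup_k F k `&` Q) \1_Q p1 _ _ _ _ _ e e0'.
  + by move=> K; apply: measurable_indic; exact: measurableI.
  + by apply: measurable_indic; exact: measurableI.
  + exact: measurable_indic.
  + rewrite /pint (eq_integral (fun x => (\1_Q x)%:E)); first by rewrite integral_indic// setIT.
    move=> x _; rewrite indicE; case: (_ \in _); rewrite ?normr1 ?powR1// normr0 powR0//.
    by rewrite gt_eqF// (lt_le_trans _ p1).
  + apply: aeW => x _; split.
      apply: cvg_near_cst; have [[k _ Fk]|nF] := pselect ((\bigcup_k F k) x).
        exists k.+1 => // K /= kK; rewrite !indicE !in_setI (mem_set (A := \bigcup_k F k)); last by exists k.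
        by rewrite (mem_set (A := G K))// /G -bigcup_mkord; exists k.
      apply: nearW => K; rewrite !indicE !in_setI (memNset (A := \bigcup_k F k))// (memNset (A := G K))//.
      by rewrite /G -bigcup_mkord => -[k _ Fk]; apply: nF; exists k.
    move=> K; rewrite ger0_norm// !indicE in_setI ler_nat.
    by case: (_ \in G K).
  move=> N _ /(_ N (leqnn N)) /= h; exists \1_(G N `&` Q).
  by split; [exact: LI|exact: hG|rewrite pintBC].
Qed.

(** Subtracting M / 2 where g > 0 and - M / 2 elsewhere on Q halves the bound on g; N rounds give N
    binary digits. *)
Lemma indicator_approximation p Q N : 1 <= p -> open Q -> (mu Q < +oo)%E ->
  forall g M, measurable_fun setT g -> (forall x, `|g x| <= M * \1_Q x) ->
  exists h, [/\ measurable_fun setT h, L1 h, mollifies p h &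
    forall x, `|g x - h x| <= M / 2 ^+ N * \1_Q x].
Proof.
move=> p1 oQ Qfin; have mQ := open_measurable_rV oQ.
have LI B : measurable B -> L1 (\1_(B `&` Q) : rV -> R).
  move=> mB; apply: L1_indic; first exact: measurableI.
  by apply: le_lt_trans Qfin; apply: le_measure; rewrite ?inE//; exact: measurableI.
elim: N => [|N IH] g M mg gM.
  exists (fun x => 0 * \1_(set0 `&` Q) x); split.
  - by apply: measurable_funM => //; apply: measurable_indic; exact: measurableI.
  - exact/L1Z/LI.
  - by apply: mollifiesZ; [exact: LI|exact: mollifies_measurable].
  - by move=> x; rewrite expr0 divr1 mul0r subr0.
pose A := g @^-1` `]0, +oo[%classic.
have mA : measurable A by rewrite -[A]setTI; exact: mg.
pose s x := M / 2 * (\1_(A `&` Q) x + -1 * \1_(~` A `&` Q) x).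
have mAC := measurableC mA.
have Ls : L1 s by apply/L1Z/L1D; [exact: LI|exact/L1Z/LI].
have ms : mollifies p s.
  apply: mollifiesZ; first by apply: L1D; [exact: LI|exact/L1Z/LI].
  apply: mollifiesD => //; [exact: LI|exact/L1Z/LI|exact: mollifies_measurable|].
  by apply: mollifiesZ; [exact: LI|exact: mollifies_measurable].
have [|x|h [mh Lh moh hh]] := IH (g \- s) (M / 2).
- by apply: measurable_funB => //; exact: L1_measurable.
- have := gM x; rewrite /s /= !indicE !in_setI in_setC.
  have [xQ|xQ] := boolP (x \in Q); last first.
    by rewrite !andbF !mulr0 addr0 mulr0 subr0.
  rewrite !andbT !mulr1 => xM.
  have [/set_mem|/negP xA] := boolP (x \in A).
    rewrite /A /= in_itv/= andbT => x0; move: xM; rewrite mulr1n mulr0n mulr0 addr0 mulr1 gtr0_norm// ler_norml; lra.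
  have : g x <= 0 by rewrite leNgt; apply/negP => x0; apply: xA; apply/mem_set; rewrite /A/= in_itv/= x0.
  by move=> x0; move: xM; rewrite mulr1n mulr0n add0r mulr1 ler0_norm// ler_norml; lra.
- exists (s \+ h); split.
  + by apply: measurable_funD => //; exact: L1_measurable.
  + exact: L1D.
  + exact: mollifiesD.
  + move=> x; have := hh x; rewrite /= opprD addrA => /le_trans; apply.
    by rewrite le_eqVlt; apply/orP; left; apply/eqP; rewrite exprS; field; rewrite expf_neq0.
Qed.

Lemma mollifies_bounded p Q g M : 1 <= p -> open Q -> (mu Q < +oo)%E -> 
  measurable_fun setT g -> (forall x, `|g x| <= M * \1_Q x) -> mollifies p g.
Proof.
move=> p1 oQ Qfin mg gM; have mQ := open_measurable_rV oQ.
have p0 : 0 < p by exact: lt_le_trans p1.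
have LQ := L1_indic mQ Qfin.
have Lg : L1 g.
  apply: (le_integrable measurableT _ _ (L1Z M LQ)); first exact/measurable_EFinP.
  by move=> x _; rewrite /= lee_fin; apply: le_trans (gM x) _; exact: ler_norm.
apply: mollifies_closed => // d d0.
have /choice[h hh] N := indicator_approximation N p1 oQ Qfin mg gM.
have mgh N : measurable_fun setT (g \- h N) by apply: measurable_funB => //; case: (hh N).
have MQ0 x : 0 <= M * \1_Q x by apply: le_trans (gM x).
have [] := @pint_dominated _ _ _ mu setT measurableT p (fun N => g \- h N)
   (cst 0) (fun x => M * \1_Q x) p1 mgh _ _ _ _ d d0.
- exact: measurable_cst.
- by apply: measurable_funM => //; exact: measurable_indic.
- rewrite pintZ//.
  apply: mule_fin_lty; [exact: powR_ge0|exact: pint_ge0|].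
  rewrite /pint (eq_integral (fun x => (\1_Q x)%:E)); first by rewrite integral_indic// setIT.
  move=> x _; rewrite indicE; case: (_ \in _); rewrite ?normr1 ?powR1// normr0 powR0//.
  by rewrite gt_eqF.
- apply: aeW => x _; split; last first.
    move=> N; have [_ _ _ /(_ x) /le_trans] := hh N; apply.
    by rewrite mulrAC ler_piMr// invf_le1 ?exprn_gt0// exprn_ege1// ler1n.
  apply/cvgr0Pnorm_le => e e0.
  have c0 : (M * \1_Q x) * (2^-1) ^+ k @[k --> \oo] --> (0 : R).
    by apply: cvg_geometric; rewrite ger0_norm// invf_lt1// ltr1n.
  move/cvgr0Pnorm_le : c0 => /(_ _ e0); apply: filterS => k; apply: le_trans.
  have [_ _ _ /(_ x) /le_trans] := hh k; apply.
  by rewrite exprVn mulrAC ler_norm.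
move=> N _ /(_ N (leqnn N)) /= hN; exists (h N); have [_ Lh moh _] := hh N; split; [exact: Lh|exact: moh|].
apply: le_trans hN; rewrite le_eqVlt; apply/orP; left; apply/eqP.
by apply: eq_integral => x _ /=; rewrite subr0.
Qed.

(** Truncation in height and in space at once: g is kept where |g| <= k and |x| < k. *)
Lemma mollifies_Lp p g : 1 <= p -> L1 g -> (P p g < +oo)%E -> mollifies p g.
Proof.
move=> p1 Lg pg; have mg := L1_measurable Lg; have p0 : 0 < p by exact: lt_le_trans p1.
pose Q k : set rV := ball 0 k%:R.
have oQ k : open (Q k).
  case: k => [|k]; last exact: ball_open.
  rewrite /Q (_ : ball _ _ = set0); first exact: open0.
  by rewrite -subset0 => x; rewrite -ball_normE/= sub0r normrN normr_lt0.
have Qfin k : (mu (Q k) < +oo)%E.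
  apply: (@bounded_lebesgue_fin _ _ _ k%:R); first exact: measurable_ball_rV.
  by move=> x; rewrite /Q -ball_normE/= sub0r normrN => /ltW.
pose A k : set rV := (fun x => `|g x|) @^-1` `]-oo, k%:R]%classic.
have mA k : measurable (A k).
  rewrite -[A k]setTI; apply: (measurableT_comp (@normr_measurable R setT) mg) => //.
pose h k x := g x * \1_(A k `&` Q k) x.
have mAQ k : measurable (A k `&` Q k) by apply: measurableI => //; exact: measurable_ball_rV.
have mh k : measurable_fun setT (h k) by apply: measurable_funM => //; exact: measurable_indic.
have hM k x : `|h k x| <= k%:R * \1_(Q k) x.
  rewrite /h normrM (ger0_norm (_ : 0 <= \1_(A k `&` Q k) x))// !indicE in_setI.
  have [/set_mem|_] := boolP (x \in A k); last by rewrite andFb mulr0 mulr_ge0.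
  by rewrite /A/= in_itv/= => gk; rewrite ler_wpM2r.
apply: mollifies_closed => // d d0.
have [] := @pint_dominated _ _ _ mu setT measurableT p h g (fun x => `|g x|) p1 mh mg _ _ _ d d0.
- exact: measurableT_comp.
- rewrite (_ : P p _ = P p g); first exact: pg.
  by apply: eq_integral => x _; rewrite normr_id.
- apply: aeW => x _; split; last first.
    by move=> k; rewrite /h normrM ler_piMr// (ger0_norm (_ : 0 <= \1_(A k `&` Q k) x))// indicE; case: (_ \in _).
  apply: cvg_near_cst; near=> k.
  rewrite /h indicE mem_set ?mulr1//; split.
    by rewrite /A/= in_itv/=; near: k; exact: nbhs_infty_ger.
  by rewrite /Q -ball_normE/= sub0r normrN; near: k; exact: nbhs_infty_gtr.
move=> N _ /(_ N (leqnn N)) /= hN; exists (h N); split; last by rewrite pintBC.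
- apply: (le_integrable measurableT _ _ Lg); first exact/measurable_EFinP.
  move=> x _; rewrite /= lee_fin /h normrM ler_piMr// (ger0_norm (_ : 0 <= \1_(A N `&` Q N) x))// indicE; by case: (_ \in _).
- exact: mollifies_bounded (hM N).
Unshelve. all: by end_near.
Qed.

End mollifier_approximation.

Section dominated2.
Context d (T : measurableType d) {R : realType} (mu : {measure set T -> \bar R}).
Variable D : set T.
Hypothesis mD : measurable D.

Lemma Rintegral_support (E : set T) (f : T -> R) : E `<=` D ->
  (forall x, D x -> ~ E x -> f x = 0) ->
  \int[mu]_(x in D) f x = \int[mu]_(x in E) f x.
Proof.
move=> ED f0; rewrite Rintegral_mkcond [RHS]Rintegral_mkcond; congr (fine _).
apply: eq_integral => x _; congr EFin; rewrite /patch.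
have [/set_mem Ex|Ex] := boolP (x \in E); first by rewrite mem_set//; exact: ED.
case: ifPn => // /set_mem Dx; apply: f0 => // /mem_set Ex'; by rewrite Ex' in Ex.
Qed.

Lemma Rintegral_eq0 (f : T -> R) : (forall x, D x -> f x = 0) ->
  \int[mu]_(x in D) f x = 0.
Proof.
move=> f0; rewrite /Rintegral (eq_integral (cst 0%E)) ?integral0// => x /set_mem Dx.
by rewrite f0.
Qed.

Lemma Rintegral_dominated (f_ : nat -> T -> R) (f g : T -> R) :
  (forall k, measurable_fun D (f_ k)) -> measurable_fun D f ->
  mu.-integrable D (EFin \o g) ->
  {ae mu, forall x, D x -> (f_ k x @[k --> \oo] --> f x) /\ (forall k, `|f_ k x| <= g x)} ->
  \int[mu]_(x in D) f_ k x @[k --> \oo] --> \int[mu]_(x in D) f x.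
Proof.
move=> mf_ mf ig ff; have [] := @dominated_convergence _ _ _ mu D mD
  (fun k x => (f_ k x)%:E) (EFin \o f) (EFin \o g).
- by move=> k; exact/measurable_EFinP.
- exact/measurable_EFinP.
- by apply: filterS ff => x /[swap] Dx /(_ Dx)[h _]; apply: cvg_EFin; [exact: nearW|exact: h].
- exact: ig.
- by apply: filterS ff => x + k Dx => /(_ Dx)[_ /(_ k)]; rewrite /= lee_fin.
move=> If _ h; apply: fine_cvg; rewrite fineK//.
exact: integrable_fin_num.
Qed.

Lemma pint_fast p (v : nat -> T -> R) (u : T -> R) : 1 <= p ->
  (forall k, measurable_fun D (v k)) -> measurable_fun D u ->
  (forall k, pint mu D p (fun x => 2 ^+ k * (v k x - u x))%R <= (1 / (2 ^ k.+1)%:R)%:E)%E ->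
  exists S : T -> R, [/\ measurable_fun D S, forall x, 0 <= S x, (pint mu D p S < +oo)%E &
    {ae mu, forall x, D x -> (v k x @[k --> \oo] --> u x) /\ forall k, `|v k x - u x| <= S x}].
Proof.
move=> p1 mv mu_ hv.
have mw k : measurable_fun D (fun x => 2 ^+ k * (v k x - u x))%R.
  by apply: measurable_funM => //; exact: measurable_funB.
have [S [mS S0 pS aS]] := fast_bound mD p1 mw hv.
exists S; split => //; apply: filterS aS => x /[swap] Dx /(_ Dx) h.
have h2 k : `|v k x - u x| <= S x / 2 ^+ k.
  by rewrite ler_pdivlMr ?exprn_gt0// mulrC; have := h k; rewrite normrM (ger0_norm (exprn_ge0 _ _)).
split; last first.
  by move=> k; apply: le_trans (h2 k) _; rewrite ler_piMr// invf_le1 ?exprn_gt0// exprn_ege1// ler1n.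
apply/cvgrPdist_le => e e0.
have c0 : S x * (2^-1) ^+ k @[k --> \oo] --> (0 : R).
  by apply: cvg_geometric; rewrite ger0_norm// invf_lt1// ltr1n.
move/cvgr0Pnorm_le : c0 => /(_ _ e0); apply: filterS => k; apply: le_trans.
by rewrite distrC; apply: le_trans (h2 k) _; rewrite exprVn ler_norm.
Qed.

End dominated2.

(** * Mollification inside an open set and the fundamental lemma *)

Section local_approximation.
Context {R : realType} {n : nat}.
Local Notation rV := 'rV[R]_n.
Local Notation mu := (@lebesgue_rV R n).
Local Notation L1 g := (mu.-integrable setT (EFin \o g)).
Implicit Types (rho g h eta : rV -> R) (p e : R) (A X K : set rV).

(** One sequence serves finitely many functions, which is how a map and all its derivatives are
    smoothed together. *)
Lemma mollifier_sequence (I : finType) (g : I -> rV -> R) p r : 1 <= p -> 0 < r ->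
  (forall i, L1 (g i)) -> (forall i, (pint mu setT p (g i) < +oo)%E) ->
  exists rho : nat -> rV -> R, (forall k, mollifier r (rho k)) /\
  forall i, exists S : rV -> R, [/\ measurable_fun setT S, forall x, 0 <= S x, (pint mu setT p S < +oo)%E &
    {ae mu, forall x, (conv (rho k) (g i) x @[k --> \oo] --> g i x) /\
                      forall k, `|conv (rho k) (g i) x - g i x| <= S x}].
Proof.
(* Small enough that the error weighted by 2^k has modular at most 2^-(k+1), as [pint_fast]
   requires. *)
move=> p1 r0 Lg pg; pose d (k : nat) : R := (2 ^+ k) `^ (- p) / (2 ^ k.+1)%:R.
have d0 k : 0 < d k by rewrite divr_gt0 ?powR_gt0 ?exprn_gt0// ltr0n expn_gt0.
have /choice[e he] (ik : I * nat) : exists e : R, 0 < e /\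
    forall rho, mollifier e rho -> (pint mu setT p (conv rho (g ik.1) \- g ik.1)%R <= (d ik.2)%:E)%E.
  by have [e e0 h] := mollifies_Lp p1 (Lg ik.1) (pg ik.1) (d0 ik.2); exists e.
pose E k : R := \big[Num.min/r]_i e (i, k).
have E0 k : 0 < E k.
  rewrite /E; elim/big_rec : _ => // i x _ x0; rewrite lt_min x0 andbT.
  by have [] := he (i, k).
have /choice[rho hrho] k := mollifier_exists (R := R) (n := n) (E0 k).
exists rho; split.
  by move=> k; apply: mollifier_sub (hrho k); rewrite /E; elim/big_rec : _ => // i x _ x0; rewrite ge_min x0 orbT.
move=> i; have mg := L1_measurable (Lg i).
have mc k : measurable_fun setT (conv (rho k) (g i)) by apply: conv_measurable (Lg i); exact: mollifier_testT (hrho k).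
have [|S [mS S0 pS aS]] := pint_fast (mu := mu) measurableT p1 mc mg.
  move=> k; have mk : measurable_fun setT (conv (rho k) (g i) \- g i) by exact: measurable_funB.
  have := pintZ mu measurableT p (2 ^+ k) mk => /= ->.
  have := (he (i, k)).2 (rho k); rewrite /= => /(_ _)/wrap[].
    by apply: mollifier_sub (hrho k); rewrite /E (bigD1 i)//= ge_min lexx.
  move=> h; apply: le_trans (lee_wpmul2l _ h) _; first by rewrite lee_fin powR_ge0.
  rewrite -EFinM lee_fin (ger0_norm (exprn_ge0 _ _))// /d powRN mulrA mulfV ?gt_eqF ?powR_gt0 ?exprn_gt0//.
exists S; split=> //; apply: filterS aS => x; exact.
Qed.

(** Room around a support: mollifying at radius e spreads K over the compact K + [-e, e]^n, still
    inside X. *)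
Lemma compact_thicken X K : open X -> compact K -> K `<=` X ->
  exists e K', [/\ 0 < e, compact K', K' `<=` X & forall x, K x -> closed_ball_ Num.norm x e `<=` K'].
Proof.
move=> oX cK KX.
have : \forall k \near \oo, K `<=` [set x | ball x (k.+1%:R^-1) `<=` X].
  move/compact_near_coveringP : cK => /(_ nat \oo (fun k x => ball x (k.+1%:R^-1) `<=` X)); apply.
  move=> x /KX Xx; have /nbhs_ballP[e e0 xe] := open_nbhs_nbhs (conj oX Xx).
  have e02 : 0 < e / 2 by rewrite divr_gt0.
  have [N _ hN] := near_infty_natSinv_lt (PosNum e02).
  exists (ball x (e / 2), [set k | (N <= k)%N]) => /=.
    by split; [exact: nbhsx_ballx|exists N].
  move=> [y k] /= [xy Nk] z yz; apply: xe; rewrite (splitr e); apply: ball_triangle xy _.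
  by apply: le_ball yz; apply: ltW; exact: hN.
move=> [k _ /(_ k (leqnn k)) hk]; pose e : R := k.+1%:R^-1 / 2.
have e0 : 0 < e by rewrite divr_gt0 ?invr_gt0.
pose K' := (fun z : rV * rV => z.1 + z.2) @` (K `*` @cube R n e).
exists e, K'; split => //.
- apply: continuous_compact; last by apply: compact_setX => //; exact: compact_cube.
  apply: continuous_subspaceT => z.
  by apply: cvgD; [exact: cvg_fst|exact: cvg_snd].
- move=> _ [[x d] [/= Kx /cube_norm de] <-]; apply: (hk x Kx); rewrite -ball_normE/=.
  rewrite opprD addrA subrr add0r normrN; apply: le_lt_trans (de (ltW e0)) _.
  by rewrite /e ltr_pdivrMr// ltr_pMr ?invr_gt0// ltr1n.
- move=> x Kx y xy; exists (x, y - x); last by rewrite /= addrC subrK.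
  by split=> //=; apply/cube_norm; [exact: ltW|rewrite distrC].
Qed.

Lemma compact_exhaustion X : open X -> exists K : nat -> set rV,
  (forall m, compact (K m) /\ K m `<=` X) /\ \bigcup_m K m = X.
Proof.
move=> oX; pose K m := @cube R n m%:R `&` [set x | ball x (m.+1%:R^-1) `<=` X].
have KX m : K m `<=` X by move=> x [_]; apply; exact: ballxx.
exists K; split.
  move=> m; split=> //; apply: (subclosed_compact _ (@compact_cube R n m%:R)); last by move=> x [].
  rewrite /K; apply: closedI; first by apply: compact_closed; [exact: norm_hausdorff|exact: compact_cube].
  rewrite (_ : mkset _ = ~` \bigcup_(y in ~` X) ball y (m.+1%:R^-1)).
    by rewrite closedC; apply: bigcup_open => y _; exact: ball_open.
  apply/seteqP; split => x /=; first by move=> h [y nXy /ball_sym /h].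
  by move=> h y xy; apply: contrapT => nXy; apply: h; exists y => //; exact: ball_sym.
apply/seteqP; split => [x [m _ /KX]//|x Xx].
have /nbhs_ballP[e e0 xe] := open_nbhs_nbhs (conj oX Xx).
have e0' : 0 < e := e0.
have : \forall m \near \oo, K m x.
  near=> m; split.
    by apply/cube_norm => //; near: m; exact: nbhs_infty_ger.
  move=> y /= xy; apply: xe; apply: le_ball xy; apply: ltW; near: m.
  exact: (near_infty_natSinv_lt (PosNum e0')).
by move=> [m _ /(_ m (leqnn m)) ?]; exists m.
Unshelve. all: by end_near.
Qed.

Lemma conv_eq0 e rho g x : mollifier e rho -> (forall y, `|x - y| < e -> g y = 0) ->
  conv rho g x = 0.
Proof.
move=> [_ _ _ rs _] g0; apply: Rintegral_eq0 => y _.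
by have [xy|xy] := leP e `|x - y|; [rewrite rs ?mul0r|rewrite g0 ?mulr0].
Qed.

Lemma conv_bound e rho g M x : mollifier e rho -> L1 g -> (forall y, 0 <= g y <= M) ->
  0 <= conv rho g x <= M.
Proof.
move=> mr Lg gM; have [_ r0 _ _ _] := mr; have tr := mollifier_testT mr.
apply/andP; split.
  by apply: Rintegral_ge0 => y _; rewrite mulr_ge0//; case/andP: (gM y).
have Lr : L1 (fun y => rho (x - y)).
  have := mollifier_test (X := setT) (x := x) mr => /(_ (@subsetT _ _)).
  exact: test_function_integrable.
have LMr : L1 (fun y => M * rho (x - y)) by exact: L1Z.
apply: (@le_trans _ _ (\int[mu]_y (M * rho (x - y)))).
  apply: le_Rintegral => //; first exact: conv_integrable.
  by move=> y _; rewrite mulrC ler_wpM2r//; case/andP: (gM y).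
by rewrite RintegralZl// /Rintegral (mollifier_mass x mr) mulr1.
Qed.

Lemma locally_integrable_measurable X u : open X -> locally_integrable_in X u -> measurable_fun X u.
Proof.
move=> oX lu; have [K [hK <-]] := compact_exhaustion oX.
apply/measurable_fun_bigcup => m.
  by apply: closed_measurable_rV; apply: compact_closed; [exact: norm_hausdorff|case: (hK m)].
have [cK KX] := hK m.
by have /integrableP[/measurable_EFinP] := lu _ cK KX.
Qed.

Lemma compact_measurable_rV K : compact K -> measurable K.
Proof. by move=> cK; apply: closed_measurable_rV; apply: compact_closed => //; exact: norm_hausdorff. Qed.

(** The fundamental lemma of the calculus of variations in one-sided form: mollified indicators of
    the negative set of g, cut by a compact, are admissible test functions. It serves both for
    uniqueness of weak derivatives and for comparing Jacobians. *)
Lemma fundamental_ge X g : open X -> locally_integrable_in X g ->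
  (forall eta, test_function X eta -> (forall x, 0 <= eta x) ->
     0 <= \int[mu]_(x in X) (g x * eta x)) ->
  {ae mu, forall x, X x -> 0 <= g x}.
Proof.
move=> oX lg hg; have [K [hK XK]] := compact_exhaustion oX.
have mX := open_measurable_rV oX.
have mg := locally_integrable_measurable oX lg.
suff H m : mu.-negligible (K m `&` [set x | g x < 0]).
  apply: (negligibleS _ (negligible_bigcup H)) => x /= /not_implyP[Xx /negP]; rewrite -ltNge => gx.
  by move: Xx; rewrite -{1}XK => -[m _ Kx]; exists m.
have [cK KX] := hK m; set A := _ `&` _.
have mK := compact_measurable_rV cK.
have mA : measurable A.
  have := measurable_funS mX KX mg => /(_ mK `]-oo, 0[%classic (measurable_itv _)).
  by congr (measurable (_ `&` _)); apply/seteqP; split => x /=; rewrite in_itv.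
have AK : A `<=` K m by move=> x [].
have Afin : (mu A < +oo)%E.
  by apply: le_lt_trans (compact_lebesgue_fin cK); apply: le_measure; rewrite ?inE.
have [e [K' [e0 cK' K'X KK']]] := compact_thicken oX cK KX.
have mK' := compact_measurable_rV cK'.
have LA : L1 (\1_A : rV -> R) by exact: L1_indic.
have pA : (pint mu setT 1 (\1_A : rV -> R) < +oo)%E.
  rewrite /pint (eq_integral (fun x => (\1_A x)%:E)); first by rewrite integral_indic// setIT.
  by move=> x _; rewrite powRr1// ger0_norm.
have [rho [mr /(_ tt) [S [_ _ _ aS]]]] := mollifier_sequence (lexx 1) e0 (fun _ : unit => LA) (fun _ => pA).
pose eta k := conv (rho k) \1_A.
have b k x : 0 <= eta k x <= 1.
  by apply: (conv_bound x (mr k) LA) => y; rewrite indicE; case: (_ \in _); rewrite ?lexx ?ler01.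
have eta0 k x : ~ K' x -> eta k x = 0.
  move=> nK; apply: conv_eq0 (mr k) _ => y xy; rewrite indicE memNset// => -[Ky _].
  by apply: nK; apply: (KK' _ Ky); rewrite /closed_ball_/= distrC ltW.
have te k : test_function X (eta k).
  apply: test_functionI cK' K'X (eta0 k); apply: conv_smooth LA; exact: mollifier_testT (mr k).
have gK' : mu.-integrable K' (EFin \o g) by exact: lg.
have mgK' : measurable_fun K' g by have /integrableP[/measurable_EFinP] := gK'.
(* All [eta k] live on K' and take values in [0, 1], so |g| is a majorant. *)
have c : \int[mu]_(x in K') (g x * eta k x) @[k --> \oo] --> \int[mu]_(x in K') (g x * \1_A x).
  apply: (@Rintegral_dominated _ _ _ _ _ mK' _ _ (fun x => `|g x|)).
  - move=> k; apply: measurable_funM => //; apply: (measurable_funS measurableT) => //.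
    by apply: conv_measurable LA; exact: mollifier_testT (mr k).
  - by apply: measurable_funM => //; exact: measurable_indic.
  - by have := integrable_abse gK'; rewrite /comp.
  - apply: filterS aS => x [h _] _; split; first by apply: cvgM => //; exact: cvg_cst.
    by move=> k; rewrite normrM ler_piMr//; have /andP[h0 h1] := b k x; rewrite ger0_norm.
have I0 : 0 <= \int[mu]_(x in A) g x.
  have AK' : A `<=` K' by move=> x [Kx _]; apply: (KK' x Kx); rewrite /closed_ball_/= subrr normr0 ltW.
  have -> : \int[mu]_(x in A) g x = \int[mu]_(x in K') (g x * \1_A x).
    rewrite [RHS](Rintegral_support mu AK'); last by move=> x _ nA; rewrite indicE memNset// mulr0.
    by apply: eq_Rintegral => x Ax; rewrite indicE Ax mulr1.
  apply: (ler_cvg_to (cvg_cst 0) c); apply: nearW => k.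
  have := hg _ (te k) (fun x => proj1 (andP (b k x))).
  by rewrite (Rintegral_support mu K'X)// => x _ nK; rewrite eta0// mulr0.
have iA : mu.-integrable A (EFin \o g) by apply: integrableS gK' => // x [Kx _]; apply: (KK' x Kx); rewrite /closed_ball_/= subrr normr0 ltW.
have mgA : measurable_fun A (EFin \o g) by case/integrableP : iA.
have : (\int[mu]_(x in A) `|(EFin \o g) x| = 0)%E.
  apply/eqP; rewrite eq_le integral_ge0// andbT.
  rewrite (eq_integral (fun x => - (EFin \o g) x)%E); last first.
    by move=> x /set_mem[_ gx]; rewrite /= ltr0_norm.
  rewrite integralN/=; last by apply: integrable_add_def.
  by rewrite leeNl oppe0 -(fineK (integrable_fin_num _ iA))// lee_fin.
move/(ae_eq_integral_abs mu mA mgA); apply: negligibleS => x /= Ax; apply/not_implyP; split=> //.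
by move=> [gx]; case: Ax => _ /=; rewrite gx ltxx.
Qed.

End local_approximation.

(** * Weak derivatives and the closure of the test functions *)

Section small_modular.
Context d (T : measurableType d) {R : realType} (mu : {measure set T -> \bar R}).
Variable D : set T.
Hypotheses (mD : measurable D) (Dfin : (mu D < +oo)%E).

(* Stands in for Hoelder's inequality on sets of finite measure. *)
Lemma norm_le_powR (e t p : R) : 1 <= p -> 0 < e -> `|t| <= e + e `^ (1 - p) * `|t| `^ p.
Proof.
move=> p1 e0; have [te|et] := leP `|t| e.
  by apply: le_trans te _; rewrite lerDl mulr_ge0 ?powR_ge0.
apply: (@le_trans _ _ (e `^ (1 - p) * `|t| `^ p)); last by rewrite lerDr ltW.
have t0 : 0 < `|t| by exact: lt_trans et.
have tE : `|t| = `|t| `^ (1 - p) * `|t| `^ p.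
  by rewrite -powRD ?subrK ?powRr1 ?ltW// gt_eqF// implybT.
rewrite [leLHS]tE ler_wpM2r ?powR_ge0//.
have -> : 1 - p = - (p - 1) by rewrite opprB.
rewrite !powRN lef_pV2 ?posrE ?powR_gt0//.
by rewrite ge0_ler_powR ?nnegrE ?subr_ge0// ltW.
Qed.

Lemma pint_small_L1 (p e : R) : 1 <= p -> 0 < e -> exists2 d, 0 < d &
  forall w, measurable_fun D w -> (pint mu D p w <= d%:E)%E ->
  (\int[mu]_(x in D) (`|w x|)%:E <= e%:E)%E.
Proof.
move=> p1 e0; pose m := fine (mu D) + 1.
have m0 : 0 < m by rewrite ltr_wpDl// fine_ge0.
(* The constant term contributes c mu(D) <= e / 2; [m] is mu(D) + 1 so as not to vanish. *)
pose c := e / (2 * m); have c0 : 0 < c by rewrite divr_gt0// mulr_gt0.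
have k0 : 0 < c `^ (1 - p) by exact: powR_gt0.
exists (e / 2 / c `^ (1 - p)); first by rewrite !divr_gt0.
move=> w mw hw.
have mP := measurable_pint p mw.
have P0 x : D x -> (0 <= (`|w x| `^ p)%:E)%E by move=> _; rewrite lee_fin powR_ge0.
have c0' x : D x -> (0 <= c%:E)%E by move=> _; rewrite lee_fin ltW.
apply: (@le_trans _ _ (\int[mu]_(x in D) (c%:E + (c `^ (1 - p))%:E * (`|w x| `^ p)%:E))%E).
  apply: ge0_le_integral => //.
  - by apply/measurable_EFinP; exact: measurableT_comp.
  - by apply: emeasurable_funD => //; exact: measurable_funeM.
  - by move=> x Dx; rewrite -EFinM -EFinD lee_fin norm_le_powR.
have cP0 x : D x -> (0 <= (c `^ (1 - p))%:E * (`|w x| `^ p)%:E)%E by move=> Dx; rewrite -EFinM lee_fin mulr_ge0 ?powR_ge0.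
rewrite (ge0_integralD _ mD c0' (measurable_cst _) cP0); last exact: measurable_funeM.
rewrite integral_cst// ge0_integralZl// ?lee_fin ?(ltW k0)//.
apply: (@le_trans _ _ ((e / 2)%:E + (e / 2)%:E)%E); last by rewrite -EFinD lee_fin -splitr.
apply: leeD.
  have Df : mu D \is a fin_num by rewrite ge0_fin_numE.
  rewrite -[X in (_ * X)%E](fineK Df) -EFinM lee_fin /c.
  rewrite (_ : e / (2 * m) * _ = e / 2 * (fine (mu D) / m)); last by field; rewrite gt_eqF.
  by rewrite ler_piMr ?divr_ge0 ?(ltW e0)// ler_pdivrMr// mul1r /m lerDl.
apply: le_trans (lee_wpmul2l _ hw) _; first by rewrite lee_fin ltW.
by rewrite -EFinM lee_fin mulrC divfK// gt_eqF.
Qed.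

Lemma pint_integrable p w : 1 <= p -> measurable_fun D w -> (pint mu D p w < +oo)%E ->
  mu.-integrable D (EFin \o w).
Proof.
move=> p1 mw pw; apply/integrableP; split; first exact/measurable_EFinP.
have mP := measurable_pint p mw.
apply: (@le_lt_trans _ _ (\int[mu]_(x in D) (1%:E + (`|w x| `^ p)%:E))%E).
  apply: ge0_le_integral => //.
  - by apply/measurable_EFinP; exact: measurableT_comp.
  - by apply: emeasurable_funD => //; exact: measurable_cst.
  - by move=> x _; have := norm_le_powR (w x) p1 ltr01; rewrite powR1 mul1r -EFinD lee_fin.
rewrite ge0_integralD//.
by rewrite integral_cst// mul1e lte_add_pinfty.
Qed.

Lemma Rintegral_bound (w eta : T -> R) (M e : R) : 0 <= M ->
  measurable_fun D w -> measurable_fun D eta ->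
  (forall x, D x -> `|eta x| <= M) -> (\int[mu]_(x in D) (`|w x|)%:E <= e%:E)%E ->
  `|\int[mu]_(x in D) (w x * eta x)| <= M * e.
Proof.
move=> M0 mw me eM we.
have iw : mu.-integrable D (EFin \o w).
  by apply/integrableP; split; [exact/measurable_EFinP|exact: le_lt_trans we (ltry _)].
have iMw : mu.-integrable D (fun x => (M * `|w x|)%:E).
  have := integrableZl mD M (integrable_abse iw); by under eq_fun do rewrite /= -EFinM.
have iwe : mu.-integrable D (EFin \o (w \* eta)).
  apply: (le_integrable mD _ _ iMw); first by apply/measurable_EFinP; exact: measurable_funM.
  move=> x Dx; rewrite /= lee_fin normrM [leRHS]ger0_norm ?mulr_ge0// mulrC.
  by rewrite ler_wpM2r// eM.
apply: le_trans (le_normr_Rintegral mD iwe) _.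
apply: (@le_trans _ _ (\int[mu]_(x in D) (M * `|w x|))).
  apply: le_Rintegral => //.
  - by have := integrable_abse iwe; rewrite /comp.
  - by move=> x Dx; rewrite /= normrM mulrC ler_wpM2r// eM.
rewrite RintegralZl//; last by have := integrable_abse iw; rewrite /comp.
rewrite ler_wpM2l// -lee_fin fineK//.
by have := integrable_fin_num mD (integrable_abse iw).
Qed.

End small_modular.

(** * Weak derivatives: linearity, uniqueness, closedness *)

Section weak_derivatives.
Context {R : realType} {n : nat}.
Local Notation rV := 'rV[R]_n.
Local Notation mu := (@lebesgue_rV R n).
Local Notation L1 g := (mu.-integrable setT (EFin \o g)).
Variable X : set rV.
Hypothesis oX : open X.
Implicit Types (rho u v g h eta : rV -> R) (p e : R) (i : 'I_n).

Let mX : measurable X := open_measurable_rV oX.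

Lemma integrable_test u eta : locally_integrable_in X u -> test_function X eta ->
  mu.-integrable X (fun x => (u x * eta x)%:E).
Proof.
move=> lu te; have [K [cK KX] e0] := test_function_support te.
have mK := compact_measurable_rV cK.
have me := test_function_measurable te.
have [M M0 hM] := test_function_bounded te.
have iK := lu K cK KX.
have : mu.-integrable K (fun x => (u x * eta x)%:E).
  apply: (integrableMl mK iK); first exact: measurable_funS me.
  by exists M; split; [exact: num_real|move=> r Mr x _; apply: le_trans (hM x) (ltW Mr)].
move/(integrable_mkcond _ mK) => h; apply/(integrable_mkcond _ mX).
move: h; congr (_.-integrable _ _); apply/funext => x; rewrite /patch.
case: ifPn => [/set_mem/KX Xx|xK]; first by rewrite mem_set.
by case: ifPn => // _; rewrite e0 ?mulr0// => /mem_set; rewrite (negbTE xK).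
Qed.

Lemma smooth_locally_integrable u : smooth u -> locally_integrable_in X u.
Proof.
move=> su K cK KX; have mK := compact_measurable_rV cK.
apply: measurable_bounded_integrable => //; first exact: compact_lebesgue_fin.
  apply: measurable_funS (continuous_measurable_rV (smooth_continuous su)) => //.
have /compact_bounded[M [_ hM]] : compact (u @` K).
  by apply: continuous_compact => //; apply: continuous_subspaceT; exact: smooth_continuous.
exists M; split; first exact: num_real.
by move=> r Mr x Kx; apply: hM => //; exists x.
Qed.

Lemma smooth_weak_partial u i : smooth u -> is_weak_partial X i u (partial i u).
Proof.
move=> su; split; [exact: smooth_locally_integrable| |].
  by apply: smooth_locally_integrable; exact: smooth_partial.
move=> eta te; have tp := test_function_partial i te.
rewrite -(Rintegral_support mu (@subsetT _ X)); last first.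
  by move=> x _ nX; rewrite (test_function_eq0 tp nX) mulr0.
rewrite -(Rintegral_support mu (@subsetT _ X)); last first.
  by move=> x _ nX; rewrite (test_function_eq0 te nX) mulr0.
exact: integration_by_parts_rV su te.
Qed.

Lemma locally_integrableD u v : locally_integrable_in X u -> locally_integrable_in X v ->
  locally_integrable_in X (u \+ v).
Proof.
move=> lu lv K cK KX; have := integrableD (compact_measurable_rV cK) (lu K cK KX) (lv K cK KX).
by [].
Qed.

Lemma locally_integrableZ c u : locally_integrable_in X u ->
  locally_integrable_in X (fun x => c * u x).
Proof.
by move=> lu K cK KX; exact: (integrableZl (compact_measurable_rV cK) c (lu K cK KX)).
Qed.

Lemma is_weak_partialD i u v g h : is_weak_partial X i u g -> is_weak_partial X i v h ->
  is_weak_partial X i (u \+ v) (g \+ h).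
Proof.
move=> [lu lg hu] [lv lh hv]; split; [exact: locally_integrableD|exact: locally_integrableD|].
move=> eta te; have tp := test_function_partial i te.
have -> : \int[mu]_(x in X) ((u \+ v) x * partial i eta x) = \int[mu]_(x in X) (u x * partial i eta x + v x * partial i eta x).
  by apply: eq_Rintegral => x _; rewrite /= mulrDl.
have -> : \int[mu]_(x in X) ((g \+ h) x * eta x) = \int[mu]_(x in X) (g x * eta x + h x * eta x).
  by apply: eq_Rintegral => x _; rewrite /= mulrDl.
rewrite !RintegralD//; try exact: integrable_test.
by rewrite hu// hv// opprD.
Qed.

Lemma is_weak_partialZ i c u g : is_weak_partial X i u g ->
  is_weak_partial X i (fun x => c * u x) (fun x => c * g x).
Proof.
move=> [lu lg hu]; split; [exact: locally_integrableZ|exact: locally_integrableZ|].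
move=> eta te; have tp := test_function_partial i te.
have -> : \int[mu]_(x in X) (c * u x * partial i eta x) = \int[mu]_(x in X) (c * (u x * partial i eta x)).
  by apply: eq_Rintegral => x _; rewrite mulrA.
have -> : \int[mu]_(x in X) (c * g x * eta x) = \int[mu]_(x in X) (c * (g x * eta x)).
  by apply: eq_Rintegral => x _; rewrite mulrA.
rewrite !RintegralZl//; try exact: integrable_test.
by rewrite hu// mulrN.
Qed.

Lemma is_weak_partialB i u v g h : is_weak_partial X i u g -> is_weak_partial X i v h ->
  is_weak_partial X i (u \- v) (g \- h).
Proof.
move=> hu hv; have := is_weak_partialD hu (is_weak_partialZ (-1) hv).
by congr (is_weak_partial X i _ _); apply/funext => x /=; rewrite mulN1r.
Qed.

(** The difference of two candidates is a weak derivative of 0; [fundamental_ge] applies to it and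
    to its negative. *)
Lemma is_weak_partial_unique i u g h : is_weak_partial X i u g -> is_weak_partial X i u h ->
  {ae mu, forall x, X x -> g x = h x}.
Proof.
move=> hg hh.
suff H (g1 h1 : rV -> R) : is_weak_partial X i u g1 -> is_weak_partial X i u h1 ->
    {ae mu, forall x, X x -> 0 <= g1 x - h1 x}.
  apply: filterS2 (H _ _ hg hh) (H _ _ hh hg) => x a b Xx.
  by apply/eqP; rewrite eq_le -subr_ge0 b// -subr_ge0 a.
move=> w1 w2; have [_ l hl] := is_weak_partialB w1 w2.
apply: fundamental_ge oX l _ => eta te _.
have := hl eta te.
rewrite (_ : \int[mu]_(x in X) ((u \- u) x * _) = 0); last by apply: Rintegral_eq0 => x _; rewrite /= subrr mul0r.
by move/esym/eqP; rewrite oppr_eq0 => /eqP ->.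
Qed.

Lemma weak_partialP i u g : is_weak_partial X i u g ->
  is_weak_partial X i u (weak_partial X i u) /\
  {ae mu, forall x, X x -> weak_partial X i u x = g x}.
Proof.
move=> hg; have hw : is_weak_partial X i u (weak_partial X i u).
  rewrite /weak_partial; case: xgetP => [y -> //|/(_ g)]; exact.
by split=> //; exact: is_weak_partial_unique hw hg.
Qed.

Lemma weak_partial_measurable i u g : is_weak_partial X i u g -> measurable_fun X g.
Proof. by move=> [_ lg _]; exact: locally_integrable_measurable. Qed.

Lemma locally_integrable_measurable1 i u g : is_weak_partial X i u g -> measurable_fun X u.
Proof. by move=> [lu _ _]; exact: locally_integrable_measurable. Qed.

Lemma locally_integrable_L1 u K : locally_integrable_in X u -> compact K -> K `<=` X ->
  L1 (u \_ K).
Proof.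
move=> lu cK KX; have /(integrable_mkcond _ (compact_measurable_rV cK)) := lu K cK KX.
by congr (_.-integrable _ _); apply/funext => x; rewrite /patch /=; case: ifP.
Qed.

Lemma partial_reflect u (a y : rV) i : smooth u ->
  partial i (fun y => u (a - y)) y = - partial i u (a - y).
Proof.
move=> su; apply: derive_val.
apply: is_derive_line.
have h1 : is_derive (- (0 : R)) 1 (fun h : R => u (h *: delta_mx 0 i + (a - y))) (partial i u (a - y)).
  have := @line_is_derive _ _ u (a - y) (delta_mx 0 i) (- 0); rewrite oppr0 scale0r add0r; apply.
  exact: smooth_derivable.
have h2 : is_derive (0 : R) 1 (fun h : R => - h) (-1) by apply: is_deriveNid.
have := is_derive1_comp (f := fun h : R => u (h *: delta_mx 0 i + (a - y))) (g := fun h : R => - h) h1 h2.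
rewrite mulrN1; congr is_derive; apply/funext => h /=; congr u.
by rewrite scaleNr opprD addrCA addrA.
Qed.

(** The derivative falls on rho (x - y), which as a function of y is a test function in X, so the
    definition of the weak derivative moves it onto u. Truncation to K makes u integrable on the
    whole space and is invisible at x. *)
Lemma conv_weak_partial e rho i u g K x : mollifier e rho -> is_weak_partial X i u g ->
  compact K -> K `<=` X -> closed_ball_ Num.norm x e `<=` K ->
  partial i (conv rho (u \_ K)) x = conv rho (g \_ K) x.
Proof.
move=> mr [lu lg hu] cK KX xK; have tr := mollifier_testT mr.
have Lu := locally_integrable_L1 lu cK KX.
have te : test_function X (fun y => rho (x - y)).
  by apply: (mollifier_test mr) => y /xK; exact: KX.
have [sr _ _ rs _] := mr.
have off y : ~ K y -> rho (x - y) = 0.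
  by move=> nK; rewrite rs// leNgt; apply/negP => xy; apply: nK; apply: xK; rewrite /closed_ball_/= ltW.
have offp y : ~ K y -> partial i rho (x - y) = 0.
  move=> nK; have := partial_reflect x y i sr.
  have -> : partial i (fun y => rho (x - y)) y = 0.
    by apply: (partial_support i (compact_closed (@norm_hausdorff _ _) cK) off).
  by move/esym/eqP; rewrite oppr_eq0 => /eqP.
rewrite conv_partial// /conv.
have -> : \int[mu]_y (partial i rho (x - y) * (u \_ K) y) = - \int[mu]_(y in X) (u y * partial i (fun y => rho (x - y)) y).
  rewrite -mulN1r -RintegralZl//; last exact: integrable_test lu (test_function_partial i te).
  rewrite (Rintegral_support mu (@subsetT _ X)); last first.
    by move=> y _ nX; rewrite offp ?mul0r// => /KX.
  apply: eq_Rintegral => y _; rewrite partial_reflect// mulN1r mulrN opprK mulrC /patch.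
  by case: ifPn => // /negP yK; rewrite mul0r offp ?mulr0// => /mem_set.
rewrite hu// opprK (Rintegral_support mu (@subsetT _ X)); last first.
  by move=> y _ nX; rewrite off ?mul0r// => /KX.
apply: eq_Rintegral => y _; rewrite mulrC /patch.
by case: ifPn => // /negP yK; rewrite off ?mul0r// => /mem_set.
Qed.

(** The defining identity is tested against bounded functions, so smallness in L^1 suffices, and
    small modulars give it on a set of finite measure. *)
Lemma is_weak_partial_closed p i u g : 1 <= p -> (mu X < +oo)%E ->
  measurable_fun X u -> measurable_fun X g ->
  (pint mu X p u < +oo)%E -> (pint mu X p g < +oo)%E ->
  (forall e, 0 < e -> exists v h, [/\ is_weak_partial X i v h,
     (pint mu X p (u \- v)%R <= e%:E)%E & (pint mu X p (g \- h)%R <= e%:E)%E]) ->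
  is_weak_partial X i u g.
Proof.
move=> p1 Xfin mu_ mg pu pg H.
have iu := pint_integrable mX Xfin p1 mu_ pu; have ig := pint_integrable mX Xfin p1 mg pg.
have lu : locally_integrable_in X u by move=> K cK KX; apply: integrableS iu => //; exact: compact_measurable_rV.
have lg : locally_integrable_in X g by move=> K cK KX; apply: integrableS ig => //; exact: compact_measurable_rV.
split=> // eta te; have tp := test_function_partial i te.
have [M1 M10 hM1] := test_function_bounded te; have [M2 M20 hM2] := test_function_bounded tp.
have me : measurable_fun X eta by apply: measurable_funS (test_function_measurable te).
have mp : measurable_fun X (partial i eta) by apply: measurable_funS (test_function_measurable tp).
apply/eqP; rewrite -subr_eq0 opprK -normr_le0; apply/ler_addgt0Pr => z z0; rewrite add0r.
have M0 : 0 < M1 + M2 by exact: addr_gt0.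
have [d d0 hd] := pint_small_L1 mX Xfin p1 (divr_gt0 z0 M0).
have [v [h [wv uv gh]]] := H d d0; have [lv lh hv] := wv.
have mv := locally_integrable_measurable1 wv; have mh := weak_partial_measurable wv.
have b1 := Rintegral_bound mX (ltW M20) (measurable_funB mu_ mv) mp (fun x _ => hM2 x) (hd _ (measurable_funB mu_ mv) uv).
have b2 := Rintegral_bound mX (ltW M10) (measurable_funB mg mh) me (fun x _ => hM1 x) (hd _ (measurable_funB mg mh) gh).
move: b1 b2.
have -> : \int[mu]_(x in X) ((u \- v) x * partial i eta x) = \int[mu]_(x in X) (u x * partial i eta x) - \int[mu]_(x in X) (v x * partial i eta x).
  rewrite -RintegralB//; try exact: integrable_test.
  by apply: eq_Rintegral => x _; rewrite /= mulrBl.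
have -> : \int[mu]_(x in X) ((g \- h) x * eta x) = \int[mu]_(x in X) (g x * eta x) - \int[mu]_(x in X) (h x * eta x).
  rewrite -RintegralB//; try exact: integrable_test.
  by apply: eq_Rintegral => x _; rewrite /= mulrBl.
rewrite hv// opprK => b1 b2.
have -> : z = M2 * (z / (M1 + M2)) + M1 * (z / (M1 + M2)) by field; rewrite gt_eqF.
apply: le_trans (lerD b1 b2); apply: le_trans (ler_normD _ _); rewrite le_eqVlt; apply/orP; left; apply/eqP.
by congr (`| _ |); ring.
Qed.

End weak_derivatives.

Section Lp_modular.
Context d (T : measurableType d) {R : realType} (mu : {measure set T -> \bar R}).
Variable D : set T.
Hypotheses (mD : measurable D).
Implicit Types (p : R) (u v : T -> R).

Definition Lpm p u := measurable_fun D u /\ (pint mu D p u < +oo)%E.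

Lemma LpmD p u v : 1 <= p -> Lpm p u -> Lpm p v -> Lpm p (u \+ v).
Proof.
move=> p1 [mu_ pu] [mv pv]; split; first exact: measurable_funD.
apply: le_lt_trans (pintD mu mD p1 mu_ mv) _.
apply: mule_fin_lty; [exact: powR_ge0|by apply: adde_ge0; exact: pint_ge0|].
exact: (lte_add_pinfty pu pv).
Qed.

Lemma LpmZ p c u : Lpm p u -> Lpm p (fun x => c * u x).
Proof.
move=> [mu_ pu]; split; first exact: measurable_funM.
by rewrite pintZ//; apply: mule_fin_lty => //; exact: pint_ge0.
Qed.

Lemma LpmB p u v : 1 <= p -> Lpm p u -> Lpm p v -> Lpm p (u \- v).
Proof.
move=> p1 lu lv; have := LpmD p1 lu (LpmZ (-1) lv).
by congr Lpm; apply/funext => x /=; rewrite mulN1r.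
Qed.

Lemma Lpm_bounded p u M : 0 <= p -> (mu D < +oo)%E -> measurable_fun D u ->
  (forall x, D x -> `|u x| <= M) -> Lpm p u.
Proof.
move=> p0 Dfin mu_ uM; split => //.
apply: (@le_lt_trans _ _ (\int[mu]_(x in D) (M `^ p)%:E)%E).
  apply: ge0_le_integral => //; first exact: measurable_pint.
  move=> x Dx; rewrite lee_fin ge0_ler_powR ?nnegrE ?uM//.
  by apply: le_trans (uM x Dx).
by rewrite integral_cst// mule_fin_lty// powR_ge0.
Qed.

Lemma Lpm_close p u v e : 1 <= p -> measurable_fun D u -> Lpm p v ->
  (pint mu D p (u \- v)%R <= e%:E)%E -> Lpm p u.
Proof.
move=> p1 mu_ lv uv; have [mv _] := lv.
have l : Lpm p (u \- v) by split; [exact: measurable_funB|exact: le_lt_trans uv (ltry _)].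
by have := LpmD p1 l lv; congr Lpm; apply/funext => x /=; rewrite subrK.
Qed.

Lemma pint_ae p u v : measurable_fun D u -> measurable_fun D v ->
  {ae mu, forall x, D x -> u x = v x} -> pint mu D p u = pint mu D p v.
Proof.
move=> mu_ mv uv; apply: ae_eq_integral => //; try exact: measurable_pint.
by apply: filterS uv => x /[swap] Dx /(_ Dx) ->.
Qed.

Lemma Lnorm_pint p u : 0 < p ->
  ('N[mu]_p%:E[EFin \o u \_ D] = (pint mu D p u) `^ (p^-1))%E.
Proof.
move=> p0; rewrite unlock; congr (_ `^ _)%E; rewrite /pint [RHS]integral_mkcond.
apply: eq_integral => x _; rewrite /= /patch; case: ifPn => _ //.
by rewrite normr0 powR0// gt_eqF.
Qed.

Lemma LpP p u : 0 < p -> Lfun mu p%:E (u \_ D) <-> Lpm p u.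
Proof.
move=> p0; split.
  move=> /andP[]; rewrite inE/= => mf; rewrite inE/= /finite_norm Lnorm_pint// => h.
  split; first exact/(measurable_restrictT _ mD).
  by move: h; apply: lty_poweRy; rewrite invr_neq0// gt_eqF.
move=> [mf h]; apply/andP; split; rewrite inE/=; first exact/(measurable_restrictT _ mD).
by rewrite /finite_norm Lnorm_pint//; exact: poweR_lty.
Qed.

Lemma Lnorm_lt_pint p u e : 0 < p -> 0 <= e ->
  ('N[mu]_p%:E[EFin \o u \_ D] <= e%:E)%E -> (pint mu D p u <= (e `^ p)%:E)%E.
Proof.
move=> p0 e0; rewrite Lnorm_pint//; have := pint_ge0 mu D p u.
have ip : p^-1 != 0 by rewrite invr_neq0// gt_eqF.
case: (pint mu D p u) => [r| |]//; last by rewrite poweRyr// leye_eq.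
rewrite lee_fin => r0; rewrite poweR_EFin !lee_fin => h.
rewrite -[r](@powRr1 _ r)// -(mulVf (lt0r_neq0 p0)) powRrM.
by rewrite ge0_ler_powR ?nnegrE ?powR_ge0// ltW.
Qed.

Lemma pint_lt_Lnorm p u e : 0 < p -> 0 <= e ->
  (pint mu D p u <= (e `^ p)%:E)%E -> ('N[mu]_p%:E[EFin \o u \_ D] <= e%:E)%E.
Proof.
move=> p0 e0; rewrite Lnorm_pint//; have := pint_ge0 mu D p u.
case: (pint mu D p u) => [r| |]//.
rewrite lee_fin => r0; rewrite poweR_EFin !lee_fin => h.
rewrite -[e](@powRr1 _ e)// -(mulfV (lt0r_neq0 p0)) powRrM.
by rewrite ge0_ler_powR ?nnegrE ?powR_ge0 ?invr_ge0// ltW.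
Qed.

End Lp_modular.

(** * Zero boundary values, Poincare's inequality and Rellich's theorem *)

Section sobolev0.
Context {R : realType} {n : nat}.
Local Notation rV := 'rV[R]_n.
Local Notation mu := (@lebesgue_rV R n).
Variable X : set rV.
Hypotheses (oX : open X) (Xfin : (mu X < +oo)%E).
Variable p : R.
Hypothesis p1 : 1 <= p.
Implicit Types (u v g h eta : rV -> R) (e : R) (i : 'I_n) (w : option 'I_n -> rV -> R).

Let mX : measurable X := open_measurable_rV oX.
Let p0 : 0 < p. Proof. exact: lt_le_trans p1. Qed.
Local Notation P u := (pint mu X p u).

Definition jet u : option 'I_n -> rV -> R :=
  fun o => if o is Some i then partial i u else u.

Definition weak_jet u : option 'I_n -> rV -> R :=
  fun o => if o is Some i then weak_partial X i u else u.

(* [w None] is the function and [w (Some i)] its i-th weak derivative, so that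
   convergence in W^{1,p} is convergence of every component. *)
Definition W0 w := (forall o, Lpm mu X p (w o)) /\
  forall e, 0 < e -> exists eta, test_function X eta /\
    forall o, (P (w o \- jet eta o)%R <= e%:E)%E.

Lemma test_jet eta o : test_function X eta -> test_function X (jet eta o).
Proof. by case: o => [i|]//=; exact: test_function_partial. Qed.

Lemma test_Lpm eta : test_function X eta -> Lpm mu X p eta.
Proof.
move=> te; have [M M0 hM] := test_function_bounded te.
apply: (@Lpm_bounded _ _ _ _ _ _ p eta M) => //; first exact: ltW.
by apply: measurable_funS (test_function_measurable te).
Qed.

Lemma jet_Lpm eta o : test_function X eta -> Lpm mu X p (jet eta o).
Proof. by move=> te; apply: test_Lpm; exact: test_jet. Qed.

Lemma W0_test eta : test_function X eta -> W0 (jet eta).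
Proof.
move=> te; split=> [ o|e e0]; first exact: jet_Lpm.
exists eta; split=> // o; rewrite (_ : P _ = 0%E) ?lee_fin ?(ltW e0)//.
rewrite /pint (eq_integral (cst 0%E)) ?integral0// => x _.
by rewrite /= subrr normr0 powR0// gt_eqF.
Qed.

Lemma W0D w w' : W0 w -> W0 w' -> W0 (fun o => w o \+ w' o).
Proof.
move=> [lw hw] [lw' hw']; split=> [ o|e e0]; first exact: LpmD.
have e1 : 0 < e / (2 `^ p * 2) by rewrite divr_gt0 ?mulr_gt0 ?powR_gt0.
have [eta [te h]] := hw _ e1; have [zeta [tz h']] := hw' _ e1.
exists (eta \+ zeta); split; first exact: test_functionD.
move=> o; rewrite (_ : P _ = P ((w o \- jet eta o) \+ (w' o \- jet zeta o))); last first.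
  apply: eq_integral => x _; congr ((`| _ | `^ _)%:E); case: o => [i|]/=; last by ring.
  by rewrite partialD; [ring|exact: test_function_smooth te|exact: test_function_smooth tz].
have m1 : measurable_fun X (w o \- jet eta o) by have [] := LpmB mX p1 (lw o) (jet_Lpm o te).
have m2 : measurable_fun X (w' o \- jet zeta o) by have [] := LpmB mX p1 (lw' o) (jet_Lpm o tz).
apply: le_trans (pintD mu mX p1 m1 m2) _.
apply: le_trans (lee_wpmul2l _ (leeD (h o) (h' o))) _; first by rewrite lee_fin powR_ge0.
rewrite -EFinD -EFinM lee_fin le_eqVlt; apply/orP; left; apply/eqP.
by field; rewrite gt_eqF ?powR_gt0.
Qed.

Lemma W0Z c w : W0 w -> W0 (fun o x => c * w o x).
Proof.
move=> [lw hw]; split=> [ o|e e0]; first exact: LpmZ.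
pose K := `|c| `^ p + 1.
have K0 : 0 < K by rewrite ltr_wpDl ?powR_ge0.
have [eta [te h]] := hw _ (divr_gt0 e0 K0).
exists (fun x => c * eta x); split; first exact: test_functionZ.
move=> o; rewrite (_ : P _ = P (fun x => c * (w o \- jet eta o) x)); last first.
  apply: eq_integral => x _; congr ((`| _ | `^ _)%:E); case: o => [i|]/=; last by ring.
  by rewrite partialZ; [ring|exact: test_function_smooth te].
rewrite pintZ//; last by have [] := LpmB mX p1 (lw o) (jet_Lpm o te).
apply: le_trans (lee_wpmul2l _ (h o)) _; first by rewrite lee_fin powR_ge0.
rewrite -EFinM lee_fin mulrA ler_pdivrMr// mulrC ler_wpM2l ?(ltW e0)//.
by rewrite lerDl.
Qed.

Lemma W0B w w' : W0 w -> W0 w' -> W0 (fun o => w o \- w' o).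
Proof.
move=> h h'; have := W0D h (W0Z (-1) h').
by congr W0; apply/funext => o; apply/funext => x /=; rewrite mulN1r.
Qed.

Lemma W0_closed w : (forall o, measurable_fun X (w o)) ->
  (forall e, 0 < e -> exists2 w', W0 w' & forall o, (P (w o \- w' o)%R <= e%:E)%E) -> W0 w.
Proof.
move=> mw H; have lw o : Lpm mu X p (w o).
  by have [w' [lw' _] /(_ o)] := H 1 ltr01; exact: Lpm_close.
split=> // e e0.
have e1 : 0 < e / (2 `^ p * 2) by rewrite divr_gt0 ?mulr_gt0 ?powR_gt0.
have [w' [lw' hw'] h] := H _ e1; have [eta [te h']] := hw' _ e1.
exists eta; split => // o.
rewrite (_ : P _ = P ((w o \- w' o) \+ (w' o \- jet eta o))); last first.
  by apply: eq_integral => x _ /=; congr ((`| _ | `^ _)%:E); ring.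
have m1 : measurable_fun X (w o \- w' o) by have [] := LpmB mX p1 (lw o) (lw' o).
have m2 : measurable_fun X (w' o \- jet eta o) by have [] := LpmB mX p1 (lw' o) (jet_Lpm o te).
apply: le_trans (pintD mu mX p1 m1 m2) _.
apply: le_trans (lee_wpmul2l _ (leeD (h o) (h' o))) _; first by rewrite lee_fin powR_ge0.
rewrite -EFinD -EFinM lee_fin le_eqVlt; apply/orP; left; apply/eqP.
by field; rewrite gt_eqF ?powR_gt0.
Qed.

Lemma W0_weak_partial w i : W0 w -> is_weak_partial X i (w None) (w (Some i)).
Proof.
move=> [lw hw]; have [m0 f0] := lw None; have [mi fi] := lw (Some i).
apply: (is_weak_partial_closed oX p1 Xfin m0 mi f0 fi) => e e0.
have [eta [te h]] := hw e e0; exists eta, (partial i eta).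
split; [apply: smooth_weak_partial; exact: test_function_smooth te|exact: h None|exact: h (Some i)].
Qed.

Lemma W1p_Lpm u : W1p p X u -> (forall o, Lpm mu X p (weak_jet u o)) /\
  forall i, is_weak_partial X i u (weak_partial X i u).
Proof.
move=> [/LpP-/(_ mX p0) lu hu].
have hw i : is_weak_partial X i u (weak_partial X i u).
  by have [g wg _] := hu i; have [] := weak_partialP oX wg.
split; last exact: hw.
case=> [i|]; last exact: lu.
have [g wg /LpP-/(_ mX p0) [mg fg]] := hu i.
have [w1 ae1] := weak_partialP oX wg; have mw := weak_partial_measurable oX w1.
by split; [exact: mw|rewrite (pint_ae mX p mw mg ae1)].
Qed.

Lemma W1pI u (g : 'I_n -> rV -> R) : Lpm mu X p u -> (forall i, Lpm mu X p (g i)) ->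
  (forall i, is_weak_partial X i u (g i)) -> W1p p X u.
Proof.
move=> lu lg hg; split; first exact/(LpP mu mX u p0).
by move=> i; exists (g i); [exact: hg|exact/(LpP mu mX (g i) p0)].
Qed.

Lemma W1p_norm_term u i : ('N[mu]_p%:E[EFin \o (weak_partial X i u) \_ X] <= W1p_norm p X u)%E.
Proof.
rewrite /W1p_norm (bigD1 i)//= addeCA leeDl// adde_ge0 ?Lnorm_ge0//.
by apply: sume_ge0 => j _; exact: Lnorm_ge0.
Qed.

(** Each term of the Sobolev norm is bounded by the norm, and testing with e^(1/p) undoes the p-th
    root. *)
Lemma W1p0_W0 u : W1p0 p X u -> W0 (weak_jet u).
Proof.
move=> [hu hd]; have [lw hw] := W1p_Lpm hu; split=> // e e0.
have d0 : 0 < e `^ p^-1 by exact: powR_gt0.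
have dE : (e `^ p^-1) `^ p = e by rewrite -powRrM mulVf ?gt_eqF// powRr1// ltW.
have [eta te heta] := hd _ d0; exists eta; split=> // o.
have ste := test_function_smooth te.
rewrite -dE; case: o => [i|].
  have [w1 ae1] := weak_partialP oX (is_weak_partialB oX (hw i) (smooth_weak_partial X i ste)).
  rewrite -(pint_ae mX p (weak_partial_measurable oX w1) _ ae1); last first.
    by have [] := LpmB mX p1 (lw (Some i)) (jet_Lpm (Some i) te).
  apply: Lnorm_lt_pint => //; [exact: ltW|].
  by apply: le_trans (W1p_norm_term _ i) (ltW heta).
apply: Lnorm_lt_pint => //; [exact: ltW|]; apply: le_trans (ltW heta).
by rewrite /W1p_norm leeDl// sume_ge0// => j _; exact: Lnorm_ge0.
Qed.

Lemma W0_W1p0 w : W0 w -> W1p0 p X (w None).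
Proof.
move=> Ww; have [lw hw] := Ww; split.
  apply: (@W1pI _ (fun i => w (Some i))) => // i; exact: W0_weak_partial.
(* The norm has n + 1 terms, each at most d; dividing by n + 2 makes the final inequality strict. *)
move=> e e0; pose d := e / (n.+2)%:R.
have d0 : 0 < d by rewrite divr_gt0.
have [eta [te h]] := hw _ (powR_gt0 p d0); exists eta => //.
have ste := test_function_smooth te.
have hN (u : rV -> R) : (P u <= (d `^ p)%:E)%E -> ('N[mu]_p%:E[EFin \o u \_ X] <= d%:E)%E.
  by apply: pint_lt_Lnorm => //; exact: ltW.
apply: (@le_lt_trans _ _ (d%:E + \sum_(i < n) d%:E)%E).
  apply: leeD; first by apply: hN; exact: h None.
  apply: lee_sum => i _; apply: hN.
  have [w1 ae1] := weak_partialP oX (is_weak_partialB oX (W0_weak_partial i Ww) (smooth_weak_partial X i ste)).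
  rewrite (pint_ae mX p (weak_partial_measurable oX w1) _ ae1); first exact: h (Some i).
  by have [] := LpmB mX p1 (lw (Some i)) (jet_Lpm (Some i) te).
rewrite sumEFin -EFinD lte_fin sumr_const card_ord -mulr_natr.
rewrite -[X in X + _]mulr1 -mulrDr /d mulrAC ltr_pdivrMr// ltr_pM2l//.
by rewrite nat1r ltr_nat.
Qed.

Lemma pint_test eta : test_function X eta -> P eta = pint mu setT p eta.
Proof.
move=> te; rewrite /pint integral_mkcond; apply: eq_integral => x _; rewrite /patch.
case: ifPn => // /negP nX; rewrite (test_function_eq0 te) ?normr0 ?powR0 ?gt_eqF// => /mem_set; exact: nX.
Qed.

(** The two factors [K] pay for passing to a test function and back; the error z is arbitrary, so
    the constant does not see the approximation. *)
Lemma W0_poincare r : (forall x, X x -> `|x| <= r) -> 0 < r -> exists2 C, 0 <= C &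
  forall w i, W0 w -> (P (w None) <= C%:E * P (w (Some i)))%E.
Proof.
move=> Xr r0; pose K := 2 `^ p : R; pose C := (2 * r + 1) `^ p.
have K0 : 0 <= K by exact: powR_ge0.
have C0 : 0 <= C by exact: powR_ge0.
exists (K * C * K); first by rewrite !mulr_ge0.
move=> w i [lw hw].
have [m0 f0] := lw None; have [mi fi] := lw (Some i).
have fin1 : P (w (Some i)) \is a fin_num by rewrite ge0_fin_numE// pint_ge0.
apply/lee_addgt0Pr => z z0.
pose D := K * (1 + C * K) + 1.
have D0 : 0 < D by rewrite ltr_wpDl// mulr_ge0// addr_ge0// mulr_ge0.
have [eta [te h]] := hw _ (divr_gt0 z0 D0).
have [me fe] := jet_Lpm None te; have [mp fp] := jet_Lpm (Some i) te.
have b1 : (P (w None) <= K%:E * ((z / D)%:E + P eta))%E.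
  rewrite (_ : P (w None) = P ((w None \- eta) \+ eta)); last first.
    by apply: eq_integral => x _; rewrite /= subrK.
  apply: le_trans (pintD mu mX p1 (measurable_funB m0 me) me) _.
  apply: lee_wpmul2l => //; apply: leeD => //; exact: h None.
have b2 : (P eta <= C%:E * P (partial i eta))%E.
  rewrite !pint_test//; last exact: test_function_partial.
  exact: poincare_test Xr te.
have b3 : (P (partial i eta) <= K%:E * ((z / D)%:E + P (w (Some i))))%E.
  rewrite (_ : P (partial i eta) = P ((partial i eta \- w (Some i)) \+ w (Some i))); last first.
    by apply: eq_integral => x _; rewrite /= subrK.
  apply: le_trans (pintD mu mX p1 (measurable_funB mp mi) mi) _.
  apply: lee_wpmul2l => //; apply: leeD => //; rewrite pintBC; exact: h (Some i).
apply: le_trans b1 _.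
apply: (@le_trans _ _ (K%:E * ((z / D)%:E + C%:E * (K%:E * ((z / D)%:E + P (w (Some i))))))%E).
  apply: lee_wpmul2l => //; apply: leeD => //; apply: le_trans b2 _; exact: lee_wpmul2l.
case: (P (w (Some i))) fin1 => [q| |]// _; rewrite -EFinM -EFinD.
rewrite lee_fin; have zD : z / D * D = z by rewrite divfK// gt_eqF.
have -> : K * (z / D + C * (K * (z / D + q))) = K * C * K * q + z / D * (K * (1 + C * K)) by ring.
by rewrite lerD2l -[leRHS]zD ler_wpM2l ?divr_ge0 ?(ltW z0) ?(ltW D0)// /D lerDl.
Qed.

(** The difference of the mollification and w is the rho-average of w(x - d) - w(x) over |d| < e;
    Jensen, then [shift_estimate] for each d. *)
Lemma conv_near : exists2 C, 0 <= C & forall e rho (w : rV -> R), 0 <= e -> mollifier e rho ->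
  test_function setT w -> (pint mu setT p (conv rho w \- w)%R <=
    (C * e `^ p)%:E * \sum_i pint mu setT p (partial i w))%E.
Proof.
have [C C0 hC] := @shift_estimate R n p p1; exists C => // e rho w e0 mr tw.
have sw := test_function_smooth tw; have Lw := test_function_integrable tw.
have tr := mollifier_testT mr; have [_ r0 re rs rm] := mr.
have mrho := test_function_measurable tr; have mw := test_function_measurable tw.
set S := (\sum_i _)%E.
have S0 : (0 <= S)%E by apply: sume_ge0 => i _; exact: pint_ge0.
pose F (xd : rV * rV) : \bar R := (rho xd.2 * `|w (xd.1 - xd.2) - w xd.1| `^ p)%:E.
have F0 xd : (0 <= F xd)%E by rewrite lee_fin mulr_ge0 ?powR_ge0.
have mF : measurable_fun setT F.
  apply/measurable_EFinP; apply: measurable_funM; first exact: measurableT_comp.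
  apply: measurable_powR_norm; apply: measurable_funB; first exact: measurable_diff_pair.
  exact: measurableT_comp.
apply: (@le_trans _ _ (\int[mu]_x \int[mu]_d F (x, d))%E).
  apply: ge0_le_integral => //.
  - by apply: measurable_pint; apply: measurable_funB => //; exact: conv_measurable.
  - exact: measurable_fun_fubini_tonelli_F.
  move=> x _; have mG : measurable_fun setT (fun y : rV => (rho (x - y) * `|w y - w x| `^ p)%:E).
    apply/measurable_EFinP; apply: measurable_funM; first exact: measurable_reflect.
    by apply: measurable_powR_norm; exact: measurable_funB.
  have -> : (\int[mu]_d F (x, d) = \int[mu]_y (rho (x - y) * `|w y - w x| `^ p)%:E)%E.
    rewrite -(integral_reflect x mG); apply: eq_integral => d _.
    by rewrite /F /= subKr.
  have Lr : mu.-integrable setT (EFin \o (fun y => rho (x - y))).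
    by apply: test_function_integrable; apply: (mollifier_test (X := setT) mr) => y.
  have Lc : mu.-integrable setT (fun y => (rho (x - y) * (w y - w x))%:E).
    have := L1B (conv_integrable x tr Lw) (L1Z (w x) Lr).
    by congr (_.-integrable _ _); apply/funext => y /=; congr EFin; ring.
  have -> : (conv rho w \- w) x = \int[mu]_y (rho (x - y) * (w y - w x)).
    have -> : \int[mu]_y (rho (x - y) * (w y - w x)) = \int[mu]_y (rho (x - y) * w y - w x * rho (x - y)).
      by apply: eq_Rintegral => y _; ring.
    rewrite RintegralB//; [|exact: conv_integrable|exact: L1Z].
    by rewrite RintegralZl// /Rintegral (mollifier_mass x mr) mulr1.
  apply: (@jensen_powR _ _ _ mu setT (fun y => rho (x - y)) (fun y => w y - w x)) => //.
  - exact: measurable_reflect.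
  - exact: measurable_funB.
  - exact: mollifier_mass mr.
rewrite (@fubini_tonelli _ _ _ _ _ mu mu _ mF F0).
apply: (@le_trans _ _ (\int[mu]_d ((rho d)%:E * ((C * e `^ p)%:E * S)))%E).
  apply: ge0_le_integral => //.
  - by move=> d _; exact: integral_ge0.
  - exact: measurable_fun_fubini_tonelli_G.
  - by apply: emeasurable_funM => //; exact/measurable_EFinP.
  move=> d _; have mg : measurable_fun setT (fun x : rV => (`|w (x - d) - w x| `^ p)%:E).
    apply: measurable_pint; apply: measurable_funB => //.
    exact: (measurableT_comp mw (measurable_add_rV _)).
  rewrite /F /=; under eq_integral do rewrite EFinM.
  rewrite ge0_integralZl ?lee_fin//.
  have [de|de] := leP e `|d|; first by rewrite rs// !mul0e.
  apply: lee_wpmul2l; first by rewrite lee_fin.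
  apply: le_trans (hC w (- d) sw) _; rewrite normrN; apply: lee_wpmul2r => //.
  by rewrite lee_fin ler_wpM2l// ge0_ler_powR ?nnegrE ?(ltW p0) ?(ltW de).
rewrite ge0_integralZr//; last 3 first.
- exact/measurable_EFinP.
- by move=> d _; rewrite lee_fin.
- by rewrite mule_ge0// lee_fin mulr_ge0 ?powR_ge0.
by rewrite rm mul1e.
Qed.

Lemma conv_sup_bound rho g M x : test_function setT rho -> mu.-integrable setT (EFin \o g) ->
  (forall y, `|rho y| <= M) -> `|conv rho g x| <= M * \int[mu]_y `|g y|.
Proof.
move=> tr ig hM; have iag : mu.-integrable setT (EFin \o (fun y => `|g y|)) by exact: integrable_norm.
apply: le_trans (le_normr_Rintegral _ (conv_integrable x tr ig)) _ => //.
rewrite -RintegralZl//; apply: le_Rintegral => //.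
- exact: (integrable_norm (conv_integrable x tr ig)).
- exact: (integrableZl measurableT M iag).
- by move=> y _; rewrite normrM ler_wpM2r.
Qed.

Lemma ultra_cvg_bounded (U : set_system nat) (v : nat -> R) (M : R) : UltraFilter U ->
  (forall k, `|v k| <= M) -> exists l : R, v @ U --> l.
Proof.
move=> UU vM; have cM : compact `[- M, M]%classic by exact: segment_compact.
have [|l [_ cl]] := cM (v @ U) _.
  by apply: (@filterE _ U) => k /=; rewrite in_itv/= -ler_norml.
exists l; apply/cvgrPdist_lt => e e0.
have [//|nU] := @in_ultra_setVsetC _ U [set k | `|l - v k| < e] UU.
have [|_ [[k nk <-]]] := cl (v @` [set k | ~ `|l - v k| < e]) (ball l e) _ (nbhsx_ballx l e e0).
  by apply: (@filterS _ U _ _ _ _ nU) => k nk; exists k.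
by rewrite -ball_normE.
Qed.

Lemma pint_subset (u : rV -> R) : measurable_fun setT u -> (P u <= pint mu setT p u)%E.
Proof.
by move=> mu_; apply: ge0_subset_integral => //; exact: measurable_pint.
Qed.

(* The mollifications at a fixed scale are equicontinuous and uniformly close
   to [w]; an ultrafilter on the indices makes them converge at every scale at once. *)
Lemma rellich r B (w : nat -> rV -> R) : (0 < n)%N -> 0 < r -> (forall x, X x -> `|x| <= r) ->
  (forall k, test_function X (w k)) -> (forall k i, (P (partial i (w k)) <= B%:E)%E) ->
  exists phi : nat -> nat, (forall k, (phi k < phi k.+1)%N) /\
    forall e, 0 < e -> exists N, forall k l, (N <= k)%N -> (N <= l)%N ->
      (P (w (phi k) \- w (phi l))%R <= e%:E)%E.
Proof.
move=> n0 r0 Xr tw wB; have i0 : 'I_n by case: n n0 => // m _; exact: ord0.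
have [U [UU Uoo]] := @ultraFilterLemma nat \oo _.
have PU : ProperFilter U := ultra_proper.
have B0 : 0 <= B by have := le_trans (pint_ge0 _ _ _ _) (wB 0%N i0); rewrite lee_fin.
have tT k : test_function setT (w k) by exact: test_function_sub (tw k).
have Lw k := test_function_integrable (tw k).
have mw k := test_function_measurable (tw k).
have [C C0 hC] := conv_near.
(* An L^1 bound on all w k, from |t| <= 1 + |t|^p and Poincare's inequality. *)
pose J := fine (mu X) + (2 * r + 1) `^ p * B.
have J0 : 0 <= J by rewrite addr_ge0 ?fine_ge0// mulr_ge0 ?powR_ge0.
have wJ k : \int[mu]_x `|w k x| <= J.
  rewrite (Rintegral_support mu (@subsetT _ X)); last first.
    by move=> x _ nX; rewrite (test_function_eq0 (tw k) nX) normr0.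
  have Xf : mu X \is a fin_num by rewrite ge0_fin_numE.
  have h : (\int[mu]_(x in X) (`|w k x|)%:E <= J%:E)%E.
    have mwk : measurable_fun X (w k) by apply: measurable_funS (mw k).
    apply: (@le_trans _ _ (\int[mu]_(x in X) (1%:E + (`|w k x| `^ p)%:E))%E).
      apply: ge0_le_integral => //.
      - by apply/measurable_EFinP; exact: measurableT_comp.
      - by apply: emeasurable_funD => //; exact: measurable_pint.
      - by move=> x _; have := norm_le_powR (w k x) p1 ltr01; rewrite powR1 mul1r -EFinD lee_fin.
    rewrite ge0_integralD//; last exact: measurable_pint.
    rewrite integral_cst// mul1e /J EFinD fineK// leeD2l// -/(pint _ _ _ _) pint_test//.
    apply: le_trans (poincare_test i0 p1 r0 Xr (tw k)) _; rewrite EFinM.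
    apply: lee_wpmul2l; first by rewrite lee_fin powR_ge0.
    by rewrite -/(pint mu setT p _) -pint_test//; exact: test_function_partial.
  rewrite -lee_fin fineK//.
  by have := integrable_fin_num mX (integrable_abse (integrableS measurableT mX (@subsetT _ X) (Lw k))).
have key e : 0 < e -> exists A, U A /\ forall k l, A k -> A l -> (P (w k \- w l)%R <= e%:E)%E.
  move=> e0; pose K := 2 `^ p : R.
  have K0 : 0 < K by exact: powR_gt0.
  (* Chosen so that K (d + K (d + d)) = e, the cost of splitting w k - w l into three
     differences. *)
  pose d := e / (K * (1 + K * 2)).
  have d0 : 0 < d by rewrite divr_gt0 ?mulr_gt0 ?addr_gt0 ?mulr_gt0.
  have root t : 0 < t -> (t `^ p^-1) `^ p = t.
    by move=> t0; rewrite -powRrM mulVf ?gt_eqF// powRr1// ltW.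
  pose D := C * (n%:R * B) + 1.
  have D0 : 0 < D by rewrite ltr_wpDl// !mulr_ge0.
  (* The radius of mollification: its p-th power times C n B is at most d. *)
  have e1 : 0 < (d / D) `^ p^-1 by exact: powR_gt0 (divr_gt0 d0 D0).
  have [rho mr] := @mollifier_exists R n _ e1.
  have tr := mollifier_testT mr.
  have near k : (pint mu setT p (conv rho (w k) \- w k)%R <= d%:E)%E.
    apply: le_trans (hC _ rho (w k) (ltW e1) mr (tT k)) _.
    rewrite (root _ (divr_gt0 d0 D0)).
    apply: (@le_trans _ _ ((C * (d / D))%:E * \sum_(i < n) B%:E)%E).
      apply: lee_wpmul2l; first by rewrite lee_fin mulr_ge0// divr_ge0 ?ltW.
      by apply: lee_sum => i _; rewrite -pint_test//; exact: test_function_partial.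
    rewrite sumEFin -EFinM lee_fin sumr_const card_ord -mulr_natl.
    rewrite (_ : C * (d / D) * _ = d * ((C * (n%:R * B)) / D)); last by field; rewrite gt_eqF.
    by rewrite ler_piMr ?(ltW d0)// ler_pdivrMr// mul1r /D lerDl.
  have [L L0 hL] := conv_lipschitz tr.
  have [M M0 hM] := test_function_bounded tr.
  pose v k := conv rho (w k).
  have vM k x : `|v k x| <= M * J.
    by apply: le_trans (conv_sup_bound x tr (Lw k) hM) _; rewrite ler_wpM2l ?(ltW M0).
  have vL k x y : `|v k x - v k y| <= L * J * `|x - y|.
    by apply: le_trans (hL _ x y (Lw k)) _; rewrite ler_wpM2r// ler_wpM2l.
  have /choice[V hV] x := ultra_cvg_bounded UU (vM ^~ x).
  have VL x y : `|V x - V y| <= L * J * `|x - y|.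
    apply: (ler_cvg_to (cvg_norm (cvgB (hV x) (hV y))) (cvg_cst _)).
    by apply: nearW => k; exact: vL.
  pose m := fine (mu X) + 1.
  have m0 : 0 < m by rewrite ltr_wpDl// fine_ge0.
  pose d2 := (d / m) `^ p^-1 / 2.
  have d20 : 0 < d2 by apply: divr_gt0 => //; exact: powR_gt0 (divr_gt0 d0 m0).
  (* Pointwise convergence along U, with a Lipschitz constant common to all v k and V, is uniform on
     the compact cube. *)
  have /compact_near_coveringP/(_ _ U (fun k x => `|v k x - V x| < d2)) cov := @compact_cube R n r.
  have {cov} UA : \forall k \near U, @cube R n r `<=` [set x | `|v k x - V x| < d2].
    apply: cov => x _.
    have LJ : 0 < 3 * (L * J + 1) by rewrite mulr_gt0// ltr_wpDl// mulr_ge0.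
    have d30 : 0 < d2 / (3 * (L * J + 1)) by rewrite divr_gt0.
    have d31 : 0 < d2 / 3 by rewrite divr_gt0.
    have Ux : U [set k | `|v k x - V x| < d2 / 3].
      by have /cvgrPdist_lt/(_ _ d31) := hV x; apply: filterS => k; rewrite distrC.
    exists (ball x (d2 / (3 * (L * J + 1))), [set k | `|v k x - V x| < d2 / 3]).
      by split=> //=; exact: nbhsx_ballx.
    move=> [y k] /= [xy kx].
    have h3 : L * J * `|x - y| < d2 / 3.
      apply: (@le_lt_trans _ _ (L * J * (d2 / (3 * (L * J + 1))))).
        by rewrite ler_wpM2l ?mulr_ge0// ltW//; move: xy; rewrite -ball_normE.
      rewrite (_ : L * J * _ = d2 / 3 * (L * J / (L * J + 1))); last first.
        by field; rewrite gt_eqF// ltr_wpDl// mulr_ge0.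
      by rewrite gtr_pMr// ltr_pdivrMr ?mul1r ?ltrDl// ltr_wpDl// mulr_ge0.
    have -> : v k y - V y = (v k y - v k x) + (v k x - V x) + (V x - V y) by ring.
    apply: le_lt_trans (ler_normD _ _) _; apply: le_lt_trans (lerD (ler_normD _ _) (lexx _)) _.
    have := vL k x y; have := VL x y; rewrite (distrC (v k x)) => a1 a2.
    by lra.
  exists [set k | @cube R n r `<=` [set x | `|v k x - V x| < d2]]; split=> // k l /= Ak Al.
  have mv j : measurable_fun X (v j).
    by apply: measurable_funS (conv_measurable tr (Lw j)).
  have mwX j : measurable_fun X (w j) by apply: measurable_funS (mw j).
  have b1 j : (P (v j \- w j)%R <= d%:E)%E.
    apply: le_trans (near j); apply: pint_subset; apply: measurable_funB => //.
    exact: conv_measurable.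
  have b2 : (P (v k \- v l)%R <= d%:E)%E.
    apply: (@le_trans _ _ (\int[mu]_(x in X) ((d / m)%:E))%E).
      apply: ge0_le_integral => //.
      - by apply: measurable_pint; exact: measurable_funB.
      move=> x Xx; rewrite lee_fin -(root _ (divr_gt0 d0 m0)).
      rewrite ge0_ler_powR ?nnegrE ?powR_ge0 ?(ltW p0)//.
      have cx : @cube R n r x by apply/cube_norm; [exact: ltW|exact: Xr].
      have := Ak x cx; have := Al x cx => /= a1 a2.
      have -> : v k x - v l x = (v k x - V x) - (v l x - V x) by ring.
      apply: le_trans (ler_normB _ _) _.
      have -> : (d / m) `^ p^-1 = d2 + d2 by rewrite /d2 -splitr.
      by rewrite lerD// ltW.
    have Xf : mu X \is a fin_num by rewrite ge0_fin_numE.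
    rewrite integral_cst// -[X in (_ * X)%E](fineK Xf).
    rewrite -EFinM lee_fin mulrAC -mulrA ler_piMr ?(ltW d0)// ler_pdivrMr// mul1r /m lerDl//.
  have -> : P (w k \- w l)%R = P ((w k \- v k) \+ ((v k \- v l) \+ (v l \- w l)))%R.
    by apply: eq_integral => x _ /=; congr ((`| _ | `^ _)%:E); ring.
  apply: le_trans (pintD mu mX p1 (measurable_funB (mwX k) (mv k)) (measurable_funD (measurable_funB (mv k) (mv l)) (measurable_funB (mv l) (mwX l)))) _.
  apply: (@le_trans _ _ (K%:E * (d%:E + K%:E * (d%:E + d%:E)))%E).
    apply: lee_wpmul2l; first by rewrite lee_fin (ltW K0).
    apply: leeD; first by rewrite pintBC; exact: b1.
    apply: le_trans (pintD mu mX p1 (measurable_funB (mv k) (mv l)) (measurable_funB (mv l) (mwX l))) _.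
    by apply: lee_wpmul2l; [rewrite lee_fin (ltW K0)|exact: (leeD b2 (b1 l))].
  have -> : (K%:E * (d%:E + K%:E * (d%:E + d%:E)) = (K * (d + K * (d + d)))%:E)%E by [].
  rewrite lee_fin le_eqVlt; apply/orP; left; apply/eqP.
  rewrite /d; field.
  by rewrite !gt_eqF// addr_gt0// mulr_gt0.
have e0 (m : nat) : 0 < m.+1%:R^-1 :> R by rewrite invr_gt0.
have /choice[A hA] m := key _ (e0 m).
(* All the sets A j belong to one ultrafilter that refines convergence to infinity, so indices good
   for finitely many scales exist beyond any bound; no nested subsequences are needed. *)
have UB m : U [set k | forall j, (j <= m)%N -> A j k].
  elim: m => [|m IH].
    by have [UA _] := hA 0%N; apply: filterS UA => k Ak j; rewrite leqn0 => /eqP ->.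
  have [UA _] := hA m.+1; apply: filterS2 IH UA => k h1 h2 j.
  by rewrite leq_eqVlt => /orP[/eqP -> //|/h1].
have /choice[pick hpick] (mN : nat * nat) : exists k, (mN.2 < k)%N /\ forall j, (j <= mN.1)%N -> A j k.
  have UN : U [set k | (mN.2 < k)%N] by apply: Uoo; exists mN.2.+1.
  have [k [h1 h2]] := filter_ex (filterI UN (UB mN.1)); by exists k.
pose phi := fix phi k := if k is k'.+1 then pick (k'.+1, phi k') else pick (0%N, 0%N).
exists phi; split; first by move=> k; have [] := hpick (k.+1, phi k).
have hphi m k : (m <= k)%N -> A m (phi k).
  by case: k => [|k] mk; [have [_] := hpick (0%N, 0%N)|have [_] := hpick (k.+1, phi k)]; apply.
move=> e e0'; have [m _ /(_ m (leqnn m)) hm] := near_infty_natSinv_lt (PosNum e0').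
exists m => k l mk ml; have [_ /(_ _ _ (hphi m k mk) (hphi m l ml))] := hA m.
by move=> h; apply: le_trans h _; rewrite lee_fin ltW.
Qed.

End sobolev0.

(** * Weak continuity of the Jacobian *)

Section det_facts.
Context {R : realType}.

Lemma cvg_prod_seq (I : eqType) (s : seq I) (F : I -> nat -> R) (l : I -> R) :
  (forall i, F i k @[k --> \oo] --> l i) ->
  \prod_(i <- s) F i k @[k --> \oo] --> \prod_(i <- s) l i.
Proof.
move=> h; elim: s => [|i s IH].
  by under eq_fun do rewrite big_nil; rewrite big_nil; exact: cvg_cst.
by under eq_fun do rewrite big_cons; rewrite big_cons; exact: cvgM.
Qed.

Lemma cvg_sum_seq (I : eqType) (s : seq I) (F : I -> nat -> R) (l : I -> R) :
  (forall i, F i k @[k --> \oo] --> l i) ->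
  \sum_(i <- s) F i k @[k --> \oo] --> \sum_(i <- s) l i.
Proof.
move=> h; elim: s => [|i s IH].
  by under eq_fun do rewrite big_nil; rewrite big_nil; exact: cvg_cst.
by under eq_fun do rewrite big_cons; rewrite big_cons; exact: cvgD.
Qed.

Lemma det_cvg n (A : nat -> 'M[R]_n) (B : 'M[R]_n) :
  (forall i j, A k i j @[k --> \oo] --> B i j) -> \det (A k) @[k --> \oo] --> \det B.
Proof.
move=> h; apply: cvg_sum_seq => s; apply: cvgM; first exact: cvg_cst.
by apply: cvg_prod_seq => i; exact: h.
Qed.

Lemma det_bound n (A : 'M[R]_n) (c : 'I_n -> R) : (forall i j, `|A i j| <= c i) ->
  `|\det A| <= n`!%:R * \prod_i c i.
Proof.
move=> h; apply: le_trans (ler_norm_sum _ _ _) _.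
apply: (@le_trans _ _ (\sum_(s : 'S_n) \prod_i c i)).
  apply: ler_sum => s _; rewrite normrM normrX normrN1 expr1n mul1r normr_prod.
  by apply: ler_prod => i _; rewrite normr_ge0 h.
by rewrite sumr_const card_Sn mulr_natl.
Qed.

Lemma det_row0 n (A : 'M[R]_n) i : (forall j, A i j = 0) -> \det A = 0.
Proof.
by move=> h; rewrite (expand_det_row _ i) big1// => j _; rewrite h mul0r.
Qed.

Context d (T : measurableType d).

Lemma measurable_sum_seq (D : set T) (I : eqType) (s : seq I) (F : I -> T -> R) :
  (forall i, measurable_fun D (F i)) -> measurable_fun D (fun x => \sum_(i <- s) F i x).
Proof.
move=> h; elim: s => [|i s IH].
  by under eq_fun do rewrite big_nil; exact: measurable_cst.
by under eq_fun do rewrite big_cons; exact: measurable_funD.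
Qed.

Lemma measurable_prod_seq (D : set T) (I : eqType) (s : seq I) (F : I -> T -> R) :
  (forall i, measurable_fun D (F i)) -> measurable_fun D (fun x => \prod_(i <- s) F i x).
Proof.
move=> h; elim: s => [|i s IH].
  by under eq_fun do rewrite big_nil; exact: measurable_cst.
by under eq_fun do rewrite big_cons; exact: measurable_funM.
Qed.

Lemma measurable_det n (D : set T) (A : T -> 'M[R]_n) :
  (forall i j, measurable_fun D (fun x => A x i j)) -> measurable_fun D (fun x => \det (A x)).
Proof.
move=> h; apply: measurable_sum_seq => s; apply: measurable_funM => //.
by apply: measurable_prod_seq.
Qed.

Lemma Rintegral_sum_seq (mu : {measure set T -> \bar R}) (D : set T) (I : eqType) (s : seq I)
    (F : I -> T -> R) : measurable D -> (forall i, mu.-integrable D (EFin \o F i)) ->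
  mu.-integrable D (EFin \o (fun x => \sum_(i <- s) F i x)) /\
  \int[mu]_(x in D) (\sum_(i <- s) F i x) = \sum_(i <- s) \int[mu]_(x in D) F i x.
Proof.
move=> mD h; elim: s => [|i s [IH1 IH2]].
  under eq_fun do rewrite big_nil; rewrite big_nil; split; first exact: integrable0.
  by rewrite Rintegral_cst// mul0r.
split; first by under eq_fun do rewrite big_cons; exact: (integrableD mD (h i) IH1).
by under eq_Rintegral do rewrite big_cons; rewrite big_cons RintegralD// IH2.
Qed.

End det_facts.

(** * The determinant of a gradient is a divergence *)

Section null_lagrangian.
Context {R : realType} {n : nat}.
Local Notation rV := 'rV[R]_n.
Local Notation mu := (@lebesgue_rV R n).
Local Notation de i := (delta_mx 0 i : rV).
Implicit Types (u w eta : rV -> R) (i j k l : 'I_n).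

Lemma subrACA (a b c r : R) : a - b - (c - r) = a - c - (b - r).
Proof. ring. Qed.

Lemma line_MVT u i (x : rV) (h : R) : smooth u -> 0 < h -> exists2 c, 0 <= c <= h &
  u (h *: de i + x) - u x = partial i u (c *: de i + x) * h.
Proof.
move=> su h0.
have cf : {within `[0, h], continuous (fun r : R => u (r *: de i + x))}.
  apply: continuous_subspaceT; apply: derivable_continuous => t.
  exact: is_derive_line_sub.
have [|c ch hc] := @MVT_segment R (fun r : R => u (r *: de i + x))
  (fun r : R => partial i u (r *: de i + x)) 0 h (ltW h0) _ cf.
  by move=> r _; exact: is_derive_line_sub.
exists c; first by move: ch; rewrite in_itv.
by move: hc; rewrite scale0r add0r subr0.
Qed.

(** The mean value theorem is used twice, first on the difference of u in direction j. The left side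
    is symmetric in i and j, which gives Schwarz' theorem as h tends to 0. *)
Lemma second_difference u i j (x : rV) (h : R) : smooth u -> 0 < h ->
  exists y : rV, `|y - x| <= 2 * h /\
  u (h *: de i + (h *: de j + x)) - u (h *: de j + x) - (u (h *: de i + x) - u x) =
    partial j (partial i u) y * h ^+ 2.
Proof.
move=> su h0.
pose v := fun y : rV => u (y + h *: de j) - u y.
have sv : smooth v by exact: (smoothB (smooth_shift _ su) su).
have [c /andP[c0 ch] hc] := line_MVT i x sv h0.
have spi := smooth_partial i su.
have [e /andP[e0 eh] he] := line_MVT j (c *: de i + x) spi h0.
exists (e *: de j + (c *: de i + x)); split.
  rewrite (addrC _ x) addrCA addrC addrK.
  have nd k : `|de k| <= 1.
    rewrite -[leLHS]/(Num.norm (de k)).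
    apply/cube_norm => // l; rewrite mxE; case: (_ && _); rewrite /= in_itv/= ?mulr1n ?mulr0n ?lexx ?lerN10 ?ler01 ?andbT//; exact: le_trans (lerN10 R) ler01.
  apply: le_trans (ler_normD _ _) _; rewrite !normrZ (ger0_norm e0) (ger0_norm c0).
  by rewrite mulr_natl mulr2n; apply: lerD; rewrite -[leRHS]mulr1; apply: ler_pM.
move: hc; rewrite /v.
rewrite (partialB _ _ (smooth_shift _ su) su).
rewrite partial_shift => hc.
rewrite (addrC (h *: de j) x) addrA subrACA hc (addrC _ (h *: de j)) he.
by rewrite expr2 mulrA.
Qed.

Lemma continuous_eq_near (a b : rV -> R) (x : rV) : continuous a -> continuous b ->
  (forall h : R, 0 < h -> exists y z : rV, [/\ `|y - x| <= 2 * h, `|z - x| <= 2 * h & b y = a z]) ->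
  a x = b x.
Proof.
move=> ca cb H; apply/eqP; rewrite -subr_eq0 -normr_le0; apply/ler_addgt0Pr => e e0; rewrite add0r.
have e2 : 0 < e / 2 by rewrite divr_gt0.
have : \forall y \near x, `|a x - a y| < e / 2 /\ `|b x - b y| < e / 2.
  have /cvgrPdist_lt/(_ _ e2) h1 := ca x; have /cvgrPdist_lt/(_ _ e2) h2 := cb x.
  exact: (filterI h1 h2).
move=> /nbhs_ballP[d d0 hd]; have d0' : 0 < d := d0.
have d3 : 0 < d / 3 by rewrite divr_gt0.
have [y [z [yx zx E]]] := H _ d3.
have B (w : rV) : `|w - x| <= 2 * (d / 3) -> ball x d w.
  move=> wx; rewrite -ball_normE/= distrC; apply: le_lt_trans wx _.
  by move: d0'; clear; lra.
have [_ h1] := hd _ (B _ yx); have [h2 _] := hd _ (B _ zx).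
apply: le_trans (ler_distD (a z) _ _) _; rewrite (splitr e); apply: lerD (ltW h2) _.
by rewrite -E distrC ltW.
Qed.

Lemma schwarz u i j (x : rV) : smooth u ->
  partial i (partial j u) x = partial j (partial i u) x.
Proof.
move=> su; have cij := smooth_continuous (smooth_partial i (smooth_partial j su)).
have cji := smooth_continuous (smooth_partial j (smooth_partial i su)).
apply: (continuous_eq_near cij cji) => h h0.
have [y [yx hy]] := second_difference i j x su h0.
have [z [zx hz]] := second_difference j i x su h0.
exists y, z; split; [exact: yx|exact: zx|].
have hh : h ^+ 2 != 0 by rewrite expf_neq0// gt_eqF.
rewrite (addrCA (h *: de i)) in hy.
exact: (mulIf hh (etrans (esym hy) (etrans (subrACA _ _ _ _) hz))).
Qed.

Lemma smooth_prod_seq (I : eqType) (s : seq I) (P : pred I) (F : I -> rV -> R) :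
  (forall t, smooth (F t)) -> smooth (fun x => \prod_(t <- s | P t) F t x).
Proof.
move=> h; elim: s => [|t s IH].
  by under eq_fun do rewrite big_nil; exact: smooth_cst.
under eq_fun do rewrite big_cons.
by case: (P t); [exact: (smoothM (h t) IH)|exact: IH].
Qed.

Lemma partial_prod_seq (I : eqType) (s : seq I) (P : pred I) (F : I -> rV -> R) i x : uniq s ->
  (forall t, smooth (F t)) ->
  partial i (fun x => \prod_(t <- s | P t) F t x) x =
  \sum_(r <- s | P r) partial i (F r) x * \prod_(t <- s | P t && (t != r)) F t x.
Proof.
move=> us h; elim: s us => [_|k s IH /= /andP[ks us]].
  have -> : (fun x => \prod_(t <- [::] | P t) F t x) = cst 1 by apply/funext => y; rewrite big_nil.
  by rewrite big_nil /partial derive_cst.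
have e1 : (fun x => \prod_(t <- k :: s | P t) F t x) =
    if P k then F k \* (fun x => \prod_(t <- s | P t) F t x) else (fun x => \prod_(t <- s | P t) F t x).
  by apply/funext => y; rewrite big_cons; case: ifP.
have e2 : \sum_(r <- s | P r) partial i (F r) x * \prod_(t <- k :: s | P t && (t != r)) F t x =
    (if P k then F k x else 1) * \sum_(r <- s | P r) partial i (F r) x * \prod_(t <- s | P t && (t != r)) F t x.
  rewrite mulr_sumr big_seq_cond [RHS]big_seq_cond; apply: eq_bigr => l /andP[ls _].
  rewrite big_cons; have -> : k != l by apply: contraNneq ks => ->.
  by rewrite andbT; case: (P k); rewrite ?mul1r// mulrCA.
rewrite e1 big_cons; case: ifP e2 => Pk e2; last by rewrite IH// e2 mul1r.
rewrite partialM//; last exact: smooth_prod_seq.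
rewrite IH// e2 addrC; congr (_ + _); rewrite mulrC; congr (_ * _).
rewrite big_cons eqxx andbF big_seq_cond [RHS]big_seq_cond; apply: eq_bigl => l.
by case ls : (l \in s) => //=; rewrite (_ : l != k) ?andbT//; apply: contraNneq ks => <-.
Qed.

Definition grad (H : 'I_n -> rV -> R) (x : rV) : 'M[R]_n := \matrix_(k, i) partial i (H k) x.

(* The cofactors of a gradient matrix are divergence free. *)
Lemma det_grad_divergence (H : 'I_n -> rV -> R) j x : (forall k, smooth (H k)) ->
  \det (grad H x) = \sum_(s : 'S_n) (-1) ^+ s *
    partial (s j) ((fun y => \prod_(k | k != j) partial (s k) (H k) y) \* H j) x.
Proof.
move=> sH; pose c (s : 'S_n) l : R := partial (s j) (partial (s l) (H l)) x *
  \prod_(k | (k != j) && (k != l)) partial (s k) (H k) x.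
have sp (s : 'S_n) k : smooth (partial (s k) (H k)) by exact: smooth_partial.
have E (s : 'S_n) : partial (s j) ((fun y => \prod_(k | k != j) partial (s k) (H k) y) \* H j) x =
    \prod_k grad H x k (s k) + H j x * \sum_(l | l != j) c s l.
  rewrite (partialM _ _ (smooth_prod_seq _ _ (sp s)) (sH j)).
  rewrite partial_prod_seq ?index_enum_uniq//; congr (_ + _).
  rewrite [RHS](bigD1 j)//= mulrC; congr (_ * _); first by rewrite mxE.
  by apply: eq_bigr => k _; rewrite mxE.
under [RHS]eq_bigr do rewrite E mulrDr.
rewrite big_split/= -[LHS]addr0; congr (_ + _); apply/esym.
under eq_bigr do rewrite mulrCA mulr_sumr.
rewrite -mulr_sumr exchange_big/= big1 ?mulr0// => l lj.
set S := \sum_(s : 'S_n) _.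
suff : S = - S by move=> /eqP; rewrite -addr_eq0 -mulr2n mulrn_eq0/= => /eqP.
(* Composition with the transposition (j l) flips the sign of the permutation and exchanges the two
   differentiations of H l, which commute; so the sum equals its own opposite. *)
rewrite {1}/S (reindex_inj (mulgI (tperm j l))) -sumrN; apply: eq_bigr => s _.
rewrite odd_permM odd_tperm eq_sym lj signr_addb mulN1r mulNr; congr (- (_ * _)).
rewrite /c !permM tpermL tpermR (schwarz _ _ _ (sH l)); congr (_ * _).
by apply: eq_bigr => k /andP[kj kl]; rewrite permM tpermD// eq_sym.
Qed.

(** H j is the undifferentiated factor of every divergence term, so its compact support alone makes
    each of them integrate to 0. *)
Lemma null_lagrangian (H : 'I_n -> rV -> R) j : (forall k, smooth (H k)) ->
  test_function setT (H j) -> \int[mu]_x \det (grad H x) = 0.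
Proof.
move=> sH tH; pose F (s : 'S_n) := (fun y => \prod_(k | k != j) partial (s k) (H k) y) \* H j.
have tF s : test_function setT (F s).
  by apply: test_functionMl tH; apply: smooth_prod_seq => k; exact: smooth_partial.
have -> : \int[mu]_x \det (grad H x) = \int[mu]_x (\sum_(s : 'S_n) (-1) ^+ s * partial (s j) (F s) x).
  by apply: eq_Rintegral => x _; exact: det_grad_divergence.
have iF s : mu.-integrable setT (EFin \o (fun x => (-1) ^+ odd_perm s * partial (s j) (F s) x)).
  by apply: L1Z; apply: test_function_integrable; exact: test_function_partial (tF s).
have [_ ->] := Rintegral_sum_seq (index_enum _) measurableT iF.
apply: big1 => s _; rewrite RintegralZl//; last first.
  by apply: test_function_integrable; exact: test_function_partial (tF s).
by rewrite (integral_partial _ (tF s)) mulr0.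
Qed.

Definition replace (T : Type) (j : 'I_n) (w : T) (G : 'I_n -> T) : 'I_n -> T :=
  fun k => if k == j then w else G k.

(** Apply [null_lagrangian] with G j eta in place of G j: the determinant is linear in row j, and
    that gradient splits by the product rule. *)
Lemma det_identity_smooth (G : 'I_n -> rV -> R) j eta : (forall k, smooth (G k)) ->
  test_function setT eta ->
  \int[mu]_x (\det (grad G x) * eta x) =
  - \int[mu]_x (G j x * \det (grad (replace j eta G) x)).
Proof.
move=> sG te; have se := test_function_smooth te.
have sr w : smooth w -> forall k, smooth (replace j w G k) by move=> sw k; rewrite /replace; case: ifP => _; [exact: sw|exact: sG].
pose H := replace j (G j \* eta) G.
have tH : test_function setT (H j) by rewrite /H /replace eqxx; exact: (test_functionMl (sG j) te).
have := null_lagrangian (sr _ (smoothM (sG j) se)) tH.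
have dsm K : (forall k, smooth (K k)) -> smooth (fun x => \det (grad K x)).
  move=> sK.
  have -> : (fun x => \det (grad K x)) = (fun x => \sum_(s : 'S_n) (-1) ^+ s * \prod_k partial (s k) (K k) x).
    by apply/funext => x; apply: eq_bigr => s _; congr (_ * _); apply: eq_bigr => k _; rewrite mxE.
  elim: (index_enum _) => [|s l IH].
    by under eq_fun do rewrite big_nil; exact: smooth_cst.
  under eq_fun do rewrite big_cons; apply: smoothD IH.
  by apply: smoothZ; apply: smooth_prod_seq => k; exact: (smooth_partial (s k) (sK k)).
have i1 : mu.-integrable setT (EFin \o (fun x => \det (grad G x) * eta x)).
  by apply: (@test_function_integrable _ _ setT); exact: (test_functionMl (dsm G sG) te).
have t2 : test_function setT (fun x => G j x * \det (grad (replace j eta G) x)).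
  have [K [cK KT] e0] := test_function_support te.
  apply: (test_functionI _ cK KT).
    by apply: smoothM (sG j) _; apply: dsm; exact: sr.
  move=> x nK; rewrite (@det_row0 _ _ _ j) ?mulr0// => i; rewrite mxE /replace eqxx.
  exact: (partial_support i (compact_closed (@norm_hausdorff _ _) cK) e0).
have -> : \int[mu]_x \det (grad H x) =
    \int[mu]_x (\det (grad G x) * eta x + G j x * \det (grad (replace j eta G) x)).
  apply: eq_Rintegral => x _; rewrite mulrC.
  have nl (k : 'I_n.-1) : (lift j k == j) = false by rewrite eq_sym (negbTE (neq_lift _ _)).
  apply: (@determinant_multilinear _ _ _ _ _ j).
  - apply/rowP => i; rewrite !mxE /H /replace eqxx (partialM _ _ (sG j) se) addrC.
    by congr (_ + _).
  - by apply/matrixP => k i; rewrite !mxE /H /replace nl.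
  - by apply/matrixP => k i; rewrite !mxE /H /replace !nl.
rewrite RintegralD//; last exact: test_function_integrable t2.
by move/eqP; rewrite addr_eq0 => /eqP.
Qed.

End null_lagrangian.

(** * Weak continuity of Jacobians of Sobolev maps *)

Section jacobians.
Context {R : realType} {n : nat}.
Local Notation rV := 'rV[R]_n.
Local Notation mu := (@lebesgue_rV R n).
Implicit Types (eta : rV -> R) (i j k : 'I_n) (G F H : 'I_n -> rV -> R) (dG dF dH : 'I_n -> 'I_n -> rV -> R).

Definition mat dG (x : rV) : 'M[R]_n := \matrix_(k, i) dG k i x.

Variables (X : set rV) (p : R).
Hypotheses (oX : open X) (Xfin : (mu X < +oo)%E) (n0 : (0 < n)%N) (np : n%:R <= p).

Let mX : measurable X := open_measurable_rV oX.
Let p1 : 1 <= p. Proof. by apply: le_trans np; rewrite ler1n. Qed.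
Let p0 : 0 < p. Proof. exact: lt_le_trans p1. Qed.
Local Notation P u := (pint mu X p u).

Lemma Lpm_sum_seq (D : set rV) (I : eqType) (s : seq I) (u : I -> rV -> R) : measurable D ->
  (mu D < +oo)%E -> (forall t, Lpm mu D p (u t)) -> Lpm mu D p (fun x => \sum_(t <- s) u t x).
Proof.
move=> mD Dfin h; elim: s => [|t s IH].
  under eq_fun do rewrite big_nil.
  by apply: (@Lpm_bounded _ _ _ _ _ _ _ _ 0) => // [|x _]; [exact: ltW|rewrite normr0].
by under eq_fun do rewrite big_cons; exact: (LpmD mD p1 (h t) IH).
Qed.

Lemma Lpm_norm (D : set rV) (u : rV -> R) : Lpm mu D p u -> Lpm mu D p (fun x => `|u x|).
Proof.
move=> [m1 f1]; split; first exact: measurableT_comp.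
rewrite (_ : pint _ _ _ _ = pint mu D p u); first exact: f1.
by apply: eq_integral => x _; rewrite normr_id.
Qed.

Lemma Lpm_subset (D E : set rV) (u : rV -> R) : measurable D -> measurable E -> D `<=` E ->
  Lpm mu E p u -> Lpm mu D p u.
Proof.
move=> mD mE DE [m1 f1]; split; first exact: measurable_funS m1.
apply: le_lt_trans f1; apply: ge0_subset_integral => //; exact: measurable_pint.
Qed.

Lemma Lpm_restrict (D : set rV) (u : rV -> R) : measurable D -> Lpm mu D p u ->
  (pint mu setT p (u \_ D) < +oo)%E.
Proof.
move=> mD [_]; rewrite /pint [in X in X -> _]integral_mkcond; apply: le_lt_trans.
rewrite le_eqVlt; apply/orP; left; apply/eqP; apply: eq_integral => x _.
by rewrite /patch; case: ifP => //; rewrite normr0 powR0// gt_eqF.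
Qed.

Lemma powR_integrable (D : set rV) (b : rV -> R) : measurable D -> Lpm mu D p b ->
  mu.-integrable D (EFin \o (fun x => `|b x| `^ p)).
Proof.
move=> mD [mb fb]; apply/integrableP; split; first exact: measurable_pint.
rewrite (eq_integral (fun x => (`|b x| `^ p)%:E)) // => x _.
by rewrite gee0_abs// lee_fin powR_ge0.
Qed.

(** This is why the majorants below contain the summand 1: a product of n entries is then bounded by
    an integrable p-th power, as p >= n. *)
Lemma expr_le_powR (b : R) : 1 <= b -> b ^+ n <= b `^ p.
Proof. by move=> b1; rewrite -powR_mulrn ?(le_trans _ b1)// ler_powR. Qed.

Lemma det_replace_bound j (A : 'M[R]_n) (M b : R) :
  (forall k i, `|A k i| <= if k == j then M else b) ->
  `|\det A| <= n`!%:R * (M * b ^+ n.-1).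
Proof.
move=> h; apply: le_trans (det_bound h) _.
rewrite (bigD1 j)//= eqxx; rewrite (eq_bigr (fun=> b)); last by move=> k /negbTE ->.
by rewrite prodr_const cardC1 card_ord.
Qed.

Lemma det_integrable dG : (forall k i, Lpm mu X p (dG k i)) ->
  mu.-integrable X (EFin \o (fun x => \det (mat dG x))).
Proof.
move=> lG; pose b x := 1 + \sum_(ki : 'I_n * 'I_n) `|dG ki.1 ki.2 x|.
have lb : Lpm mu X p b.
  apply: (LpmD mX p1); last by apply: Lpm_sum_seq => // ki; exact: Lpm_norm.
  by apply: (@Lpm_bounded _ _ _ _ _ _ _ _ 1) => // [|x _]; [exact: ltW|rewrite normr1].
have b1 x : 1 <= b x by rewrite /b lerDl sumr_ge0.
have bG k i x : `|dG k i x| <= b x.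
  rewrite /b (bigD1 (k, i))//= addrCA lerDl addr_ge0// sumr_ge0//.
have := integrableZl mX n`!%:R (powR_integrable mX lb).
apply: le_integrable => //.
  by apply/measurable_EFinP; apply: measurable_det => k i; under eq_fun do rewrite mxE; case: (lG k i).
move=> x _; rewrite /= lee_fin [leRHS]ger0_norm ?mulr_ge0 ?powR_ge0//.
apply: (le_trans (@det_bound _ _ _ (fun=> b x) _)) => [k i|]; first by rewrite mxE.
rewrite prodr_const card_ord ler_wpM2l// ger0_norm ?(le_trans ler01)//.
exact: expr_le_powR.
Qed.

(** All components and derivatives are mollified by one sequence; the smooth identity passes to the
    limit by dominated convergence. *)
Lemma det_identity_weak G dG j eta : (forall k, Lpm mu X p (G k)) ->
  (forall k i, Lpm mu X p (dG k i)) -> (forall k i, is_weak_partial X i (G k) (dG k i)) ->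
  test_function X eta ->
  \int[mu]_(x in X) (\det (mat dG x) * eta x) =
  - \int[mu]_(x in X) (G j x * \det (mat (replace j (fun i => partial i eta) dG) x)).
Proof.
move=> lG ldG wG te; have [K [cK KX] eK] := test_function_support te.
have [e [K' [e0 cK' K'X KK']]] := compact_thicken oX cK KX.
have mK := compact_measurable_rV cK; have mK' := compact_measurable_rV cK'.
have KK'2 x : K x -> K' x by move=> Kx; apply: (KK' x Kx); rewrite /closed_ball_/= subrr normr0 ltW.
have Kfin := compact_lebesgue_fin cK.
have dK i x : ~ K x -> partial i eta x = 0.
  exact: (partial_support i (compact_closed (@norm_hausdorff _ _) cK) eK).
(* Truncation to K' gives integrable functions; on K, where everything is integrated, mollification
   at radius at most e does not see it. *)
pose g (ko : 'I_n * option 'I_n) : rV -> R :=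
  (if ko.2 is Some i then dG ko.1 i else G ko.1) \_ K'.
have Lg ko : mu.-integrable setT (EFin \o g ko).
  case: ko => k [i|]; apply: (locally_integrable_L1 (X := X)) => //=; first by case: (wG k i).
  by case: (wG k (Ordinal n0)).
have pg ko : (pint mu setT p (g ko) < +oo)%E.
  by case: ko => k [i|]; apply: Lpm_restrict => //=; apply: (Lpm_subset mK' mX K'X).
have [rho [mr hS]] := mollifier_sequence p1 e0 Lg pg.
have {hS}/choice[S hS] := hS.
have [M1 M10 hM1] := test_function_bounded te.
have /choice[M2 hM2] i : exists M : R, forall x, `|partial i eta x| <= M.
  by have [M _ hM] := test_function_bounded (test_function_partial i te); exists M.
pose M := M1 + \sum_i `|M2 i|.
have MM1 x : `|eta x| <= M by apply: le_trans (hM1 x) _; rewrite /M lerDl sumr_ge0.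
have MM2 i x : `|partial i eta x| <= M.
  apply: le_trans (hM2 i x) _; apply: le_trans (ler_norm _) _.
  by rewrite /M (bigD1 i)//= addrCA lerDl addr_ge0 ?sumr_ge0// ltW.
have M0 : 0 <= M by apply: le_trans (MM1 0).
pose b x := 1 + \sum_(ko : 'I_n * option 'I_n) (S ko x + `|g ko x|).
have b1 x : 1 <= b x.
  rewrite /b lerDl sumr_ge0// => ko _; rewrite addr_ge0//; by have [_ ->] := hS ko.
have bS ko x : S ko x + `|g ko x| <= b x.
  rewrite /b (bigD1 ko)//= addrCA lerDl addr_ge0// sumr_ge0// => kl _.
  by rewrite addr_ge0//; have [_ ->] := hS kl.
have lb : Lpm mu K p b.
  apply: (LpmD mK p1).
    by apply: (@Lpm_bounded _ _ _ _ _ _ _ _ 1) => // [|x _]; [exact: ltW|rewrite normr1].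
  apply: Lpm_sum_seq => // ko; apply: (LpmD mK p1).
    by apply: (Lpm_subset mK measurableT (@subsetT _ K)); have [? _ ? _] := hS ko.
  apply: Lpm_norm; apply: (Lpm_subset mK measurableT (@subsetT _ K)); split; last exact: pg.
  exact: L1_measurable (Lg ko).
pose D x := n`!%:R * M * `|b x| `^ p.
have iD : mu.-integrable K (EFin \o D).
  exact: (integrableZl mK (n`!%:R * M) (powR_integrable mK lb)).
pose Gm m k := conv (rho m) (G k \_ K').
have tr m := mollifier_testT (mr m).
have sGm m k : smooth (Gm m k) by apply: conv_smooth => //; exact: (Lg (k, None)).
have pGm m k i x : K x -> partial i (Gm m k) x = conv (rho m) (dG k i \_ K') x.
  move=> Kx; exact: (conv_weak_partial oX (mr m) (wG k i) cK' K'X (KK' x Kx)).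
have ae1 : {ae mu, forall x, forall ko, (conv (rho m) (g ko) x @[m --> \oo] --> g ko x) /\
                      forall m, `|conv (rho m) (g ko) x| <= b x}.
  apply: filter_forall => ko; have [_ _ _ h] := hS ko.
  apply: filterS h => x [h1 h2]; split=> // m.
  apply: le_trans (bS ko x); rewrite -[X in `|X|](subrK (g ko x)).
  by apply: le_trans (ler_normD _ _) _; rewrite lerD2r.
have gE k o x : K x -> g (k, o) x = if o is Some i then dG k i x else G k x.
  by move=> Kx; rewrite /g /patch mem_set /=; [case: o|exact: KK'2].
have E1 m : \int[mu]_(x in K) (\det (grad (Gm m) x) * eta x) =
    - \int[mu]_(x in K) (Gm m j x * \det (grad (replace j eta (Gm m)) x)).
  have := det_identity_smooth j (sGm m) (test_function_sub (@subsetT _ X) te).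
  rewrite (Rintegral_support mu (@subsetT _ K)); last by move=> x _ /eK ->; rewrite mulr0.
  move=> ->; congr (- _); apply: Rintegral_support => // x _ nK.
  by rewrite (@det_row0 _ _ _ j) ?mulr0// => i; rewrite mxE /replace eqxx dK.
have mdet (A : rV -> 'M[R]_n) : (forall k i, measurable_fun K (fun x => A x k i)) -> measurable_fun K (fun x => \det (A x)).
  exact: measurable_det.
have meK : measurable_fun K eta by apply: measurable_funS (test_function_measurable te).
have mpK i : measurable_fun K (partial i eta).
  by apply: measurable_funS (test_function_measurable (test_function_partial i te)).
have mGm m k : measurable_fun K (Gm m k).
  by apply: measurable_funS (continuous_measurable_rV (smooth_continuous (sGm m k))).
have mpGm m k i : measurable_fun K (partial i (Gm m k)).
  by apply: measurable_funS (continuous_measurable_rV (smooth_continuous (smooth_partial i (sGm m k)))).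
have mdG k i : measurable_fun K (dG k i) by have [h _] := ldG k i; exact: measurable_funS h.
have mG k : measurable_fun K (G k) by have [h _] := lG k; exact: measurable_funS h.
have bp x : b x ^+ n <= `|b x| `^ p.
  by rewrite ger0_norm ?(le_trans ler01)//; exact: expr_le_powR.
have c1 : \int[mu]_(x in K) (\det (grad (Gm m) x) * eta x) @[m --> \oo] -->
          \int[mu]_(x in K) (\det (mat dG x) * eta x).
  apply: (Rintegral_dominated mK _ _ iD).
  - move=> m; apply: measurable_funM => //; apply: mdet => k i.
    by under eq_fun do rewrite mxE; exact: mpGm.
  - by apply: measurable_funM => //; apply: mdet => k i; under eq_fun do rewrite mxE; exact: mdG.
  - apply: filterS ae1 => x hx Kx; split.
      apply: cvgM; last exact: cvg_cst.
      apply: det_cvg => k i; rewrite mxE -(gE k (Some i) x Kx).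
      under eq_fun do rewrite mxE pGm//.
      by have [h _] := hx (k, Some i).
    move=> m; rewrite normrM; apply: (@le_trans _ _ (n`!%:R * (b x ^+ n) * M)).
      apply: ler_pM => //; apply: (le_trans (@det_bound _ _ _ (fun=> b x) _)).
        by move=> k i; rewrite mxE pGm//; have [_ h] := hx (k, Some i); exact: h.
      by rewrite prodr_const card_ord.
    by rewrite mulrAC /D ler_wpM2l ?mulr_ge0.
have c2 : \int[mu]_(x in K) (Gm m j x * \det (grad (replace j eta (Gm m)) x)) @[m --> \oo] -->
          \int[mu]_(x in K) (G j x * \det (mat (replace j (fun i => partial i eta) dG) x)).
  apply: (Rintegral_dominated mK _ _ iD).
  - move=> m; apply: measurable_funM => //; apply: mdet => k i.
    under eq_fun do rewrite mxE /replace; case: ifP => _; [exact: mpK|exact: mpGm].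
  - apply: measurable_funM => //; apply: mdet => k i.
    under eq_fun do rewrite mxE /replace; case: ifP => _; [exact: mpK|exact: mdG].
  - apply: filterS ae1 => x hx Kx; split.
      apply: cvgM; first by rewrite -(gE j None x Kx); have [h _] := hx (j, None).
      apply: det_cvg => k i; rewrite mxE /replace.
      under eq_fun do rewrite mxE /replace.
      case: ifP => _; first exact: cvg_cst.
      rewrite -(gE k (Some i) x Kx); under eq_fun do rewrite pGm//.
      by have [h _] := hx (k, Some i).
    move=> m; rewrite normrM; apply: (@le_trans _ _ (b x * (n`!%:R * (M * b x ^+ n.-1)))).
      apply: ler_pM => //; first by have [_ h] := hx (j, None); exact: h.
      apply: (@det_replace_bound j) => k i; rewrite mxE /replace; case: ifP => _; first exact: MM2.
      by rewrite pGm//; have [_ h] := hx (k, Some i); exact: h.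
    (* One factor b from G j and n - 1 from the rows other than j make b^n again. *)
    rewrite mulrCA (mulrCA (b x)) -exprS prednK// mulrA /D ler_wpM2l ?mulr_ge0//.
have e1 : \int[mu]_(x in X) (\det (mat dG x) * eta x) = \int[mu]_(x in K) (\det (mat dG x) * eta x).
  by apply: Rintegral_support => // x _ /eK ->; rewrite mulr0.
have e2 : \int[mu]_(x in X) (G j x * \det (mat (replace j (fun i => partial i eta) dG) x)) =
    \int[mu]_(x in K) (G j x * \det (mat (replace j (fun i => partial i eta) dG) x)).
  apply: Rintegral_support => // x _ nK.
  by rewrite (@det_row0 _ _ _ j) ?mulr0// => i; rewrite mxE /replace eqxx dK.
rewrite e1 e2; move: c1; rewrite (funext E1) => c1.
exact: (cvg_unique (@norm_hausdorff _ R^o) c1 (cvgN c2)).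
Qed.

(** Young's inequality with a parameter: [norm_le_powR] for w / b, multiplied by b^p. *)
Lemma young_powR (w b e : R) : 0 < e -> 0 < b ->
  `|w| * b `^ (p - 1) <= e `^ (1 - p) * `|w| `^ p + e * b `^ p.
Proof.
move=> e0 b0; have := norm_le_powR (w / b) p1 e0.
have bp0 : 0 < b `^ p by exact: powR_gt0.
rewrite -(ler_pM2r bp0) => h.
have E1 : `|w / b| * b `^ p = `|w| * b `^ (p - 1).
  rewrite normrM normfV (gtr0_norm b0) -mulrA; congr (_ * _).
  rewrite -[X in X^-1](@powRr1 _ b) ?ltW// -powRN -powRD; first by rewrite addrC.
  by rewrite (gt_eqF b0) implybT.
have E2 : `|w / b| `^ p * b `^ p = `|w| `^ p.
  by rewrite -powRM// ?ltW// normrM normfV (gtr0_norm b0) divfK// gt_eqF.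
rewrite -E1; apply: le_trans h _; rewrite mulrDl addrC lerD2r.
by rewrite -mulrA E2.
Qed.

Lemma pint_sum_bound (I : eqType) (s : seq I) (B : R) : 0 <= B -> exists2 C, 0 <= C &
  forall u : I -> rV -> R, (forall t, measurable_fun X (u t)) -> (forall t, (P (u t) <= B%:E)%E) ->
  (P (fun x => \sum_(t <- s) `|u t x|)%R <= C%:E)%E.
Proof.
move=> B0; elim: s => [|t s [C C0 IH]].
  exists 0 => // u _ _; rewrite /pint (eq_integral (cst 0%E)) ?integral0// => x _.
  by rewrite big_nil normr0 powR0// gt_eqF.
exists (2 `^ p * (B + C)); first by rewrite mulr_ge0 ?powR_ge0// addr_ge0.
move=> u mu_ uB.
have mn r : measurable_fun X (fun x => `|u r x|) by exact: measurableT_comp.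
have ms : measurable_fun X (fun x => \sum_(r <- s) `|u r x|) by exact: measurable_sum_seq.
under eq_fun do rewrite big_cons.
apply: le_trans (pintD mu mX p1 (mn t) ms) _; rewrite EFinM EFinD.
apply: lee_wpmul2l; first by rewrite lee_fin powR_ge0.
apply: leeD; last exact: IH.
apply: le_trans (uB t); rewrite le_eqVlt; apply/orP; left; apply/eqP.
by apply: eq_integral => x _; rewrite normr_id.
Qed.

Definition sobolev_map F dF := [/\ forall k, Lpm mu X p (F k), forall k i, Lpm mu X p (dF k i) &
  forall k i, is_weak_partial X i (F k) (dF k i)].

(** The identity moves the derivative from F j - H j to eta, leaving |F j - H j| times n - 1 bounded
    rows. As n - 1 <= p - 1, Young's inequality splits this into a part small with d and a part
    small with e. *)
Lemma jacobian_step G dG F dF H dH j eta (M C e d : R) : 0 < e ->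
  sobolev_map G dG -> sobolev_map F dF -> sobolev_map H dH -> test_function X eta ->
  (forall i x, `|partial i eta x| <= M) ->
  forall b : rV -> R, measurable_fun X b -> (forall x, 1 <= b x) -> (P b <= C%:E)%E ->
  (forall k i x, `|dG k i x| <= b x) ->
  (P (F j \- H j)%R <= d%:E)%E ->
  `|\int[mu]_(x in X) (\det (mat (replace j (fun i => dF j i \- dH j i) dG) x) * eta x)|
    <= n`!%:R * M * (e `^ (1 - p) * d + e * C).
Proof.
move=> e0 [lG ldG wG] [lF ldF wF] [lH ldH wH] te hM b mb b1 bC dGb FH.
have M0 : 0 <= M by apply: le_trans (hM j 0).
pose U := replace j (F j \- H j) G.
pose dU := replace j (fun i => dF j i \- dH j i) dG.
have lU k : Lpm mu X p (U k) by rewrite /U /replace; case: ifP => _ //; exact: LpmB.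
have ldU k i : Lpm mu X p (dU k i) by rewrite /dU /replace; case: ifP => _ //; exact: LpmB.
have wU k i : is_weak_partial X i (U k) (dU k i).
  by rewrite /U /dU /replace; case: ifP => _ //; exact: is_weak_partialB.
rewrite (det_identity_weak j lU ldU wU te) normrN.
have Uj : U j = F j \- H j by rewrite /U /replace eqxx.
have mw : measurable_fun X (F j \- H j) by have [] := LpmB mX p1 (lF j) (lH j).
pose w := F j \- H j; pose V x := \det (mat (replace j (fun i => partial i eta) dU) x).
have Vb x : `|V x| <= n`!%:R * (M * b x ^+ n.-1).
  apply: (@det_replace_bound j) => k i; rewrite mxE /replace; case: ifP => kj; first exact: hM.
  by rewrite /dU /replace kj.
have pt x : `|w x * V x| <= n`!%:R * M * (e `^ (1 - p) * `|w x| `^ p + e * `|b x| `^ p).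
  have b0 : 0 < b x by exact: lt_le_trans ltr01 (b1 x).
  rewrite normrM; apply: (@le_trans _ _ (`|w x| * (n`!%:R * (M * b x ^+ n.-1)))).
    by rewrite ler_wpM2l.
  rewrite mulrA mulrCA mulrA -[leLHS]mulrA ler_wpM2l ?mulr_ge0//.
  rewrite (gtr0_norm b0); apply: le_trans (young_powR _ e0 b0); rewrite ler_wpM2l//.
  rewrite -powR_mulrn ?(ltW b0)//; apply: ler_powR => //.
  by rewrite -subn1 natrB// lerD2r.
have mV : measurable_fun X V.
  apply: measurable_det => k i; under eq_fun do rewrite mxE /replace.
  case: ifP => _; last by case: (ldU k i).
  by apply: measurable_funS (test_function_measurable (test_function_partial i te)).
have lb : Lpm mu X p b by split=> //; exact: le_lt_trans bC (ltry _).
have lw : Lpm mu X p w by split=> //; exact: le_lt_trans FH (ltry _).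
pose D x := n`!%:R * M * (e `^ (1 - p) * `|w x| `^ p + e * `|b x| `^ p).
have i1 := powR_integrable mX lw; have i2 := powR_integrable mX lb.
have j1 : mu.-integrable X (EFin \o (fun x => e `^ (1 - p) * `|w x| `^ p)) by exact: (integrableZl mX (e `^ (1 - p)) i1).
have j2 : mu.-integrable X (EFin \o (fun x => e * `|b x| `^ p)) by exact: (integrableZl mX e i2).
have j3 : mu.-integrable X (EFin \o (fun x => e `^ (1 - p) * `|w x| `^ p + e * `|b x| `^ p)) by exact: (integrableD mX j1 j2).
have iD : mu.-integrable X (EFin \o D) by exact: (integrableZl mX (n`!%:R * M) j3).
have iV : mu.-integrable X (EFin \o (fun x => w x * V x)).
  apply: (le_integrable mX _ _ iD); first by apply/measurable_EFinP; exact: measurable_funM.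
  by move=> x _; rewrite /= lee_fin; apply: le_trans (pt x) (ler_norm _).
rewrite Uj; apply: le_trans (le_normr_Rintegral mX iV) _.
apply: (@le_trans _ _ (\int[mu]_(x in X) D x)).
  by apply: le_Rintegral => //; exact: (integrable_norm iV).
have fw : \int[mu]_(x in X) `|w x| `^ p <= d.
  by rewrite -lee_fin fineK//; exact: (integrable_fin_num mX i1).
have fb : \int[mu]_(x in X) `|b x| `^ p <= C.
  by rewrite -lee_fin fineK//; exact: (integrable_fin_num mX i2).
rewrite /D RintegralZl// ler_wpM2l ?mulr_ge0// RintegralD// !RintegralZl//.
by apply: lerD; apply: ler_wpM2l; rewrite ?powR_ge0 ?(ltW e0).
Qed.

Lemma telescope_bound (a : nat -> R) N kappa :
  (forall r, (r < N)%N -> `|a r.+1 - a r| <= kappa) -> `|a N - a 0%N| <= N%:R * kappa.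
Proof.
elim: N => [|N IH] h; first by rewrite subrr normr0 mul0r.
apply: le_trans (ler_distD (a N) _ _) _; rewrite -nat1r mulrDl mul1r lerD ?h//.
by apply: IH => r rN; apply: h; exact: ltnW.
Qed.

(** Closeness of the maps in L^p is enough when the gradients are bounded: the rows of dH are
    exchanged for those of dF one at a time, each exchange costing one [jacobian_step]. *)
Lemma jacobian_weak_continuity eta (B delta : R) : test_function X eta -> 0 <= B -> 0 < delta ->
  exists2 d, 0 < d & forall F dF H dH, sobolev_map F dF -> sobolev_map H dH ->
    (forall k i, (P (dF k i) <= B%:E)%E) -> (forall k i, (P (dH k i) <= B%:E)%E) ->
    (forall k, (P (F k \- H k)%R <= d%:E)%E) ->
    `|\int[mu]_(x in X) (\det (mat dF x) * eta x) -
      \int[mu]_(x in X) (\det (mat dH x) * eta x)| <= delta.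
Proof.
move=> te B0 delta0.
have /choice[M2 hM2] i : exists M : R, forall x, `|partial i eta x| <= M.
  by have [M _ hM] := test_function_bounded (test_function_partial i te); exists M.
pose M := \sum_i `|M2 i|.
have hM i x : `|partial i eta x| <= M.
  apply: le_trans (hM2 i x) _; apply: le_trans (ler_norm _) _.
  by rewrite /M (bigD1 i)//= lerDl sumr_ge0.
have M0 : 0 <= M by apply: sumr_ge0.
have [C C0 hC] := @pint_sum_bound (bool * ('I_n * 'I_n))%type (index_enum _) B B0.
pose m := fine (mu X); have m0 : 0 <= m by exact: fine_ge0.
pose C' := 2 `^ p * (m + C).
have C'0 : 0 <= C' by rewrite mulr_ge0 ?powR_ge0// addr_ge0.
pose c := n%:R * (n`!%:R * M) + 1.
have c0 : 0 < c by rewrite ltr_wpDl// !mulr_ge0.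
(* First e makes e C' at most delta / (2 c); then d is chosen with e^(1-p) d = delta / (2 c). The
   constant c exceeds the cost n n! M of the n exchanges. *)
pose e := delta / (2 * c * (C' + 1)).
have e0 : 0 < e by rewrite divr_gt0// mulr_gt0 ?mulr_gt0// ltr_wpDl.
have k0 : 0 < e `^ (1 - p) by exact: powR_gt0.
exists (delta / (2 * c * e `^ (1 - p))); first by rewrite divr_gt0// !mulr_gt0.
set d := _ / _ => F dF H dH sF sH FB HB FH.
have [lF ldF wF] := sF; have [lH ldH wH] := sH.
pose g (bki : bool * ('I_n * 'I_n)) := if bki.1 then dF bki.2.1 bki.2.2 else dH bki.2.1 bki.2.2.
pose b x := 1 + \sum_bki `|g bki x|.
have mg t : measurable_fun X (g t).
  by case: t => [[] [k i]]; rewrite /g /=; [have [] := ldF k i|have [] := ldH k i].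
have gB t : (P (g t) <= B%:E)%E by case: t => [[] [k i]]; rewrite /g /=.
have b1 x : 1 <= b x by rewrite /b lerDl sumr_ge0.
have mgs : measurable_fun X (fun x => \sum_bki `|g bki x|).
  by apply: measurable_sum_seq => t; exact: measurableT_comp.
have mb : measurable_fun X b by exact: measurable_funD.
have bg t x : `|g t x| <= b x by rewrite /b (bigD1 t)//= addrCA lerDl addr_ge0// sumr_ge0.
have bC : (P b <= C'%:E)%E.
  have hb := pintD mu mX p1 (measurable_cst (1 : R)) mgs.
  apply: le_trans hb _; rewrite /C' EFinM EFinD.
  apply: lee_wpmul2l; first by rewrite lee_fin powR_ge0.
  apply: leeD; last exact: hC.
  rewrite /pint (eq_integral (cst 1%E)); last by move=> x _; rewrite normr1 powR1.
  by rewrite integral_cst// mul1e fineK// ge0_fin_numE.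
(* The first r components come from F, so that consecutive maps differ in component r only. *)
pose T (r : nat) k := if (k < r)%N then F k else H k.
pose dT (r : nat) k := if (k < r)%N then dF k else dH k.
have sT r : sobolev_map (T r) (dT r).
  by split=> [k|k i|k i]; rewrite /T /dT; case: ifP.
pose I r := \int[mu]_(x in X) (\det (mat (dT r) x) * eta x).
have [M1 M10 hM1] := test_function_bounded te.
have me : measurable_fun X eta by apply: measurable_funS (test_function_measurable te).
have iI dG : (forall k i, Lpm mu X p (dG k i)) -> mu.-integrable X (EFin \o (fun x => \det (mat dG x) * eta x)).
  move=> lG; have i1 := det_integrable lG.
  apply: (integrableMl mX i1 me); exists M1; split; first exact: num_real.
  by move=> r Mr x _; apply: le_trans (hM1 x) (ltW Mr).
pose kappa := n`!%:R * M * (e `^ (1 - p) * d + e * C').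
have step r : (r < n)%N -> `|I r.+1 - I r| <= kappa.
  move=> rn; pose j := Ordinal rn.
  have [lT ldT wT] := sT r; have [lT1 ldT1 wT1] := sT r.+1.
  have nl (k : 'I_n.-1) : (lift j k == j) = false by rewrite eq_sym (negbTE (neq_lift _ _)).
  have nlr (k : 'I_n.-1) : (lift j k < r.+1)%N = (lift j k < r)%N.
    by rewrite ltnS leq_eqVlt -[X in X || _]/(lift j k == j) nl.
  have -> : I r.+1 - I r = \int[mu]_(x in X) (\det (mat (replace j (fun i => dF j i \- dH j i) (dT r)) x) * eta x).
    rewrite /I -RintegralB//; try exact: iI.
    apply: eq_Rintegral => x _; rewrite -mulrBl; congr (_ * _).
    suff ml : \det (mat (dT r.+1) x) = 1 * \det (mat (dT r) x) +
        1 * \det (mat (replace j (fun i => dF j i \- dH j i) (dT r)) x).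
      by rewrite ml !mul1r addrAC subrr add0r.
    apply: (@determinant_multilinear _ _ _ _ _ j).
    - apply/rowP => i; rewrite !mxE /replace /dT /= eqxx ltnn ltnSn !mul1r.
      by rewrite addrC subrK.
    - by apply/matrixP => k i; rewrite !mxE /dT nlr.
    - by apply/matrixP => k i; rewrite !mxE /dT /replace nl nlr.
  apply: (jacobian_step e0 (sT r) sF sH te hM mb b1 bC) => //.
  by move=> k i x; rewrite /dT; case: ifP => _; [exact: (bg (true, (k, i)))|exact: (bg (false, (k, i)))].
have tel := telescope_bound step.
have IF : I n = \int[mu]_(x in X) (\det (mat dF x) * eta x).
  by apply: eq_Rintegral => x _; congr (\det _ * _); apply/matrixP => k i; rewrite !mxE /dT ltn_ord.
have IH : I 0%N = \int[mu]_(x in X) (\det (mat dH x) * eta x).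
  by apply: eq_Rintegral => x _; congr (\det _ * _); apply/matrixP => k i; rewrite !mxE /dT ltn0.
rewrite -IF -IH; apply: le_trans tel _.
have ed : e `^ (1 - p) * d = delta / (2 * c) by rewrite /d; field; rewrite !gt_eqF.
have eC : e * C' <= delta / (2 * c).
  have -> : delta / (2 * c) = e * (C' + 1) by rewrite /e; field; rewrite !gt_eqF// ltr_wpDl.
  by rewrite ler_wpM2l ?(ltW e0)// lerDl.
rewrite /kappa ed mulrA.
apply: (@le_trans _ _ (c * (delta / (2 * c) + delta / (2 * c)))).
  have q0 : 0 < delta / (2 * c) by rewrite divr_gt0// mulr_gt0.
  have s0 : 0 <= e * C' by rewrite mulr_ge0// ltW.
  have a0 : 0 <= n%:R * (n`!%:R * M) by rewrite !mulr_ge0.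
  by apply: (ler_pM a0 (addr_ge0 (ltW q0) s0)); [rewrite /c lerDl|rewrite lerD2l].
rewrite le_eqVlt; apply/orP; left; apply/eqP; field; by rewrite gt_eqF.
Qed.

End jacobians.

(** * The operator norm: convexity, continuity, measurability *)

Section operator_norm.
Context {R : realType}.

Lemma euclidean_norm_ge0 n (v : 'cV[R]_n) : 0 <= euclidean_norm v.
Proof. exact: sqrtr_ge0. Qed.

Lemma euclidean_norm_sqr n (v : 'cV[R]_n) : euclidean_norm v ^+ 2 = \sum_i v i 0 ^+ 2.
Proof. by rewrite sqr_sqrtr// sumr_ge0// => i _; exact: sqr_ge0. Qed.

Lemma euclidean_norm_coord n (v : 'cV[R]_n) i : `|v i 0| <= euclidean_norm v.
Proof.
rewrite -(@ler_pXn2r _ 2) ?nnegrE ?euclidean_norm_ge0// euclidean_norm_sqr real_normK ?num_real//.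
by rewrite (bigD1 i)//= lerDl sumr_ge0// => j _; exact: sqr_ge0.
Qed.

Lemma euclidean_norm_le_sum n (v : 'cV[R]_n) : euclidean_norm v <= \sum_i `|v i 0|.
Proof.
have s0 : 0 <= \sum_i `|v i 0| by exact: sumr_ge0.
rewrite -(@ler_pXn2r _ 2) ?nnegrE ?euclidean_norm_ge0// euclidean_norm_sqr.
rewrite expr2 mulr_suml; apply: ler_sum => i _.
rewrite -[_ ^+ 2]real_normK ?num_real// expr2 ler_wpM2l//.
by rewrite (bigD1 i)//= lerDl sumr_ge0.
Qed.

Lemma euclidean_normZ n (c : R) (v : 'cV[R]_n) : euclidean_norm (c *: v) = `|c| * euclidean_norm v.
Proof.
apply/eqP; rewrite -(@eqrXn2 _ 2) ?mulr_ge0 ?euclidean_norm_ge0// exprMn !euclidean_norm_sqr.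
rewrite real_normK ?num_real// mulr_sumr; apply/eqP; apply: eq_bigr => i _.
by rewrite mxE exprMn.
Qed.

(** In place of Cauchy-Schwarz, each square is bounded by (s + t)^2 <= (1 + b/a) s^2 + (1 + a/b)
    t^2; with a and b the two norms, the sum is (a + b)^2. *)
Lemma euclidean_normD n (u v : 'cV[R]_n) :
  euclidean_norm (u + v) <= euclidean_norm u + euclidean_norm v.
Proof.
set a := euclidean_norm u; set b := euclidean_norm v.
have a0 : 0 <= a by exact: euclidean_norm_ge0.
have b0 : 0 <= b by exact: euclidean_norm_ge0.
have z n' (w : 'cV[R]_n') : euclidean_norm w = 0 -> w = 0.
  move=> w0; apply/colP => i; rewrite mxE; apply/eqP; rewrite -normr_le0 -w0.
  exact: euclidean_norm_coord.
have [a00|a1] := eqVneq a 0; first by rewrite (z _ u a00) add0r lerDr.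
have [b00|b1] := eqVneq b 0; first by rewrite (z _ v b00) addr0 lerDl.
have {a1}a1 : 0 < a by rewrite lt_neqAle eq_sym a1.
have {b1}b1 : 0 < b by rewrite lt_neqAle eq_sym b1.
rewrite -(@ler_pXn2r _ 2) ?nnegrE ?euclidean_norm_ge0 ?addr_ge0// euclidean_norm_sqr.
have ab : 0 < a / b by rewrite divr_gt0.
have ba : 0 < b / a by rewrite divr_gt0.
apply: (@le_trans _ _ (\sum_i ((1 + b / a) * u i 0 ^+ 2 + (1 + a / b) * v i 0 ^+ 2))).
  apply: ler_sum => i _; rewrite mxE; move: (u i 0) (v i 0) => s t.
  have h : 0 <= (b * s - a * t) ^+ 2 / (a * b) by rewrite divr_ge0 ?sqr_ge0// mulr_ge0.
  rewrite -subr_ge0 (_ : _ - _ = (b * s - a * t) ^+ 2 / (a * b))//.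
  by field; rewrite !gt_eqF.
rewrite big_split/= -!mulr_sumr -!euclidean_norm_sqr -/a -/b le_eqVlt; apply/orP; left; apply/eqP.
by field; rewrite !gt_eqF.
Qed.

Section bounds.
Variables (m n : nat).
Implicit Types A B : 'M[R]_(m, n).

Lemma mulmx_norm_le A (v : 'cV[R]_n) : euclidean_norm v <= 1 ->
  euclidean_norm (A *m v) <= \sum_i \sum_j `|A i j|.
Proof.
move=> v1; apply: le_trans (euclidean_norm_le_sum _) _; apply: ler_sum => i _.
rewrite mxE; apply: le_trans (ler_norm_sum _ _ _) _; apply: ler_sum => j _.
by rewrite normrM ler_piMr// (le_trans (euclidean_norm_coord v j)).
Qed.

Lemma operator_norm_has_sup A :
  has_sup [set euclidean_norm (A *m v) | v in [set v | euclidean_norm v <= 1]].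
Proof.
split; last by exists (\sum_i \sum_j `|A i j|) => _ [v v1 <-]; exact: mulmx_norm_le.
exists (euclidean_norm (A *m 0)), 0 => //=.
by rewrite /euclidean_norm big1 ?sqrtr0// => i _; rewrite mxE expr0n.
Qed.

Lemma operator_norm_ub A v : euclidean_norm v <= 1 -> euclidean_norm (A *m v) <= operator_norm A.
Proof. by move=> v1; apply: sup_upper_bound; [exact: operator_norm_has_sup|exists v]. Qed.

Lemma operator_norm_lub A M : (forall v, euclidean_norm v <= 1 -> euclidean_norm (A *m v) <= M) ->
  operator_norm A <= M.
Proof.
move=> h; apply: sup_le_ub; first by have [] := operator_norm_has_sup A.
by move=> _ [v v1 <-]; exact: h.
Qed.

Lemma operator_norm_ge0 A : 0 <= operator_norm A.
Proof.
have := @operator_norm_ub A 0; rewrite /euclidean_norm big1; last by move=> i _; rewrite mxE expr0n.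
by rewrite sqrtr0 => /(_ ler01); apply: le_trans; exact: sqrtr_ge0.
Qed.

Lemma operator_norm_le_sum A : operator_norm A <= \sum_i \sum_j `|A i j|.
Proof. by apply: operator_norm_lub => v; exact: mulmx_norm_le. Qed.

Lemma operator_normD A B : operator_norm (A + B) <= operator_norm A + operator_norm B.
Proof.
apply: operator_norm_lub => v v1; rewrite mulmxDl.
by apply: le_trans (euclidean_normD _ _) _; rewrite lerD// operator_norm_ub.
Qed.

Lemma operator_norm_half A B :
  operator_norm (2^-1 *: (A + B)) <= (operator_norm A + operator_norm B) / 2.
Proof.
apply: operator_norm_lub => v v1; rewrite -scalemxAl euclidean_normZ ger0_norm// mulrC.
rewrite ler_wpM2r//; apply: le_trans (operator_norm_ub _ v1) _; exact: operator_normD.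
Qed.

Lemma operator_norm_entry A i j : `|A i j| <= operator_norm A.
Proof.
have v1 : euclidean_norm (delta_mx j 0 : 'cV[R]_n) <= 1.
  rewrite -(@ler_pXn2r _ 2) ?nnegrE ?euclidean_norm_ge0// euclidean_norm_sqr (bigD1 j)//=.
  rewrite mxE !eqxx expr1n big1 ?addr0// => k kj; by rewrite mxE (negbTE kj) expr0n.
apply: le_trans (operator_norm_ub A v1); rewrite -colE.
by apply: le_trans (euclidean_norm_coord _ i); rewrite mxE.
Qed.

Lemma operator_norm_dist A B : `|operator_norm A - operator_norm B| <= \sum_i \sum_j `|A i j - B i j|.
Proof.
have H (C D : 'M[R]_(m, n)) : operator_norm C - operator_norm D <= \sum_i \sum_j `|C i j - D i j|.
  rewrite lerBlDr; have e : C = (C - D) + D by rewrite subrK.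
  rewrite {1}e; apply: le_trans (operator_normD _ _) _; rewrite lerD2r.
  apply: le_trans (operator_norm_le_sum _) _.
  by apply: ler_sum => i _; apply: ler_sum => j _; rewrite !mxE.
rewrite ler_norml H andbT lerNl opprB; apply: le_trans (H _ _) _.
by apply: ler_sum => i _; apply: ler_sum => j _; rewrite distrC.
Qed.

Lemma operator_norm_cvg (A : nat -> 'M[R]_(m, n)) B :
  (forall i j, A k i j @[k --> \oo] --> B i j) ->
  operator_norm (A k) @[k --> \oo] --> operator_norm B.
Proof.
move=> h; apply/cvgrPdist_le => e e0.
have c : \sum_i \sum_j `|B i j - A k i j| @[k --> \oo] --> \sum_(i < m) \sum_(j < n) (0 : R).
  apply: cvg_sum_seq => i; apply: cvg_sum_seq => j.
  rewrite -[X in _ --> X](@normr0 _ R) -(subrr (B i j)); apply: cvg_norm.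
  by apply: cvgB => //; exact: cvg_cst.
move: c; rewrite big1; last by move=> i _; rewrite big1.
move=> /cvgrPdist_le/(_ _ e0); apply: filterS => k; rewrite sub0r normrN; apply: le_trans.
by apply: le_trans (operator_norm_dist _ _) (ler_norm _).
Qed.

(** The norm is an uncountable supremum; its measurability comes from being Lipschitz, hence
    continuous, in the m n entries read as a row vector. *)
Lemma measurable_operator_norm d (T : measurableType d) (D : set T) (A : T -> 'M[R]_(m, n)) :
  measurable D -> (forall i j, measurable_fun D (fun x => A x i j)) ->
  measurable_fun D (fun x => operator_norm (A x)).
Proof.
move=> mD mA; pose f (v : 'rV[R]_(m * n)) := operator_norm (vec_mx v : 'M[R]_(m, n)).
have cf : continuous f.
  apply: (@lipschitz_continuous_rV _ _ _ (m%:R * n%:R)) => v w.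
  apply: le_trans (operator_norm_dist _ _) _.
  apply: (@le_trans _ _ (\sum_(i < m) \sum_(j < n) `|v - w|)).
    apply: ler_sum => i _; apply: ler_sum => j _; rewrite !mxE.
    by apply: le_trans (rV_coord_norm (v - w) (mxvec_index i j)); rewrite !mxE.
  move: (`|v - w|) => t.
  have -> : \sum_(i < m) \sum_(j < n) t = m%:R * (n%:R * t) by rewrite !sumr_const !card_ord !mulr_natl.
  by rewrite mulrA.
pose B x : 'rV[R]_(m * n) := mxvec (\matrix_(i, j) ((fun x => A x i j) \_ D) x).
have mB : measurable_fun setT B.
  apply: measurable_fun_coordP => k; case: (mxvec_indexP k) => i j.
  have mAD : measurable_fun setT ((fun x => A x i j) \_ D) by exact/(measurable_restrictT _ mD).
  by apply: eq_measurable_fun mAD => x _; rewrite /B mxvecE mxE.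
have mfB : measurable_fun D (f \o B).
  apply: (measurable_funS measurableT) => //.
  exact: (measurableT_comp (continuous_measurable_rV cf) mB).
apply: eq_measurable_fun mfB => x xD; rewrite /f /B /= mxvecK; congr operator_norm.
by apply/matrixP => i j; rewrite mxE /patch xD.
Qed.

End bounds.
End operator_norm.

Section scalar.
Context {R : realType}.
Implicit Types a b alpha : R.

(** The inequality of arithmetic and geometric means twice: for a and b, and for their powers of
    exponent -alpha/2. *)
Lemma powRN_half a b alpha : 0 < a -> 0 < b -> 0 <= alpha ->
  ((a + b) / 2) `^ (- alpha) <= (a `^ (- alpha) + b `^ (- alpha)) / 2.
Proof.
move=> a0 b0 al; pose g := - alpha / 2.
have E c : 0 <= c -> c `^ (- alpha) = (c ^+ 2) `^ g.
  by move=> c0; rewrite -powR_mulrn// -powRrM; congr (_ `^ _); rewrite /g mulrC divfK.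
have ab : 0 < (a + b) / 2 by rewrite divr_gt0// addr_gt0.
apply: (@le_trans _ _ (a `^ g * b `^ g)).
  rewrite E ?(ltW ab)// -powRM ?(ltW a0) ?(ltW b0)//.
  have ab2 : a * b <= ((a + b) / 2) ^+ 2.
    by rewrite -subr_ge0 (_ : _ - _ = ((a - b) / 2) ^+ 2) ?sqr_ge0//; field.
  have p1 : 0 < a * b by exact: mulr_gt0.
  have p2 : 0 < ((a + b) / 2) ^+ 2 by exact: exprn_gt0.
  rewrite /g mulNr !powRN lef_pV2 ?posrE ?powR_gt0//.
  by apply: ge0_ler_powR; rewrite ?nnegrE ?(ltW p1) ?(ltW p2)// divr_ge0.
have E2 c : 0 < c -> c `^ (- alpha) = (c `^ g) ^+ 2.
  by move=> c0; rewrite -powR_mulrn ?powR_ge0// -powRrM; congr (_ `^ _); rewrite /g divfK.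
rewrite !E2// -subr_ge0 (_ : _ - _ = (a `^ g - b `^ g) ^+ 2 / 2); last by field.
by rewrite divr_ge0// sqr_ge0.
Qed.

Lemma cvg_powR (u : nat -> R) a s : 0 < a -> u k @[k --> \oo] --> a ->
  u k `^ s @[k --> \oo] --> a `^ s.
Proof.
move=> a0 ua; rewrite {2}/powR gt_eqF//.
have h : expR (s * ln (u k)) @[k --> \oo] --> expR (s * ln a).
  apply: (@cvg_comp _ _ _ (fun k => s * ln (u k)) expR _ _ _ _ (@continuous_expR R _)).
  apply: cvgM; first exact: cvg_cst.
  exact: (@cvg_comp _ _ _ u (@ln R) _ _ _ ua (continuous_ln a0)).
apply: cvg_trans h; apply: near_eq_cvg.
have h0 : \forall k \near \oo, 0 < u k by exact: (cvgr_gt a ua 0 a0).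
apply: (@filterS _ \oo _ _ _ _ h0) => k uk.
by rewrite /powR gt_eqF.
Qed.

Lemma cvg_powR_ge0 (u : nat -> R) a s : 0 < s -> 0 <= a -> (forall k, 0 <= u k) ->
  u k @[k --> \oo] --> a -> u k `^ s @[k --> \oo] --> a `^ s.
Proof.
move=> s0; rewrite le_eqVlt => /orP[/eqP <- u0 ua|a0 _]; last exact: cvg_powR.
rewrite powR0 ?gt_eqF//; apply/cvgrPdist_lt => e e0.
have e1 : 0 < e `^ s^-1 by exact: powR_gt0.
move/cvgrPdist_lt : ua => /(_ _ e1); apply: filterS => k.
rewrite !sub0r !normrN !ger0_norm ?powR_ge0// => h.
have -> : e = (e `^ s^-1) `^ s by rewrite -powRrM mulVf ?gt_eqF// powRr1// ltW.
by rewrite gt0_ltr_powR ?nnegrE ?powR_ge0.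
Qed.

Context d (T : measurableType d) (mu : {measure set T -> \bar R}).

(** The exceptional null set is removed from D first, so that the lower limit is the given f at
    every remaining point. *)
Lemma fatou_ae (D : set T) (f_ : nat -> T -> \bar R) (f : T -> \bar R) (c : \bar R) : measurable D ->
  (forall k, measurable_fun D (f_ k)) -> (forall k x, D x -> (0 <= f_ k x)%E) ->
  measurable_fun D f -> (forall x, D x -> (0 <= f x)%E) ->
  {ae mu, forall x, D x -> f_ k x @[k --> \oo] --> f x} ->
  (forall k, (\int[mu]_(x in D) f_ k x <= c)%E) -> (\int[mu]_(x in D) f x <= c)%E.
Proof.
move=> mD mf_ f0_ mf f0 ff fc.
have [N [mN N0 hN]] := ff.
have mDN : measurable (D `\` N) by exact: measurableD.
have DN : D `\` N `<=` D by move=> x [].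
rewrite (ge0_negligible_integral mN mD mf f0 N0).
have -> : (\int[mu]_(x in D `\` N) f x = \int[mu]_(x in D `\` N) limn_einf (f_ ^~ x))%E.
  apply: eq_integral => x /set_mem[Dx Nx]; have : D x -> f_ k x @[k --> \oo] --> f x.
    by apply: contrapT => h; apply: Nx; exact: hN.
  by move=> /(_ Dx)/cvg_limn_einf_sup [-> _].
apply: le_trans (fatou _ mDN (fun k => measurable_funS mD DN (mf_ k)) (fun k x h => f0_ k x (DN x h))) _.
rewrite limn_einf_lim; apply: lime_le; first exact: is_cvg_einfs.
apply: nearW => k; apply: (@le_trans _ _ (\int[mu]_(x in D `\` N) f_ k x)%E).
  by apply: ereal_inf_lbound; exists k => //=.
apply: le_trans (fc k); apply: ge0_subset_integral => // x; exact: f0_.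
Qed.

End scalar.

(** * Minimisers in dimension at least two *)

Section minimisation.
Context {R : realType} {n : nat}.
Local Notation rV := 'rV[R]_n.
Local Notation mu := (@lebesgue_rV R n).
Variables (X : set rV) (r p alpha : R) (phi : rV -> rV).
Hypotheses (oX : open X) (r0 : 0 < r) (Xr : forall x, X x -> `|x| <= r).
Hypotheses (n0 : (0 < n)%N) (np : n%:R <= p) (al0 : 0 < alpha).
Implicit Types (f g : rV -> rV) (t : 'I_n * option 'I_n).

Let mX : measurable X := open_measurable_rV oX.
Let Xfin : (mu X < +oo)%E. Proof. exact: bounded_lebesgue_fin mX Xr. Qed.
Let p1 : 1 <= p. Proof. by apply: le_trans np; rewrite ler1n. Qed.
Let p0 : 0 < p. Proof. exact: lt_le_trans p1. Qed.
Local Notation P u := (pint mu X p u).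
Local Notation A := (admissible p X phi).
Local Notation E := (energy alpha p X).

Definition jets f t : rV -> R := weak_jet X (component f t.1) t.2.

Lemma halfE (u v : rV -> R) : (fun x => (u x + v x) / 2) = (fun x => 2^-1 * (u \+ v) x).
Proof. by apply/funext => x; rewrite mulrC. Qed.

Lemma W0_ae (w w' : option 'I_n -> rV -> R) : W0 X p w -> (forall o, measurable_fun X (w' o)) ->
  (forall o, {ae mu, forall x, X x -> w o x = w' o x}) -> W0 X p w'.
Proof.
move=> [lw hw] mw' ww'; split=> [ o|e e0].
  split=> //; have [m1 f1] := lw o.
  by rewrite -(pint_ae mX p m1 (mw' o) (ww' o)).
have [eta [te h]] := hw e e0; exists eta; split; [exact: te|move=> o].
have [m1 _] := lw o; have mj : measurable_fun X (jet eta o).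
  by have [] := jet_Lpm oX Xfin p1 o te.
rewrite -(pint_ae mX p (measurable_funB m1 mj) (measurable_funB (mw' o) mj)); first exact: h.
by apply: filterS (ww' o) => x h1 Xx /=; rewrite h1.
Qed.

Section admissible_facts.
Variables (f : rV -> rV).
Hypothesis Af : A f.

Lemma jets_Lpm t : Lpm mu X p (jets f t).
Proof. by have [hW _ _] := Af; have [h _] := W1p_Lpm oX p1 (hW t.1); exact: h. Qed.

Lemma jets_weak j i : is_weak_partial X i (jets f (j, None)) (jets f (j, Some i)).
Proof. by have [hW _ _] := Af; have [_ h] := W1p_Lpm oX p1 (hW j); exact: h. Qed.

Lemma jets_sobolev_map : sobolev_map X p (fun j => jets f (j, None)) (fun j i => jets f (j, Some i)).
Proof. by split=> [k|k i|k i]; [exact: jets_Lpm|exact: jets_Lpm|exact: jets_weak]. Qed.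

Lemma jacobian_measurable : measurable_fun X (jacobian_det X f).
Proof.
apply: measurable_det => k i; under eq_fun do rewrite mxE.
by have [] := jets_Lpm (k, Some i).
Qed.

Lemma weak_diff_norm_measurable : measurable_fun X (fun x => operator_norm (weak_diff X f x) `^ p).
Proof.
apply: (measurableT_comp (measurable_powR p)).
apply: (measurable_operator_norm mX) => k i; under eq_fun do rewrite mxE.
by have [] := jets_Lpm (k, Some i).
Qed.

Lemma jets_energy (c : R) j i : (E f <= c%:E)%E -> (P (jets f (j, Some i)) <= c%:E)%E.
Proof.
apply: le_trans; apply: ge0_le_integral => //.
- by apply: measurable_pint; have [] := jets_Lpm (j, Some i).
- apply/measurable_EFinP; apply: measurable_funD; first exact: weak_diff_norm_measurable.
  under eq_fun do rewrite -powRN.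
  exact: (measurableT_comp (measurable_powR (- alpha)) jacobian_measurable).
- move=> x _; rewrite lee_fin; apply: (@le_trans _ _ (operator_norm (weak_diff X f x) `^ p)).
    rewrite ge0_ler_powR ?nnegrE ?operator_norm_ge0 ?(ltW p0)//.
    by have := operator_norm_entry (weak_diff X f x) j i; rewrite mxE.
  by rewrite lerDl invr_ge0 powR_ge0.
Qed.

End admissible_facts.

(** The boundary map cancels in (f - phi) - (g - phi). The chosen derivatives of these differences
    agree with the differences of the jets only almost everywhere, which [W0_ae] absorbs. *)
Lemma jets_diff_W0 f g j : A f -> A g -> W0 X p (fun o => jets f (j, o) \- jets g (j, o)).
Proof.
move=> Af Ag; have [_ _ hf] := Af; have [_ _ hg] := Ag.
have w := W0B oX Xfin p1 (W1p0_W0 oX Xfin p1 (hf j)) (W1p0_W0 oX Xfin p1 (hg j)).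
apply: (W0_ae w).
  by move=> o; have [h1 _] := jets_Lpm Af (j, o); have [h2 _] := jets_Lpm Ag (j, o); exact: measurable_funB.
move=> [i|]; last by apply: aeW => x _; rewrite /jets /= /component /= !mxE; ring.
have w1 := W0_weak_partial oX Xfin p1 i w.
have w2 := is_weak_partialB oX (jets_weak Af j i) (jets_weak Ag j i).
rewrite (_ : weak_jet X (component (f \- phi) j) None \- weak_jet X (component (g \- phi) j) None =
    jets f (j, None) \- jets g (j, None)) in w1; last first.
  by apply/funext => x; rewrite /jets /= /component /= !mxE; ring.
by have := is_weak_partial_unique oX w1 w2; apply: filterS => x h /h.
Qed.

(* A state lists the Jacobian at [None] and the jets of the components at [Some];
   the Jacobian is averaged along with the map, not recomputed from it. *)
Definition state_grad (h : option ('I_n * option 'I_n) * rV -> R) x : 'M[R]_n :=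
  \matrix_(j, i) h (Some (j, Some i), x).

(* The shift by 1/(N+1) keeps the density finite and continuous at J = 0, where
   the density of [energy] takes the junk value [0^-1 = 0]. *)
Definition relaxed_density N (M : 'M[R]_n) (J : R) : R :=
  operator_norm M `^ p + (J + N.+1%:R^-1) `^ (- alpha).

Definition relaxed_energy N (h : option ('I_n * option 'I_n) * rV -> R) : \bar R :=
  (\int[mu]_(x in X) (relaxed_density N (state_grad h x) (h (None, x)))%:E)%E.

Definition good_state (h : option ('I_n * option 'I_n) * rV -> R) :=
  (forall o, measurable_fun X (fun x => h (o, x))) /\ forall x, 0 <= h (None, x).

Lemma relaxed_density_ge0 N M J : 0 <= relaxed_density N M J.
Proof. by rewrite addr_ge0 ?powR_ge0. Qed.

Lemma measurable_relaxed_density N (M : rV -> 'M[R]_n) (J : rV -> R) :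
  (forall i j, measurable_fun X (fun x => M x i j)) -> measurable_fun X J ->
  measurable_fun X (fun x => relaxed_density N (M x) (J x)).
Proof.
move=> mM mJ; apply: measurable_funD.
  apply: (measurableT_comp (measurable_powR p)); exact: (measurable_operator_norm mX).
by apply: (measurableT_comp (measurable_powR (- alpha))); exact: measurable_funD.
Qed.

Lemma relaxed_density_half N M M' J J' : 0 <= J -> 0 <= J' ->
  relaxed_density N (2^-1 *: (M + M')) ((J + J') / 2) <=
  (relaxed_density N M J + relaxed_density N M' J') / 2.
Proof.
move=> J0 J0'; rewrite /relaxed_density addrACA [leRHS]mulrDl lerD//.
  apply: (@le_trans _ _ (((operator_norm M + operator_norm M') / 2) `^ p)).
    rewrite ge0_ler_powR ?nnegrE ?operator_norm_ge0 ?(ltW p0) ?divr_ge0 ?addr_ge0 ?operator_norm_ge0//.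
    exact: operator_norm_half.
  by apply: powR_half; rewrite ?operator_norm_ge0.
have e0 : 0 < N.+1%:R^-1 :> R by rewrite invr_gt0.
have -> : (J + J') / 2 + N.+1%:R^-1 = ((J + N.+1%:R^-1) + (J' + N.+1%:R^-1)) / 2 by field.
by apply: powRN_half; rewrite ?(ltW al0)// ltr_wpDl.
Qed.

Lemma relaxed_energy_half N v w c : good_state v -> good_state w ->
  (relaxed_energy N v <= c)%E -> (relaxed_energy N w <= c)%E ->
  (relaxed_energy N (fun y => (v y + w y) / 2)%R <= c)%E.
Proof.
move=> [mv v0] [mw w0] vc wc.
pose a x := relaxed_density N (state_grad v x) (v (None, x)).
pose b x := relaxed_density N (state_grad w x) (w (None, x)).
have ma : measurable_fun X a.
  by apply: measurable_relaxed_density => // i j; under eq_fun do rewrite mxE; exact: mv.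
have mb : measurable_fun X b.
  by apply: measurable_relaxed_density => // i j; under eq_fun do rewrite mxE; exact: mw.
have a0 x : X x -> (0 <= (2^-1)%:E * (a x)%:E)%E by move=> _; rewrite -EFinM lee_fin mulr_ge0 ?relaxed_density_ge0.
have b0 x : X x -> (0 <= (2^-1)%:E * (b x)%:E)%E by move=> _; rewrite -EFinM lee_fin mulr_ge0 ?relaxed_density_ge0.
have a0' x : X x -> (0 <= (a x)%:E)%E by move=> _; rewrite lee_fin relaxed_density_ge0.
have b0' x : X x -> (0 <= (b x)%:E)%E by move=> _; rewrite lee_fin relaxed_density_ge0.
have mA := (measurable_EFinP _ _).2 ma; have mB := (measurable_EFinP _ _).2 mb.
have mA2 := measurable_funeM (2^-1)%:E mA; have mB2 := measurable_funeM (2^-1)%:E mB.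
have h0 : 0 <= 2^-1 :> R by [].
apply: (@le_trans _ _ (\int[mu]_(x in X) ((2^-1)%:E * (a x)%:E + (2^-1)%:E * (b x)%:E))%E).
  apply: ge0_le_integral => //.
  - by move=> x _; rewrite lee_fin relaxed_density_ge0.
  - apply/measurable_EFinP; apply: measurable_relaxed_density.
      move=> i j; under eq_fun do rewrite mxE.
      by apply: measurable_funM => //; exact: measurable_funD.
    by apply: measurable_funM => //; exact: measurable_funD.
  - exact: emeasurable_funD.
  - move=> x _; rewrite -!EFinM -EFinD lee_fin -mulrDr [leRHS]mulrC.
    rewrite (_ : state_grad _ x = 2^-1 *: (state_grad v x + state_grad w x)).
      by apply: relaxed_density_half.
    by apply/matrixP => i j; rewrite !mxE mulrC.
rewrite (ge0_integralD _ mX a0 mA2 b0 mB2) !ge0_integralZl//.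
apply: (@le_trans _ _ ((2^-1)%:E * c + (2^-1)%:E * c)%E).
  have h1 : (0 <= (2^-1 : R)%:E)%E by rewrite lee_fin.
  exact: (leeD (lee_wpmul2l h1 vc) (lee_wpmul2l h1 wc)).
have c0 : (0 <= c)%E by apply: le_trans vc; apply: integral_ge0.
have e1 : 2^-1 + 2^-1 = 1 :> R by lra.
by rewrite -ge0_muleDl ?lee_fin// -EFinD e1 mul1e.
Qed.

Section core.
Hypothesis n1 : (1 < n)%N.
Let p2 : 2 <= p. Proof. by apply: le_trans np; rewrite ler_nat. Qed.
Variables (f_ : nat -> rV -> rV) (c B : R).
Hypotheses (Af : forall k, A (f_ k)) (Ef : forall k, (E (f_ k) <= (c + k.+1%:R^-1)%:E)%E).
Hypothesis fB : forall k t, (P (jets (f_ k) t) <= B%:E)%E.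
Hypothesis fC : forall e, 0 < e -> exists N, forall k l j, (N <= k)%N -> (N <= l)%N ->
  (P (jets (f_ k) (j, None) \- jets (f_ l) (j, None))%R <= e%:E)%E.

(** Jacobians are positive only almost everywhere, while [hull_limit] asks for a [None] component
    that is nonnegative everywhere; hence the absolute value. *)
Let st k (y : option ('I_n * option 'I_n) * rV) : R :=
  if y.1 is Some t then jets (f_ k) t y.2 else `|jacobian_det X (f_ k) y.2|.

Let mst k o : measurable_fun X (fun x => st k (o, x)).
Proof.
case: o => [t|] /=; first by have [] := jets_Lpm (Af k) t.
apply: measurableT_comp => //; exact: jacobian_measurable.
Qed.

Let hull_good_state m w : hull st m w -> good_state w.
Proof.
move: w; apply: hull_prop => [k _|v w [mv v0] [mw w0]]; split.
- exact: mst.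
- by move=> x; exact: normr_ge0.
- by move=> o; apply: measurable_funM => //; exact: measurable_funD.
- by move=> x; rewrite divr_ge0// addr_ge0.
Qed.

Let jets0 j o := jets (f_ 0%N) (j, o).

(** What survives averaging: weak derivatives are averaged with the maps, and boundary values are
    recorded as a difference from the fixed [f_ 0], because [W0] is a linear space. *)
Let hull_sobolev w : hull st 0 w ->
  [/\ forall t, Lpm mu X p (fun x => w (Some t, x)),
      forall j i, is_weak_partial X i (fun x => w (Some (j, None), x)) (fun x => w (Some (j, Some i), x)) &
      forall j, W0 X p (fun o => (fun x => w (Some (j, o), x)) \- jets0 j o)].
Proof.
move: w; apply: hull_prop => [k _|v w [lv wv Wv] [lw ww Ww]]; split.
- by move=> t; exact: (jets_Lpm (Af k) t).
- by move=> j i; exact: (jets_weak (Af k) j i).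
- by move=> j; exact: jets_diff_W0.
- move=> t; rewrite (halfE (fun x => v (Some t, x)) (fun x => w (Some t, x))).
  by apply: (LpmZ mX); exact: (LpmD mX p1 (lv t) (lw t)).
- move=> j i; rewrite (halfE (fun x => v (Some (j, None), x)) (fun x => w (Some (j, None), x))).
  rewrite (halfE (fun x => v (Some (j, Some i), x)) (fun x => w (Some (j, Some i), x))).
  by apply: (is_weak_partialZ oX); exact: (is_weak_partialD oX (wv j i) (ww j i)).
- move=> j; have := W0Z oX Xfin p1 2^-1 (W0D oX Xfin p1 (Wv j) (Ww j)).
  congr W0; apply/funext => o; apply/funext => x; by rewrite /=; field.
Qed.

(** For a single map the shift only enlarges the base of a negative power, so the relaxed density
    lies below the true one; averages inherit the bound by convexity. *)
Let hull_energy N m w : hull st m w -> (relaxed_energy N w <= (c + m.+1%:R^-1)%:E)%E.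
Proof.
move=> hw; suff : good_state w /\ (relaxed_energy N w <= (c + m.+1%:R^-1)%:E)%E by case.
move: w hw; apply: hull_prop => [k mk|v w [gv vc] [gw wc]]; last first.
  split; last exact: relaxed_energy_half.
  case: gv => mv v0; case: gw => mw w0; split.
    by move=> o; apply: measurable_funM => //; exact: measurable_funD.
  by move=> x; rewrite divr_ge0// addr_ge0.
split; first by apply: (@hull_good_state 0); exact: hull_in.
apply: (@le_trans _ _ (c + k.+1%:R^-1)%:E); last by rewrite lee_fin lerD2l lef_pV2 ?posrE// ler_nat.
apply: le_trans (Ef k); have [_ Jpos _] := Af k.
apply: ae_ge0_le_integral => //.
- by move=> x _; rewrite lee_fin relaxed_density_ge0.
- apply/measurable_EFinP; apply: measurable_relaxed_density.
    by move=> i j; under eq_fun do rewrite mxE; exact: mst.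
  exact: (mst k None).
- by move=> x _; rewrite lee_fin addr_ge0 ?powR_ge0// invr_ge0 powR_ge0.
- apply/measurable_EFinP; apply: measurable_funD; first exact: weak_diff_norm_measurable (Af k).
  under eq_fun do rewrite -powRN.
  exact: (measurableT_comp (measurable_powR (- alpha)) (jacobian_measurable (Af k))).
- apply: filterS Jpos => x + Xx => /(_ Xx) J0; rewrite lee_fin /relaxed_density.
  rewrite (_ : state_grad (st k) x = weak_diff X (f_ k) x); last by apply/matrixP => i j; rewrite !mxE.
  rewrite lerD2l -powRN /st /= gtr0_norm// !powRN lef_pV2 ?posrE ?powR_gt0 ?addr_gt0 ?invr_gt0//.
  by rewrite ge0_ler_powR ?nnegrE ?addr_ge0 ?(ltW al0) ?(ltW J0) ?invr_ge0// lerDl invr_ge0.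
Qed.

Lemma minimiser_exists : exists2 f0, A f0 & (E f0 <= c%:E)%E.
Proof.
have st0 k x : 0 <= st k (None, x) by exact: normr_ge0.
have [h [hh hv [e me he]]] := hull_limit mX Xfin p2 mst fB st0.
have {hv}/choice[v hv] := hv; have {hv}/choice[H hv] := hv.
have h0 m : hull st 0 (h m) by apply: hull_sub (hh m).
have gh m := hull_good_state (hh m).
have mh m o : measurable_fun X (fun x => h m (o, x)) by have [] := gh m.
have conv t d : 0 < d -> \forall m \near \oo, (P ((fun x => h m (Some t, x)) \- v t)%R <= d%:E)%E.
  have [mv mH fH aH] := hv t => d0.
  exact: (pint_dominated mX p1 (fun m => mh m (Some t)) mv mH fH aH d0).
have lv t : Lpm mu X p (v t).
  have [mv _ _ _] := hv t; have [m _ /(_ m (leqnn m)) hm] := conv t 1 ltr01.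
  have [lh _ _] := hull_sobolev (h0 m).
  by apply: (Lpm_close mX p1 mv (lh t) (e := 1)); rewrite pintBC.
have wv j i : is_weak_partial X i (v (j, None)) (v (j, Some i)).
  have [m1 f1] := lv (j, None); have [m2 f2] := lv (j, Some i).
  apply: (is_weak_partial_closed oX p1 Xfin m1 m2 f1 f2) => d d0.
  have [m [c1 c2]] := filter_ex (filterI (conv (j, None) d d0) (conv (j, Some i) d d0)).
  have [_ wh _] := hull_sobolev (h0 m).
  by eexists _, _; split; [exact: (wh j i)|rewrite pintBC; exact: c1|rewrite pintBC; exact: c2].
have Wv j : W0 X p (fun o => v (j, o) \- jets0 j o).
  apply: (W0_closed oX Xfin p1).
    by move=> o; have [] := LpmB mX p1 (lv (j, o)) (jets_Lpm (Af 0%N) (j, o)).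
  move=> d d0.
  have near : \forall m \near \oo, forall o, (P ((fun x => h m (Some (j, o), x)) \- v (j, o))%R <= d%:E)%E.
    by apply: filter_forall => o; exact: conv.
  have [m hm] := filter_ex near; have [_ _ Wh] := hull_sobolev (h0 m).
  exists (fun o => (fun x => h m (Some (j, o), x)) \- jets0 j o); first exact: Wh.
  move=> o; apply: le_trans (hm o); rewrite pintBC le_eqVlt; apply/orP; left; apply/eqP.
  by apply: eq_integral => x _ /=; congr ((`| _ | `^ _)%:E); ring.
pose f0 x : rV := \row_j v (j, None) x.
have cf0 j : component f0 j = v (j, None) by apply/funext => x; rewrite /component mxE.
have sv : sobolev_map X p (fun j => v (j, None)) (fun j i => v (j, Some i)).
  by split=> [k|k i|k i]; [exact: lv|exact: lv|exact: wv].
pose J0 x := \det (mat (fun j i => v (j, Some i)) x).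
have aew j i : {ae mu, forall x, X x -> weak_partial X i (component f0 j) x = v (j, Some i) x}.
  by have [_ +] := weak_partialP oX (wv j i); rewrite cf0.
have aeD : {ae mu, forall x, X x -> weak_diff X f0 x = mat (fun j i => v (j, Some i)) x}.
  have : {ae mu, forall x, forall ji : 'I_n * 'I_n, X x -> weak_partial X ji.2 (component f0 ji.1) x = v (ji.1, Some ji.2) x}.
    by apply: filter_forall => ji; exact: aew.
  by apply: filterS => x hx Xx; apply/matrixP => j i; rewrite !mxE; exact: (hx (j, i) Xx).
have W1 j : W1p p X (component f0 j).
  by rewrite cf0; apply: (W1pI oX p1 (lv (j, None)) (fun i => lv (j, Some i)) (wv j)).
have W2 j : W1p0 p X (component (f0 \- phi) j).
  have [_ _ h1] := Af 0%N.
  have := W0_W1p0 oX Xfin p1 (W0D oX Xfin p1 (Wv j) (W1p0_W0 oX Xfin p1 (h1 j))).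
  congr W1p0; apply/funext => x; rewrite /jets0 /jets /weak_jet /component /= !mxE; ring.
have mJ0 : measurable_fun X J0.
  by apply: measurable_det => k i; under eq_fun do rewrite mxE; case: (lv (k, Some i)).
have iJ0 : mu.-integrable X (EFin \o J0).
  by apply: (det_integrable oX Xfin n0 np) => k i; exact: lv.
(* The maps themselves, not only their averages, must approach v, since weak continuity speaks of
   their own Jacobians. By [fC] every late map is close to the whole hull of the tail, hence to its
   limit. *)
have fl d : 0 < d -> exists N, forall k j, (N <= k)%N -> (P (jets (f_ k) (j, None) \- v (j, None))%R <= d%:E)%E.
  move=> d0; pose K := 2 `^ p : R; have K0 : 0 < K by exact: powR_gt0.
  have d1 : 0 < d / (K * 2) by rewrite divr_gt0// mulr_gt0.
  have [N hN] := fC d1; exists N => k j Nk.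
  have hk w : hull st N w -> measurable_fun X (fun x => w (Some (j, None), x)) /\
     (P (jets (f_ k) (j, None) \- (fun x => w (Some (j, None), x)))%R <= (d / (K * 2))%:E)%E.
    move: w; apply: hull_prop => [l Nl|w1 w2 [m1 c1] [m2 c2]].
      by split; [exact: (mst l (Some (j, None)))|exact: hN].
    have mk : measurable_fun X (jets (f_ k) (j, None)) by exact: (mst k (Some (j, None))).
    split; first by apply: measurable_funM => //; exact: measurable_funD.
    have := pint_half mX p1 (measurable_funB mk m1) (measurable_funB mk m2) c1 c2.
    apply: le_trans; rewrite le_eqVlt; apply/orP; left; apply/eqP.
    by apply: eq_integral => x _ /=; congr ((`| _ | `^ _)%:E); field.
  have [m [c1 c2]] := filter_ex (filterI (conv (j, None) _ d1) (nbhs_infty_ge N)).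
  have [mw c3] := hk _ (hull_sub c2 (hh m)).
  have [mv _ _ _] := hv (j, None).
  have mk : measurable_fun X (jets (f_ k) (j, None)) by exact: (mst k (Some (j, None))).
  rewrite (_ : P _ = P ((jets (f_ k) (j, None) \- (fun x => h m (Some (j, None), x))) \+ ((fun x => h m (Some (j, None), x)) \- v (j, None)))%R); last first.
    by apply: eq_integral => x _ /=; congr ((`| _ | `^ _)%:E); ring.
  have b1 := pintD mu mX p1 (measurable_funB mk mw) (measurable_funB mw mv).
  apply: le_trans b1 _.
  apply: le_trans (lee_wpmul2l _ (leeD c3 c1)) _; first by rewrite lee_fin (ltW K0).
  rewrite -EFinD -EFinM lee_fin le_eqVlt; apply/orP; left; apply/eqP.
  by rewrite -/K; field; rewrite gt_eqF.
have B0 : 0 <= B by have := le_trans (pint_ge0 _ _ _ _) (fB 0%N (Ordinal n0, None)); rewrite lee_fin.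
pose B' := B + \sum_(ji : 'I_n * 'I_n) fine (P (v (ji.1, Some ji.2))).
have BB' : B <= B' by rewrite lerDl sumr_ge0// => ji _; rewrite fine_ge0// pint_ge0.
have vB' j i : (P (v (j, Some i)) <= B'%:E)%E.
  have [_ fv] := lv (j, Some i).
  have fv' : P (v (j, Some i)) \is a fin_num by rewrite ge0_fin_numE// pint_ge0.
  rewrite -(fineK fv') lee_fin /B' (bigD1 (j, i))//= addrCA lerDl addr_ge0// sumr_ge0// => ji _.
  by rewrite fine_ge0// pint_ge0.
have jl eta d : test_function X eta -> 0 < d -> exists N, forall k, (N <= k)%N ->
    `|\int[mu]_(x in X) (jacobian_det X (f_ k) x * eta x) - \int[mu]_(x in X) (J0 x * eta x)| <= d.
  move=> te d0; have [d1 d10 hd] := jacobian_weak_continuity oX Xfin n0 np te (le_trans B0 BB') d0.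
  have [N hN] := fl d1 d10; exists N => k Nk.
  have gk j i : (P (jets (f_ k) (j, Some i)) <= B'%:E)%E.
    by apply: le_trans (fB k (j, Some i)) _; rewrite lee_fin.
  exact: (hd _ _ _ _ (jets_sobolev_map (Af k)) sv gk vB' (fun j => hN k j Nk)).
have iJ k : mu.-integrable X (EFin \o jacobian_det X (f_ k)).
  by apply: (det_integrable oX Xfin n0 np) => j i; exact: (jets_Lpm (Af k) (j, Some i)).
(* The inequality is linear in the [None] component, so it passes from the Jacobians of the tail to
   their averages, which need not be determinants. *)
have hl eta d : test_function X eta -> 0 < d -> exists N, forall m, (N <= m)%N ->
    mu.-integrable X (EFin \o (fun x => h m (None, x))) /\
    \int[mu]_(x in X) (h m (None, x) * eta x) <= \int[mu]_(x in X) (J0 x * eta x) + d.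
  move=> te d0; have [N hN] := jl eta d te d0; exists N => m Nm.
  have [M M0 hM] := test_function_bounded te.
  have me' : measurable_fun X eta by apply: measurable_funS (test_function_measurable te).
  have im u : mu.-integrable X (EFin \o u) -> mu.-integrable X (EFin \o (fun x => u x * eta x)).
    move=> iu; apply: (integrableMl mX iu me'); exists M; split; first exact: num_real.
    by move=> s Ms x _; apply: le_trans (hM x) (ltW Ms).
  move: (h m) (hull_sub Nm (hh m)); apply: hull_prop => [k Nk|w1 w2 [i1 c1] [i2 c2]].
    have ik := integrable_norm (iJ k); split; first exact: ik.
    have [_ Jpos _] := Af k.
    have -> : \int[mu]_(x in X) (st k (None, x) * eta x) = \int[mu]_(x in X) (jacobian_det X (f_ k) x * eta x).
      congr fine; apply: ae_eq_integral => //.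
      + by have /integrableP[] := im _ ik.
      + by have /integrableP[] := im _ (iJ k).
      + by apply: filterS Jpos => x h1 Xx; rewrite /st /= gtr0_norm// h1.
    by have := hN k Nk; rewrite ler_norml => /andP[_]; rewrite lerBlDl.
  have i3 : mu.-integrable X (EFin \o (fun x => (w1 (None, x) + w2 (None, x)) / 2)).
    rewrite halfE; exact: (integrableZl mX 2^-1 (integrableD mX i1 i2)).
  split; first exact: i3.
  have -> : \int[mu]_(x in X) ((w1 (None, x) + w2 (None, x)) / 2 * eta x) =
      2^-1 * (\int[mu]_(x in X) (w1 (None, x) * eta x) + \int[mu]_(x in X) (w2 (None, x) * eta x)).
    rewrite -RintegralD//; [|exact: im|exact: im].
    rewrite -RintegralZl//; last exact: (integrableD mX (im _ i1) (im _ i2)).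
    by apply: eq_Rintegral => x _; field.
  by move: c1 c2; lra.
(* [cut N (exp (- z / 2)) = min z N] for z >= 0. *)
pose cut (N : nat) (s : R) := - 2 * ln (Num.max s (expR (- (N%:R : R) / 2))).
have cut_pos N (s : R) : 0 < Num.max s (expR (- (N%:R : R) / 2)) by rewrite lt_max expR_gt0 orbT.
have cut_cont N s : {for s, continuous (cut N)}.
  apply: cvgM; first exact: cvg_cst.
  apply: (@cvg_comp _ _ _ (fun s => Num.max s (expR (- (N%:R : R) / 2))) (@ln R)); last exact: continuous_ln.
  exact: (@continuous_max _ _ (fun s : R => s) (fun _ => expR (- (N%:R : R) / 2)) s cvg_id (cvg_cst _)).
have cut_bound N s : s <= 1 -> 0 <= cut N s <= N%:R.
  move=> s1; have c1 : Num.max s (expR (- (N%:R : R) / 2)) <= 1.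
    by rewrite ge_max s1 expR_le1 mulNr oppr_le0 divr_ge0.
  have c2 : expR (- (N%:R : R) / 2) <= Num.max s (expR (- (N%:R : R) / 2)) by rewrite le_max lexx orbT.
  have l1 := ln_le0 c1; have l2 : - N%:R / 2 <= ln (Num.max s (expR (- (N%:R : R) / 2))).
    by rewrite -[leLHS]expRK ler_ln ?posrE ?expR_gt0.
  by rewrite /cut; lra.
have cut_le N z : cut N (expR (- z / 2)) <= z.
  have c2 : expR (- z / 2) <= Num.max (expR (- z / 2)) (expR (- (N%:R : R) / 2)) by rewrite le_max lexx.
  have l2 : - z / 2 <= ln (Num.max (expR (- z / 2)) (expR (- (N%:R : R) / 2))).
    by rewrite -[leLHS]expRK ler_ln ?posrE ?expR_gt0.
  by rewrite /cut; lra.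
have h_le1 m x : expR (- h m (None, x) / 2) <= 1.
  by rewrite expR_le1 mulNr oppr_le0 divr_ge0//; have [_] := gh m; apply.
(* The limit e is at most 1 only almost everywhere; after truncation [cut_bound] applies at every
   point. *)
pose e1 x := Num.min (e x) 1.
have ae1 : {ae mu, forall x, X x -> expR (- h j (None, x) / 2) @[j --> \oo] --> e1 x}.
  apply: filterS he => x hx Xx; have ex : e x <= 1.
    by apply: (cvgr_to_le (hx Xx)); apply: nearW => j; exact: h_le1.
  by rewrite /e1 min_l//; exact: hx.
have me1 : measurable_fun X e1 by apply: measurable_minr => //; exact: measurable_cst.
have mcut N : measurable_fun setT (cut N).
  apply: measurable_funM => //; apply: (measurableT_comp (@measurable_ln R)).
  by apply: measurable_maxr => //; exact: measurable_cst.
have mg N : measurable_fun X (fun x => cut N (e1 x)) by exact: (measurableT_comp (mcut N) me1).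
have e1le x : e1 x <= 1 by rewrite /e1 ge_min lexx orbT.
(* The cut is bounded and continuous, so its integrals against eta converge; by [cut_le] it stays
   below the averaged Jacobian, whose integrals [hl] controls. The fundamental lemma makes the
   inequality pointwise. *)
have lsc N : {ae mu, forall x, X x -> cut N (e1 x) <= J0 x}.
  have ig : mu.-integrable X (EFin \o (fun x => cut N (e1 x))).
    apply: measurable_bounded_integrable => //; exists N%:R; split; first exact: num_real.
    move=> s Ns x _ /=; have /andP[g0 gN] := cut_bound N _ (e1le x).
    by rewrite ger0_norm// (le_trans gN (ltW Ns)).
  have iJg : mu.-integrable X (EFin \o (J0 \- (fun x => cut N (e1 x)))) by exact: (integrableB mX iJ0 ig).
  have lJg : locally_integrable_in X (J0 \- (fun x => cut N (e1 x))).
    by move=> K cK KX; apply: integrableS iJg => //; exact: compact_measurable_rV.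
  have := fundamental_ge oX lJg; move=> /(_ _)/wrap[].
    move=> eta te eta0.
    have [M M0 hM] := test_function_bounded te.
    have me' : measurable_fun X eta by apply: measurable_funS (test_function_measurable te).
    have im u : mu.-integrable X (EFin \o u) -> mu.-integrable X (EFin \o (fun x => u x * eta x)).
      move=> iu; apply: (integrableMl mX iu me'); exists M; split; first exact: num_real.
      by move=> s Ms x _; apply: le_trans (hM x) (ltW Ms).
    have -> : \int[mu]_(x in X) ((J0 \- (fun x0 => cut N (e1 x0))) x * eta x) =
        \int[mu]_(x in X) (J0 x * eta x) - \int[mu]_(x in X) (cut N (e1 x) * eta x).
      rewrite -RintegralB//; [|exact: im|exact: im].
      by apply: eq_Rintegral => x _; rewrite /= mulrBl.
    rewrite subr_ge0; apply/ler_addgt0Pr => d d0.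
    have [N0 hN0] := hl eta d te d0.
    have ca : \int[mu]_(x in X) (cut N (expR (- h m (None, x) / 2)) * eta x) @[m --> \oo] -->
              \int[mu]_(x in X) (cut N (e1 x) * eta x).
      have iM : mu.-integrable X (EFin \o (fun _ : rV => N%:R * M)).
        apply: measurable_bounded_integrable => //; exists (N%:R * M); split; first exact: num_real.
        by move=> s Ns x _ /=; rewrite ger0_norm ?mulr_ge0 ?(ltW M0)// ltW.
      have mch m : measurable_fun X (fun x => cut N (expR (- h m (None, x) / 2))).
        apply: (measurableT_comp (mcut N)); apply: (measurableT_comp (@measurable_expR R)).
        by apply: measurable_funM => //; exact: measurable_funN.
      apply: (Rintegral_dominated mX _ _ iM).
      + by move=> m; exact: measurable_funM.
      + exact: measurable_funM.
      + apply: filterS ae1 => x hx Xx; split.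
          apply: cvgM; last exact: cvg_cst.
          exact: (@cvg_comp _ _ _ (fun m => expR (- h m (None, x) / 2)) (cut N) _ _ _ (hx Xx) (cut_cont N _)).
        move=> m; rewrite normrM ler_pM//.
        by have /andP[a1 a2] := cut_bound N _ (h_le1 m x); rewrite ger0_norm.
    apply: (cvgr_to_le ca); exists N0 => // m /= N0m.
    have [ih ch] := hN0 m N0m; apply: le_trans ch.
    apply: le_Rintegral => //; [|exact: im|].
      apply: im; apply: measurable_bounded_integrable => //.
        apply: (measurableT_comp (mcut N)); apply: (measurableT_comp (@measurable_expR R)).
        by apply: measurable_funM => //; exact: measurable_funN.
      exists N%:R; split; first exact: num_real.
      move=> s Ns x _ /=; have /andP[g0 gN] := cut_bound N _ (h_le1 m x).
      by rewrite ger0_norm// (le_trans gN (ltW Ns)).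
    by move=> x _; rewrite ler_wpM2r.
  by apply: filterS => x hx Xx; rewrite -subr_ge0; exact: hx.
(* If e1 x were 0, the cut would equal N for every N, against the finiteness of J0 x. Elsewhere a
   large N makes the cut inactive. *)
have dJ : {ae mu, forall x, X x -> 0 < e1 x /\ - 2 * ln (e1 x) <= J0 x}.
  have := ae_foralln lsc; apply: filterS => x hx Xx.
  have [k hk] : exists k : nat, J0 x < k%:R.
    exists (Num.truncn `|J0 x|).+1; apply: le_lt_trans (ler_norm _) _; exact: truncnS_gt.
  have e0 : 0 < e1 x.
    rewrite ltNge; apply/negP => e0; have := hx k Xx; rewrite leNgt => /negP; apply.
    rewrite /cut max_r; last by apply: le_trans e0 _; exact: expR_ge0.
    by rewrite expRK; move: hk; lra.
  split=> //.
  pose k' := (Num.truncn `|- 2 * ln (e1 x)|).+1.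
  have hk' : - 2 * ln (e1 x) < k'%:R by apply: le_lt_trans (ler_norm _) _; exact: truncnS_gt.
  have := hx k' Xx; rewrite /cut max_l//.
  rewrite -[leRHS]lnK ?posrE// ler_expR; move: hk'; lra.
pose Jp x := Num.max (J0 x) 0.
have mJp : measurable_fun X Jp by apply: measurable_maxr => //; exact: measurable_cst.
have mD i j : measurable_fun X (fun x => mat (fun j i => v (j, Some i)) x i j).
  by under eq_fun do rewrite mxE; case: (lv (i, Some j)).
have bound1 N : (\int[mu]_(x in X) (relaxed_density N (mat (fun j i => v (j, Some i)) x) (Jp x))%:E <= c%:E)%E.
  pose dl x := - 2 * ln (e1 x).
  have mdl : measurable_fun X dl.
    by apply: measurable_funM => //; exact: (measurableT_comp (@measurable_ln R)).
  (* The density decreases in its Jacobian variable, so the smaller [dl] may replace [Jp]; it is to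
     [dl] that the averages converge. *)
  apply: (@le_trans _ _ (\int[mu]_(x in X) (relaxed_density N (mat (fun j i => v (j, Some i)) x) (dl x))%:E)%E).
    apply: ae_ge0_le_integral => //.
    - by move=> x _; rewrite lee_fin relaxed_density_ge0.
    - by apply/measurable_EFinP; exact: measurable_relaxed_density.
    - by move=> x _; rewrite lee_fin relaxed_density_ge0.
    - by apply/measurable_EFinP; exact: measurable_relaxed_density.
    - apply: filterS dJ => x + Xx => /(_ Xx)[ex dx]; rewrite lee_fin lerD2l.
      have dl0 : 0 <= dl x by have := ln_le0 (e1le x); rewrite /dl; lra.
      have N0 : 0 < N.+1%:R^-1 :> R by rewrite invr_gt0.
      have q1 : 0 < dl x + N.+1%:R^-1 by rewrite ltr_wpDl.
      have q2 : dl x + N.+1%:R^-1 <= Jp x + N.+1%:R^-1 by rewrite lerD2r /Jp le_max dx.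
      rewrite !powRN lef_pV2 ?posrE ?powR_gt0// ?(lt_le_trans q1 q2)//.
      by rewrite ge0_ler_powR ?nnegrE ?(ltW al0) ?(ltW q1)// (le_trans (ltW q1) q2).
  apply/lee_addgt0Pr => d d0.
  have [j0 _ /(_ j0 (leqnn j0)) hj0] := near_infty_natSinv_lt (PosNum d0).
  (* The sequence is started at j0, where the excess 1/(j0+1) is already below d, so that one bound
     holds for all its terms. *)
  apply: (@fatou_ae _ _ _ mu X (fun k x => (relaxed_density N (state_grad (h (j0 + k)%N) x) (h (j0 + k)%N (None, x)))%:E)) => //.
  - move=> k; apply/measurable_EFinP; apply: measurable_relaxed_density => // i j.
    by under eq_fun do rewrite mxE; exact: mh.
  - by move=> k x _; rewrite lee_fin relaxed_density_ge0.
  - by apply/measurable_EFinP; exact: measurable_relaxed_density.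
  - by move=> x _; rewrite lee_fin relaxed_density_ge0.
  - have aeh : {ae mu, forall x, forall t, X x -> h m (Some t, x) @[m --> \oo] --> v t x}.
      apply: filter_forall => t; have [_ _ _ ht] := hv t.
      by apply: filterS ht => x hx Xx; have [] := hx Xx.
    apply: filterS3 aeh ae1 dJ => x hx ex dx Xx.
    have [e0 _] := dx Xx.
    apply: cvg_EFin; first exact: nearW.
    have sh (a : nat -> R) (l : R) : a k @[k --> \oo] --> l -> a (j0 + k)%N @[k --> \oo] --> l.
      by move=> al; have := @cvg_comp _ _ _ (fun k => (j0 + k)%N) a _ _ _ (cvg_addnl j0) al.
    apply: cvgD.
      apply: cvg_powR_ge0 => //; [exact: operator_norm_ge0|by move=> k; exact: operator_norm_ge0|].
      apply: operator_norm_cvg => i j; rewrite mxE; under eq_fun do rewrite mxE.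
      exact: (sh (fun k => h k (Some (i, Some j), x)) (v (i, Some j) x) (hx (i, Some j) Xx)).
    have dl0 : 0 <= dl x by have := ln_le0 (e1le x); rewrite /dl; lra.
    apply: cvg_powR; first by rewrite ltr_wpDl// invr_gt0.
    apply: cvgD; last exact: cvg_cst.
    apply: (sh (fun k => h k (None, x))).
    have -> : (fun k => h k (None, x)) = (fun k => - 2 * ln (expR (- h k (None, x) / 2))).
      by apply/funext => k; rewrite expRK; field.
    apply: cvgM; first exact: cvg_cst.
    exact: (@cvg_comp _ _ _ (fun k => expR (- h k (None, x) / 2)) (@ln R) _ _ _ (ex Xx) (continuous_ln e0)).
  - move=> k; apply: le_trans (hull_energy N (hh (j0 + k)%N)) _.
    rewrite -EFinD lee_fin lerD2l; apply: le_trans (ltW hj0).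
    by rewrite lef_pV2 ?posrE// ler_nat ltnS leq_addr.
pose M x := mat (fun j i => v (j, Some i)) x.
(* The limit of the relaxed densities as N tends to infinity, with the true value +oo at J = 0;
   integrability of F is what excludes Jp = 0. *)
pose F x : \bar R := if 0 < Jp x then (operator_norm (M x) `^ p + (Jp x `^ alpha)^-1)%:E else +oo%E.
have mF : measurable_fun X F.
  apply: measurable_fun_if => //.
  - by apply: measurable_fun_ltr => //; exact: measurable_cst.
  - apply/measurable_EFinP; apply: (measurable_funS mX); first by move=> x [].
    apply: measurable_funD.
      by apply: (measurableT_comp (measurable_powR p)); exact: (measurable_operator_norm mX).
    under eq_fun do rewrite -powRN.
    exact: (measurableT_comp (measurable_powR (- alpha)) mJp).
have F0 x : X x -> (0 <= F x)%E.
  by move=> _; rewrite /F; case: ifP => // _; rewrite lee_fin addr_ge0 ?powR_ge0// invr_ge0 powR_ge0.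
have boundF : (\int[mu]_(x in X) F x <= c%:E)%E.
  apply: (@fatou_ae _ _ _ mu X (fun N x => (relaxed_density N (M x) (Jp x))%:E)) => //.
  - by move=> N; apply/measurable_EFinP; exact: measurable_relaxed_density.
  - by move=> N x _; rewrite lee_fin relaxed_density_ge0.
  apply: aeW => x Xx; have Jp0 : 0 <= Jp x by rewrite /Jp le_max lexx orbT.
  rewrite /F; case: ifP => [Jx|/negbT].
    apply: cvg_EFin; first exact: nearW.
    apply: cvgD; first exact: cvg_cst.
    rewrite -powRN; apply: cvg_powR => //; rewrite -[X in _ --> X]addr0.
    by apply: cvgD; [exact: cvg_cst|exact: cvg_harmonic].
  rewrite -leNgt => Jx; have -> : Jp x = 0 by apply/le_anti; rewrite Jx Jp0.
  apply/cvgeyPge => a; near=> N.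
  have NV : (N.+1%:R^-1 `^ alpha)^-1 = N.+1%:R `^ alpha :> R.
    have NVe : N.+1%:R^-1 `^ alpha * N.+1%:R `^ alpha = 1 :> R.
      by rewrite -powRM ?invr_ge0// mulVf ?pnatr_eq0// powR1.
    by apply: (mulfI (x := N.+1%:R^-1 `^ alpha)); rewrite ?NVe ?mulfV// gt_eqF// powR_gt0 ?invr_gt0.
  rewrite lee_fin /relaxed_density add0r powRN NV.
  apply: (@le_trans _ _ (N.+1%:R `^ alpha)); last by rewrite lerDr powR_ge0.
  have [a0|a0] := leP a 0; first exact: le_trans a0 (powR_ge0 _ _).
  have -> : a = (a `^ alpha^-1) `^ alpha by rewrite -powRrM mulVf ?gt_eqF// powRr1// ltW.
  rewrite ge0_ler_powR ?nnegrE ?powR_ge0 ?(ltW al0)//.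
  apply: (@le_trans _ _ N%:R); last by rewrite ler_nat.
  by near: N; exact: nbhs_infty_ger.
have iF : mu.-integrable X F.
  apply/integrableP; split=> //; rewrite (eq_integral F); first exact: le_lt_trans boundF (ltry _).
  by move=> x /set_mem Xx; rewrite gee0_abs ?F0.
have Jpos : {ae mu, forall x, X x -> 0 < J0 x}.
  have := integrable_ae mX iF; apply: filterS => x hx Xx; have := hx Xx.
  by rewrite /F; case: ifP => //; rewrite /Jp lt_max ltxx orbF.
exists f0.
  split=> //; apply: filterS2 Jpos aeD => x h1 h2 Xx; rewrite /jacobian_det h2//; exact: h1.
apply: le_trans boundF; rewrite le_eqVlt; apply/orP; left; apply/eqP.
apply: ae_eq_integral => //.
  apply/measurable_EFinP.
  have Wf t : measurable_fun X (jets f0 t) by have [hl' _] := W1p_Lpm oX p1 (W1 t.1); have [] := hl' t.2.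
  apply: measurable_funD.
    apply: (measurableT_comp (measurable_powR p)); apply: (measurable_operator_norm mX) => i j.
    by under eq_fun do rewrite mxE; exact: (Wf (i, Some j)).
  under eq_fun do rewrite -powRN; apply: (measurableT_comp (measurable_powR (- alpha))).
  by apply: measurable_det => i j; under eq_fun do rewrite mxE; exact: (Wf (i, Some j)).
apply: filterS2 Jpos aeD => x h1 h2 Xx.
have J1 := h1 Xx; have Jpx : Jp x = J0 x by rewrite /Jp max_l// ltW.
by rewrite /F Jpx J1 /jacobian_det h2.
Unshelve. all: by end_near.
Qed.

End core.

End minimisation.

Lemma increasing_ge (phi : nat -> nat) : (forall k, (phi k < phi k.+1)%N) -> forall k, (k <= phi k)%N.
Proof. by move=> hphi; elim=> // k IH; apply: leq_ltn_trans IH (hphi k). Qed.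

Lemma increasing_leq (phi : nat -> nat) : (forall k, (phi k < phi k.+1)%N) ->
  forall k l, (k < l)%N -> (phi k < phi l)%N.
Proof.
move=> hphi k; elim=> // l IH; rewrite ltnS leq_eqVlt => /orP[/eqP->|kl]; first exact: hphi.
exact: ltn_trans (IH kl) (hphi l).
Qed.

(** Components are treated one after another; what is inherited by subsequences survives the later
    extractions. *)
Lemma common_subsequence (I : eqType) (Q : I -> (nat -> nat) -> Prop) (s : seq I) :
  (forall i phi, (forall k, (phi k < phi k.+1)%N) ->
    exists2 psi, (forall k, (psi k < psi k.+1)%N) & Q i (phi \o psi)) ->
  (forall i phi psi, (forall k, (psi k < psi k.+1)%N) -> Q i phi -> Q i (phi \o psi)) ->
  exists2 phi, (forall k, (phi k < phi k.+1)%N) & forall i, i \in s -> Q i phi.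
Proof.
move=> hex hsub; elim: s => [|i s [phi hphi Qphi]].
  by exists id.
have [psi hpsi Qpsi] := hex i phi hphi; exists (phi \o psi).
  by move=> k; apply: (increasing_leq hphi); exact: hpsi.
by move=> j; rewrite inE => /orP[/eqP->//|js]; apply: hsub => //; exact: Qphi.
Qed.

(** * Bounds and compactness of minimising sequences *)

Section minimisation.
Context {R : realType} {n : nat}.
Local Notation rV := 'rV[R]_n.
Local Notation mu := (@lebesgue_rV R n).
Variables (X : set rV) (r p alpha : R) (phi : rV -> rV).
Hypotheses (oX : open X) (r0 : 0 < r) (Xr : forall x, X x -> `|x| <= r).
Hypotheses (n1 : (1 < n)%N) (np : n%:R <= p) (al0 : 0 < alpha).

Let mX : measurable X := open_measurable_rV oX.
Let Xfin : (mu X < +oo)%E. Proof. exact: bounded_lebesgue_fin mX Xr. Qed.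
Let n0 : (0 < n)%N. Proof. exact: ltnW. Qed.
Let p1 : 1 <= p. Proof. by apply: le_trans np; rewrite ler1n. Qed.
Let p0 : 0 < p. Proof. exact: lt_le_trans p1. Qed.
Local Notation P u := (pint mu X p u).
Local Notation A := (admissible p X phi).
Local Notation E := (energy alpha p X).
Local Notation K := (2 `^ p).

Let K0 : 0 < K :> R. Proof. exact: powR_gt0. Qed.

Let leD u v (a b : R) : measurable_fun X u -> measurable_fun X v ->
  (P u <= a%:E)%E -> (P v <= b%:E)%E -> (P (u \+ v)%R <= (K * (a + b))%:E)%E.
Proof.
move=> mu1 mv ua vb; apply: le_trans (pintD mu mX p1 mu1 mv) _.
by apply: le_trans (lee_wpmul2l _ (leeD ua vb)) _; rewrite ?lee_fin ?(ltW K0).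
Qed.

Let leB u v (a b : R) : measurable_fun X u -> measurable_fun X v ->
  (P u <= a%:E)%E -> (P v <= b%:E)%E -> (P (u \- v)%R <= (K * (a + b))%:E)%E.
Proof.
move=> mu1 mv ua vb.
rewrite (_ : P _ = P (u \+ (fun x => -1 * v x))%R); last first.
  by apply: eq_integral => x _ /=; rewrite mulN1r.
apply: leD; [exact: mu1|exact: measurable_funM|exact: ua|].
by rewrite (pintZ mu mX)// normrN1 powR1 mul1e.
Qed.

Lemma energy_ge0 f : (0 <= E f)%E.
Proof.
by apply: integral_ge0 => x _; rewrite lee_fin addr_ge0 ?invr_ge0 ?powR_ge0.
Qed.

Section sequence.
Variables (f_ : nat -> rV -> rV) (c : R).
Hypotheses (Af : forall k, A (f_ k)) (Ef : forall k, (E (f_ k) <= (c + k.+1%:R^-1)%:E)%E).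

Let w j k o := jets X (f_ k) (j, o) \- jets X (f_ 0%N) (j, o).
Let D : R := K * ((c + 1) + (c + 1)).

Let Ww j k : W0 X p (w j k).
Proof. exact: (jets_diff_W0 oX Xr n0 np). Qed.

Let mj k t : measurable_fun X (jets X (f_ k) t).
Proof. by have [] := jets_Lpm oX n0 np (Af k) t. Qed.

Let gradE k j i : (P (jets X (f_ k) (j, Some i)) <= (c + 1)%:E)%E.
Proof.
apply: (jets_energy oX n0 np (Af k)); apply: le_trans (Ef k) _.
by rewrite lee_fin lerD2l invf_le1// ler1n.
Qed.

Let gradw j k i : (P (w j k (Some i)) <= D%:E)%E.
Proof. exact: leB. Qed.

(** The energy bounds only the gradients; Poincare's inequality is applied to the difference from
    f_0, which has zero boundary values. *)
Lemma sequence_bounded : exists B : R, forall k t, (P (jets X (f_ k) t) <= B%:E)%E.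
Proof.
have [C C0 hC] := W0_poincare oX Xfin p1 Xr r0.
have c0 : 0 <= c + 1.
  by have := le_trans (pint_ge0 _ _ _ _) (gradE 0 (Ordinal n0) (Ordinal n0)); rewrite lee_fin.
pose S := \sum_(j : 'I_n) fine (P (jets X (f_ 0%N) (j, None))).
have hS j : (P (jets X (f_ 0%N) (j, None)) <= S%:E)%E.
  have [_ fv] := jets_Lpm oX n0 np (Af 0%N) (j, None).
  have fv' : P (jets X (f_ 0%N) (j, None)) \is a fin_num by rewrite ge0_fin_numE// pint_ge0.
  rewrite -(fineK fv') lee_fin /S (bigD1 j)//= lerDl sumr_ge0// => ji _.
  by rewrite fine_ge0// pint_ge0.
have S0 : 0 <= S by rewrite sumr_ge0// => j _; rewrite fine_ge0// pint_ge0.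
have CD0 : 0 <= K * (C * D + S).
  rewrite mulr_ge0 ?(ltW K0)// addr_ge0// mulr_ge0//.
  by rewrite /D mulr_ge0 ?(ltW K0)// addr_ge0.
exists (K * (C * D + S) + (c + 1)) => k [j [i|]].
  by apply: le_trans (gradE k j i) _; rewrite lee_fin lerDr.
have wN : (P (w j k None) <= (C * D)%:E)%E.
  apply: le_trans (hC _ (Ordinal n0) (Ww j k)) _; rewrite EFinM.
  by apply: lee_wpmul2l; rewrite ?lee_fin.
apply: (@le_trans _ _ (K * (C * D + S))%:E); last by rewrite lee_fin lerDl.
rewrite (_ : P _ = P (w j k None \+ jets X (f_ 0%N) (j, None))%R); last first.
  by apply: eq_integral => x _; rewrite /w /= subrK.
by apply: leD => //; exact: measurable_funB.
Qed.

(** [rellich] speaks of test functions, so each difference from f_0 is replaced by a test function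
    within 1/(k+1), and the Cauchy property is carried back. *)
Lemma sequence_compact : exists2 psi : nat -> nat, (forall k, (psi k < psi k.+1)%N) &
  forall e, 0 < e -> exists N, forall k l j, (N <= k)%N -> (N <= l)%N ->
    (P (jets X (f_ (psi k)) (j, None) \- jets X (f_ (psi l)) (j, None))%R <= e%:E)%E.
Proof.
have /choice[tau0 htau0] (jk : 'I_n * nat) : exists eta, test_function X eta /\
    forall o, (P (w jk.1 jk.2 o \- jet eta o)%R <= (jk.2.+1%:R^-1)%:E)%E.
  by have [_ h] := Ww jk.1 jk.2; apply: h; rewrite invr_gt0.
pose tau j k := tau0 (j, k).
have ttau j k : test_function X (tau j k) by have [] := htau0 (j, k).
have htau j k o : (P (w j k o \- jet (tau j k) o)%R <= (k.+1%:R^-1)%:E)%E by have [_] := htau0 (j, k).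
have mtau j k o : measurable_fun X (jet (tau j k) o) by have [] := jet_Lpm oX Xfin p1 o (ttau j k).
have mw j k o : measurable_fun X (w j k o) by exact: measurable_funB.
have btau j k i : (P (partial i (tau j k)) <= (K * (D + 1))%:E)%E.
  rewrite (_ : P _ = P (w j k (Some i) \- (w j k (Some i) \- jet (tau j k) (Some i)))%R); last first.
    by apply: eq_integral => x _ /=; rewrite opprB addrC subrK.
  apply: leB => //; first exact: measurable_funB.
  by apply: le_trans (htau j k (Some i)) _; rewrite lee_fin invf_le1// ler1n.
pose Q j (psi : nat -> nat) := forall e, 0 < e -> exists N, forall k l, (N <= k)%N -> (N <= l)%N ->
  (P (tau j (psi k) \- tau j (psi l))%R <= e%:E)%E.
have [||psi hpsi Qpsi] := @common_subsequence 'I_n Q (enum 'I_n).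
- move=> j psi hpsi.
  have [psi' [h1 h2]] := rellich oX Xfin p1 n0 r0 Xr (fun k => ttau j (psi k)) (fun k => btau j (psi k)).
  by exists psi'.
- move=> j psi psi' hpsi' h e e0; have [N hN] := h e e0; exists N => k l Nk Nl; apply: hN.
    by apply: leq_trans Nk (increasing_ge _ _).
  by apply: leq_trans Nl (increasing_ge _ _).
have Qj j : Q j psi by apply: Qpsi; rewrite mem_enum.
exists psi => // e e0.
(* Chosen so that K (K (d + d) + d) = e, the cost of the two splittings below. *)
pose d := e / (K * (K * 2 + 1)).
have d0 : 0 < d by rewrite divr_gt0// mulr_gt0 ?ltr_wpDl// mulr_ge0// ltW.
have /choice[N hN] j := Qj j d d0.
have [N1 _ /(_ N1 (leqnn N1)) hN1] := near_infty_natSinv_lt (PosNum d0).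
exists (maxn N1 (\max_j N j)) => k l j; rewrite !geq_max => /andP[k1 k2] /andP[l1 l2].
have hd m : (N1 <= m)%N -> (P (w j (psi m) None \- tau j (psi m))%R <= d%:E)%E.
  move=> Nm; apply: le_trans (htau j (psi m) None) _; rewrite lee_fin; apply: le_trans (ltW hN1).
  by rewrite lef_pV2 ?posrE// ler_nat ltnS (leq_trans Nm)// increasing_ge.
rewrite (_ : P _ = P (((w j (psi k) None \- tau j (psi k)) \+ (tau j (psi k) \- tau j (psi l))) \-
    (w j (psi l) None \- tau j (psi l)))%R); last first.
  by apply: eq_integral => x _; congr ((`| _ | `^ _)%:E); rewrite /w /=; ring.
have mt m := mtau j (psi m) None; have mwN m := mw j (psi m) None.
have -> : e = K * (K * (d + d) + d).
  rewrite /d; generalize K K0 => k' k0; field.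
  rewrite (gt_eqF k0) andbT gt_eqF//.
  by rewrite ltr_wpDl// mulr_ge0// ltW.
have hm1 : measurable_fun X (w j (psi k) None \- tau j (psi k)) by exact: (measurable_funB (mwN k) (mt k)).
have hm2 : measurable_fun X (tau j (psi k) \- tau j (psi l)) by exact: (measurable_funB (mt k) (mt l)).
have hm3 : measurable_fun X (w j (psi l) None \- tau j (psi l)) by exact: (measurable_funB (mwN l) (mt l)).
apply: leB; [exact: measurable_funD|exact: hm3| |exact: hd].
apply: leD; [exact: hm1|exact: hm2|exact: hd|].
by apply: hN; rewrite (leq_trans _ k2, leq_trans _ l2)// (bigmaxD1 j)//= leq_maxl.
Qed.

End sequence.

Lemma minimiser_above (c : R) : (forall e, 0 < e -> exists2 f, A f & (E f <= (c + e)%:E)%E) ->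
  exists2 f0, A f0 & (E f0 <= c%:E)%E.
Proof.
move=> h; have /choice[f_ hf] k : exists f, A f /\ (E f <= (c + k.+1%:R^-1)%:E)%E.
  by have [|f Af Ef] := h k.+1%:R^-1; [rewrite invr_gt0|exists f].
have Af k : A (f_ k) by have [] := hf k.
have Ef k : (E (f_ k) <= (c + k.+1%:R^-1)%:E)%E by have [] := hf k.
have [psi hpsi Cpsi] := sequence_compact Af Ef.
have [B hB] := sequence_bounded Af Ef.
have Ef' k : (E ((f_ \o psi) k) <= (c + k.+1%:R^-1)%:E)%E.
  apply: le_trans (Ef (psi k)) _.
  by rewrite lee_fin lerD2l lef_pV2 ?posrE// ler_nat ltnS increasing_ge.
exact: (minimiser_exists oX Xr n0 np al0 n1 (fun k => Af (psi k)) Ef' (fun k => hB (psi k)) Cpsi).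
Qed.

Lemma minimiser_dim_ge2 : A !=set0 ->
  exists2 f0, A f0 & ereal_inf [set E f | f in A] = E f0.
Proof.
move=> [f1 Af1]; set c := ereal_inf _.
have lb f : A f -> (c <= E f)%E by move=> Af; apply: ereal_inf_lbound; exists f.
have c0 : (0 <= c)%E by apply: le_ereal_inf_tmp => _ [f _ <-]; exact: energy_ge0.
(* Nothing guarantees a map of finite energy; if the infimum is infinite, any admissible map attains
   it. *)
have [cfin|] := boolP (c \is a fin_num); last first.
  rewrite ge0_fin_numE// -leNgt leye_eq => /eqP cy; exists f1 => //.
  by apply/eqP; rewrite eq_le lb//= cy leey.
have [f0 Af0 Ef0] : exists2 f0, A f0 & (E f0 <= (fine c)%:E)%E.
  apply: minimiser_above => e e0.
  have [_ [f Af <-] /ltW Ef] := lb_ereal_inf_adherent e0 cfin.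
  by exists f; rewrite // EFinD fineK.
by exists f0 => //; apply/eqP; rewrite eq_le lb//= -(fineK cfin).
Qed.

End minimisation.

(** * Minimisers in dimension one *)

Section density.
Context {R : realType} {n : nat}.
Local Notation rV := 'rV[R]_n.
Local Notation mu := (@lebesgue_rV R n).
Variables (X : set rV) (p : R).
Hypotheses (oX : open X) (Xfin : (mu X < +oo)%E) (p1 : 1 <= p).
Local Notation P u := (pint mu X p u).

Let mX : measurable X := open_measurable_rV oX.

(** Truncate to a compact subset of X, then mollify at a radius that keeps the support inside X. *)
Lemma test_dense g e : Lpm mu X p g -> 0 < e ->
  exists2 tau, test_function X tau & (P (g \- tau)%R <= e%:E)%E.
Proof.
move=> [mg fg] e0; have [K0 [hK XK]] := compact_exhaustion oX.
pose K m := \big[setU/set0]_(i < m.+1) K0 i.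
have cK m : compact (K m) by apply: bigsetU_compact => i _; case: (hK i).
have KX m : K m `<=` X.
  by rewrite /K -bigcup_mkord => x [i _]; case: (hK i) => _; apply.
have mK m := compact_measurable_rV (cK m).
pose d := e / (2 `^ p * 2).
have q0 : 0 < 2 `^ p :> R by exact: powR_gt0.
have d0 : 0 < d by rewrite divr_gt0// mulr_gt0.
have mgK m : measurable_fun setT (g \_ (K m)).
  by apply/(measurable_restrictT _ (mK m)); exact: measurable_funS mg.
have [m hm] : exists m, (P ((g \_ (K m)) \- g)%R <= d%:E)%E.
  have f0 : \forall m \near \oo, (P ((g \_ (K m)) \- g)%R <= d%:E)%E; last exact: filter_ex f0.
  apply: (pint_dominated mX p1 (v := fun m => g \_ (K m)) (u := g) (H := fun x => `|g x|) _ _ _ _ _ d0).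
  - by move=> m; exact: measurable_funS (mgK m).
  - exact: mg.
  - exact: measurableT_comp.
  - have -> : P (fun x => `|g x|) = P g by apply: eq_integral => x _; rewrite normr_id.
    exact: fg.
  apply: aeW => x Xx; split; last first.
    by move=> m; rewrite /patch; case: ifP => // _; rewrite normr0.
  move: (Xx); rewrite -{1}XK => -[m0 _ Km0].
  apply: cvg_near_cst; exists m0 => // m /= m0m; rewrite /patch mem_set//.
  by rewrite /K -bigcup_mkord; exists m0.
have LK : mu.-integrable setT (EFin \o g \_ (K m)).
  have /(integrable_mkcond _ (mK m)) : mu.-integrable (K m) (EFin \o g).
    exact: (integrableS mX (mK m) (KX m) (pint_integrable mX Xfin p1 mg fg)).
  by congr (_.-integrable _ _); apply/funext => x; rewrite /patch /=; case: ifP.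
have pK : (pint mu setT p (g \_ (K m)) < +oo)%E.
  apply: le_lt_trans fg; rewrite /pint [leRHS]integral_mkcond.
  apply: ge0_le_integral => //.
  - exact: measurable_pint.
  - by apply/(measurable_restrictT _ mX); exact: measurable_pint.
  move=> x _; rewrite /patch; case: ifPn => xK.
    by rewrite mem_set//; apply: (KX m); exact: set_mem.
  rewrite normr0 powR0 ?gt_eqF// ?(lt_le_trans ltr01 p1)//.
  by case: ifP => // _; rewrite lee_fin powR_ge0.
have [e1 e10 he1] := mollifies_Lp p1 LK pK d0.
have [e2 [K' [e20 cK' K'X hK']]] := compact_thicken oX (cK m) (KX m).
pose e3 := Num.min e1 e2; have e30 : 0 < e3 by rewrite lt_min e10.
have [rho hrho] := mollifier_exists (R := R) (n := n) e30.
have h1 : mollifier e1 rho by apply: mollifier_sub hrho; rewrite ge_min lexx.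
have h2 : mollifier e2 rho by apply: mollifier_sub hrho; rewrite ge_min lexx orbT.
exists (conv rho (g \_ (K m))).
  apply: (test_functionI (conv_smooth (mollifier_testT h1) LK) cK' K'X) => x nx.
  apply: (conv_eq0 h2) => y xy; rewrite /patch; case: ifPn => // /set_mem Ky.
  by exfalso; apply: nx; apply: (hK' y Ky); rewrite /closed_ball_ /= distrC ltW.
have mc : measurable_fun setT (conv rho (g \_ (K m))) by exact: conv_measurable (mollifier_testT h1) LK.
rewrite (_ : P _ = P ((g \- g \_ (K m)) \+ (g \_ (K m) \- conv rho (g \_ (K m))))%R); last first.
  by apply: eq_integral => x _; congr ((`| _ | `^ _)%:E); rewrite /=; ring.
have b1 : measurable_fun X (g \- g \_ (K m)).
  by apply: measurable_funB => //; exact: measurable_funS (mgK m).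
have b2' : measurable_fun setT (g \_ (K m) \- conv rho (g \_ (K m))) by exact: measurable_funB.
have b2 : measurable_fun X (g \_ (K m) \- conv rho (g \_ (K m))) by exact: measurable_funS b2'.
apply: le_trans (pintD mu mX p1 b1 b2) _.
have c1 : (P (g \- g \_ (K m))%R <= d%:E)%E by rewrite pintBC.
have c2 : (P (g \_ (K m) \- conv rho (g \_ (K m)))%R <= d%:E)%E.
  by apply: le_trans (pint_subset oX p b2') _; rewrite pintBC; exact: he1.
apply: le_trans (lee_wpmul2l _ (leeD c1 c2)) _; first by rewrite lee_fin ltW.
rewrite -EFinD -EFinM lee_fin le_eqVlt; apply/orP; left; apply/eqP.
by rewrite /d; move: q0; generalize (2 `^ p : R) => k k0; field; rewrite gt_eqF.
Qed.

Lemma W0_mean i w : W0 X p w -> \int[mu]_(x in X) w (Some i) x = 0.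
Proof.
move=> [lw hw]; apply/eqP; rewrite -normr_le0; apply/ler_addgt0Pr => e e0; rewrite add0r.
have [d d0 hd] := pint_small_L1 mX Xfin p1 e0.
have [eta [te he]] := hw d d0.
have [m1 f1] := lw (Some i); have [m2 f2] := jet_Lpm oX Xfin p1 (Some i) te.
have i1 := pint_integrable mX Xfin p1 m1 f1; have i2 := pint_integrable mX Xfin p1 m2 f2.
have z : \int[mu]_(x in X) partial i eta x = 0.
  rewrite -(integral_partial i te); apply/esym; apply: Rintegral_support => // x _ nx.
  exact: test_function_eq0 (test_function_partial i te) nx.
have -> : \int[mu]_(x in X) w (Some i) x = \int[mu]_(x in X) (w (Some i) x - partial i eta x).
  by rewrite RintegralB// z subr0.
have := hd _ (measurable_funB m1 m2) (he (Some i)).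
have := le_normr_Rintegral mX (integrableB mX i1 i2).
move=> h1 h2; apply: le_trans h1 _.
have h3 : mu.-integrable X (EFin \o (fun x => `|w (Some i) x - partial i eta x|)).
  exact: integrable_norm (integrableB mX i1 i2).
by rewrite -lee_fin /Rintegral fineK ?(integrable_fin_num mX h3)//.
Qed.

(** Poincare's inequality makes the test functions converge once their derivatives do. With a single
    coordinate direction, T is the whole gradient of the limit. *)
Lemma W0_complete i r T : (forall x, X x -> `|x| <= r) -> 0 < r -> Lpm mu X p T ->
  (forall j, j = i) ->
  (forall d, 0 < d -> exists2 eta, test_function X eta & (P (T \- partial i eta)%R <= d%:E)%E) ->
  exists u, W0 X p (fun o => if o is Some _ then T else u).
Proof.
move=> Xr r0 [mT fT] onlyi hT.
have [C C0 hC] := W0_poincare oX Xfin p1 Xr r0.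
have q0 : 0 < 2 `^ p :> R by exact: powR_gt0.
pose a k : R := (2 ^+ k) `^ p.
have a0 k : 0 < a k by rewrite powR_gt0// exprn_gt0.
(* Each factor cancels one loss: the weight 2^k, Poincare's constant, the triangle inequality and
   its two terms; the summable 2^-(k+1) remains. *)
pose d k : R := (a k * (C + 1) * (2 `^ p) * 2 * (2 ^ k.+1)%:R)^-1.
have C10 : 0 < C + 1 by rewrite ltr_wpDl.
have w0 k : 0 < (2 ^ k.+1)%:R :> R by rewrite ltr0n expn_gt0.
have d0 k : 0 < d k by rewrite invr_gt0 !mulr_gt0.
have dle k : d k.+1 <= d k.
  have aa : a k <= a k.+1.
    rewrite ge0_ler_powR ?nnegrE ?exprn_ge0// ?(le_trans ler01 p1)//.
    by rewrite exprS ler_peMl ?exprn_ge0// ler1n.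
  have ww : (2 ^ k.+1)%:R <= (2 ^ k.+2)%:R :> R by rewrite ler_nat leq_exp2l.
  rewrite lef_pV2 ?posrE ?mulr_gt0// ler_pM ?mulr_ge0 ?(ltW (a0 _)) ?(ltW C10) ?(ltW q0) ?(ltW (w0 _))//.
  by rewrite !ler_pM2r.
have /choice[v hv] k : exists eta, test_function X eta /\ (P (T \- partial i eta)%R <= (d k)%:E)%E.
  by have [eta] := hT (d k) (d0 k); exists eta.
have tv k : test_function X (v k) by case: (hv k).
have mj k o : measurable_fun X (jet (v k) o) by have [] := jet_Lpm oX Xfin p1 o (tv k).
have mv k : measurable_fun X (v k) by exact: (mj k None).
have mp k : measurable_fun X (partial i (v k)) by exact: (mj k (Some i)).
have grad k : (P (partial i (v k.+1) \- partial i (v k))%R <= (2 `^ p * (d k + d k))%:E)%E.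
  rewrite (_ : P _ = P ((T \- partial i (v k)) \- (T \- partial i (v k.+1)))%R); last first.
    by apply: eq_integral => x _; congr ((`| _ | `^ _)%:E); rewrite /=; ring.
  apply: le_trans (pintB mu mX p1 (measurable_funB mT (mp k)) (measurable_funB mT (mp k.+1))) _.
  have c1 := (hv k).2; have c2 : (P (T \- partial i (v k.+1))%R <= (d k)%:E)%E.
    by apply: le_trans (hv k.+1).2 _; rewrite lee_fin.
  by apply: le_trans (lee_wpmul2l _ (leeD c1 c2)) _; rewrite ?lee_fin ?(ltW q0).
have fast k : (P (fun x => 2 ^+ k * (v k.+1 x - v k x))%R <= (1 / (2 ^ k.+1)%:R)%:E)%E.
  rewrite (pintZ mu mX); last exact: (measurable_funB (mv k.+1) (mv k)).
  have w1 : W0 X p (fun o => jet (v k.+1) o \- jet (v k) o).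
    exact: (W0B oX Xfin p1 (W0_test oX Xfin p1 (tv k.+1)) (W0_test oX Xfin p1 (tv k))).
  have h1 := hC _ i w1.
  rewrite ger0_norm ?exprn_ge0//.
  have h2 := le_trans h1 (lee_wpmul2l _ (grad k)).
  apply: le_trans (lee_wpmul2l _ (h2 _)) _; [by rewrite lee_fin powR_ge0|by rewrite lee_fin|].
  rewrite -!EFinM lee_fin; apply: (@le_trans _ _ (a k * ((C + 1) * (2 `^ p * (d k + d k))))).
    have dk0 : 0 <= 2 `^ p * (d k + d k).
      by apply: mulr_ge0; [exact: ltW|apply: addr_ge0; exact: ltW].
    by rewrite ler_pM2l ?a0// ler_wpM2r// lerDl.
  rewrite le_eqVlt; apply/orP; left; apply/eqP; rewrite /d.
  transitivity (((2 ^ k.+1)%:R : R)^-1); last by rewrite div1r.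
  move: (a0 k) q0 C10 (w0 k).
  generalize (a k) (2 `^ p : R) (C + 1) ((2 ^ k.+1)%:R : R) => A Q C' W hA hQ hC' hW.
  by field; rewrite !gt_eqF.
have [_ f0] := jet_Lpm oX Xfin p1 None (tv 0%N).
have [u [H [mu_ mH fH uH]]] := fast_cvg mX p1 mv f0 fast.
exists u; apply: (W0_closed oX Xfin p1); first by case.
move=> e e0; have h1 := pint_dominated mX p1 mv mu_ mH fH uH e0.
have h2 : \forall k \near \oo, d k <= e.
  have [N _ hN] := near_infty_natSinv_lt (PosNum e0).
  exists N => // k /= Nk; apply: le_trans (ltW (hN k Nk)).
  rewrite lef_pV2 ?posrE ?mulr_gt0//.
  have one_powR (x : R) : 1 <= x -> 1 <= x `^ p.
    move=> x1; have -> : 1 = 1 `^ p :> R by rewrite powR1.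
    by rewrite ge0_ler_powR ?nnegrE// ?(le_trans ler01 p1)// (le_trans ler01 x1).
  have a1 : 1 <= a k by apply: one_powR; rewrite exprn_ege1// ler1n.
  have q1 : 1 <= 2 `^ p :> R by apply: one_powR; rewrite ler1n.
  have c1 : 1 <= C + 1 by rewrite lerDr.
  apply: (@le_trans _ _ (2 ^ k.+1)%:R); first by rewrite ler_nat ltnW// ltn_expl.
  by rewrite ler_peMl ?(ltW (w0 k))// !mulr_ege1// ler1n.
have [k [k1 k2]] := filter_ex (filterI h1 h2).
exists (jet (v k)); first exact: W0_test.
move=> [j|]; last by rewrite pintBC.
by rewrite (onlyi j); apply: le_trans (hv k).2 _; rewrite lee_fin.
Qed.

End density.

(** * Primitives on the line *)

Section line.
Context {R : realType}.
Local Notation rV := 'rV[R]_1.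
Local Notation mu := (@lebesgue_rV R 1).
Local Notation lam := (@lebesgue_measure R).
Local Notation pt := (fun t : measurableTypeR R => const_mx t : rV).

Lemma rV1E (x : rV) : x = const_mx (x 0 ord0).
Proof. by apply/rowP => j; rewrite mxE (ord1 j). Qed.

Lemma measurable_pt : measurable_fun setT pt.
Proof. by apply: measurable_fun_coordP => i; under eq_fun do rewrite mxE; exact: measurable_id. Qed.

Lemma lebesgue_rV1 A : measurable A -> mu A = lam (pt @^-1` A).
Proof.
move=> mA; have mB : measurable (pt @^-1` A) by rewrite -[X in measurable X]setTI; exact: measurable_pt.
rewrite /= /leb_step /pushforward /= /product_measure1.
transitivity (\int[lam]_x (\1_(pt @^-1` A) x)%:E)%E; last by rewrite integral_indic// setIT.
apply: eq_integral => t _ /=; rewrite diracE indicE; congr ((_%:R)%:E); congr nat_of_bool.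
have e : consrV (t, 0 : 'rV[R]_0) = const_mx t.
  by apply/rowP => i; rewrite !mxE (ord1 i) unlift_none.
apply/idP/idP => /set_mem h; apply/mem_set; move: h; rewrite /xsection /=.
  by move=> /set_mem; rewrite /preimage /= e.
by move=> h; apply/mem_set; rewrite /preimage /= e.
Qed.

Lemma integral_rV1 (f : rV -> R) : mu.-integrable setT (EFin \o f) ->
  lam.-integrable setT (EFin \o (f \o pt)) /\ \int[lam]_t f (const_mx t) = \int[mu]_x f x.
Proof.
move=> /integrableP[mf fi].
have eqm (A : set rV) : measurable A -> A `<=` setT -> mu A = pushforward lam pt A.
  by move=> mA _; exact: lebesgue_rV1.
have ge0E (g : rV -> \bar R) : measurable_fun setT g -> (forall x, (0 <= g x)%E) ->
    (\int[mu]_x g x = \int[lam]_t g (const_mx t))%E.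
  move=> mg g0; rewrite (eq_measure_integral _ eqm); first exact: measurable_pt.
  by move=> h; rewrite (ge0_integral_pushforward h).
have mfp : measurable_fun setT (EFin \o (f \o pt)) by apply: (measurableT_comp mf); exact: measurable_pt.
have ifp : lam.-integrable setT (EFin \o (f \o pt)).
  apply/integrableP; split=> //; move: fi; rewrite ge0E//.
  exact: measurableT_comp.
split=> //; rewrite /Rintegral; congr fine.
rewrite [in RHS](eq_measure_integral _ eqm); first exact: measurable_pt.
by move=> h; rewrite (integral_pushforward h).
Qed.

Lemma continuous_pt : continuous (fun t : R => const_mx t : rV).
Proof.
move=> t; apply/cvgrPdist_lt => e e0; near=> s.
apply/rV_norm_ltP => // i; rewrite !mxE; near: s.
by apply: cvgr_dist_lt => //; exact: cvg_id.
Unshelve. all: by end_near.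
Qed.

Lemma connected_between (X : set rV) : connected X -> forall x y z : rV, X x -> X y ->
  x 0 ord0 <= z 0 ord0 <= y 0 ord0 -> X z.
Proof.
move=> cX x y z Xx Xy zxy.
have /connected_intervalP H : connected ((fun x : rV => x 0 ord0) @` X).
  apply: connected_continuous_connected => //; apply: continuous_subspaceT.
  exact: coord_continuous.
have [w Xw wz] : ((fun x : rV => x 0 ord0) @` X) (z 0 ord0).
  by apply: (H (x 0 ord0) (y 0 ord0)) => //; [exists x|exists y].
by rewrite (rV1E z) -wz -rV1E.
Qed.

(** The primitive from -oo vanishes to the left of the support, and to the right because tau has
    mean zero. Its support lies between two points of X, hence in X by connectedness. *)
Lemma test_primitive (X : set rV) tau : connected X -> X !=set0 -> test_function X tau ->
  \int[mu]_x tau x = 0 -> exists2 eta, test_function X eta & partial ord0 eta = tau.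
Proof.
move=> cX [x0 Xx0] tt tau0.
have [K0 [cK0 K0X] K0E] := test_function_support tt.
(* The extra point keeps K nonempty, so that the extreme coordinates exist even for tau = 0. *)
pose K := x0 |` K0.
have cK : compact K by apply: compactU => //; exact: compact_set1.
have KX : K `<=` X by move=> x [->//|/K0X].
have KE x : ~ K x -> tau x = 0 by move=> nx; apply: K0E => Kx; apply: nx; right.
have Kne : K !=set0 by exists x0; left.
have cc : {within K, continuous (fun x : rV => x 0 ord0)}.
  by apply: continuous_subspaceT; exact: coord_continuous.
have [a /set_mem Ka ha] := EVT_min_rV Kne cK cc.
have [b /set_mem Kb hb] := EVT_max_rV Kne cK cc.
pose J : set rV := [set z | a 0 ord0 <= z 0 ord0 <= b 0 ord0].
have JX : J `<=` X by move=> z; apply: (connected_between cX); exact: KX.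
have cJ : compact J.
  pose r := Num.max `|a| `|b|.
  have r0 : 0 <= r by rewrite le_max normr_ge0.
  apply: (subclosed_compact _ (@compact_cube R 1 r)).
    rewrite (_ : J = (fun x : rV => x 0 ord0) @^-1` `[a 0 ord0, b 0 ord0]); last first.
      by apply/seteqP; split => z; rewrite /J /= in_itv.
    by apply: closed_comp => [z _|]; [exact: coord_continuous|exact: itv_closed].
  move=> z /andP[az zb] i; rewrite (ord1 i) /= in_itv /=; apply/andP; split.
    apply: le_trans az; rewrite lerNl; apply: le_trans (ler_norm _) _; rewrite normrN.
    by apply: le_trans (rV_coord_norm _ _) _; rewrite le_max lexx.
  apply: le_trans zb _; apply: le_trans (ler_norm _) _.
  by apply: le_trans (rV_coord_norm _ _) _; rewrite le_max lexx orbT.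
have itau := test_function_integrable tt.
have [ipt pt0] := integral_rV1 itau; rewrite tau0 in pt0.
pose F (s : R) := \int[lam]_(t in [set` `]-oo, s]%R]) tau (const_mx t).
have ctau : continuous (fun t : R => tau (const_mx t)).
  move=> t; apply: (@cvg_comp _ _ _ (fun t : R => const_mx t : rV) tau); first exact: continuous_pt.
  exact: (test_function_continuous tt).
have dF (s : R) : is_derive s 1 F (tau (const_mx s)).
  have su : s < s + 1 by rewrite ltrDl.
  have ii : lam.-integrable [set` `]-oo, s + 1]%R] (EFin \o (fun t : R => tau (const_mx t))).
    by apply: integrableS ipt => //.
  have [d1 d2] := continuous_FTC1 su ii (ltNyr _) (ctau s).
  by split; [exact: d1|rewrite -derive1E; exact: d2].
pose eta (x : rV) := F (x 0 ord0).
have deta x : is_derive x (delta_mx 0 ord0) eta (tau x).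
  apply: is_derive_line; rewrite (_ : (fun _ => _) = F \o (fun h : R => h + x 0 ord0)); last first.
    by apply/funext => h; rewrite /eta /= !mxE eqxx mulr1.
  have dh : is_derive (0 : R) 1 (fun h : R => h + x 0 ord0) 1.
    have := is_deriveD (is_derive_id (0 : R) 1) (is_derive_cst (x 0 ord0) (0 : R) 1).
    by rewrite addr0.
  have d0 : is_derive ((fun h : R => h + x 0 ord0) 0) 1 F (tau x).
    by rewrite /= add0r [in X in is_derive _ _ _ X](rV1E x).
  by have := @is_derive1_comp R F (fun h : R => h + x 0 ord0) 0 _ _ d0 dh; rewrite mulr1.
have peta : partial ord0 eta = tau.
  by apply/funext => x; rewrite /partial; case: (deta x).
have ceta : continuous eta.
  move=> x; apply: (@cvg_comp _ _ _ (fun x : rV => x 0 ord0) F); first exact: coord_continuous.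
  exact: (derivable_continuous dF).
exists eta => //; apply: (test_functionI _ cJ JX).
  case/lastP => [|s i].
    by split=> [|i x]; [exact: ceta|rewrite (ord1 i); case: (deta x)].
  by rewrite foldr_rcons (ord1 i) peta; exact: (test_function_smooth tt).
move=> x nJ; rewrite /eta /F; have [xa|ax] := ltP (x 0 ord0) (a 0 ord0).
  apply: Rintegral_eq0 => t; rewrite /= in_itv /= => tx; apply: KE => Kt.
  by have := ha (const_mx t) (mem_set Kt); rewrite mxE leNgt (le_lt_trans tx xa).
have bx : b 0 ord0 < x 0 ord0.
  by rewrite ltNge; apply/negP => xb; apply: nJ; rewrite /J /= ax.
rewrite -pt0; apply/esym; apply: Rintegral_support => // t _ /=; rewrite in_itv /= => /negP; rewrite -ltNge => xt.
apply: KE => Kt; have := hb (const_mx t) (mem_set Kt); rewrite mxE leNgt.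
by rewrite (lt_trans bx xt).
Qed.

End line.

(** Scaling by L reduces the claim to t^(-alpha) >= 1 - alpha (t - 1), which follows from exp x >= 1
    + x and ln t <= t - 1. *)
Lemma powRN_tangent {R : realType} (L s alpha : R) : 0 < L -> 0 < s -> 0 <= alpha ->
  (L `^ alpha)^-1 + - (alpha * (L `^ alpha)^-1 / L) * (s - L) <= (s `^ alpha)^-1.
Proof.
move=> L0 s0 al0; have t0 : 0 < s / L by rewrite divr_gt0.
have q0 : 0 < (L `^ alpha)^-1 by rewrite invr_gt0 powR_gt0.
have -> : s = L * (s / L) by field; rewrite gt_eqF.
rewrite powRM ?(ltW L0) ?(ltW t0)// invfM; set t := s / L in t0 *.
have -> : (L `^ alpha)^-1 + - (alpha * (L `^ alpha)^-1 / L) * (L * t - L) =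
    (L `^ alpha)^-1 * (1 - alpha * (t - 1)).
  by field; rewrite !gt_eqF ?powR_gt0.
rewrite ler_pM2l//.
have l1 : ln t <= t - 1.
  by have := ln_ge1BV (s := t^-1); rewrite invr_gt0 => /(_ t0); rewrite invrK lnV ?posrE//; lra.
have -> : (t `^ alpha)^-1 = expR (- (alpha * ln t)) by rewrite /powR gt_eqF// expRN.
apply: le_trans (expR_ge1Dx _); rewrite lerD2l lerN2.
by rewrite ler_wpM2l.
Qed.

(** * Maps of constant slope *)

Section dimension_one.
Context {R : realType}.
Local Notation rV := 'rV[R]_1.
Local Notation mu := (@lebesgue_rV R 1).
Variables (X : set rV) (r p alpha : R) (phi : rV -> rV).
Hypotheses (oX : open X) (cX : connected X) (X0 : X !=set0).
Hypotheses (r0 : 0 < r) (Xr : forall x, X x -> `|x| <= r).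
Hypotheses (p1 : 1 <= p) (al0 : 0 < alpha).

Let mX : measurable X := open_measurable_rV oX.
Let Xfin : (mu X < +oo)%E. Proof. exact: bounded_lebesgue_fin mX Xr. Qed.
Local Notation P u := (pint mu X p u).
Local Notation A := (admissible p X phi).
Local Notation E := (energy alpha p X).
Let i0 : 'I_1 := ord0.

Lemma unit_mass_test : exists2 beta, test_function X beta & \int[mu]_x beta x = 1.
Proof.
have [x0 Xx0] := X0.
have /nbhs_ballP[e /= e0 xe] := open_nbhs_nbhs (conj oX Xx0).
have e2 : 0 < e / 2 by rewrite divr_gt0.
have [rho hrho] := mollifier_exists (R := R) (n := 1) e2.
exists (fun y => rho (x0 - y)).
  apply: (mollifier_test hrho) => y; rewrite /closed_ball_ /= => xy; apply: xe.
  by rewrite -ball_normE /=; apply: le_lt_trans xy _; rewrite ltr_pdivrMr// mulr_natr mulr2n ltrDl.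
by rewrite /Rintegral (mollifier_mass x0 hrho).
Qed.

Lemma Rintegral_test eta : test_function X eta -> \int[mu]_x eta x = \int[mu]_(x in X) eta x.
Proof. by move=> te; apply: Rintegral_support => // x _; exact: test_function_eq0 te. Qed.

(** A test function near T has a small mean c; subtracting c beta, with beta of mass one, makes it
    the derivative of a test function. *)
Lemma mean_zero_partial T : Lpm mu X p T -> \int[mu]_(x in X) T x = 0 ->
  exists u, W0 X p (fun o => if o is Some _ then T else u).
Proof.
move=> lT T0; apply: (W0_complete oX Xfin p1 Xr r0 lT (fun j => ord1 j)) => d d0.
have [mT fT] := lT; have iT := pint_integrable mX Xfin p1 mT fT.
have [beta tb b1] := unit_mass_test; have [mb fb] := test_Lpm oX Xfin p1 tb.
have q0 : 0 < 2 `^ p :> R by exact: powR_gt0.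
pose b := fine (P beta); have b0 : 0 <= b by rewrite fine_ge0// pint_ge0.
have bE : P beta = b%:E by rewrite fineK// ge0_fin_numE// pint_ge0.
pose d1 := d / (2 `^ p * 2); have d10 : 0 < d1 by rewrite divr_gt0// mulr_gt0.
have b10 : 0 < b + 1 by rewrite ltr_wpDl.
(* The bound 1 gives |c|^p <= |c|; the other one makes the correction c beta cost at most d1. *)
pose e1 := Num.min 1 (d1 / (b + 1)).
have e10 : 0 < e1 by rewrite lt_min ltr01 divr_gt0.
have [d2 d20 hd2] := pint_small_L1 mX Xfin p1 e10.
pose e := Num.min d2 d1; have e0 : 0 < e by rewrite lt_min d20.
have [tau tt ht] := test_dense oX Xfin p1 lT e0.
have [mt ft] := test_Lpm oX Xfin p1 tt; have it := pint_integrable mX Xfin p1 mt ft.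
pose c := \int[mu]_x tau x.
have ce : `|c| <= e1.
  have -> : c = - \int[mu]_(x in X) (T x - tau x) by rewrite RintegralB// T0 sub0r opprK /c Rintegral_test.
  rewrite normrN; apply: le_trans (le_normr_Rintegral mX (integrableB mX iT it)) _.
  have h3 : mu.-integrable X (EFin \o (fun x => `|T x - tau x|)).
    exact: integrable_norm (integrableB mX iT it).
  rewrite -lee_fin /Rintegral fineK ?(integrable_fin_num mX h3)//.
  by apply: hd2; [exact: measurable_funB|apply: le_trans ht _; rewrite lee_fin ge_min lexx].
have tz := test_functionZ c tb.
have [|eta te he] := test_primitive cX X0 (test_functionB tt tz).
  rewrite (_ : \int[mu]_x _ = \int[mu]_x (tau x - c * beta x))//.
  have ib := test_function_integrable tb.
  rewrite RintegralB//; [|exact: test_function_integrable tt|exact: test_function_integrable tz].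
  by rewrite RintegralZl// b1 mulr1 subrr.
exists eta => //; rewrite he.
rewrite (_ : P _ = P ((T \- tau) \+ (fun x => c * beta x))%R); last first.
  by apply: eq_integral => x _; congr ((`| _ | `^ _)%:E); rewrite /=; ring.
have mcb : measurable_fun X (fun x => c * beta x) by exact: measurable_funM.
apply: le_trans (pintD mu mX p1 (measurable_funB mT mt) mcb) _.
have c1 : (P (T \- tau)%R <= d1%:E)%E by apply: le_trans ht _; rewrite lee_fin ge_min lexx orbT.
have c2 : (P (fun x => (c * beta x)%R) <= d1%:E)%E.
  rewrite (pintZ mu mX)// bE -EFinM lee_fin.
  have cp : `|c| `^ p <= e1.
    have ce1 : `|c| <= 1 by apply: le_trans ce _; rewrite ge_min lexx.
    apply: le_trans ce; have [->|c0] := eqVneq `|c| 0; first by rewrite powR0// gt_eqF// (lt_le_trans ltr01).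
    by apply: ge1r_powR => //; rewrite ce1 andbT lt_neqAle eq_sym c0 normr_ge0.
  apply: (@le_trans _ _ (e1 * (b + 1))).
    by apply: ler_pM => //; rewrite lerDl.
  by rewrite -ler_pdivlMr// ge_min lexx orbT.
apply: le_trans (lee_wpmul2l _ (leeD c1 c2)) _; first by rewrite lee_fin ltW.
rewrite -EFinD -EFinM lee_fin le_eqVlt; apply/orP; left; apply/eqP.
by rewrite /d1; move: q0; generalize (2 `^ p : R) => k k0; field; rewrite gt_eqF.
Qed.

Let n0 : (0 < 1)%N. Proof. by []. Qed.
Let np : 1%:R <= p. Proof. by []. Qed.

Let slope f : rV -> R := jets X f (i0, Some i0).

Lemma jacobian_det1 f x : jacobian_det X f x = slope f x.
Proof. by rewrite /jacobian_det det_mx11 mxE. Qed.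

Lemma operator_norm1 (M : 'M[R]_1) : operator_norm M = `|M ord0 ord0|.
Proof.
apply/le_anti; rewrite operator_norm_entry andbT.
by apply: le_trans (operator_norm_le_sum M) _; rewrite !big_ord1.
Qed.

Lemma energy1 f : E f = (\int[mu]_(x in X) (`|slope f x| `^ p + (slope f x `^ alpha)^-1)%:E)%E.
Proof. by apply: eq_integral => x _; rewrite jacobian_det1 operator_norm1 mxE. Qed.

Let slope_measurable f : A f -> measurable_fun X (slope f).
Proof. by move=> Af; have [] := jets_Lpm oX n0 np Af (i0, Some i0). Qed.

Let slope_integrable f : A f -> mu.-integrable X (EFin \o slope f).
Proof.
by move=> Af; have [m1 f1] := jets_Lpm oX n0 np Af (i0, Some i0); exact: pint_integrable m1 f1.
Qed.

Let slope_gt0 f : A f -> {ae mu, forall x, X x -> 0 < slope f x}.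
Proof. by move=> [_ h _]; apply: filterS h => x hx Xx; rewrite -jacobian_det1; exact: hx. Qed.

Lemma slope_mean f g : A f -> A g -> \int[mu]_(x in X) slope f x = \int[mu]_(x in X) slope g x.
Proof.
move=> Af Ag; apply/eqP; rewrite -subr_eq0 -RintegralB//; [|exact: slope_integrable|exact: slope_integrable].
by have /= -> := W0_mean oX Xfin p1 i0 (jets_diff_W0 oX Xr n0 np i0 Af Ag).
Qed.

Let m : R := fine (mu X).

Let mE : mu X = m%:E.
Proof. by rewrite /m fineK// ge0_fin_numE. Qed.

(** On a null set a test function could not have integral 1. *)
Lemma lebesgue_gt0 : 0 < m.
Proof.
rewrite lt_neqAle fine_ge0// andbT eq_sym; apply/eqP => m0.
have muX0 : mu X = 0%E by rewrite mE m0.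
have [beta tb] := unit_mass_test; rewrite Rintegral_test// /Rintegral null_set_integral//.
  by move/eqP; rewrite eq_sym oner_eq0.
by apply/measurable_EFinP; have [] := test_Lpm oX Xfin p1 tb.
Qed.

Lemma mean_slope_gt0 f : A f -> 0 < \int[mu]_(x in X) slope f x.
Proof.
move=> Af; have i1 := slope_integrable Af; have m1 := slope_measurable Af.
have aE : \int[mu]_(x in X) slope f x = fine (\int[mu]_(x in X) `|(slope f x)%:E|)%E.
  congr fine; apply: ae_eq_integral => //.
  - exact/measurable_EFinP.
  - by apply: measurableT_comp => //; exact/measurable_EFinP.
  by apply: filterS (slope_gt0 Af) => x hx Xx; rewrite /= gtr0_norm// hx.
rewrite aE lt_neqAle fine_ge0 ?integral_ge0// andbT; apply/eqP => z.
have z0 : (\int[mu]_(x in X) `|(slope f x)%:E| = 0)%E.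
  have /integrableP[_ fi] := i1.
  by rewrite -[LHS]fineK -?z// ge0_fin_numE// integral_ge0.
have ez : ae_eq mu X (EFin \o slope f) (cst 0%E).
  by apply/(ae_eq_integral_abs mu mX); [exact/measurable_EFinP|exact: z0].
have : mu X = 0%E.
  apply: (measure_negligible mX).
  have : {ae mu, forall x, ~ X x}.
    apply: filterS2 ez (slope_gt0 Af) => x h1 h2 Xx.
    by have := h2 Xx; have [->] := h1 Xx; rewrite ltxx.
  by apply: negligibleS => x /= Xx; rewrite -[X in ~ X]/(~ X x) => /(_ Xx).
by rewrite mE => -[m0]; have := lebesgue_gt0; rewrite m0 ltxx.
Qed.

(** L minus the slope of f has mean zero, so it is the derivative of some u with zero boundary
    values, and f + u has slope L. *)
Lemma affine_competitor f : A f ->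
  exists2 g, A g & {ae mu, forall x, X x -> slope g x = (\int[mu]_(x in X) slope f x) / m}.
Proof.
move=> Af; set L := _ / m; have L0 : 0 < L by rewrite divr_gt0 ?mean_slope_gt0 ?lebesgue_gt0.
have lf o : Lpm mu X p (jets X f (i0, o)) by exact: (jets_Lpm oX n0 np Af).
have lL : Lpm mu X p (cst L).
  by apply: (@Lpm_bounded _ _ _ _ _ mX p _ `|L|) => //; exact: le_trans ler01 p1.
pose T : rV -> R := cst L \- slope f.
have iL : mu.-integrable X (EFin \o (cst L : rV -> R)).
  by have [mL fL] := lL; exact: pint_integrable mL fL.
have [|u Wu] := mean_zero_partial (LpmB mX p1 lL (lf (Some i0))).
  rewrite RintegralB//; last exact: slope_integrable.
  by rewrite Rintegral_cst// /L -/m divfK ?subrr// gt_eqF// lebesgue_gt0.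
pose g (x : rV) : rV := \row_j (f x 0 j + u x).
have cg j : component g j = jets X f (j, None) \+ u.
  by apply/funext => x; rewrite /component mxE.
have [lu wu] := (Wu.1 None, W0_weak_partial oX Xfin p1 i0 Wu).
have wg : is_weak_partial X i0 (component g i0) (slope f \+ T).
  by rewrite cg; exact: (is_weak_partialD oX (jets_weak oX n0 np Af i0 i0) wu).
have [_ sg] := weak_partialP oX wg.
have sL : {ae mu, forall x, X x -> slope g x = L}.
  by apply: filterS sg => x hx Xx; rewrite /slope /jets /= hx// /T /= addrC subrK.
exists g; last exact: sL.
have [_ _ hf] := Af; split.
- move=> j; rewrite (ord1 j); apply: (W1pI oX p1 (g := fun _ => slope f \+ T)).
  + by rewrite cg; exact: (LpmD mX p1 (lf None) lu).
  + by move=> _; exact: (LpmD mX p1 (lf (Some i0)) (LpmB mX p1 lL (lf (Some i0)))).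
  + by move=> i; rewrite (ord1 i).
- by apply: filterS sL => x hx Xx; rewrite jacobian_det1 hx.
- move=> j; have := W0_W1p0 oX Xfin p1 (W0D oX Xfin p1 Wu (W1p0_W0 oX Xfin p1 (hf j))).
  by congr W1p0; apply/funext => x; rewrite /weak_jet /component /= !mxE; ring.
Qed.

Lemma energy_affine_le f g : A f -> A g ->
  {ae mu, forall x, X x -> slope g x = (\int[mu]_(x in X) slope f x) / m} -> (E g <= E f)%E.
Proof.
move=> Af Ag; set L := _ / m => sg.
have L0 : 0 < L by rewrite divr_gt0 ?mean_slope_gt0 ?lebesgue_gt0.
pose F x := `|slope f x| `^ p + (slope f x `^ alpha)^-1.
pose G := L `^ p + (L `^ alpha)^-1.
(* The derivative of t^p + t^(-alpha) at L; the linear term of the tangent integrates to 0 because L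
   is the mean slope. *)
pose k := p * L `^ (p - 1) + - (alpha * (L `^ alpha)^-1 / L).
have ms h : A h -> measurable_fun X (fun x => `|slope h x| `^ p + (slope h x `^ alpha)^-1).
  move=> Ah; have mh := slope_measurable Ah; apply: measurable_funD.
    by apply: (measurableT_comp (measurable_powR p)); exact: measurableT_comp.
  under eq_fun do rewrite -powRN.
  exact: (measurableT_comp (measurable_powR (- alpha)) mh).
have EgE : E g = (G * m)%:E.
  rewrite energy1 EFinM -mE -(integral_cst _ mX).
  apply: ae_eq_integral; [exact: mX| |exact: measurable_cst|].
  - by apply/measurable_EFinP; exact: ms.
  - by apply: filterS sg => x hx Xx; rewrite hx// gtr0_norm.
have Ef0 : (0 <= E f)%E by exact: energy_ge0.
rewrite EgE; have [Efoo|] := boolP (E f \is a fin_num); last first.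
  by move: (E f) Ef0 => e e0; rewrite ge0_fin_numE// -leNgt leye_eq => /eqP->; exact: leey.
have F0 x : 0 <= F x by rewrite addr_ge0 ?invr_ge0 ?powR_ge0.
have iF : mu.-integrable X (EFin \o F).
  apply/integrableP; split; first by apply/measurable_EFinP; exact: ms.
  have -> : (\int[mu]_(x in X) `|(EFin \o F) x| = E f)%E.
    by rewrite energy1; apply: eq_integral => x _ /=; rewrite ger0_norm.
  by rewrite -ge0_fin_numE.
have icst (c : R) : mu.-integrable X (EFin \o (fun=> c : R)).
  have [mL fL] : Lpm mu X p (fun=> c).
    by apply: (@Lpm_bounded _ _ _ _ _ mX p _ `|c|) => //; exact: le_trans ler01 p1.
  exact: pint_integrable mL fL.
have isf := slope_integrable Af.
have iS : mu.-integrable X (EFin \o (fun x => k * (slope f x - L))).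
  exact: (integrableZl mX k (integrableB mX isf (icst L))).
have iH : mu.-integrable X (EFin \o (fun x => G + k * (slope f x - L))).
  exact: (integrableD mX (icst G) iS).
have HE : \int[mu]_(x in X) (G + k * (slope f x - L)) = G * m.
  rewrite RintegralD// Rintegral_cst// RintegralZl//; last exact: (integrableB mX isf (icst L)).
  rewrite RintegralB// Rintegral_cst// -/m /L divfK ?subrr ?mulr0 ?addr0//.
  by rewrite gt_eqF// lebesgue_gt0.
have FH : {ae mu, forall x, X x -> G + k * (slope f x - L) <= F x}.
  apply: filterS (slope_gt0 Af) => x hx Xx; have s0 := hx Xx.
  rewrite /F gtr0_norm// /G /k mulrDl addrACA; apply: lerD.
    exact: powR_ge_tangent L0 (ltW s0) p1.
  exact: powRN_tangent L0 s0 (ltW al0).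
have EfE : E f = (\int[mu]_(x in X) F x)%:E.
  by rewrite energy1 in Efoo *; rewrite /Rintegral (fineK Efoo).
rewrite EfE lee_fin -HE -subr_ge0 -RintegralB//.
pose D x := F x - (G + k * (slope f x - L)).
have iD : mu.-integrable X (EFin \o D) by exact: (integrableB mX iF iH).
have mD : measurable_fun X (EFin \o D) by have /integrableP[] := iD.
(* [D] is nonnegative only almost everywhere; the absolute value has the same integral and an
   evident sign. *)
rewrite (_ : \int[mu]_(x in X) _ = \int[mu]_(x in X) `|D x|).
  by apply: Rintegral_ge0 => x _.
congr fine; apply: ae_eq_integral => //.
  by have /integrableP[] := integrable_norm iD.
by apply: filterS FH => x hx Xx; rewrite /= ger0_norm// subr_ge0 hx.
Qed.

Lemma minimiser_dim1 : A !=set0 ->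
  exists2 f0, A f0 & ereal_inf [set E f | f in A] = E f0.
Proof.
move=> [f1 Af1]; have [g Ag sg] := affine_competitor Af1; exists g => //.
apply/eqP; rewrite eq_le; apply/andP; split; first by apply: ereal_inf_lbound; exists g.
apply: le_ereal_inf_tmp => _ [f Af <-].
by apply: (energy_affine_le Af Ag); rewrite (slope_mean Af Af1).
Qed.

End dimension_one.

Theorem theorem6p1 (R : realType) (n : nat) (X Y : set 'rV[R]_n)
    (phi : 'rV[R]_n -> 'rV[R]_n) (alpha p : R) :
  (0 < n)%N ->
  bounded_lipschitz_domain X -> bounded_lipschitz_domain Y ->
  homeomorphism_between (closure X) (closure Y) phi ->
  0 < alpha -> n%:R <= p ->
  admissible p X phi !=set0 ->
  exists2 f0, admissible p X phi f0 &
    ereal_inf [set energy alpha p X f | f in admissible p X phi] =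
    energy alpha p X f0.
Proof.
move=> n0 [oX cX X0 bX _] _ _ al0 np.
have [r r0 Xr] : exists2 r, 0 < r & forall x, X x -> `|x| <= r.
  by have [r r0 hr] := pinfty_ex_gt0 bX; exists r.
have [n1|] := ltnP 1 n; first exact: (minimiser_dim_ge2 oX r0 Xr n1 np al0).
rewrite leq_eqVlt ltnNge n0 orbF => /eqP nE; subst n.
exact: (minimiser_dim1 oX cX X0 r0 Xr np al0).
Qed.
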